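(* Let $0\neq p(x)\in\mathbb C((x))$, $\phi(x,z)=e^{zp(x)\frac{d}{dx}}(x)$, and $\ell\in\mathbb C$. Then $\phi$-coordinated modules for the Virasoro vertex algebra $V_{\mathcal V}(\ell,0)$ are exactly restricted $\mathcal V$-modules of level $\ell$. That is, every restricted $\mathcal V$-module $W$ of level $\ell$ is a $\phi$-coordinated $V_{\mathcal V}(\ell,0)$-module with $$Y_W(\omega,z)=\sum_{n\in\mathbb Z}\left(-x^np(x)^2\frac{d}{dx}+\alpha_\phi(x^np(x))\,\mathbf c\right)z^{-n-1},$$ and every $\phi$-coordinated $V_{\mathcal V}(\ell,0)$-module $W$ is a restricted $\mathcal V$-module of level $\ell$ such that this same relation holds.
   Context: $\phi(x,z)=\sum_{n\ge0}\frac{z^n}{n!}\left(p(x)\frac{d}{dx}\right)^n(x)\in\mathbb C((x))[[z]]$. $\mathcal V=\mathbb C((x))\frac{d}{dx}\oplus\mathbb C\mathbf c$ is the Lie algebra with $\mathbf c$ central and $$\left[f\tfrac{d}{dx},g\tfrac{d}{dx}\right]=f\left(\tfrac{d}{dx}g\right)\tfrac{d}{dx}-g\left(\tfrac{d}{dx}f\right)\tfrac{d}{dx}+\tfrac{\mathbf c}{12}\mathrm{Res}_x\left(\left(\left(\tfrac{d}{dx}\right)^3f\right)g\right).$$ $V_{\mathcal V}(\ell,0)=\mathcal U(\mathcal V)\otimes_{\mathcal U(\mathbb C[[x]]\frac{d}{dx}\oplus\mathbb C\mathbf c)}\mathbb C$, where $\mathbb C[[x]]\frac d{dx}$ acts trivially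 and $\mathbf c$ acts as $\ell$ on $\mathbb C$; it is the Virasoro vertex algebra with vacuum $\mathbf 1=1\otimes1$, generated by $\omega=\left(-x^{-1}\frac{d}{dx}\right)\mathbf 1$ with $Y(\omega,z)=\sum_{n\in\mathbb Z}\left(-x^n\frac d{dx}\right)z^{-n-1}$. $\alpha_\phi:\mathbb C((x))\to\mathbb C$ is the linear map $\alpha_\phi(f)=\frac1{24}\mathrm{Res}_x\,f(x)\left(2p''(x)-p(x)^{-1}p'(x)^2\right)$. A $\mathcal V$-module $W$ is restricted if for all $w\in W$, $\left(x^n\frac d{dx}\right)w=0$ for $n\gg0$, where the action is understood to be compatible with infinite formal sums, i.e. $\left(\sum_{n\ge n_0}b_nx^n\frac{d}{dx}\right)w=\sum_{n\ge n_0}b_n\left(x^n\frac{d}{dx}\right)w$. It is of level $\ell$ if $\mathbf c$ acts as $\ell$. A $\phi$-coordinated module for a vertex algebra $(V,Y,\mathbf1)$ is a vector space $W$ with a linear map $Y_W(\cdot,z):V\to\mathrm{Hom}(W,W((z)))$ such that $Y_W(\mathbf 1,z)=1_W$ and for all $u,v\in V$ there is $k\in\mathbb N$ with $(z_1-z_2)^kY_W(u,z_1)Y_W(v,z_2)\in\mathrm{Hom}(W,W((z_1,z_2)))$ and $(\phi(z_2,z_0)-z_2)^kY_W(Y(u,z_0)v,z_2)=\left((z_1-z_2)^kY_W(u,z_1)Y_W(v,z_2)\right)|_{z_1=\phi(z_2,z_0)}$. Here $W((z_1,z_2))=W[[z_1,z_2]][z_1^{-1},z_2^{-1}]$ and $A(z_1,z_2)|_{z_1=\phi(z_2,z_0)}=\left(e^{z_0p(z_1)\partial/\partial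 z_1}A(z_1,z_2)\right)|_{z_1=z_2}$. *)

(* Defs.v *)
From HB Require Import structures.
From mathcomp Require Import all_boot all_order all_algebra.
From mathcomp Require Import all_classical reals complex.
From mathcomp Require Import zify ring.

Set Implicit Arguments.
Unset Strict Implicit.
Unset Printing Implicit Defensive.

Import Order.TTheory GRing.Theory Num.Theory.
Local Open Scope classical_set_scope.
Local Open Scope quotient_scope.
Local Open Scope ring_scope.

(** * Formal Laurent series *)

(* A series in one variable with coefficients in a vector space [M] is the
   function [a : int -> M] sending [n] to the coefficient of [z ^ n].  Every
   infinite sum below is a sum over the (finite) support of its summand, which
   is what [\sum_(i \in A) F i] computes. *)
Definition ltrunc (M : zmodType) (a : int -> M) : Prop :=
  exists N : int, forall n, n < N -> a n = 0.

Record laurent (K : fieldType) :=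
  Laurent { lcoef :> int -> K; laurent_subproof : ltrunc lcoef }.

Section LaurentRing.
Variable K : fieldType.
Implicit Types f g h : laurent K.

Lemma laurentP f g : f =1 g -> f = g.
Proof.
case: f g => [f hf] [g hg] /= /funext efg; subst g.
by congr Laurent; exact: Prop_irrelevance.
Qed.

HB.instance Definition _ := gen_eqMixin (laurent K).
HB.instance Definition _ := gen_choiceMixin (laurent K).

Lemma lzero_subproof : ltrunc (fun=> 0 : K).
Proof. by exists 0. Qed.
Definition lzero : laurent K := Laurent lzero_subproof.

Lemma lopp_subproof f : ltrunc (fun n => - f n).
Proof.
by case: f => [f [N hN]]; exists N => n /hN /= ->; rewrite oppr0.
Qed.
Definition lopp f : laurent K := Laurent (lopp_subproof f).

Lemma ladd_subproof f g : ltrunc (fun n => f n + g n).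
Proof.
case: f g => [f [N hN]] [g [M hM]]; exists (Order.min N M) => n /=.
by rewrite lt_min => /andP[/hN -> /hM ->]; rewrite addr0.
Qed.
Definition ladd f g : laurent K := Laurent (ladd_subproof f g).

Lemma lscale_subproof (c : K) f : ltrunc (fun n => c * f n).
Proof.
by case: f => [f [N hN]]; exists N => n /hN /= ->; rewrite mulr0.
Qed.
Definition lscale (c : K) f : laurent K := Laurent (lscale_subproof c f).

Fact laddA : associative ladd.
Proof. by move=> f g h; apply: laurentP => n /=; rewrite addrA. Qed.
Fact laddC : commutative ladd.
Proof. by move=> f g; apply: laurentP => n /=; rewrite addrC. Qed.
Fact ladd0 : left_id lzero ladd.
Proof. by move=> f; apply: laurentP => n /=; rewrite add0r. Qed.
Fact laddN : left_inverse lzero lopp ladd.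
Proof. by move=> f; apply: laurentP => n /=; rewrite addNr. Qed.

HB.instance Definition _ :=
  GRing.isZmodule.Build (laurent K) laddA laddC ladd0 laddN.

Fact lscaleA a b f : lscale a (lscale b f) = lscale (a * b) f.
Proof. by apply: laurentP => n /=; rewrite mulrA. Qed.
Fact lscale1 : left_id 1 lscale.
Proof. by move=> f; apply: laurentP => n /=; rewrite mul1r. Qed.
Fact lscaleDr : right_distributive lscale +%R.
Proof. by move=> c f g; apply: laurentP => n /=; rewrite mulrDr. Qed.
Fact lscaleDl f : {morph lscale^~ f : a b / a + b}.
Proof. by move=> a b; apply: laurentP => n /=; rewrite mulrDl. Qed.

HB.instance Definition _ := GRing.Zmodule_isLmodule.Build K (laurent K)
  lscaleA lscale1 lscaleDr lscaleDl.

Lemma lmono_subproof (m : int) : ltrunc (fun n => (n == m)%:R : K).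
Proof. by exists m => n; case: eqP => // ->; rewrite ltxx. Qed.
Definition lmono (m : int) : laurent K := Laurent (lmono_subproof m).

Definition cauchy (a b : int -> K) (n : int) : K :=
  \sum_(i \in [set: int]) a i * b (n - i).

Lemma cauchyE (a b : int -> K) (s t : int) (N : nat) :
  (forall i, i < s -> a i = 0) -> (forall i, i < t -> b i = 0) ->
  cauchy a b (s + t + N%:Z) =
    \sum_(k < N.+1) a (s + k%:Z) * b (t + (N - k)%N%:Z).
Proof.
move=> ha hb; rewrite /cauchy.
rewrite (fsbigE [seq s + (k : nat)%:Z | k <- iota 0 N.+1]) //.
- rewrite (eq_bigl xpredT) => [|i]; last by rewrite in_setT.
  rewrite big_map -[iota 0 N.+1]/(index_iota 0 N.+1) big_mkord.
  by apply: eq_bigr => k _; congr (_ * b _); have := ltn_ord k; lia.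
- by rewrite map_inj_uniq ?iota_uniq // => i j; lia.
- move=> i _ hi; have [/ha ->|si] := ltP i s; first by rewrite mul0r.
  rewrite (hb (_ - _)) ?mulr0 //; rewrite ltNge; apply/negP => hti.
  case/negP: hi; apply/mapP; exists `|i - s|%N; last by lia.
  by rewrite mem_iota; lia.
Qed.

Lemma cauchy0 (a b : int -> K) (s t n : int) :
  (forall i, i < s -> a i = 0) -> (forall i, i < t -> b i = 0) ->
  n < s + t -> cauchy a b n = 0.
Proof.
move=> ha hb hn; apply: fsbig1 => i _.
have [/ha ->|si] := ltP i s; first by rewrite mul0r.
by rewrite hb ?mulr0 //; lia.
Qed.

Lemma lmul_subproof f g : ltrunc (cauchy f g).
Proof.
case: f g => [f [s hs]] [g [t ht]]; exists (s + t) => n.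
exact: cauchy0.
Qed.
Definition lmul f g : laurent K := Laurent (lmul_subproof f g).

Lemma lmulE f g (s t : int) (N : nat) :
  (forall i, i < s -> f i = 0) -> (forall i, i < t -> g i = 0) ->
  lmul f g (s + t + N%:Z) =
    ((\poly_(k < N.+1) f (s + k%:Z)) * (\poly_(k < N.+1) g (t + k%:Z)))`_N.
Proof.
move=> hf hg; rewrite /= (cauchyE _ hf hg) coefM; apply: eq_bigr => k _.
by rewrite !coef_poly ltn_ord ltnS leq_subr.
Qed.

Lemma lmulE_le f g (s t : int) (M N : nat) :
  (forall i, i < s -> f i = 0) -> (forall i, i < t -> g i = 0) ->
  (N <= M)%N ->
  lmul f g (s + t + N%:Z) =
    ((\poly_(k < M.+1) f (s + k%:Z)) * (\poly_(k < M.+1) g (t + k%:Z)))`_N.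
Proof.
move=> hf hg NM; rewrite /= (cauchyE _ hf hg) coefM; apply: eq_bigr => k _.
by rewrite !coef_poly !ifT //; have := ltn_ord k; lia.
Qed.

Lemma lmul0 f g (s t n : int) :
  (forall i, i < s -> f i = 0) -> (forall i, i < t -> g i = 0) ->
  n < s + t -> lmul f g n = 0.
Proof. exact: cauchy0. Qed.

Lemma int_split (s n : int) : n < s \/ exists N : nat, n = s + N%:Z.
Proof.
have [|sn] := ltP n s; first by left.
by right; exists `|n - s|%N; lia.
Qed.

Fact lmulC : commutative lmul.
Proof.
move=> f g; have [s hs] := laurent_subproof f.
have [t ht] := laurent_subproof g; apply: laurentP => n.
have [hn|[N ->]] := int_split (s + t) n.
  by rewrite (lmul0 hs ht) // (lmul0 ht hs) // addrC.
by rewrite (lmulE _ hs ht) mulrC -(lmulE _ ht hs) [t + s]addrC.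
Qed.

Fact lmulA : associative lmul.
Proof.
move=> f g h; have [r hr] := laurent_subproof f.
have [s hs] := laurent_subproof g; have [t ht] := laurent_subproof h.
have hrs i : i < r + s -> lmul f g i = 0 by apply: lmul0.
have hst i : i < s + t -> lmul g h i = 0 by apply: lmul0.
apply: laurentP => n; have [hn|[N ->]] := int_split (r + s + t) n.
  by rewrite (lmul0 hrs ht) // (lmul0 hr hst) // addrA.
rewrite (lmulE _ hrs ht) -[r + s + t]addrA (lmulE _ hr hst).
set F := \poly_(k < _) f _; set H := \poly_(k < N.+1) h _.
set G := \poly_(k < N.+1) g (s + k%:Z).
transitivity ((F * G * H)`_N).
  rewrite -mulrA coefM [RHS]coefM; apply: eq_bigr => k _; congr (_ * _).
  by rewrite coef_poly ifT ?(@lmulE_le _ _ _ _ N) //; have := ltn_ord k; lia.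
rewrite coefM [RHS]coefM; apply: eq_bigr => k _; congr (_ * _).
by rewrite coef_poly ifT ?(@lmulE_le _ _ _ _ N) //; have := ltn_ord k; lia.
Qed.

Fact lmul1 : left_id (lmono 0) lmul.
Proof.
move=> f; have [s hs] := laurent_subproof f.
have h0 (i : int) : i < 0 -> lmono 0 i = 0.
  by move=> i0 /=; case: eqP => // ie; lia.
apply: laurentP => n; have [hn|[N ->]] := int_split (0 + s) n.
  by rewrite (lmul0 h0 hs) // hs // -[s]add0r.
rewrite [LHS](cauchyE _ h0 hs) big_ord_recl /= subn0 big1 => [|k _].
  by rewrite mul1r addr0 add0r.
by rewrite mul0r.
Qed.

Fact lmulDl : left_distributive lmul ladd.
Proof.
move=> f g h; have [r hr] := laurent_subproof f.
have [s hs] := laurent_subproof g; have [t ht] := laurent_subproof h.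
pose m := Order.min r s.
have hf i : i < m -> f i = 0 by rewrite lt_min => /andP[/hr].
have hg i : i < m -> g i = 0 by rewrite lt_min => /andP[_ /hs].
have hfg i : i < m -> ladd f g i = 0.
  by move=> im /=; rewrite hf // hg // addr0.
apply: laurentP => n; have [hn|[N ->]] := int_split (m + t) n.
  by rewrite (lmul0 hfg ht) //= (cauchy0 hf ht) // (cauchy0 hg ht) // addr0.
rewrite [LHS](cauchyE _ hfg ht) /= (cauchyE _ hf ht) (cauchyE _ hg ht).
by rewrite -big_split; apply: eq_bigr => k _ /=; rewrite mulrDl.
Qed.

Fact lone_neq0 : lmono 0 != 0.
Proof.
apply/eqP => /(congr1 (fun f : laurent K => f 0)) /=.
by move=> /eqP; rewrite oner_eq0.
Qed.

HB.instance Definition _ := GRing.Zmodule_isComNzRing.Build (laurent K)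
  lmulA lmulC lmul1 lmulDl lone_neq0.

(* The first [n] coefficients of the inverse of [a 0 + a 1 z + ...]. *)
Fixpoint inv_seq (a : nat -> K) (n : nat) : seq K :=
  if n is n'.+1 then
    let s := inv_seq a n' in
    rcons s (((n' == 0%N)%:R - \sum_(i < n') s`_i * a (n' - i)%N) / a 0%N)
  else [::].

Lemma size_inv_seq a n : size (inv_seq a n) = n.
Proof. by elim: n => //= n IH; rewrite size_rcons IH. Qed.

Lemma nth_inv_seq a m n : (m < n)%N ->
  (inv_seq a n)`_m = (inv_seq a m.+1)`_m.
Proof.
elim: n => // n IH; rewrite ltnS leq_eqVlt => /orP[/eqP -> //|mn].
by rewrite [inv_seq a n.+1]/= nth_rcons size_inv_seq mn IH.
Qed.

Lemma inv_seqP a n : a 0%N != 0 ->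
  \sum_(i < n.+1) (inv_seq a i.+1)`_i * a (n - i)%N = (n == 0%N)%:R.
Proof.
move=> a0; rewrite big_ord_recr /= subnn nth_rcons size_inv_seq ltnn eqxx.
rewrite mulfVK //; set S := \sum_(i < n) _; set T := \sum_(i < n) _.
suff -> : S = T by rewrite addrC subrK.
by apply: eq_bigr => i _; rewrite -(@nth_inv_seq a i n).
Qed.

Lemma laurent_order f : f != 0 ->
  exists m : int, f m != 0 /\ forall i, i < m -> f i = 0.
Proof.
move=> f0; have [s hs] := laurent_subproof f.
have /existsNP[n /eqP hn] : ~ forall n, f n = 0.
  by move=> H; case/eqP: f0; apply: laurentP.
have [ns|[N0 nE]] := int_split s n; first by rewrite hs ?eqxx in hn.
have exN : exists N : nat, f (s + N%:Z) != 0 by exists N0; rewrite -nE.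
case: (ex_minnP exN) => m hm mmin; exists (s + m%:Z); split=> // i im.
have [/hs //|[k ik]] := int_split s i.
apply/eqP; apply: contraT => hi; have := mmin k; rewrite -ik => /(_ hi).
lia.
Qed.

Lemma laurent_inv_ex f : f != 0 -> exists g, g * f = 1.
Proof.
move=> /laurent_order[m [fm0 hm]].
pose a (k : nat) := f (m + k%:Z).
have a0 : a 0%N != 0 by rewrite /a addr0.
pose g (n : int) : K :=
  if n + m is Posz k then (inv_seq a k.+1)`_k else 0.
have hg n : n < - m -> g n = 0.
  by rewrite /g; case E : (n + m) => [k|k] //; lia.
exists (Laurent (ex_intro (fun N => forall n, n < N -> g n = 0) _ hg)).
apply: laurentP => n; rewrite [LHS]/=.
have [hn|[N ->]] := int_split (- m + m) n.
  rewrite (cauchy0 hg hm) //=; case: eqP => // n0.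
  by move: hn; rewrite n0 addNr ltxx.
rewrite (cauchyE _ hg hm).
transitivity (\sum_(i < N.+1) (inv_seq a i.+1)`_i * a (N - i)%N).
  apply: eq_bigr => i _; congr (_ * _); rewrite /g.
  by have -> : - m + i%:Z + m = i%:Z by lia.
by rewrite inv_seqP // addNr add0r.
Qed.

Definition linv f : laurent K :=
  if f == 0 then 0 else xget 0 [set g | g * f = 1].

Fact linvP f : f != 0 -> linv f * f = 1.
Proof.
move=> f0; rewrite /linv (negPf f0); have [g hg] := laurent_inv_ex f0.
exact: (@xgetPex _ 0 [set g | g * f = 1] (ex_intro _ g hg)).
Qed.

Fact linv0 : linv 0 = 0.
Proof. by rewrite /linv eqxx. Qed.

HB.instance Definition _ :=
  GRing.ComNzRing_isField.Build (laurent K) linvP linv0.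

Lemma lderiv_subproof f : ltrunc (fun n => (n + 1)%:~R * f (n + 1)).
Proof.
have [s hs] := laurent_subproof f; exists (s - 1) => n hn.
by rewrite hs ?mulr0 //; lia.
Qed.
Definition lderiv f : laurent K := Laurent (lderiv_subproof f).

Definition res f : K := f (-1).

End LaurentRing.

Arguments lmono {K} m.

(** * Enveloping algebras and induced modules *)

Section Enveloping.
Variables (K : fieldType) (g : lmodType K) (br : g -> g -> g).

(* U(g) is presented as the unital associative algebra generated by the
   elements of [g], with the linear relations of [g] and xy - yx = [x, y]. *)
Inductive uexpr : Type :=
  | UGen of g
  | UZero
  | UOne
  | UAdd of uexpr & uexpr
  | UScale of K & uexpr
  | UMul of uexpr & uexpr.

Inductive ueq : uexpr -> uexpr -> Prop :=
  | ueq_refl s : ueq s s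
  | ueq_sym s t : ueq s t -> ueq t s
  | ueq_trans s t u : ueq s t -> ueq t u -> ueq s u
  | ueq_add s s' t t' : ueq s s' -> ueq t t' -> ueq (UAdd s t) (UAdd s' t')
  | ueq_scale c s s' : ueq s s' -> ueq (UScale c s) (UScale c s')
  | ueq_mul s s' t t' : ueq s s' -> ueq t t' -> ueq (UMul s t) (UMul s' t')
  | ueq_addA s t u : ueq (UAdd s (UAdd t u)) (UAdd (UAdd s t) u)
  | ueq_addC s t : ueq (UAdd s t) (UAdd t s)
  | ueq_add0 s : ueq (UAdd UZero s) s
  | ueq_scaleA a b s : ueq (UScale a (UScale b s)) (UScale (a * b) s)
  | ueq_scale1 s : ueq (UScale 1 s) s
  | ueq_scale0 s : ueq (UScale 0 s) UZero
  | ueq_scaleDr c s t :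
      ueq (UScale c (UAdd s t)) (UAdd (UScale c s) (UScale c t))
  | ueq_scaleDl a b s :
      ueq (UScale (a + b) s) (UAdd (UScale a s) (UScale b s))
  | ueq_mulA s t u : ueq (UMul s (UMul t u)) (UMul (UMul s t) u)
  | ueq_mul1l s : ueq (UMul UOne s) s
  | ueq_mul1r s : ueq (UMul s UOne) s
  | ueq_mulDl s t u : ueq (UMul (UAdd s t) u) (UAdd (UMul s u) (UMul t u))
  | ueq_mulDr s t u : ueq (UMul s (UAdd t u)) (UAdd (UMul s t) (UMul s u))
  | ueq_scaleAl c s t : ueq (UScale c (UMul s t)) (UMul (UScale c s) t)
  | ueq_scaleAr c s t : ueq (UScale c (UMul s t)) (UMul s (UScale c t))
  | ueq_genD x y : ueq (UGen (x + y)) (UAdd (UGen x) (UGen y))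
  | ueq_genZ c x : ueq (UGen (c *: x)) (UScale c (UGen x))
  | ueq_br x y :
      ueq (UAdd (UMul (UGen x) (UGen y))
                (UScale (-1) (UMul (UGen y) (UGen x))))
          (UGen (br x y)).

HB.instance Definition _ := gen_eqMixin uexpr.
HB.instance Definition _ := gen_choiceMixin uexpr.

Definition ueqb (s t : uexpr) : bool := `[< ueq s t >].

Fact ueqb_refl : reflexive ueqb.
Proof. by move=> s; apply/asboolP/ueq_refl. Qed.
Fact ueqb_sym : symmetric ueqb.
Proof. by move=> s t; apply/asboolP/asboolP => /ueq_sym. Qed.
Fact ueqb_trans : transitive ueqb.
Proof.
by move=> t s u /asboolP st /asboolP tu; apply/asboolP/(ueq_trans st tu).
Qed.

Canonical ueqb_equiv := EquivRel ueqb ueqb_refl ueqb_sym ueqb_trans.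

Definition uenv : Type := {eq_quot ueqb}.
HB.instance Definition _ := Choice.on uenv.
HB.instance Definition _ : EqQuotient _ ueqb_equiv uenv :=
  EqQuotient.on uenv.

Definition ucls (s : uexpr) : uenv := \pi_uenv s.

Fact uclsP s t : ucls s = ucls t <-> ueq s t.
Proof.
split=> [/eqmodP/asboolP //|st]; exact/eqmodP/asboolP.
Qed.

Fact ureprK (u : uenv) : ucls (repr u) = u.
Proof. exact: reprK. Qed.

Fact urepr s : ueq (repr (ucls s)) s.
Proof. by apply/uclsP; rewrite ureprK. Qed.

Fact uind (P : uenv -> Prop) : (forall s, P (ucls s)) -> forall u, P u.
Proof. by move=> H u; rewrite -[u]ureprK. Qed.

Definition uadd (u v : uenv) : uenv := ucls (UAdd (repr u) (repr v)).
Definition uscale c (u : uenv) : uenv := ucls (UScale c (repr u)).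
Definition umul (u v : uenv) : uenv := ucls (UMul (repr u) (repr v)).

Fact uaddE s t : uadd (ucls s) (ucls t) = ucls (UAdd s t).
Proof. by apply/uclsP/ueq_add; apply: urepr. Qed.
Fact uscaleE c s : uscale c (ucls s) = ucls (UScale c s).
Proof. by apply/uclsP/ueq_scale; apply: urepr. Qed.
Fact umulE s t : umul (ucls s) (ucls t) = ucls (UMul s t).
Proof. by apply/uclsP/ueq_mul; apply: urepr. Qed.

Fact uaddA : associative uadd.
Proof.
elim/uind=> s; elim/uind=> t; elim/uind=> u; rewrite !uaddE.
exact/uclsP/ueq_addA.
Qed.
Fact uaddC : commutative uadd.
Proof.
by elim/uind=> s; elim/uind=> t; rewrite !uaddE; apply/uclsP/ueq_addC.
Qed.
Fact uadd0 : left_id (ucls UZero) uadd.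
Proof. by elim/uind=> s; rewrite uaddE; apply/uclsP/ueq_add0. Qed.
Fact uscaleDl0 u : {morph uscale^~ u : a b / a + b >-> uadd a b}.
Proof.
move: u; elim/uind=> s a b; rewrite !uscaleE uaddE.
exact/uclsP/ueq_scaleDl.
Qed.
Fact uscale1 : left_id 1 uscale.
Proof. by elim/uind=> s; rewrite uscaleE; apply/uclsP/ueq_scale1. Qed.
Fact uscale0 u : uscale 0 u = ucls UZero.
Proof. by move: u; elim/uind=> s; rewrite uscaleE; apply/uclsP/ueq_scale0. Qed.
Fact uaddN : left_inverse (ucls UZero) (uscale (-1)) uadd.
Proof.
move=> u; rewrite -[X in uadd _ X]uscale1 -uscaleDl0 addNr.
exact: uscale0.
Qed.

HB.instance Definition _ := GRing.isZmodule.Build uenv uaddA uaddC uadd0 uaddN.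

Fact uscaleA a b u : uscale a (uscale b u) = uscale (a * b) u.
Proof. by move: u; elim/uind=> s; rewrite !uscaleE; apply/uclsP/ueq_scaleA. Qed.
Fact uclsD s t : ucls s + ucls t = ucls (UAdd s t).
Proof. exact: uaddE. Qed.
Fact uscaleDr : right_distributive uscale +%R.
Proof.
move=> c; elim/uind=> s; elim/uind=> t; rewrite !(uclsD, uscaleE).
exact/uclsP/ueq_scaleDr.
Qed.
Fact uscaleDl u : {morph uscale^~ u : a b / a + b}.
Proof. exact: uscaleDl0. Qed.

HB.instance Definition _ := GRing.Zmodule_isLmodule.Build K uenv
  uscaleA uscale1 uscaleDr uscaleDl.

Fact umulA : associative umul.
Proof.
elim/uind=> s; elim/uind=> t; elim/uind=> u; rewrite !umulE.
exact/uclsP/ueq_mulA.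
Qed.
Fact umul1l : left_id (ucls UOne) umul.
Proof. by elim/uind=> s; rewrite umulE; apply/uclsP/ueq_mul1l. Qed.
Fact umul1r : right_id (ucls UOne) umul.
Proof. by elim/uind=> s; rewrite umulE; apply/uclsP/ueq_mul1r. Qed.
Fact umulDl : left_distributive umul +%R.
Proof.
elim/uind=> s; elim/uind=> t; elim/uind=> u; rewrite !(uclsD, umulE).
exact/uclsP/ueq_mulDl.
Qed.
Fact umulDr : right_distributive umul +%R.
Proof.
elim/uind=> s; elim/uind=> t; elim/uind=> u; rewrite !(uclsD, umulE).
exact/uclsP/ueq_mulDr.
Qed.

(* The counit, which shows that U(g) is not the zero ring. *)
Fixpoint ucounit (s : uexpr) : K :=
  match s with
  | UGen _ | UZero => 0
  | UOne => 1
  | UAdd s t => ucounit s + ucounit t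
  | UScale c s => c * ucounit s
  | UMul s t => ucounit s * ucounit t
  end.

Fact ucounitP s t : ueq s t -> ucounit s = ucounit t.
Proof.
elim=> //=; do ?by move=> *; ring.
- by move=> s' t' u _ -> _ ->.
- by move=> s1 s2 t1 t2 _ -> _ ->.
- by move=> c s1 s2 _ ->.
- by move=> s1 s2 t1 t2 _ -> _ ->.
Qed.

Fact uone_neq0 : ucls UOne != 0.
Proof. by apply/eqP => /uclsP/ucounitP/eqP /=; rewrite oner_eq0. Qed.

HB.instance Definition _ := GRing.Zmodule_isNzRing.Build uenv
  umulA umul1l umul1r umulDl umulDr uone_neq0.

Fact uclsM s t : ucls s * ucls t = ucls (UMul s t).
Proof. exact: umulE. Qed.
Fact uclsZ c s : c *: ucls s = ucls (UScale c s).
Proof. exact: uscaleE. Qed.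

Fact uscaleAl (c : K) (u v : uenv) : c *: (u * v) = (c *: u) * v.
Proof.
move: u v; elim/uind=> s; elim/uind=> t; rewrite [ucls s * _]uclsM !uclsZ uclsM.
exact/uclsP/ueq_scaleAl.
Qed.
HB.instance Definition _ := GRing.Lmodule_isLalgebra.Build K uenv uscaleAl.

Fact uscaleAr (c : K) (u v : uenv) : c *: (u * v) = u * (c *: v).
Proof.
move: u v; elim/uind=> s; elim/uind=> t; rewrite [ucls s * _]uclsM !uclsZ uclsM.
exact/uclsP/ueq_scaleAr.
Qed.
HB.instance Definition _ := GRing.Lalgebra_isAlgebra.Build K uenv uscaleAr.

Definition ugen (x : g) : uenv := ucls (UGen x).

Fact ugen_linear : linear ugen.
Proof.
move=> c x y; rewrite uclsZ uclsD; apply/uclsP.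
exact: ueq_trans (ueq_genD _ _) (ueq_add (ueq_genZ _ _) (ueq_refl _)).
Qed.
HB.instance Definition _ :=
  GRing.isLinear.Build K g uenv _ ugen ugen_linear.

Fact ugen_br x y : ugen x * ugen y - ugen y * ugen x = ugen (br x y).
Proof.
rewrite -scaleN1r !uclsM uclsZ uclsD.
exact/uclsP/ueq_br.
Qed.

(* Given a Lie subalgebra [B] of [g] acting by [actN] on [N], [indmod] is
   U(g) (x)_{U(B)} N; since [B] generates U(B), the tensor product is balanced
   over U(B) as soon as it is balanced over [B]. *)
Variables (B : set g) (N : lmodType K) (actN : g -> N -> N).

Inductive texpr : Type :=
  | TTens of uenv & N
  | TZero
  | TAdd of texpr & texpr
  | TScale of K & texpr.

Inductive teq : texpr -> texpr -> Prop :=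
  | teq_refl s : teq s s
  | teq_sym s t : teq s t -> teq t s
  | teq_trans s t u : teq s t -> teq t u -> teq s u
  | teq_add s s' t t' : teq s s' -> teq t t' -> teq (TAdd s t) (TAdd s' t')
  | teq_scale c s s' : teq s s' -> teq (TScale c s) (TScale c s')
  | teq_addA s t u : teq (TAdd s (TAdd t u)) (TAdd (TAdd s t) u)
  | teq_addC s t : teq (TAdd s t) (TAdd t s)
  | teq_add0 s : teq (TAdd TZero s) s
  | teq_scaleA a b s : teq (TScale a (TScale b s)) (TScale (a * b) s)
  | teq_scale1 s : teq (TScale 1 s) s
  | teq_scale0 s : teq (TScale 0 s) TZero
  | teq_scaleDr c s t :
      teq (TScale c (TAdd s t)) (TAdd (TScale c s) (TScale c t))
  | teq_scaleDl a b s :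
      teq (TScale (a + b) s) (TAdd (TScale a s) (TScale b s))
  | teq_tensDl u v x : teq (TTens (u + v) x) (TAdd (TTens u x) (TTens v x))
  | teq_tensDr u x y : teq (TTens u (x + y)) (TAdd (TTens u x) (TTens u y))
  | teq_tensZl c u x : teq (TTens (c *: u) x) (TScale c (TTens u x))
  | teq_tensZr c u x : teq (TTens u (c *: x)) (TScale c (TTens u x))
  | teq_balanced u b x : B b ->
      teq (TTens (u * ugen b) x) (TTens u (actN b x)).

HB.instance Definition _ := gen_eqMixin texpr.
HB.instance Definition _ := gen_choiceMixin texpr.

Definition teqb (s t : texpr) : bool := `[< teq s t >].

Fact teqb_refl : reflexive teqb.
Proof. by move=> s; apply/asboolP/teq_refl. Qed.
Fact teqb_sym : symmetric teqb.
Proof. by move=> s t; apply/asboolP/asboolP => /teq_sym. Qed.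
Fact teqb_trans : transitive teqb.
Proof.
by move=> t s u /asboolP st /asboolP tu; apply/asboolP/(teq_trans st tu).
Qed.

Canonical teqb_equiv := EquivRel teqb teqb_refl teqb_sym teqb_trans.

Definition indmod : Type := {eq_quot teqb}.
HB.instance Definition _ := Choice.on indmod.
HB.instance Definition _ : EqQuotient _ teqb_equiv indmod :=
  EqQuotient.on indmod.

Definition tcls (s : texpr) : indmod := \pi_indmod s.

Fact tclsP s t : tcls s = tcls t <-> teq s t.
Proof.
split=> [/eqmodP/asboolP //|st]; exact/eqmodP/asboolP.
Qed.

Fact treprK (u : indmod) : tcls (repr u) = u.
Proof. exact: reprK. Qed.

Fact trepr s : teq (repr (tcls s)) s.
Proof. by apply/tclsP; rewrite treprK. Qed.

Fact tind (P : indmod -> Prop) : (forall s, P (tcls s)) -> forall u, P u.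
Proof. by move=> H u; rewrite -[u]treprK. Qed.

Definition tadd (u v : indmod) : indmod := tcls (TAdd (repr u) (repr v)).
Definition tscale c (u : indmod) : indmod := tcls (TScale c (repr u)).

Fact taddE s t : tadd (tcls s) (tcls t) = tcls (TAdd s t).
Proof. by apply/tclsP/teq_add; apply: trepr. Qed.
Fact tscaleE c s : tscale c (tcls s) = tcls (TScale c s).
Proof. by apply/tclsP/teq_scale; apply: trepr. Qed.

Fact taddA : associative tadd.
Proof.
elim/tind=> s; elim/tind=> t; elim/tind=> u; rewrite !taddE.
exact/tclsP/teq_addA.
Qed.
Fact taddC : commutative tadd.
Proof.
by elim/tind=> s; elim/tind=> t; rewrite !taddE; apply/tclsP/teq_addC.
Qed.
Fact tadd0 : left_id (tcls TZero) tadd.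
Proof. by elim/tind=> s; rewrite taddE; apply/tclsP/teq_add0. Qed.
Fact tscaleDl0 u : {morph tscale^~ u : a b / a + b >-> tadd a b}.
Proof.
move: u; elim/tind=> s a b; rewrite !tscaleE taddE.
exact/tclsP/teq_scaleDl.
Qed.
Fact tscale1 : left_id 1 tscale.
Proof. by elim/tind=> s; rewrite tscaleE; apply/tclsP/teq_scale1. Qed.
Fact tscale0 u : tscale 0 u = tcls TZero.
Proof. by move: u; elim/tind=> s; rewrite tscaleE; apply/tclsP/teq_scale0. Qed.
Fact taddN : left_inverse (tcls TZero) (tscale (-1)) tadd.
Proof.
move=> u; rewrite -[X in tadd _ X]tscale1 -tscaleDl0 addNr.
exact: tscale0.
Qed.

HB.instance Definition _ :=
  GRing.isZmodule.Build indmod taddA taddC tadd0 taddN.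

Fact tscaleA a b u : tscale a (tscale b u) = tscale (a * b) u.
Proof. by move: u; elim/tind=> s; rewrite !tscaleE; apply/tclsP/teq_scaleA. Qed.
Fact tclsD s t : tcls s + tcls t = tcls (TAdd s t).
Proof. exact: taddE. Qed.
Fact tscaleDr : right_distributive tscale +%R.
Proof.
move=> c; elim/tind=> s; elim/tind=> t; rewrite !(tclsD, tscaleE).
exact/tclsP/teq_scaleDr.
Qed.
Fact tscaleDl u : {morph tscale^~ u : a b / a + b}.
Proof. exact: tscaleDl0. Qed.

HB.instance Definition _ := GRing.Zmodule_isLmodule.Build K indmod
  tscaleA tscale1 tscaleDr tscaleDl.

Fact tclsZ c s : c *: tcls s = tcls (TScale c s).
Proof. exact: tscaleE. Qed.

Definition tens (u : uenv) (x : N) : indmod := tcls (TTens u x).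

Fixpoint tact (x : g) (s : texpr) : texpr :=
  match s with
  | TTens u n => TTens (ugen x * u) n
  | TZero => TZero
  | TAdd s t => TAdd (tact x s) (tact x t)
  | TScale c s => TScale c (tact x s)
  end.

Fact tactP x s t : teq s t -> teq (tact x s) (tact x t).
Proof.
elim=> {s t} /=; do ?by move=> *; constructor.
- by move=> s t u _ st _; apply: teq_trans.
- by move=> u v y; rewrite mulrDr; constructor.
- by move=> c u y; rewrite -scalerAr; constructor.
- by move=> u b y Bb; rewrite mulrA; constructor.
Qed.

Definition indact (x : g) (v : indmod) : indmod := tcls (tact x (repr v)).

Fact indactE x s : indact x (tcls s) = tcls (tact x s).
Proof. exact/tclsP/tactP/trepr. Qed.

Fact indact_tens x u n : indact x (tens u n) = tens (ugen x * u) n.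
Proof. exact: indactE. Qed.

Fact indact_linear x : linear (indact x).
Proof.
move=> c; elim/tind=> s; elim/tind=> t.
by rewrite tclsZ tclsD !indactE tclsZ tclsD.
Qed.

End Enveloping.

Arguments ugen {K g br} x.
Arguments ucls {K g br} s.
Arguments tens {K g br B N actN} u x.
Arguments tcls {K g br B N actN} s.
Arguments indact {K g br B N actN} x v.
Arguments tclsP {K g br B N actN s t}.
Arguments tclsD {K g br B N actN} s t.
Arguments tclsZ {K g br B N actN} c s.
Arguments tind {K g br B N actN} P.
Arguments indactE {K g br B N actN} x s.
Arguments indact_tens {K g br B N actN} x u n.
Arguments indact_linear {K g br B N actN} x.

(** * The Virasoro algebra and its modules *)

Section Virasoro.
Variable K : fieldType.

(* The pair [(f, a)] stands for f(x) d/dx + a c. *)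
Definition vir : Type := (laurent K * K^o)%type.
HB.instance Definition _ := GRing.Lmodule.on vir.

Definition vir_br (a b : vir) : vir :=
  let: (f, g) := (a.1, b.1) in
  (f * lderiv g - g * lderiv f,
   12%:R^-1 * res (lderiv (lderiv (lderiv f)) * g)).

Definition vir_central : vir := (0, 1).

Definition vir_nonneg : set vir :=
  [set a : vir | forall n : int, n < 0 -> a.1 n = 0].

Definition vir_vacact (ell : K) (a : vir) (c : K^o) : K^o := (a.2 * ell) *: c.

(* V_V(ell,0), induced from C[[x]] d/dx + C c acting on C. *)
Definition virmod (ell : K) : Type := indmod vir_br vir_nonneg (vir_vacact ell).
HB.instance Definition _ (ell : K) := GRing.Lmodule.on (virmod ell).

Definition virmod_act (ell : K) (a : vir) (v : virmod ell) : virmod ell :=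
  indact a v.

Definition vacuum (ell : K) : virmod ell := tens 1 1.

Definition omega (ell : K) : virmod ell :=
  virmod_act (- lmono (-1), 0) (vacuum ell).

Section Modules.
Variables (W : lmodType K) (act : vir -> W -> W).

Record is_vir_module : Prop := {
  vir_module_linearl : forall w, linear (fun a => act a w);
  vir_module_linearr : forall a, linear (act a);
  vir_module_br : forall a b w,
    act (vir_br a b) w = act a (act b w) - act b (act a w) }.

Definition is_restricted : Prop := forall w,
  (exists N : int, forall n, N <= n -> act (lmono n, 0) w = 0) /\
  (forall f : laurent K,
     act (f, 0) w = \sum_(n \in [set: int]) f n *: act (lmono n, 0) w).

Definition has_level (ell : K) : Prop :=
  forall w, act vir_central w = ell *: w.

End Modules.

Definition alpha (p f : laurent K) : K :=
  24%:R^-1 * res (f * (2%:R *: lderiv (lderiv p) - p^-1 * lderiv p ^+ 2)).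

End Virasoro.

(** * Vertex algebras and phi-coordinated modules *)

Section Vertex.
Variable K : fieldType.

(* [Y v w m] is the coefficient of [z ^ m] in Y(v,z)w, and [mode Y v n] is the
   operator v_n in Y(v,z) = \sum_n v_n z^(-n-1). *)
Definition mode (V W : Type) (Y : V -> W -> int -> W) (v : V) (n : int)
  (w : W) : W := Y v w (- n - 1).

Record is_vertex_map (V W : lmodType K) (Y : V -> W -> int -> W) : Prop := {
  vertex_map_linearl : forall w m, linear (fun v => Y v w m);
  vertex_map_linearr : forall v m, linear (fun w => Y v w m);
  vertex_map_trunc : forall v w, ltrunc (Y v w) }.

Definition vertex_vacuum (V W : lmodType K) (Y : V -> W -> int -> W)
  (vac : V) : Prop := forall w m, Y vac w m = if m == 0 then w else 0.

Definition binz (m : int) (i : nat) : K :=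
  (\prod_(j < i) (m - j%:Z)%:~R) / i`!%:R.

(* [va_jacobi] is the Jacobi identity in components (Borcherds' identity). *)
Record is_vertex_algebra (V : lmodType K) (Y : V -> V -> int -> V)
    (vac : V) : Prop := {
  va_vertex_map : is_vertex_map Y;
  va_vacuum : vertex_vacuum Y vac;
  va_creation : forall v, Y v vac 0 = v /\ forall m, m < 0 -> Y v vac m = 0;
  va_jacobi : forall (u v w : V) (l m n : int),
    \sum_(i \in [set: nat])
      binz m i *: mode Y (mode Y u (l + i%:Z) v) (m + n - i%:Z) w =
    \sum_(i \in [set: nat])
      ((-1) ^+ i * binz l i) *:
        (mode Y u (m + l - i%:Z) (mode Y v (n + i%:Z) w) -
         (-1) ^ l *: mode Y v (n + l - i%:Z) (mode Y u (m + i%:Z) w)) }.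

(* [phi p n] is the coefficient of [z ^ n] in phi(x,z). *)
Definition phi (p : laurent K) (n : nat) : laurent K :=
  n`!%:R^-1 *: iter n (fun f => p * lderiv f) (lmono 1).

(* Elements of C((x))[[z]], as sequences of coefficients in z. *)
Definition psmul (F G : nat -> laurent K) (n : nat) : laurent K :=
  \sum_(i < n.+1) F i * G (n - i)%N.

Definition psone (n : nat) : laurent K := (n == 0%N)%:R.

Definition phi_sub_x (p : laurent K) (n : nat) : laurent K :=
  phi p n - (if n == 0%N then lmono 1 else 0).

Section Formal.
Variable W : lmodType K.
Implicit Type A : int -> int -> W.

(* [A i j] is the coefficient of [z1 ^ i * z2 ^ j]; [ltrunc2 A] says that [A]
   lies in W((z1,z2)). *)
Definition ltrunc2 A : Prop :=
  exists N : int, forall i j, (i < N) || (j < N) -> A i j = 0.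

Definition mulz12 (k : nat) A : int -> int -> W :=
  iter k (fun B i j => B (i - 1) j - B i (j - 1)) A.

(* p(z1) d/dz1 *)
Definition pderiv1 (p : laurent K) A (i j : int) : W :=
  \sum_(r \in [set: int]) p r *: ((i - r + 1)%:~R *: A (i - r + 1) j).

(* Coefficient of [z0 ^ n * z2 ^ m] in A(phi(z2,z0), z2). *)
Definition subst_phi (p : laurent K) A (n m : int) : W :=
  if n is Posz n' then
    n'`!%:R^-1 *:
      \sum_(i \in [set: int]) iter n' (pderiv1 p) A i (m - i)
  else 0.

(* The product of F(z2,z0) in C((z2))[[z0]] with a series [B] whose coefficient
   of [z0 ^ n * z2 ^ m] is [B n m]. *)
Definition psact (F : nat -> laurent K) (B : int -> int -> W) (n m : int) : W :=
  \sum_(i \in [set: nat])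
    \sum_(j \in [set: int]) F i j *: B (n - i%:Z) (m - j).

End Formal.

Record is_phi_module (p : laurent K) (V : lmodType K) (Y : V -> V -> int -> V)
    (vac : V) (W : lmodType K) (YW : V -> W -> int -> W) : Prop := {
  phi_vertex_map : is_vertex_map YW;
  phi_vacuum : vertex_vacuum YW vac;
  phi_assoc : forall u v : V, exists k : nat,
    let A w := mulz12 k (fun i j => YW u (YW v w j) i) in
    (forall w, ltrunc2 (A w)) /\
    (forall w n m,
       psact (iter k (psmul (phi_sub_x p)) psone)
         (fun n m => YW (Y u v n) w m) n m =
       subst_phi p (A w) n m) }.

End Vertex.

(* Main.v *)
Require Import Defs.
From HB Require Import structures.
From mathcomp Require Import all_boot all_order all_algebra.
From mathcomp Require Import all_classical reals complex.
From mathcomp Require Import zify ring.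

Set Implicit Arguments.
Unset Strict Implicit.
Unset Printing Implicit Defensive.

Import Order.TTheory GRing.Theory Num.Theory.
Local Open Scope classical_set_scope.
Local Open Scope ring_scope.

(** The vector field p d/dx is constant in a suitable coordinate, and the proof
    consists in working in that coordinate.  Around the point z write x = z + s,
    P(s) = p(z + s), and let g(s) be the integral of dx / p(x) from z to z + s
    ([PP] and [gg]).  For y = g(s), substituting z1 = phi(z2, y) amounts to
    expanding at z1 = z2 + s and rewriting the result as a series in y
    ([lsubst_phiE], [subst_phi_comp]).  Associativity of two fields thus says that
    some (z1 - z2)^q a(z1) b(z2) is a Laurent series in both variables, whose
    expansion at z1 = z2 + s is s^q times the series in g(s) whose coefficients
    are the fields of the products in the vertex algebra.

    Restricted modules are phi-coordinated.  On maps b from W to W((z)), the modes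
    of T(x) based at z, that is, the residues of (x - z)^m [T(x), b(z)] dx, satisfy
    the Virasoro relations ([Tm_br]), and they preserve locality ([local_Tm]).
    Passing from s to y turns them into operators for - y^n d/dy; the Schwarzian
    correction by alpha makes the central charges agree ([cocycle_gg],
    [coord_op_modes]).  The identity is annihilated by those with n >= 0, so the
    universal property of the induced module yields a field for each vector
    ([YF]).  Associativity is proved by induction on the second vector
    ([prodexp_YF]).  Applying omega_m to it is described on the side of the fields
    by Wick's rule ([prodexp_vf]) and on the side of the vertex algebra by the
    commutator formula ([Th_om]); the two agree because of the Taylor expansion of
    the vector fields y^m d/dy ([taylor_gP]).  The induction starts with Taylor's
    formula for one field, as omega_0 acts as p d/dz ([YF_om0], [taylor_comp]).

    Conversely, let a be the field of omega.  Associativity with the vacuum again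
    gives Taylor's formula ([FW_taylor]), and with the skew symmetry of the vertex
    algebra it shows that the expansion of the product of a with itself is
    unchanged when z and z + s are exchanged, under which g is odd ([X_skew]).  As
    a Laurent series in two variables is determined by this expansion, a is local
    ([omega_local]).  The commutators of the residues of f a are then residues at
    s = 0 of the four singular terms of the product omega by omega ([ares_comm]).
    Letting x d/dx act as minus the residue of x p^(-2) a, plus a central
    correction, gives the Virasoro relations, because the cocycle changes by
    the coboundary of alpha under the change of coordinate ([wact_cocycle]). *)

(** * Linear combinations with integer coefficients *)

Inductive zexpr :=
  | ZAtom of nat | ZZero | ZAdd of zexpr & zexpr | ZOpp of zexpr
  | ZMul of zexpr & int.

Fixpoint zeval (V : zmodType) (s : seq V) (e : zexpr) : V :=
  match e with
  | ZAtom n => nth 0 s n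
  | ZZero => 0
  | ZAdd a b => zeval s a + zeval s b
  | ZOpp a => - zeval s a
  | ZMul a n => zeval s a *~ n
  end.

Fixpoint zcoef (e : zexpr) (i : nat) : int :=
  match e with
  | ZAtom n => if eqn n i then 1 else 0
  | ZZero => 0
  | ZAdd a b => zcoef a i + zcoef b i
  | ZOpp a => - zcoef a i
  | ZMul a n => zcoef a i * n
  end.

Lemma zevalE (V : zmodType) (s : seq V) e :
  zeval s e = \sum_(i < size s) s`_i *~ zcoef e i.
Proof.
elim: e => [n||a IHa b IHb|a IHa|a IHa n] /=.
- case: (ltnP n (size s)) => hn; last first.
    rewrite nth_default // big1 // => i _; rewrite eqnE; case: eqP => // E.
    by have := ltn_ord i; rewrite -E ltnNge hn.
  rewrite (bigD1 (Ordinal hn)) //= eqnE eqxx mulr1z big1 ?addr0 // => i ni.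
  by case: eqP => // E; case/eqP: ni; apply: val_inj.
- by rewrite big1.
- by rewrite IHa IHb -big_split; apply: eq_bigr => i _; rewrite mulrzDr.
- by rewrite IHa -sumrN; apply: eq_bigr => i _; rewrite mulrNz.
- rewrite IHa (big_morph (fun v : V => v *~ n) (mulrzDl n) (mul0rz _ n)).
  by apply: eq_bigr => i _; rewrite mulrzA.
Qed.

Fixpoint zcheck (e1 e2 : zexpr) (n : nat) : Prop :=
  if n is n'.+1 then zcoef e1 n' = zcoef e2 n' /\ zcheck e1 e2 n' else True.

Lemma zcheckP (V : zmodType) (s : seq V) e1 e2 :
  zcheck e1 e2 (size s) -> zeval s e1 = zeval s e2.
Proof.
move=> h; rewrite !zevalE.
have {}h i : (i < size s)%N -> zcoef e1 i = zcoef e2 i.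
  elim: (size s) h => //= n IH [h1 h2]; rewrite ltnS leq_eqVlt.
  by case/orP => [/eqP ->|] //; apply: IH.
by apply: eq_bigr => i _; rewrite h.
Qed.

(** Atoms are first compared syntactically: conversion is much slower here,
    but is needed to identify different expressions of one algebraic
    structure. *)
Ltac zmem_syn x l :=
  match l with
  | nil => constr:(false)
  | cons ?y ?l' => let _ := match constr:(Set) with _ => constr_eq x y end in constr:(true)
  | cons ?y ?l' => zmem_syn x l'
  end.
Ltac zmem_conv x l :=
  match l with
  | nil => constr:(false)
  | cons ?y ?l' => let _ := constr:(erefl x : x = y) in constr:(true)
  | cons ?y ?l' => zmem_conv x l'
  end.
Ltac zatoms t l :=
  lazymatch t with
  | (?a + ?b)%R => let l := zatoms a l in zatoms b l
  | (- ?a)%R => zatoms a l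
  | (?a *~ ?n)%R => zatoms a l
  | 0%R => l
  | _ => lazymatch zmem_syn t l with
    | true => l
    | false => lazymatch zmem_conv t l with true => l | false => constr:(cons t l) end
    end
  end.
Ltac zidx_syn x l :=
  match l with
  | cons ?y ?l' => let _ := match constr:(Set) with _ => constr_eq x y end in constr:(0%N)
  | cons ?y ?l' => let n := zidx_syn x l' in constr:(S n)
  end.
Ltac zidx_conv x l :=
  match l with
  | cons ?y ?l' => let _ := constr:(erefl x : x = y) in constr:(0%N)
  | cons ?y ?l' => let n := zidx_conv x l' in constr:(S n)
  end.
Ltac zindex x l :=
  match constr:(Set) with
  | _ => zidx_syn x l
  | _ => zidx_conv x l
  end.
Ltac zquote t l :=
  lazymatch t with
  | (?a + ?b)%R => let a := zquote a l in let b := zquote b l in constr:(ZAdd a b)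
  | (- ?a)%R => let a := zquote a l in constr:(ZOpp a)
  | (?a *~ ?n)%R => let a := zquote a l in constr:(ZMul a n)
  | 0%R => constr:(ZZero)
  | _ => let n := zindex t l in constr:(ZAtom n)
  end.

(** Decides equalities between combinations of atoms with integer
    coefficients, the coefficients being compared by [ring]. *)
Ltac zlin :=
  lazymatch goal with
  | |- @eq ?T ?a ?b =>
    let l := zatoms a (@nil T) in let l := zatoms b l in
    let ea := zquote a l in let eb := zquote b l in
    apply: (@zcheckP _ l ea eb); cbn [zcheck zcoef size eqn];
    repeat (split; [ring|]); exact I
  end.

(** * Finitely supported sums over the integers *)

Definition zsum (V : zmodType) (F : int -> V) : V :=
  \sum_(i \in [set: int]) F i.

Definition fsup (V : zmodType) (F : int -> V) : Prop :=
  exists N : nat, forall i : int, (N < `|i|)%N -> F i = 0.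

Section ZSum.
Variable V : zmodType.
Implicit Types F G : int -> V.

Lemma eq_zsum F G : F =1 G -> zsum F = zsum G.
Proof. by move=> FG; apply: eq_fsbigr => i _; apply: FG. Qed.

Lemma zsum0 F : (forall i, F i = 0) -> zsum F = 0.
Proof. by move=> F0; apply: fsbig1 => i _; apply: F0. Qed.

Lemma zsum_lo F (s : int) (n : nat) :
  (forall i, i < s -> F i = 0) -> (forall i, s + n%:Z <= i -> F i = 0) ->
  zsum F = \sum_(k < n) F (s + k%:Z).
Proof.
move=> hlo hhi; rewrite /zsum (fsbigE [seq s + (k : nat)%:Z | k <- iota 0 n]) //.
- rewrite (eq_bigl xpredT) => [|i]; last by rewrite in_setT.
  by rewrite big_map (_ : iota 0 n = index_iota 0 n) ?big_mkord // /index_iota subn0.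
- by rewrite map_inj_uniq ?iota_uniq // => i j; lia.
- move=> i _ hi; have [/hlo //|si] := ltP i s.
  have [/hhi //|hn] := leP (s + n%:Z) i.
  case/negP: hi; apply/mapP; exists `|i - s|%N; last by lia.
  by rewrite mem_iota; lia.
Qed.

Lemma zsumN F (N : nat) : (forall i : int, (N < `|i|)%N -> F i = 0) ->
  zsum F = \sum_(k < (N * 2).+1) F (- N%:Z + k%:Z).
Proof. by move=> h; apply: zsum_lo => i hi; apply: h; lia. Qed.

Lemma zsum_nat F (n : nat) :
  (forall i : int, i < 0 -> F i = 0) -> (forall i : int, n%:Z <= i -> F i = 0) ->
  zsum F = \sum_(k < n) F k%:Z.
Proof.
move=> h0 h1; rewrite (zsum_lo (n := n) h0) => [|i hi]; last by apply: h1; lia.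
by apply: eq_bigr => k _; rewrite add0r.
Qed.

Lemma zsum_pt F (i0 : int) : (forall i, i != i0 -> F i = 0) -> zsum F = F i0.
Proof.
move=> h; rewrite (@zsum_lo F i0 1) ?big_ord1 ?addr0 // => i hi; apply: h; lia.
Qed.

Lemma zsum_bij F (h h' : int -> int) : cancel h h' -> cancel h' h ->
  zsum F = zsum (F \o h).
Proof.
move=> c1 c2; rewrite /zsum (reindex_fsbigT h) //.
by exists h'.
Qed.

Lemma zsum_shift F (a : int) : zsum F = zsum (fun i => F (i + a)).
Proof.
by apply: (@zsum_bij F (fun i => i + a) (fun i => i - a)) => i; lia.
Qed.

Lemma zsum_rev F (a : int) : zsum F = zsum (fun i => F (a - i)).
Proof.
by apply: (@zsum_bij F (fun i => a - i) (fun i => a - i)) => i; lia.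
Qed.

Lemma fsupP F (lo hi : int) : (forall i, i < lo -> F i = 0) ->
  (forall i, hi < i -> F i = 0) -> fsup F.
Proof.
move=> h1 h2; exists (`|lo| + `|hi|)%N => i hi0.
have [/h1 //|l1] := ltP i lo; apply: h2; lia.
Qed.

Lemma fsup2 F G : fsup F -> fsup G -> exists N : nat,
  (forall i : int, (N < `|i|)%N -> F i = 0) /\
  (forall i : int, (N < `|i|)%N -> G i = 0).
Proof.
move=> [N hN] [M hM]; exists (N + M)%N.
by split=> i hi; [apply: hN|apply: hM]; lia.
Qed.

Lemma fsupD F G : fsup F -> fsup G -> fsup (fun i => F i + G i).
Proof.
move=> hF hG; have [N [h1 h2]] := fsup2 hF hG; exists N => i hi.
by rewrite h1 // h2 // addr0.
Qed.

Lemma zsumD F G : fsup F -> fsup G ->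
  zsum (fun i => F i + G i) = zsum F + zsum G.
Proof.
move=> hF hG; have [N [h1 h2]] := fsup2 hF hG.
rewrite (zsumN h1) (zsumN h2) -big_split; apply: zsumN => i hi.
by rewrite h1 // h2 // addr0.
Qed.

End ZSum.

Lemma fsup_map (V V' : zmodType) (f : V -> V') (F : int -> V) :
  f 0 = 0 -> fsup F -> fsup (fun i => f (F i)).
Proof. by move=> f0 [N hN]; exists N => i hi; rewrite hN. Qed.

Lemma zsum_additive (V V' : zmodType) (f : V -> V') (F : int -> V) :
  {morph f : x y / x + y} -> fsup F -> f (zsum F) = zsum (fun i => f (F i)).
Proof.
move=> fD [N hN].
have f0 : f 0 = 0 by apply: (@addrI _ (f 0)); rewrite -fD !addr0.
rewrite (zsumN hN) (@zsumN _ (fun i => f (F i)) N) => [|i hi]; last by rewrite hN.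
by rewrite (big_morph f fD f0).
Qed.

Lemma zsumN1 (V : zmodType) (F : int -> V) : fsup F ->
  zsum (fun i => - F i) = - zsum F.
Proof. by move=> hF; rewrite (zsum_additive (f := -%R) (@opprD V) hF). Qed.

Lemma zsumB (V : zmodType) (F G : int -> V) : fsup F -> fsup G ->
  zsum (fun i => F i - G i) = zsum F - zsum G.
Proof.
move=> hF hG; rewrite -zsumN1 // zsumD //.
by apply: (fsup_map (f := -%R)) hG; rewrite oppr0.
Qed.

Lemma zsum_sum (V : zmodType) (n : nat) (F : 'I_n -> int -> V) :
  (forall k, fsup (F k)) ->
  zsum (fun i => \sum_(k < n) F k i) = \sum_(k < n) zsum (F k).
Proof.
elim: n F => [|n IH] F h; first by rewrite big_ord0; apply: zsum0 => i; rewrite big_ord0.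
rewrite big_ord_recl -IH // -zsumD //; first by apply: eq_zsum => i; rewrite big_ord_recl.
have /all_sig[N hN] k : {N : nat | forall i : int, (N < `|i|)%N -> F (lift ord0 k) i = 0}.
  exact: cid (h _).
exists (\max_k N k)%N => i hi; apply: big1 => k _; apply: hN.
by apply: leq_ltn_trans hi; apply: (leq_bigmax k).
Qed.

Lemma fsup_sum (V : zmodType) (n : nat) (F : 'I_n -> int -> V) :
  (forall k, fsup (F k)) -> fsup (fun i => \sum_(k < n) F k i).
Proof.
elim: n F => [|n IH] F h; first by exists 0%N => i _; rewrite big_ord0.
have [N hN] := fsupD (h ord0) (IH _ (fun k => h (lift ord0 k))).
by exists N => i hi; rewrite big_ord_recl hN.
Qed.

(** A common bound on both supports reduces the exchange to finite sums. *)
Lemma zsum_exchange (V : zmodType) (F : int -> int -> V) (N : nat) :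
  (forall i j : int, (N < `|i|)%N -> F i j = 0) ->
  (forall i j : int, (N < `|j|)%N -> F i j = 0) ->
  zsum (fun i => zsum (fun j => F i j)) = zsum (fun j => zsum (fun i => F i j)).
Proof.
move=> h1 h2.
rewrite (@zsumN _ (fun i => zsum (fun j => F i j)) N) => [|i hi]; last first.
  by apply: zsum0 => j; apply: h1.
rewrite (@zsumN _ (fun j => zsum (fun i => F i j)) N) => [|i hi]; last first.
  by apply: zsum0 => j; apply: h2.
under eq_bigr => k _ do rewrite (zsumN (h2 _)).
under [RHS]eq_bigr => k _.
  rewrite (@zsumN _ (fun i => F i (- N%:Z + k%:Z)) N) => [|i hi]; last exact: h1.
  over.
exact: exchange_big.
Qed.

Lemma zsum_scale (R : pzRingType) (V : lmodType R) (c : R) (F : int -> V) :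
  fsup F -> c *: zsum F = zsum (fun i => c *: F i).
Proof. by apply: zsum_additive => x y; rewrite scalerDr. Qed.

Lemma zsum_scalel (R : pzRingType) (V : lmodType R) (F : int -> R) (v : V) :
  fsup F -> zsum F *: v = zsum (fun i => F i *: v).
Proof. by apply: (zsum_additive (f := fun c => c *: v)) => x y; rewrite scalerDl. Qed.

(** * Integer binomial coefficients *)

(** Binomial coefficients with integer upper argument. Keeping them integral
    makes their identities independent of the characteristic of the scalars.
    *)
Definition zb (m l : int) : int :=
  match l with
  | Posz l => match m with
    | Posz m => 'C(m, l)%:Z
    | Negz m => (-1) ^+ l * 'C(m + l, l)%:Z
    end
  | Negz _ => 0
  end.

Arguments zb : simpl never.

(** The sign (-1)^l as an integer, also for negative l. *)
Definition sg (l : int) : int := (-1) ^+ `|l|%N.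

Lemma sgS l : sg (l + 1) = - sg l.
Proof.
rewrite /sg; case: (ltP l 0) => hl.
  have -> : `|l|%N = (`|(l + 1)%R|.+1)%N by lia.
  by rewrite exprS mulN1r opprK.
have -> : `|(l + 1)%R|%N = (`|l|.+1)%N by lia.
by rewrite exprS mulN1r.
Qed.

Lemma sg0 : sg 0 = 1. Proof. by []. Qed.

Lemma sgN l : sg (- l) = sg l. Proof. by rewrite /sg; congr (_ ^+ _); lia. Qed.

Lemma sgP l : sg (l - 1) = - sg l.
Proof. by rewrite -[in RHS](subrK 1 l) sgS opprK. Qed.

Lemma int_ind2 (Q : int -> Prop) : Q 0 -> (forall m, Q m -> Q (m + 1)) ->
  (forall m, Q (m + 1) -> Q m) -> forall m, Q m.
Proof.
move=> h0 hS hP; case=> n.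
  elim: n => // n IH; have -> : Posz n.+1 = Posz n + 1 by lia.
  exact: hS.
elim: n => [|n IH]; first by apply: hP; rewrite (_ : Negz 0 + 1 = 0) //; lia.
by apply: hP; rewrite (_ : Negz n.+1 + 1 = Negz n) //; lia.
Qed.

Lemma sgD l m : sg (l + m) = sg l * sg m.
Proof.
elim/int_ind2: m => [|m IH|m]; first by rewrite addr0 mulr1.
  by rewrite addrA !sgS IH mulrN.
by rewrite addrA !sgS mulrN => /oppr_inj.
Qed.

Lemma sg_sqr l : sg l * sg l = 1.
Proof. by rewrite -expr2 /sg -exprM mulnC exprM sqrrN !expr1n. Qed.

Lemma zb0l m : zb m 0 = 1.
Proof. by case: m => m; rewrite /zb /= bin0. Qed.

Lemma zbN m l : l < 0 -> zb m l = 0. Proof. by case: l. Qed.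

Lemma zbS m l : zb (m + 1) l = zb m l + zb m (l - 1).
Proof.
case: l => [[|l]|l].
- by rewrite !zb0l zbN // addr0.
- have -> : Posz l.+1 - 1 = l by lia.
  case: m => m.
    by have -> : Posz m + 1 = m.+1 by lia; rewrite /zb binS PoszD.
  case: m => [|m].
    have -> : Negz 0 + 1 = 0 by lia.
    by rewrite /zb /= !add0n !binn !mulr1 exprS mulN1r addNr.
  have -> : Negz m.+1 + 1 = Negz m by lia.
  have E : 'C(m.+1 + l.+1, l.+1) = ('C(m + l.+1, l.+1) + 'C(m.+1 + l, l))%N.
    by rewrite addSn binS addnS.
  rewrite /zb exprS E PoszD; ring.
- by rewrite !zbN //; lia.
Qed.

Lemma zb_large (m l : int) : 0 <= m -> m < l -> zb m l = 0.
Proof. by case: m => m //; case: l => l //= _ ml; rewrite /zb bin_small. Qed.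

Lemma zbN1 l : 0 <= l -> zb (-1) l = sg l.
Proof.
case: l => // l _; elim: l => [|l IH]; first by rewrite zb0l.
have E := zbS (-1) l.+1%:Z; have E2 : l.+1%:Z - 1 = l%:Z by lia.
rewrite addNr E2 (@zb_large 0) // in E.
have -> : zb (-1) l.+1 = - zb (-1) l by apply/eqP; rewrite -addr_eq0 -E.
have -> : l.+1%:Z = l%:Z + 1 by lia.
by rewrite sgS IH.
Qed.
Lemma zb0 l : zb 0 l = (l == 0)%:R.
Proof. by case: l => [[|l]|l]. Qed.

Lemma zb1 m : zb m 1 = m.
Proof.
elim/int_ind2: m => // m; rewrite zbS subrr zb0l; first by move->.
by move/addIr.
Qed.

(** Pascal's rule can be run in both directions: along the rows, and, for the
    rows below 0, by induction on the column, starting from the negative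
    columns. *)
Lemma pascal0 (V : zmodType) (f : int -> int -> V) :
  (forall m l, f (m + 1) l = f m l + f m (l - 1)) ->
  (forall l, f 0 l = 0) -> (forall m l, l < 0 -> f m l = 0) ->
  forall m l, f m l = 0.
Proof.
move=> fS f0 fN; elim/int_ind2 => // m IH; first by move=> l; rewrite fS !IH addr0.
case=> l; last exact: fN.
elim: l => [|l IHl]; first by have := fS m 0; rewrite IH (fN m (0 - 1)) // addr0.
have := fS m l.+1; by rewrite IH (_ : Posz l.+1 - 1 = l) ?IHl ?addr0 //; lia.
Qed.

Lemma zb_diag m l : l * zb m l = m * zb (m - 1) (l - 1).
Proof.
apply/eqP; rewrite -subr_eq0; apply/eqP.
apply: (pascal0 (f := fun m l => l * zb m l - m * zb (m - 1) (l - 1))).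
- move=> {}m {}l; rewrite zbS addrK.
  have := zbS (m - 1) (l - 1); rewrite subrK => ->; ring.
- by move=> {}l; rewrite zb0 mul0r subr0; case: eqP => [->|]; rewrite ?mul0r ?mulr0.
- by move=> {}m {}l hl; rewrite !zbN ?mulr0 ?subr0 //; lia.
Qed.

Lemma zb_absorb m l : (m - l) * zb m l = m * zb (m - 1) l.
Proof.
have := zbS (m - 1) l; rewrite subrK => E.
rewrite mulrBl zb_diag E; ring.
Qed.

(** Vandermonde's identity: both sides obey Pascal's rule in m. *)
Lemma zb_vdm m n r : zsum (fun i => zb m i * zb n (r - i)) = zb (m + n) r.
Proof.
have fs m' n' r' : fsup (fun i => zb m' i * zb n' (r' - i)).
  apply: (@fsupP _ _ 0 r') => i hi; first by rewrite zbN ?mul0r.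
  by rewrite [X in _ * X]zbN ?mulr0 //; lia.
apply/eqP; rewrite -subr_eq0; apply/eqP.
apply: (pascal0 (f := fun m r => zsum (fun i => zb m i * zb n (r - i)) - zb (m + n) r)).
- move=> {}m {}r; rewrite (addrAC m) zbS.
  under eq_zsum => i do rewrite zbS mulrDl.
  rewrite zsumD //; last first.
    apply: (@fsupP _ _ 0 r) => i hi; first by rewrite zbN ?mul0r //; lia.
    by rewrite [X in _ * X]zbN ?mulr0 //; lia.
  rewrite [X in _ + X - _](zsum_shift _ 1).
  rewrite [X in _ + X - _](@eq_zsum _ _ (fun i => zb m i * zb n (r - 1 - i))).
    ring.
  by move=> i; rewrite addrK opprD addrCA addrC.
- move=> {}r; rewrite (@zsum_pt _ _ 0) ?zb0 ?eqxx ?mul1r ?subr0 ?add0r ?subrr //.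
  by move=> i /negPf i0; rewrite zb0 i0 mul0r.
- move=> {}m {}r hr; rewrite zbN // subr0; apply: zsum0 => i.
  case: (ltP i 0) => hi; first by rewrite zbN ?mul0r.
  by rewrite [X in _ * X]zbN ?mulr0 //; lia.
Qed.

(** Both sides are the coefficient m! / (l! j! (m - l - j)!), a polynomial in
    m. *)
Lemma zb_trinom m l j : zb m l * zb (m - l) j = zb m j * zb (m - j) l.
Proof.
apply/eqP; rewrite -subr_eq0; apply/eqP.
case: (ltP j 0) => hj; first by rewrite (@zbN _ j) // (@zbN _ j) // mul0r mulr0 subrr.
case: j hj => // j _; elim: j m l => [|j IH] m l.
  by rewrite !zb0l subr0 mulr1 mul1r subrr.
apply: (@mulfI _ j.+1%:Z) => //; rewrite mulr0 mulrBr.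
have -> : j.+1%:Z * (zb m l * zb (m - l) j.+1) = m * (zb (m - 1) l * zb (m - 1 - l) j).
  rewrite mulrCA zb_diag (_ : j.+1%:Z - 1 = j); last by lia.
  by rewrite [LHS]mulrA [zb m l * _]mulrC zb_absorb -[LHS]mulrA (addrAC m).
have -> : j.+1%:Z * (zb m j.+1 * zb (m - j.+1%:Z) l) = m * (zb (m - 1) j * zb (m - 1 - j%:Z) l).
  rewrite mulrA zb_diag -mulrA; congr (_ * (zb _ _ * zb _ _)); lia.
by rewrite -mulrBr IH mulr0.
Qed.

(** * Laurent series with coefficients in a vector space *)

Arguments lcoef : simpl never.

Section LaurentFacts.
Variable F : fieldType.
Implicit Types f g : laurent F.

Lemma lcoefD f g n : (f + g) n = f n + g n. Proof. by []. Qed.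
Lemma lcoefN f n : (- f) n = - f n. Proof. by []. Qed.
Lemma lcoefB f g n : (f - g) n = f n - g n. Proof. by []. Qed.
Lemma lcoef0 n : (0 : laurent F) n = 0. Proof. by []. Qed.
Lemma lcoefZ (c : F) f n : (c *: f) n = c * f n. Proof. by []. Qed.
Lemma lcoefM f g n : (f * g) n = zsum (fun i => f i * g (n - i)). Proof. by []. Qed.
Lemma lcoef1 n : (1 : laurent F) n = (n == 0)%:R. Proof. by []. Qed.
Lemma lmonoE m n : (lmono m : laurent F) n = (n == m)%:R. Proof. by []. Qed.


Lemma lcoef_mulrn f k n : (f *+ k) n = f n *+ k.
Proof. by elim: k => // k IH; rewrite !mulrS lcoefD IH. Qed.

Lemma lcoef_mulrz f (k : int) n : (f *~ k) n = f n *~ k.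
Proof. by case: k => k; rewrite ?NegzE -?pmulrn -?nmulrn ?lcoefN lcoef_mulrn. Qed.

Lemma lcoef_lmonoM m f n : (lmono m * f) n = f (n - m).
Proof.
rewrite lcoefM (@zsum_pt _ _ m) => [|i /negPf im]; rewrite lmonoE ?im ?mul0r //.
by rewrite eqxx mul1r.
Qed.

Lemma lmono0 : (lmono 0 : laurent F) = 1. Proof. by []. Qed.

Lemma lmonoD a b : (lmono (a + b) : laurent F) = lmono a * lmono b.
Proof.
apply: laurentP => n; rewrite lcoef_lmonoM !lmonoE; congr (_ %:R); congr nat_of_bool.
by apply/eqP/eqP; lia.
Qed.

Lemma lmono_neq0 a : (lmono a : laurent F) != 0.
Proof.
apply/eqP => /(congr1 (fun f : laurent F => f a)); rewrite lmonoE eqxx lcoef0.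
by apply/eqP/oner_neq0.
Qed.

Definition lC (c : F) : laurent F := c *: (1 : laurent F).

Lemma lCE c n : lC c n = if n == 0 then c else 0.
Proof. by rewrite /lC lcoefZ lcoef1; case: eqP; rewrite ?mulr1 ?mulr0. Qed.

Lemma lcoef_lCM c f n : (lC c * f) n = c * f n.
Proof.
rewrite lcoefM (@zsum_pt _ _ 0) => [|i /negPf im]; rewrite lCE ?im ?mul0r //.
by rewrite eqxx subr0.
Qed.

Lemma lC_mul c f : lC c * f = c *: f.
Proof. by apply: laurentP => n; rewrite lcoef_lCM. Qed.

Lemma lC_is_zmod_morphism : zmod_morphism lC.
Proof. by move=> a b; rewrite /lC scalerBl. Qed.

Lemma lC_is_monoid_morphism : monoid_morphism lC.
Proof.
split; first by rewrite /lC scale1r.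
by move=> a b; apply: laurentP => n; rewrite lcoef_lCM !lCE; case: eqP; rewrite ?mulr0.
Qed.

HB.instance Definition _ :=
  GRing.isZmodMorphism.Build F (laurent F) lC lC_is_zmod_morphism.
HB.instance Definition _ :=
  GRing.isMonoidMorphism.Build F (laurent F) lC lC_is_monoid_morphism.

Definition ldom (f : laurent F) (s : int) : Prop := forall i, i < s -> f i = 0.

Lemma ldom_ex f : exists s, ldom f s.
Proof. exact: (laurent_subproof f). Qed.

Lemma ldomW f s t : ldom f s -> t <= s -> ldom f t.
Proof. by move=> h ts i hi; apply: h; lia. Qed.

Lemma ldomD f g s : ldom f s -> ldom g s -> ldom (f + g) s.
Proof. by move=> hf hg i hi; rewrite lcoefD hf // hg // addr0. Qed.

Lemma ldomZ c f s : ldom f s -> ldom (c *: f) s.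
Proof. by move=> hf i hi; rewrite lcoefZ hf // mulr0. Qed.

Lemma ldomN f s : ldom f s -> ldom (- f) s.
Proof. by move=> hf i hi; rewrite lcoefN hf // oppr0. Qed.

Lemma ldomM f g s t : ldom f s -> ldom g t -> ldom (f * g) (s + t).
Proof. by move=> hf hg i; apply: lmul0. Qed.

Lemma ldom_mono a : ldom (lmono a) a.
Proof. by move=> i hi; rewrite lmonoE; case: eqP => // E; lia. Qed.

Lemma lcoef_deriv f n : lderiv f n = f (n + 1) *~ (n + 1).
Proof. by rewrite {1}/lcoef /= mulrC mulrzr. Qed.

Lemma ldom_deriv f s : ldom f s -> ldom (lderiv f) (s - 1).
Proof. by move=> hf i hi; rewrite lcoef_deriv hf ?mul0rz //; lia. Qed.

Lemma lderivD f g : lderiv (f + g) = lderiv f + lderiv g.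
Proof. by apply: laurentP => n; rewrite lcoefD !lcoef_deriv lcoefD mulrzDl. Qed.

Lemma lderivZ c f : lderiv (c *: f) = c *: lderiv f.
Proof. by apply: laurentP => n; rewrite lcoefZ !lcoef_deriv lcoefZ mulrzAr. Qed.

Lemma lderiv0 : lderiv (0 : laurent F) = 0.
Proof. by apply: laurentP => n; rewrite lcoef_deriv lcoef0 mul0rz. Qed.

Lemma lderivN f : lderiv (- f) = - lderiv f.
Proof. by rewrite -scaleN1r lderivZ scaleN1r. Qed.

Lemma lderivB f g : lderiv (f - g) = lderiv f - lderiv g.
Proof. by rewrite lderivD lderivN. Qed.

Lemma lderiv_mono a : lderiv (lmono a : laurent F) = a%:~R *: lmono (a - 1).
Proof.
apply: laurentP => n; rewrite lcoef_deriv lcoefZ !lmonoE.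
have -> : (n + 1 == a) = (n == a - 1) by apply/eqP/eqP; lia.
by case: eqP => [->|]; rewrite ?subrK ?mulr1 ?mulr0 ?mul0rz.
Qed.

Lemma lmulZl c f g : (c *: f) * g = c *: (f * g).
Proof. by rewrite -!lC_mul mulrA. Qed.

Lemma lmulZr c f g : f * (c *: g) = c *: (f * g).
Proof. by rewrite mulrC lmulZl mulrC. Qed.

End LaurentFacts.

Definition char0 (F : fieldType) : Prop := forall n : nat, (n.+1)%:R != 0 :> F.

Lemma char0_laurent (F : fieldType) : char0 F -> char0 (laurent F).
Proof.
move=> h n; apply/eqP => /(congr1 (fun f : laurent F => f 0)).
by rewrite lcoef_mulrn lcoef1 eqxx lcoef0 => /eqP; rewrite (negPf (h n)).
Qed.

Lemma char0_int (F : fieldType) (n : int) : char0 F -> n != 0 -> n%:~R != 0 :> F.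
Proof.
move=> h; case: n => [[|n]|n] // _; first exact: h.
by rewrite NegzE mulrNz oppr_eq0; apply: h.
Qed.

Lemma char0_fact (F : fieldType) (n : nat) : char0 F -> n`!%:R != 0 :> F.
Proof. by move=> h; have := fact_gt0 n; case: n`! => // m _; apply: h. Qed.

Lemma binz_zb (F : fieldType) (m : int) (i : nat) : char0 F ->
  binz F m i = (zb m i)%:~R.
Proof.
move=> h; rewrite /binz.
have E : (zb m i * i`!%:Z)%:~R = \prod_(j < i) (m - j%:Z)%:~R :> F.
  elim: i => [|i IH]; first by rewrite big_ord0 zb0l.
  rewrite big_ord_recr /= -IH -intrM; congr (_ %:~R).
  rewrite factS PoszM mulrA [zb m i.+1 * _]mulrC zb_diag.
  have -> : i.+1%:Z - 1 = i by lia.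
  rewrite -zb_absorb; ring.
by rewrite -E intrM mulfK //; apply: char0_fact.
Qed.

(** ** The space M((z)) *)

(** Coefficients in a group only; over a field F, the series form a vector
    space over [laurent F]. *)
Record lser (M : zmodType) :=
  LSer { scoef :> int -> M; lser_subproof : ltrunc scoef }.

Section LserZmod.
Variable M : zmodType.
Implicit Types x y : lser M.

Lemma lserP x y : x =1 y -> x = y.
Proof.
case: x y => [x hx] [y hy] /= /funext exy; subst y.
by congr LSer; exact: Prop_irrelevance.
Qed.

Arguments scoef : simpl never.

HB.instance Definition _ := gen_eqMixin (lser M).
HB.instance Definition _ := gen_choiceMixin (lser M).

Lemma szero_subproof : ltrunc (fun=> 0 : M). Proof. by exists 0. Qed.
Definition szero := LSer szero_subproof.
Lemma sopp_subproof x : ltrunc (fun n => - x n).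
Proof. by have [N hN] := lser_subproof x; exists N => n /hN ->; rewrite oppr0. Qed.
Definition sopp x := LSer (sopp_subproof x).
Lemma sadd_subproof x y : ltrunc (fun n => x n + y n).
Proof.
have [N hN] := lser_subproof x; have [L hL] := lser_subproof y.
exists (Order.min N L) => n; rewrite lt_min => /andP[/hN -> /hL ->].
exact: addr0.
Qed.
Definition sadd x y := LSer (sadd_subproof x y).

Fact saddA : associative sadd.
Proof. by move=> f g h; apply: lserP => n; rewrite /scoef /= addrA. Qed.
Fact saddC : commutative sadd.
Proof. by move=> f g; apply: lserP => n; rewrite /scoef /= addrC. Qed.
Fact sadd0 : left_id szero sadd.
Proof. by move=> f; apply: lserP => n; rewrite /scoef /= add0r. Qed.
Fact saddN : left_inverse szero sopp sadd.
Proof. by move=> f; apply: lserP => n; rewrite /scoef /= addNr. Qed.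

HB.instance Definition _ := GRing.isZmodule.Build (lser M) saddA saddC sadd0 saddN.

Definition sdom x (s : int) : Prop := forall i, i < s -> x i = 0.

Lemma sdom_ex x : exists s, sdom x s.
Proof. exact: (lser_subproof x). Qed.

Lemma sdomW x s t : sdom x s -> t <= s -> sdom x t.
Proof. by move=> h ts i hi; apply: h; lia. Qed.

Lemma scoefD x y n : (x + y) n = x n + y n. Proof. by []. Qed.
Lemma scoefN x n : (- x) n = - x n. Proof. by []. Qed.
Lemma scoefB x y n : (x - y) n = x n - y n. Proof. by []. Qed.
Lemma scoef0 n : (0 : lser M) n = 0. Proof. by []. Qed.

Lemma scoef_sum (I : Type) (r : seq I) (Q : pred I) (G : I -> lser M) n :
  (\sum_(i <- r | Q i) G i) n = \sum_(i <- r | Q i) G i n.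
Proof. by elim/big_rec2: _ => // i y1 y2 _ <-. Qed.

Lemma scoef_zsum (G : int -> lser M) n : fsup G ->
  (zsum G) n = zsum (fun i => G i n).
Proof. by move=> h; rewrite (zsum_additive (f := fun x : lser M => x n)). Qed.

Lemma scoef_mulrn x k n : (x *+ k) n = x n *+ k.
Proof. by elim: k => // k IH; rewrite !mulrS scoefD IH. Qed.

Lemma scoef_mulrz x (k : int) n : (x *~ k) n = x n *~ k.
Proof. by case: k => k; rewrite ?NegzE -?pmulrn -?nmulrn ?scoefN scoef_mulrn. Qed.

(** A total constructor: series can be defined before their truncation is
    known. *)
Definition mks (a : int -> M) : lser M :=
  if pselect (ltrunc a) is left h then LSer h else 0.

Lemma mksE a n : ltrunc a -> mks a n = a n.
Proof. by rewrite /mks; case: pselect. Qed.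

Lemma sder_subproof x : ltrunc (fun n => x (n + 1) *~ (n + 1)).
Proof.
have [s hs] := sdom_ex x; exists (s - 1) => n hn.
by rewrite hs ?mul0rz //; lia.
Qed.
Definition sder x : lser M := LSer (sder_subproof x).

Lemma scoef_der x n : sder x n = x (n + 1) *~ (n + 1). Proof. by []. Qed.

Lemma sderD x y : sder (x + y) = sder x + sder y.
Proof. by apply: lserP => n; rewrite scoefD !scoef_der scoefD mulrzDl. Qed.

Definition smono (m : int) (v : M) : lser M := mks (fun n => if n == m then v else 0).

Lemma smonoE m v n : smono m v n = if n == m then v else 0.
Proof. by rewrite mksE //; exists m => i im; case: eqP => // E; lia. Qed.

End LserZmod.

Arguments scoef : simpl never.

Section LserLmod.
Variables (F : fieldType) (M : lmodType F).
Implicit Types (x y : lser M) (f g : laurent F).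

Lemma sscale_fsup (f : laurent F) x n : fsup (fun i => f i *: x (n - i)).
Proof.
have [s hs] := ldom_ex f; have [t ht] := sdom_ex x.
apply: (@fsupP _ _ s (n - t)) => i hi; first by rewrite hs ?scale0r.
by rewrite ht ?scaler0 //; lia.
Qed.

Lemma sscale0 f x s t n : ldom f s -> sdom x t -> n < s + t ->
  zsum (fun i => f i *: x (n - i)) = 0.
Proof.
move=> hs ht hn; apply: zsum0 => i.
have [/hs ->|si] := ltP i s; first by rewrite scale0r.
by rewrite ht ?scaler0 //; lia.
Qed.

Lemma sscale_subproof f x : ltrunc (fun n => zsum (fun i => f i *: x (n - i))).
Proof.
have [s hs] := ldom_ex f; have [t ht] := sdom_ex x.
by exists (s + t) => n hn; apply: sscale0 hs ht hn.
Qed.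
Definition sscale f x : lser M := LSer (sscale_subproof f x).

Lemma sscaleE f x n : sscale f x n = zsum (fun i => f i *: x (n - i)).
Proof. by []. Qed.

Fact sscaleA f g x : sscale f (sscale g x) = sscale (f * g) x.
Proof.
apply: lserP => n; rewrite !sscaleE.
have [s hs] := ldom_ex f; have [t ht] := ldom_ex g; have [u hu] := sdom_ex x.
transitivity (zsum (fun i => zsum (fun j => (f i * g j) *: x (n - i - j)))).
  apply: eq_zsum => i; rewrite sscaleE zsum_scale; last exact: sscale_fsup.
  by apply: eq_zsum => j; rewrite scalerA.
transitivity (zsum (fun i => zsum (fun j => (f i * g (j - i)) *: x (n - j)))).
  apply: eq_zsum => i; rewrite (zsum_shift _ (- i)); apply: eq_zsum => j.
  by congr (_ *: x _); lia.
rewrite (@zsum_exchange _ _ (`|s| + `|t| + `|u| + `|n|)%N).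
- apply: eq_zsum => j; rewrite zsum_scalel //.
  apply: (@fsupP _ _ s (j - t)) => i hi; first by rewrite hs ?mul0r.
  by rewrite ht ?mulr0 //; lia.
- move=> i j hi; have [/hs ->|si] := ltP i s; first by rewrite mul0r scale0r.
  have [h|h] := ltP (j - i) t; first by rewrite (ht _ h) mulr0 scale0r.
  by rewrite hu ?scaler0 //; lia.
- move=> i j hj; have [/hs ->|si] := ltP i s; first by rewrite mul0r scale0r.
  have [h|h] := ltP (j - i) t; first by rewrite (ht _ h) mulr0 scale0r.
  by rewrite hu ?scaler0 //; lia.
Qed.

Fact sscale1 : left_id 1 sscale.
Proof.
move=> x; apply: lserP => n; rewrite sscaleE (@zsum_pt _ _ 0) ?lcoef1 ?eqxx ?scale1r ?subr0 //.
by move=> i /negPf i0; rewrite lcoef1 i0 scale0r.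
Qed.
Fact sscaleDr : right_distributive sscale +%R.
Proof.
move=> f x y; apply: lserP => n; rewrite scoefD !sscaleE -zsumD; try exact: sscale_fsup.
by apply: eq_zsum => i; rewrite scalerDr.
Qed.
Fact sscaleDl x : {morph sscale^~ x : f g / f + g}.
Proof.
move=> f g; apply: lserP => n; rewrite scoefD !sscaleE -zsumD; try exact: sscale_fsup.
by apply: eq_zsum => i; rewrite scalerDl.
Qed.

HB.instance Definition _ := GRing.Zmodule_isLmodule.Build (laurent F) (lser M)
  sscaleA sscale1 sscaleDr sscaleDl.

Lemma scoefZ f x n : (f *: x) n = zsum (fun i => f i *: x (n - i)).
Proof. by []. Qed.


Lemma scoef_monoZ m x n : (lmono m *: x) n = x (n - m).
Proof.
rewrite scoefZ (@zsum_pt _ _ m) => [|i /negPf im]; rewrite lmonoE ?im ?scale0r //.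
by rewrite eqxx scale1r.
Qed.

Lemma scoef_lCZ c x n : (lC c *: x) n = c *: x n.
Proof.
rewrite scoefZ (@zsum_pt _ _ 0) => [|i /negPf im]; rewrite lCE ?im ?scale0r //.
by rewrite eqxx subr0.
Qed.

Lemma sdomZ f x s t : ldom f s -> sdom x t -> sdom (f *: x) (s + t).
Proof. by move=> hs ht n hn; apply: sscale0 hs ht hn. Qed.


Lemma sder_scale f x : sder (f *: x) = lderiv f *: x + f *: sder x.
Proof.
apply: lserP => n; rewrite scoefD scoef_der !scoefZ.
rewrite [X in _ = X + _](zsum_shift _ (-1)) -zsumD; last exact: sscale_fsup.
- rewrite (zsum_additive (f := fun v => v *~ (n + 1))); first last.
  + exact: sscale_fsup.
  + by move=> u v; rewrite mulrzDl.
  apply: eq_zsum => i; rewrite scoef_der lcoef_deriv subrK opprB addrA.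
  rewrite addrAC -scalerMzl -scalerMzr -mulrzDr; congr (_ *~ _); lia.
- have [s hs] := ldom_ex f; have [t ht] := sdom_ex x.
  apply: (@fsupP _ _ s (n + 1 - t)) => i hi.
    by rewrite lcoef_deriv subrK hs // mul0rz scale0r.
  by rewrite ht ?scaler0 //; lia.
Qed.

End LserLmod.

Lemma smap_subproof (M M' : zmodType) (h : M -> M') (x : lser M) : h 0 = 0 ->
  ltrunc (fun n => h (x n)).
Proof. by move=> h0; have [s hs] := sdom_ex x; exists s => i /hs ->. Qed.

Definition smap (M M' : zmodType) (h : M -> M') (x : lser M) : lser M' :=
  mks (fun n => h (x n)).

Lemma smapE (M M' : zmodType) (h : M -> M') (x : lser M) n : h 0 = 0 ->
  smap h x n = h (x n).
Proof. by move=> h0; rewrite /smap mksE //; apply: smap_subproof. Qed.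

Lemma lderivM (F : fieldType) (f g : laurent F) :
  lderiv (f * g) = lderiv f * g + f * lderiv g.
Proof.
pose j (h : laurent F) : lser F^o := mks (h : int -> F^o).
have jE h n : j h n = h n by rewrite /j mksE //; apply: (laurent_subproof h).
have jM h h' : j (h * h') = h *: j h'.
  by apply: lserP => n; rewrite jE scoefZ; apply: eq_zsum => i; rewrite jE.
have jd h : sder (j h) = j (lderiv h).
  by apply: lserP => n; rewrite scoef_der !jE lcoef_deriv.
have jD h h' : j (h + h') = j h + j h' by apply: lserP => n; rewrite scoefD !jE.
apply: laurentP => n; rewrite -jE -jd jM sder_scale jd -!jM -jD jE //.
Qed.

(** * From modes to modules over the Virasoro algebra *)

(** A statement that is stable under sums holds for all Laurent series if it
    holds for monomials and for series of large order, since the latter leave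
    only finitely many terms. *)
Lemma laurent_span (F : fieldType) (Q : laurent F -> Prop) :
  (forall f g, Q f -> Q g -> Q (f + g)) ->
  (forall c n, Q (c *: lmono n)) ->
  (exists M, forall f, ldom f M -> Q f) -> forall f, Q f.
Proof.
move=> QD Qm [M QM] f; have [s hs] := ldom_ex f.
have : forall (N : nat) h, ldom h (M - N%:Z) -> Q h.
  elim=> [|N IH] h hh; first by apply: QM; rewrite subr0 in hh.
  set t := M - _ in hh.
  rewrite -(subrK (h t *: lmono t) h); apply: QD => //; apply: IH => i hi.
  rewrite lcoefB lcoefZ lmonoE; case: eqP => [->|ne]; first by rewrite mulr1 subrr.
  by rewrite mulr0 subr0 hh //; lia.
by apply; apply: (ldomW (s := s)); last instantiate (1 := `|M - s|%N); lia || apply: hs.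
Qed.

(** The relations of the modes - x^n d/dx, on a subspace [S]: below, H is a
    space of fields and [S] consists of the local ones. The scalars of the
    Virasoro algebra may act through an extension [io] of fields. *)
Record vir_modes (F F' : fieldType) (io : {rmorphism F -> F'}) (H : lmodType F')
    (S : H -> Prop) (a : int -> H -> H) (el : F) : Prop := {
  vm_0 : S 0;
  vm_D : forall b c, S b -> S c -> S (b + c);
  vm_Z : forall (r : F') b, S b -> S (r *: b);
  vm_S : forall n b, S b -> S (a n b);
  vm_aD : forall n b c, S b -> S c -> a n (b + c) = a n b + a n c;
  vm_aZ : forall n (r : F') b, S b -> a n (r *: b) = r *: a n b;
  vm_restr : forall b, S b -> exists N, forall n : int, N <= n -> a n b = 0;
  vm_br : forall m n b, S b ->
     a m (a n b) - a n (a m b) = a (m + n - 1) b *~ (m - n) +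
       (if m + n == 2 then (io (12%:R^-1 * el) *: b) *~ (m * (m - 1) * (m - 2))
        else 0) }.

Section VirModes.
Variables (F F' : fieldType) (io : {rmorphism F -> F'}) (H : lmodType F').
Variables (S : H -> Prop) (a : int -> H -> H) (el : F).
Hypothesis VM : vir_modes io S a el.
Let S0 := vm_0 VM.
Let SD := vm_D VM.
Let SZ := vm_Z VM.
Let aS := vm_S VM.
Let aD := vm_aD VM.
Let aZ := vm_aZ VM.
Let a_restr := vm_restr VM.
Let a_br := vm_br VM.

Definition mact (f : laurent F) (b : H) : H :=
  - zsum (fun n => io (f n) *: a n b).

Definition vact (x : vir F) (b : H) : H := mact x.1 b + io (x.2 * el) *: b.

Lemma mact_fsup (f : laurent F) b : S b -> fsup (fun n => io (f n) *: a n b).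
Proof.
move=> Sb; have [s hs] := ldom_ex f; have [N hN] := a_restr Sb.
apply: (@fsupP _ _ s N) => i hi; first by rewrite hs // rmorph0 scale0r.
by rewrite hN ?scaler0 //; lia.
Qed.

Lemma S_sum (n : nat) (G : 'I_n -> H) : (forall k, S (G k)) -> S (\sum_(k < n) G k).
Proof. by move=> h; apply: (big_ind S). Qed.

Lemma S_zsum (G : int -> H) : fsup G -> (forall i, S (G i)) -> S (zsum G).
Proof. by move=> [N hN] h; rewrite (zsumN hN); apply: S_sum. Qed.

Lemma S_opp b : S b -> S (- b).
Proof. by rewrite -scaleN1r; apply: SZ. Qed.

Lemma mact_S f b : S b -> S (mact f b).
Proof.
move=> Sb; apply: S_opp; apply: S_zsum; first exact: mact_fsup.
by move=> i; apply: SZ; apply: aS.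
Qed.

Lemma mactDl f g b : S b -> mact (f + g) b = mact f b + mact g b.
Proof.
move=> Sb; rewrite /mact -opprD -zsumD; try exact: mact_fsup.
by congr (- _); apply: eq_zsum => i; rewrite -scalerDl -rmorphD.
Qed.

Lemma mactZl c f b : S b -> mact (c *: f) b = io c *: mact f b.
Proof.
move=> Sb; rewrite /mact scalerN zsum_scale; last exact: mact_fsup.
by congr (- _); apply: eq_zsum => i; rewrite scalerA -rmorphM.
Qed.

Lemma mactDr f b c : S b -> S c -> mact f (b + c) = mact f b + mact f c.
Proof.
move=> Sb Sc; rewrite /mact -opprD -zsumD; try exact: mact_fsup.
by congr (- _); apply: eq_zsum => i; rewrite aD // scalerDr.
Qed.

Lemma mactZr f (r : F') b : S b -> mact f (r *: b) = r *: mact f b.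
Proof.
move=> Sb; rewrite /mact scalerN zsum_scale; last exact: mact_fsup.
by congr (- _); apply: eq_zsum => i; rewrite aZ // !scalerA mulrC.
Qed.


Lemma mact_mono n b : mact (lmono n) b = - a n b.
Proof.
rewrite /mact (@zsum_pt _ _ n) ?lmonoE ?eqxx ?rmorph1 ?scale1r //.
by move=> i /negPf ni; rewrite lmonoE ni rmorph0 scale0r.
Qed.

Lemma mact_tail b : S b -> exists M, forall f, ldom f M -> mact f b = 0.
Proof.
move=> Sb; have [N hN] := a_restr Sb; exists N => f hf.
rewrite /mact zsum0 ?oppr0 // => i.
by case: (ltP i N) => hi; [rewrite hf // rmorph0 scale0r|rewrite hN // scaler0].
Qed.


Let br f g := f * lderiv g - g * lderiv f : laurent F.
Let cz (f g : laurent F) : F' :=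
  io (12%:R^-1 * res (lderiv (lderiv (lderiv f)) * g) * el).
Let Phi (f g : laurent F) b : Prop :=
  mact f (mact g b) - mact g (mact f b) = mact (br f g) b + cz f g *: b.

Let PhiDl f f' g b : S b -> Phi f g b -> Phi f' g b -> Phi (f + f') g b.
Proof.
rewrite /Phi => Sb E E'.
have -> : br (f + f') g = br f g + br f' g by rewrite /br lderivD; ring.
have -> : cz (f + f') g = cz f g + cz f' g.
  by rewrite /cz -rmorphD !lderivD mulrDl /res lcoefD mulrDr mulrDl.
rewrite (mactDl f f') ?(mactDl f f' Sb) //; last exact: mact_S.
rewrite mactDr ?(mactDl (br f g)) //; try exact: mact_S.
by rewrite (scalerDl b) opprD addrACA E E' addrACA.
Qed.

Let PhiDr f g g' b : S b -> Phi f g b -> Phi f g' b -> Phi f (g + g') b.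
Proof.
rewrite /Phi => Sb E E'.
have -> : br f (g + g') = br f g + br f g' by rewrite /br lderivD; ring.
have -> : cz f (g + g') = cz f g + cz f g'.
  by rewrite /cz -rmorphD mulrDr /res lcoefD mulrDr mulrDl.
rewrite (mactDl g g' Sb) (mactDl g g') //; last exact: mact_S.
rewrite mactDr ?(mactDl (br f g)) //; try exact: mact_S.
by rewrite (scalerDl b) opprD addrACA E E' addrACA.
Qed.

Let PhiZl c f g b : S b -> Phi f g b -> Phi (c *: f) g b.
Proof.
rewrite /Phi => Sb E.
have -> : br (c *: f) g = c *: br f g.
  by rewrite /br lderivZ lmulZl lmulZr -scalerBr.
have -> : cz (c *: f) g = io c * cz f g.
  by rewrite /cz -rmorphM !lderivZ lmulZl /res lcoefZ; congr (io _); ring.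
rewrite (mactZl c (br f g)) // (mactZl c f Sb) (mactZl c f); last exact: mact_S.
by rewrite mactZr; [rewrite -scalerBr E scalerDr scalerA|exact: mact_S].
Qed.

Let PhiZr c f g b : S b -> Phi f g b -> Phi f (c *: g) b.
Proof.
rewrite /Phi => Sb E.
have -> : br f (c *: g) = c *: br f g.
  by rewrite /br lderivZ lmulZl lmulZr -scalerBr.
have -> : cz f (c *: g) = io c * cz f g.
  by rewrite /cz -rmorphM lmulZr /res lcoefZ; congr (io _); ring.
rewrite (mactZl c (br f g)) // (mactZl c g Sb) (mactZl c g); last exact: mact_S.
by rewrite mactZr; [rewrite -scalerBr E scalerDr scalerA|exact: mact_S].
Qed.

Let res_dom (f : laurent F) : ldom f 0 -> res f = 0.
Proof. by move=> h; apply: h. Qed.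

Let br_mono m n : br (lmono m) (lmono n) = (n - m)%:~R *: lmono (m + n - 1).
Proof.
rewrite /br !lderiv_mono !lmulZr -!lmonoD.
have -> : n + (m - 1) = m + n - 1 by lia.
by rewrite addrA -scalerBl -intrB.
Qed.

Let cz_mono m n : cz (lmono m) (lmono n) =
  if m + n == 2 then io (12%:R^-1 * el) *~ (m * (m - 1) * (m - 2)) else 0.
Proof.
rewrite /cz !(lderiv_mono, lderivZ) !lmulZl -lmonoD /res !lcoefZ lmonoE.
have -> : (-1 == m - 1 - 1 - 1 + n) = (m + n == 2) by apply/eqP/eqP; lia.
case: eqP => _; last by rewrite !mulr0 mul0r rmorph0.
transitivity (io (12%:R^-1 * el * (m * (m - 1) * (m - 2))%:~R)); last first.
  by rewrite rmorphM rmorph_int mulrzr.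
congr (io _); rewrite mulr1 (_ : m - 2 = m - 1 - 1) ?intrM; [ring|lia].
Qed.

(** Both sides are bilinear in f and g and vanish for series of large order,
    so the relation for monomials suffices. *)
Lemma mact_br f g b : S b ->
  mact f (mact g b) - mact g (mact f b) =
  mact (f * lderiv g - g * lderiv f) b +
  io (12%:R^-1 * res (lderiv (lderiv (lderiv f)) * g) * el) *: b.
Proof.
(* Against a fixed monomial, a series of large order gives zero in every term
   of the relation. *)
have tail n c : S c -> exists M, forall h, ldom h M -> Phi h (lmono n) c /\ Phi (lmono n) h c.
  move=> Sc; have [M1 h1] := mact_tail Sc.
  have [M2 h2] := mact_tail (mact_S (lmono n) Sc).
  exists (`|M1| + `|M2| + `|n| + 4)%N => h hh.
  have d1 : mact h c = 0 by apply: h1; apply: (ldomW hh); lia.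
  have d2 : mact h (mact (lmono n) c) = 0 by apply: h2; apply: (ldomW hh); lia.
  have m0 k : mact k 0 = 0 by have := mactZr k 0 Sc; rewrite !scale0r.
  have hd := ldom_deriv hh; have hdd := ldom_deriv (ldom_deriv hd).
  have nd := @ldom_mono F n; have nd1 := ldom_deriv nd.
  have nd3 := ldom_deriv (ldom_deriv nd1).
  have E1 : ldom (br h (lmono n)) M1.
    by apply: ldomD; [|apply: ldomN]; [apply: (ldomW (ldomM hh nd1))|apply: (ldomW (ldomM nd hd))]; lia.
  have E2 : ldom (br (lmono n) h) M1.
    by apply: ldomD; [|apply: ldomN]; [apply: (ldomW (ldomM nd hd))|apply: (ldomW (ldomM hh nd1))]; lia.
  split; rewrite /Phi d1 d2 m0 subrr /cz res_dom ?mulr0 ?mul0r ?rmorph0 ?scale0r ?addr0 ?h1 //.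
  - by apply: (ldomW (ldomM hdd nd)); lia.
  - by apply: (ldomW (ldomM nd3 hh)); lia.
have P0 m n c : S c -> Phi (lmono m) (lmono n) c.
  move=> Sc; rewrite /Phi !mact_mono.
  have aN k l : a k (- a l c) = - a k (a l c).
    by rewrite -scaleN1r aZ ?scaleN1r //; apply: aS.
  rewrite !aN !opprK a_br // br_mono mactZl // rmorph_int mact_mono cz_mono.
  rewrite scalerN scaler_int -mulrNz opprB; congr (_ + _).
  by case: eqP; rewrite ?scale0r // scalerMzl.
move=> Sb; rewrite -/(br f g) -/(cz f g) -/(Phi f g b).
elim/laurent_span: g => [g g' Eg Eg'|c n|].
- exact: PhiDr.
- apply: PhiZr => //; elim/laurent_span: f => [f f' Ef Ef'|c' m|].
  + exact: PhiDl.
  + by apply: PhiZl => //; apply: P0.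
  + by have [M hM] := tail n b Sb; exists M => h /hM[].
have [M1 h1] := mact_tail Sb.
have [M2 h2] := mact_tail (mact_S f Sb).
have [s hs] := ldom_ex f.
exists (`|M1| + `|M2| + `|s| + 4)%N => h hh.
have d1 : mact h b = 0 by apply: h1; apply: (ldomW hh); lia.
have d2 : mact h (mact f b) = 0 by apply: h2; apply: (ldomW hh); lia.
have m0 k : mact k 0 = 0 by have := mactZr k 0 Sb; rewrite !scale0r.
have hd := ldom_deriv hh; have sd := ldom_deriv hs.
have sd3 := ldom_deriv (ldom_deriv sd).
rewrite /Phi d1 d2 m0 subrr /cz res_dom ?mulr0 ?mul0r ?rmorph0 ?scale0r ?addr0 ?h1 //.
- by apply: ldomD; [|apply: ldomN]; [apply: (ldomW (ldomM hs hd))|apply: (ldomW (ldomM hh sd))]; lia.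
- by apply: (ldomW (ldomM sd3 hh)); lia.
Qed.

Lemma vact_S x b : S b -> S (vact x b).
Proof. by move=> Sb; apply: SD; [apply: mact_S|apply: SZ]. Qed.

Lemma vact_addl x y b : S b -> vact (x + y) b = vact x b + vact y b.
Proof.
move=> Sb; rewrite /vact addrACA -scalerDl -mactDl //; congr (_ + _ *: b).
exact: etrans (congr1 io (mulrDl _ _ _)) (rmorphD io _ _).
Qed.

Lemma vact_scalel c x b : S b -> vact (c *: x) b = io c *: vact x b.
Proof.
move=> Sb; rewrite /vact scalerDr -mactZl // scalerA; congr (_ + _ *: b).
exact: etrans (congr1 io (esym (mulrA _ _ _))) (rmorphM io _ _).
Qed.

Lemma vact_addr x b c : S b -> S c -> vact x (b + c) = vact x b + vact x c.
Proof. by move=> Sb Sc; rewrite /vact scalerDr mactDr // addrACA. Qed.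

Lemma vact_scaler x (r : F') b : S b -> vact x (r *: b) = r *: vact x b.
Proof. by move=> Sb; rewrite /vact scalerDr mactZr // !scalerA mulrC. Qed.


Lemma vact_br x y b : S b ->
  vact (vir_br x y) b = vact x (vact y b) - vact y (vact x b).
Proof.
move=> Sb; case: x y => [f s] [g t]; rewrite /vact /= !mactDr ?mactZr //;
  try exact: mact_S; try exact: SZ.
rewrite !scalerDr !scalerA [io (s * el) * _]mulrC; set u := (_ * _) *: b.
set A := mact f (mact g b); set B := mact g (mact f b).
set x := _ *: mact f b; set y := _ *: mact g b.
have -> : A + x + (y + u) - (B + y + (x + u)) = A - B.
  rewrite [A + x + _]addrACA [- (_ + (x + u))]opprD.
  by rewrite [LHS]addrACA subrr addr0 [- (B + y)]opprD addrACA subrr addr0.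
by rewrite mact_br.
Qed.


End VirModes.

Lemma morph_mulrz (V V' : zmodType) (f : V -> V') x (n : int) :
  {morph f : x y / x + y} -> f (x *~ n) = f x *~ n.
Proof.
move=> fD; have f0 : f 0 = 0 by apply: (@addrI _ (f 0)); rewrite -fD !addr0.
have fN y : f (- y) = - f y.
  by apply: (@addrI _ (f y)); rewrite -fD !subrr.
have fn y k : f (y *+ k) = f y *+ k by elim: k => // k IH; rewrite !mulrS fD IH.
by case: n => n; rewrite ?NegzE ?mulrNz -!pmulrn ?fN fn.
Qed.

Lemma zsum_mulrz (V : zmodType) (F : int -> V) (n : int) : fsup F ->
  zsum F *~ n = zsum (fun i => F i *~ n).
Proof. by apply: (zsum_additive (f := fun v => v *~ n)) => x y; rewrite mulrzDl. Qed.

Lemma zsum_mulrzr (V : zmodType) (F : int -> int) (v : V) : fsup F ->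
  v *~ zsum F = zsum (fun i => v *~ F i).
Proof. by apply: (zsum_additive (f := fun n => v *~ n)) => x y; rewrite mulrzDr. Qed.

Lemma zb_fsup m m' s : fsup (fun l => zb m l * zb m' (s - l)).
Proof.
apply: (@fsupP _ _ 0 s) => i hi; first by rewrite zbN ?mul0r.
by rewrite [X in _ * X]zbN ?mulr0 //; lia.
Qed.

Lemma zb_fsupW m m' s (c : int -> int) : fsup (fun l => c l * (zb m l * zb m' (s - l))).
Proof. by have [N hN] := zb_fsup m m' s; exists N => i hi; rewrite hN ?mulr0. Qed.

(** The first moments of Vandermonde's convolution, which reduce to it by l (m
    choose l) = m (m - 1 choose l - 1). *)
Lemma zb_vdm1 (m m' s rho eps : int) :
  zsum (fun l => (rho + eps * (l - (s - l))) * (zb m l * zb m' (s - l))) =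
  rho * zb (m + m') s + eps * ((m - m') * zb (m + m' - 1) (s - 1)).
Proof.
have mz c (F : int -> int) : fsup F -> c * zsum F = zsum (fun l => c * F l).
  by apply: (zsum_additive (f := fun n => c * n)) => x y; rewrite mulrDr.
have E1 : zsum (fun l => l * (zb m l * zb m' (s - l))) = m * zb (m + m' - 1) (s - 1).
  have -> : m + m' - 1 = (m - 1) + m' by lia.
  rewrite -zb_vdm mz; last exact: zb_fsup.
  rewrite (zsum_shift _ 1); apply: eq_zsum => l.
  by rewrite mulrA zb_diag addrK -mulrA; congr (_ * (_ * zb _ _)); lia.
have E2 : zsum (fun l => (s - l) * (zb m l * zb m' (s - l))) = m' * zb (m + m' - 1) (s - 1).
  have -> : m + m' - 1 = m + (m' - 1) by lia.
  rewrite -zb_vdm mz; last exact: zb_fsup.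
  apply: eq_zsum => l; rewrite mulrCA zb_diag mulrCA.
  by congr (_ * (_ * zb _ _)); lia.
have E0 := zb_vdm m m' s.
transitivity (zsum (fun l => rho * (zb m l * zb m' (s - l)) +
  eps * (l * (zb m l * zb m' (s - l)) - (s - l) * (zb m l * zb m' (s - l))))).
  by apply: eq_zsum => l; ring.
rewrite zsumD -?mz ?zsumB ?E0 ?E1 ?E2 ?mulrBl //; do ?exact: zb_fsupW; do ?exact: zb_fsup.
- have [N hN] := fsupD (zb_fsupW m m' s id) (fsup_map (f := -%R) (oppr0 _) (zb_fsupW m m' s (fun l => s - l))).
  by exists N => i hi; rewrite hN.
- have [N hN] := fsupD (zb_fsupW m m' s id) (fsup_map (f := -%R) (oppr0 _) (zb_fsupW m m' s (fun l => s - l))).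
  by exists N => i hi; rewrite hN ?mulr0.
Qed.

(** Collecting the terms of a double binomial sum along l + l' = s. The
    bracket of two modes is a multiple of a mode of index determined by l +
    l', the factor being affine in l - l', plus a central term on one line l +
    l' = s0. *)
Lemma bracket_sum (V : zmodType) (m m' rho eps s0 : int) (h : int -> V)
    (C : V) (c : int -> int) (u : int -> int -> V) (I : int) :
  (forall s, I <= s -> h s = 0) -> s0 < I ->
  (forall l l', 0 <= l -> 0 <= l' -> u l l' = h (l + l') *~ (rho + eps * (l - l')) +
     (if l + l' == s0 then C *~ c l else 0)) ->
  zsum (fun l => zsum (fun l' => u l l' *~ (zb m l * zb m' l'))) =
  zsum (fun s => h s *~ (rho * zb (m + m') s + eps * ((m - m') * zb (m + m' - 1) (s - 1)))) +
  C *~ zsum (fun l => c l * (zb m l * zb m' (s0 - l))).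
Proof.
move=> hI sI hu.
pose U s l := (h s *~ (rho + eps * (l - (s - l))) + (if s == s0 then C *~ c l else 0))
  *~ (zb m l * zb m' (s - l)).
transitivity (zsum (fun l => zsum (fun s => U s l))).
  apply: eq_zsum => l; rewrite (zsum_shift _ (- l)); apply: eq_zsum => s.
  rewrite /U; case: (ltP l 0) => hl; first by rewrite zbN // mul0r !mulr0z.
  case: (ltP (s - l) 0) => hs; first by rewrite [zb m' _]zbN // mulr0 !mulr0z.
  by rewrite hu // (_ : l + (s - l) = s) //; lia.
have U0 s l : l < 0 \/ s < l \/ I <= s -> U s l = 0.
  rewrite /U => -[hl|[hs|hs]]; first by rewrite zbN // mul0r mulr0z.
    by rewrite [zb m' _]zbN ?mulr0 ?mulr0z //; lia.
  rewrite hI // mul0rz add0r; case: eqP => [E|_]; last by rewrite mul0rz.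
  by move: hs; rewrite E leNgt sI.
rewrite (@zsum_exchange _ _ `|I|%N) => [|l s hi|l s hi]; try by apply: U0; lia.
transitivity (zsum (fun s => h s *~ (rho * zb (m + m') s + eps * ((m - m') * zb (m + m' - 1) (s - 1)))
   + (if s == s0 then C *~ zsum (fun l => c l * (zb m l * zb m' (s0 - l))) else 0))).
  apply: eq_zsum => s; rewrite -zb_vdm1 zsum_mulrzr; last exact: zb_fsupW.
  case: (s =P s0) => [Es|ns].
    rewrite Es zsum_mulrzr; last exact: zb_fsupW.
    rewrite -zsumD.
    - apply: eq_zsum => l; rewrite /U eqxx mulrzDl; congr (_ + _); by rewrite -mulrzA.
    - by have [N hN] := zb_fsupW m m' s0 (fun l => rho + eps * (l - (s0 - l))); exists N => i hi; rewrite hN ?mulr0z.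
    - by have [N hN] := zb_fsupW m m' s0 c; exists N => i hi; rewrite hN ?mulr0z.
  rewrite addr0; apply: eq_zsum => l; rewrite /U; case: eqP => // _.
  by rewrite addr0 -mulrzA.
rewrite zsumD.
- congr (_ + _); rewrite (@zsum_pt _ _ s0) ?eqxx // => i /negPf -> //.
- apply: (@fsupP _ _ 0 I) => i hi; last by rewrite hI ?mul0rz //; lia.
  by rewrite !zbN ?mulr0 ?addr0 ?mulr0z //; lia.
- by apply: (@fsupP _ _ s0 s0) => i hi; case: eqP => // E; lia.
Qed.

(** * The Virasoro action on fields *)

Section FieldsBasics.
Variables (K : fieldType) (W : lmodType K).
Notation k := (laurent K).
Notation H := (W -> lser W).

(** Linear maps from W to W((z)). *)
Definition linf (b : H) : Prop := forall c u v, b (c *: u + v) = lC c *: b u + b v.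

Lemma linf0 b : linf b -> b 0 = 0.
Proof. by move=> lb; have := lb (-1) 0 0; rewrite scaler0 addr0 rmorphN1 scaleN1r addNr. Qed.

Lemma linfD b : linf b -> {morph b : u v / u + v}.
Proof. by move=> lb u v; have := lb 1 u v; rewrite rmorph1 !scale1r. Qed.

Lemma linfZ b c u : linf b -> b (c *: u) = lC c *: b u.
Proof. by move=> lb; have := lb c u 0; rewrite linf0 // !addr0. Qed.

Lemma linf_0 : linf (0 : H).
Proof. by move=> c u v; rewrite /GRing.zero /= scaler0 addr0. Qed.

Lemma linf_add (b b' : H) : linf b -> linf b' -> linf (b + b').
Proof.
by move=> lb lb' c u v; rewrite /GRing.add /= lb lb' scalerDr addrACA.
Qed.

Lemma linf_scale (f : k) (b : H) : linf b -> linf (f *: b).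
Proof.
move=> lb c u v; have E w : (f *: b) w = f *: b w by [].
by rewrite !E lb scalerDr !scalerA mulrC.
Qed.

Lemma fctDE (b b' : H) w : (b + b') w = b w + b' w. Proof. by []. Qed.
Lemma fctBE (b b' : H) w : (b - b') w = b w - b' w. Proof. by []. Qed.
Lemma fctZE (f : k) (b : H) w : (f *: b) w = f *: b w. Proof. by []. Qed.
Lemma fct0E w : (0 : H) w = 0. Proof. by []. Qed.
Lemma fct_mulrz (b : H) (n : int) w : (b *~ n) w = b w *~ n.
Proof. by rewrite (morph_mulrz (f := fun b : H => b w)). Qed.
Lemma fct_zsum (F : int -> H) w : fsup F -> (zsum F) w = zsum (fun i => F i w).
Proof. by apply: (zsum_additive (f := fun b : H => b w)). Qed.
Lemma fct_sum (I : Type) (r : seq I) (Q : pred I) (G : I -> H) w :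
  (\sum_(i <- r | Q i) G i) w = \sum_(i <- r | Q i) G i w.
Proof. by elim/big_rec2: _ => // i y1 y2 _ <-. Qed.

End FieldsBasics.

(** The modes - x^n d/dx of a restricted Virasoro module of level [el]. *)
Record vir_ops (K : fieldType) (W : lmodType K) (T : int -> W -> W) (el : K) : Prop := {
  vo_lin : forall n, linear (T n);
  vo_restr : forall w, exists N, forall n : int, N <= n -> T n w = 0;
  vo_br : forall m n w,
    T m (T n w) - T n (T m w) = T (m + n - 1) w *~ (m - n) +
    (if m + n == 2 then ((12%:R^-1 * el) *: w) *~ (m * (m - 1) * (m - 2)) else 0) }.

Section Fields.
Variables (K : fieldType) (W : lmodType K).
Notation k := (laurent K).
Notation H := (W -> lser W).
Variables (T : int -> W -> W) (el : K).
Hypothesis TV : vir_ops T el.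
Let T_lin := vo_lin TV.
Let T_restr := vo_restr TV.
Let T_br := vo_br TV.

Lemma TD n : {morph T n : u v / u + v}.
Proof. by move=> u v; have := T_lin n 1 u v; rewrite !scale1r. Qed.
Lemma T0 n : T n 0 = 0.
Proof. by apply: (@addrI _ (T n 0)); rewrite -TD !addr0. Qed.
Lemma TZ n c u : T n (c *: u) = c *: T n u.
Proof. by have := T_lin n c u 0; rewrite T0 !addr0. Qed.
Lemma Tmz n u (j : int) : T n (u *~ j) = T n u *~ j.
Proof. exact: morph_mulrz (TD n). Qed.

(** Left multiplication by the modes of (x - z)^m x^r T(x), expanded in the
    domain |x| > |z|. *)
Definition Lcoef (r m : int) (x : lser W) (c : int) : W :=
  zsum (fun l => T (r + m - l) (x (c - l)) *~ (sg l * zb m l)).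

Lemma Lfsup r m (x : lser W) c :
  fsup (fun l => T (r + m - l) (x (c - l)) *~ (sg l * zb m l)).
Proof.
have [s hs] := sdom_ex x; apply: (@fsupP _ _ 0 (c - s)) => i hi.
  by rewrite zbN // mulr0 mulr0z.
by rewrite hs ?T0 ?mul0rz //; lia.
Qed.

Lemma Lcoef_dom r m (x : lser W) s : sdom x s -> forall c, c < s -> Lcoef r m x c = 0.
Proof.
move=> hs c hc; apply: zsum0 => l; case: (ltP l 0) => hl; first by rewrite zbN // mulr0 mulr0z.
by rewrite hs ?T0 ?mul0rz //; lia.
Qed.

Lemma Lop_subproof r m (x : lser W) : ltrunc (Lcoef r m x).
Proof. by have [s hs] := sdom_ex x; exists s; apply: Lcoef_dom. Qed.
Definition Lop r m (x : lser W) : lser W := LSer (Lop_subproof r m x).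

Lemma LopE r m x c :
  Lop r m x c = zsum (fun l => T (r + m - l) (x (c - l)) *~ (sg l * zb m l)).
Proof. by []. Qed.

Lemma LopD r m : {morph Lop r m : x y / x + y}.
Proof.
move=> x y; apply: lserP => c; rewrite scoefD !LopE -zsumD; try exact: Lfsup.
by apply: eq_zsum => l; rewrite scoefD TD mulrzDl.
Qed.

Lemma LopZ r m (f : k) x : Lop r m (f *: x) = f *: Lop r m x.
Proof.
apply: lserP => c; rewrite LopE scoefZ.
have [s hs] := ldom_ex f; have [t ht] := sdom_ex x.
pose G l i := (f i *: T (r + m - l) (x (c - l - i))) *~ (sg l * zb m l).
have G0 l i : l < 0 \/ i < s \/ c < t + l + i -> G l i = 0.
  rewrite /G => -[hl|[hi|h]]; first by rewrite zbN // mulr0 mulr0z.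
    by rewrite hs // scale0r mul0rz.
  by rewrite ht ?T0 ?scaler0 ?mul0rz //; lia.
transitivity (zsum (fun l => zsum (fun i => G l i))).
  apply: eq_zsum => l; rewrite scoefZ (zsum_additive (TD _)); last exact: sscale_fsup.
  rewrite zsum_mulrz; last exact: fsup_map (T0 _) (sscale_fsup _ _ _).
  by apply: eq_zsum => i; rewrite TZ.
rewrite (@zsum_exchange _ _ (`|s| + `|c| + `|t|)%N) => [|l i hi|l i hi]; try by apply: G0; lia.
apply: eq_zsum => i; rewrite LopE zsum_scale; last exact: Lfsup.
apply: eq_zsum => l; rewrite /G (_ : c - l - i = c - i - l); last by lia.
by rewrite scalerMzr.
Qed.

(** Right multiplication by the same modes, expanded in |z| > |x|. *)
Definition Rop (r m : int) (b : H) : H := fun w =>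
  zsum (fun l => (lmono (m - l) *: b (T (r + l) w)) *~ (sg m * (sg l * zb m l))).

Lemma Rfsup r m (b : H) w : b 0 = 0 ->
  fsup (fun l => (lmono (m - l) *: b (T (r + l) w)) *~ (sg m * (sg l * zb m l))).
Proof.
move=> b0; have [N hN] := T_restr w; apply: (@fsupP _ _ 0 (N - r)) => i hi.
  by rewrite zbN // !mulr0 mulr0z.
by rewrite hN ?b0 ?scaler0 ?mul0rz //; lia.
Qed.

(** For x near infinity and x near the origin, the left and right parts are
    the residues of x^r (x - z)^m T(x) b(z) and x^r (x - z)^m b(z) T(x); for
    local fields the difference is a residue at x = z. *)
Definition Xop (r m : int) (b : H) : H := fun w => Lop r m (b w) - Rop r m b w.

Lemma RopD r m b b' : linf b -> linf b' -> Rop r m (b + b') = Rop r m b + Rop r m b'.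
Proof.
move=> lb lb'; apply/funext => w; rewrite fctDE /Rop -zsumD;
  try by apply: Rfsup; apply: linf0.
by apply: eq_zsum => l; rewrite fctDE scalerDr mulrzDl.
Qed.

Lemma RopZ r m (f : k) b : linf b -> Rop r m (f *: b) = f *: Rop r m b.
Proof.
move=> lb; apply/funext => w; rewrite fctZE /Rop zsum_scale; last by apply: Rfsup; apply: linf0.
by apply: eq_zsum => l; rewrite fctZE !scalerA mulrC -scalerA scalerMzr.
Qed.

Lemma Rop_lin r m b : linf b -> linf (Rop r m b).
Proof.
move=> lb c u v; rewrite /Rop zsum_scale; last by apply: Rfsup; apply: linf0.
rewrite -zsumD; first last.
- by apply: Rfsup; apply: linf0.
- by apply: fsup_map (Rfsup _ _ _ (linf0 lb)); rewrite scaler0.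
apply: eq_zsum => l; rewrite T_lin lb scalerDr mulrzDl; congr (_ + _).
by rewrite -scalerMzr !scalerA mulrC.
Qed.

Lemma Xop_lin r m b : linf b -> linf (Xop r m b).
Proof.
move=> lb c u v; rewrite /Xop lb LopD LopZ Rop_lin // scalerBr opprD addrACA //.
Qed.

Lemma XopD r m b b' : linf b -> linf b' -> Xop r m (b + b') = Xop r m b + Xop r m b'.
Proof.
move=> lb lb'; apply/funext => w.
by rewrite fctDE /Xop RopD // !fctDE LopD opprD addrACA.
Qed.

Lemma XopZ r m (f : k) b : linf b -> Xop r m (f *: b) = f *: Xop r m b.
Proof.
move=> lb; apply/funext => w.
by rewrite fctZE /Xop RopZ // !fctZE LopZ scalerBr.
Qed.

Lemma Xop_0 r m : Xop r m 0 = 0.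
Proof. by have := XopZ r m 0 (@linf_0 K W); rewrite !scale0r. Qed.

Lemma LopS (r m : int) x : Lop r (m + 1) x = Lop (r + 1) m x - lmono 1 *: Lop r m x.
Proof.
apply: lserP => c; rewrite scoefB scoef_monoZ !LopE.
rewrite [X in _ - X](zsum_shift _ (-1)) -zsumB.
- apply: eq_zsum => l; rewrite zbS mulrDr mulrzDr (_ : r + (m + 1) - l = r + 1 + m - l);
    last by lia.
  congr (_ + _); rewrite sgP mulNr mulrNz opprK.
  by congr (T _ (x _) *~ _); lia.
- exact: Lfsup.
- by have [N hN] := Lfsup r m x (c - 1); exists N.+1 => i hi; apply: hN; lia.
Qed.

Lemma RopS (r m : int) b : linf b -> Rop r (m + 1) b = Rop (r + 1) m b - lmono 1 *: Rop r m b.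
Proof.
move=> lb; apply/funext => w; rewrite fctBE fctZE /Rop.
rewrite zsum_scale; last by apply: Rfsup; apply: linf0.
rewrite (zsum_shift (fun l => (lmono (m - l) *: b (T (r + 1 + l) w)) *~ _) (-1)) -zsumB.
- apply: eq_zsum => l; rewrite zbS !mulrDr mulrzDr addrC; congr (_ + _).
    have -> : m - (l - 1) = m + 1 - l by lia.
    have -> : r + 1 + (l - 1) = r + l by lia.
    by rewrite sgS sgP !mulNr mulrN.
  rewrite sgS mulNr mulrNz; congr (- _).
  by rewrite -scalerMzr scalerA -lmonoD (_ : 1 + (m - l) = m + 1 - l) //; lia.
- by have [N hN] := Rfsup (r + 1) m w (linf0 lb); exists N.+1 => i hi; apply: hN; lia.
- by apply: fsup_map (Rfsup _ _ _ (linf0 lb)); rewrite scaler0.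
Qed.

(** This is x^r (x - z)^(m + 1) = x^(r + 1) (x - z)^m - z x^r (x - z)^m. *)
Lemma XopS (r m : int) b : linf b -> Xop r (m + 1) b = Xop (r + 1) m b - lmono 1 *: Xop r m b.
Proof.
move=> lb; apply/funext => w; rewrite fctBE fctZE /Xop LopS RopS // fctBE fctZE.
by rewrite scalerBr !opprD !opprK addrACA [- _ + _]addrC -opprB opprB.
Qed.


Definition fall3 (a : int) : int := a * (a - 1) * (a - 2).

(** The central terms of the brackets of the operators above: only the pairs
    with l + l' = q contribute, those where the indices of the two modes add
    up to 2. *)
Definition czL (r m r' m' : int) : int := let q := r + m + r' + m' - 2 in
  sg q * zsum (fun l => fall3 (r + m - l) * (zb m l * zb m' (q - l))).
Definition czR (r m r' m' : int) : int := let q := 2 - r - r' in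
  sg (m + m') * sg q * zsum (fun l => fall3 (r + l) * (zb m l * zb m' (q - l))).

Let T_br2 (i j : int) w : T i (T j w) - T j (T i w) = T (i + j - 1) w *~ (i - j) +
    (if i + j == 2 then ((12%:R^-1 * el) *: w) *~ fall3 i else 0).
Proof. exact: T_br. Qed.

(** The brackets of modes in the double sum are collected along l + l';
    Pascal's rule then recombines the result. *)
Lemma Lop_br (r m r' m' : int) x :
  Lop r m (Lop r' m' x) - Lop r' m' (Lop r m x) =
  Lop (r + r' - 1) (m + m') x *~ (r - r') + Lop (r + r') (m + m' - 1) x *~ (m - m')
  + ((lC (12%:R^-1 * el) * lmono (r + m + r' + m' - 2)) *: x) *~ czL r m r' m'.
Proof.
apply: lserP => c; rewrite scoefB !scoefD !scoef_mulrz -scalerA scoef_lCZ scoef_monoZ.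
have [t ht] := sdom_ex x; pose q := r + m + r' + m' - 2; rewrite -/q.
(* The terms of the two products, without the binomial weights zz. *)
pose A l l' := T (r + m - l) (T (r' + m' - l') (x (c - (l + l')))) *~ sg (l + l').
pose B l l' := T (r' + m' - l') (T (r + m - l) (x (c - (l + l')))) *~ sg (l + l').
pose zz l l' := zb m l * zb m' l'.
have x0 l l' : c - t < l + l' -> x (c - (l + l')) = 0 by move=> h; apply: ht; lia.
pose N := (`|c| + `|t|)%N.
have A0 l l' : l < 0 \/ l' < 0 \/ c - t < l + l' -> A l l' *~ zz l l' = 0.
  rewrite /A /zz => -[h|[h|h]]; first by rewrite zbN // mul0r mulr0z.
    by rewrite [zb m' _]zbN // mulr0 mulr0z.
  by rewrite x0 // !T0 !mul0rz.
have B0 l l' : l < 0 \/ l' < 0 \/ c - t < l + l' -> B l l' *~ zz l l' = 0.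
  rewrite /B /zz => -[h|[h|h]]; first by rewrite zbN // mul0r mulr0z.
    by rewrite [zb m' _]zbN // mulr0 mulr0z.
  by rewrite x0 // !T0 !mul0rz.
have -> : Lop r m (Lop r' m' x) c = zsum (fun l => zsum (fun l' => A l l' *~ zz l l')).
  rewrite LopE; apply: eq_zsum => l.
  rewrite LopE (zsum_additive (TD _)); last exact: Lfsup.
  rewrite zsum_mulrz; last exact: fsup_map (T0 _) (Lfsup _ _ _ _).
  apply: eq_zsum => l'; rewrite Tmz /A /zz -!mulrzA sgD (_ : c - l - l' = c - (l + l')); last by lia.
  by congr (_ *~ _); ring.
have -> : Lop r' m' (Lop r m x) c = zsum (fun l => zsum (fun l' => B l l' *~ zz l l')).
  rewrite (@zsum_exchange _ _ N) => [|l l' hl|l l' hl]; try by apply: B0; lia.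
  rewrite LopE; apply: eq_zsum => l.
  rewrite LopE (zsum_additive (TD _)); last exact: Lfsup.
  rewrite zsum_mulrz; last exact: fsup_map (T0 _) (Lfsup _ _ _ _).
  apply: eq_zsum => l'; rewrite Tmz /B /zz -!mulrzA sgD (_ : c - l - l' = c - (l' + l)); last by lia.
  by congr (_ *~ _); ring.
rewrite -zsumB; first last.
- by exists N => l hl; apply: zsum0 => l'; apply: B0; lia.
- by exists N => l hl; apply: zsum0 => l'; apply: A0; lia.
transitivity (zsum (fun l => zsum (fun l' => (A l l' - B l l') *~ zz l l'))).
  apply: eq_zsum => l; rewrite -zsumB.
  - by apply: eq_zsum => l'; rewrite mulrzBl.
  - by exists (`|l| + N)%N => l' hl'; apply: A0; lia.
  - by exists (`|l| + N)%N => l' hl'; apply: B0; lia.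
(* Up to an affine factor, the bracket of modes depends on l + l' only. *)
pose h s := T (r + m + r' + m' - 1 - s) (x (c - s)) *~ sg s.
rewrite (@bracket_sum _ m m' (r + m - (r' + m')) (-1) q h
  ((12%:R^-1 * el) *: x (c - q) *~ sg q) (fun l => fall3 (r + m - l)) _ (N + `|q|).+1%:Z); first last.
- move=> l l' _ _; rewrite /A /B -mulrzBl T_br2 mulrzDl /h.
  congr (_ + _).
    rewrite -!mulrzA mulrC (_ : r + m - l + (r' + m' - l') - 1 = r + m + r' + m' - 1 - (l + l'));
      last by lia.
    by congr (_ *~ (_ * _)); lia.
  have -> : (r + m - l + (r' + m' - l') == 2) = (l + l' == q) by rewrite /q; apply/eqP/eqP; lia.
  case: eqP => [<-|_]; last by rewrite mul0rz.
  by rewrite -!mulrzA [sg _ * _]mulrC.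
- lia.
- by move=> s hs; rewrite /h ht ?T0 ?mul0rz //; lia.
congr (_ + _); last by rewrite -mulrzA.
have fs (f : int -> int) : (forall s, s < 0 -> f s = 0) -> fsup (fun s => h s *~ f s).
  move=> f0; apply: (@fsupP _ _ 0 (c - t)) => s hs; first by rewrite f0 ?mulr0z.
  by rewrite /h ht ?T0 ?mul0rz //; lia.
rewrite !LopE zsum_mulrz; last exact: Lfsup.
rewrite zsum_mulrz; last exact: Lfsup.
rewrite -zsumD.
- apply: eq_zsum => s; rewrite /h -!mulrzA.
  have -> : r + r' - 1 + (m + m') - s = r + m + r' + m' - 1 - s by lia.
  have -> : r + r' + (m + m' - 1) - s = r + m + r' + m' - 1 - s by lia.
  rewrite -mulrzDr; congr (_ *~ _).
  have := zbS (m + m' - 1) s; rewrite subrK => ->; ring.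
- by have [M hM] := Lfsup (r + r' - 1) (m + m') x c; exists M => i hi; rewrite hM ?mul0rz.
- by have [M hM] := Lfsup (r + r') (m + m' - 1) x c; exists M => i hi; rewrite hM ?mul0rz.
Qed.

(** As for [Lop_br]; the modes act before b, so the composition is reversed.
    *)
Lemma Rop_br (r m r' m' : int) b : linf b ->
  Rop r' m' (Rop r m b) - Rop r m (Rop r' m' b) =
  Rop (r + r' - 1) (m + m') b *~ (r - r') + Rop (r + r') (m + m' - 1) b *~ (m - m')
  + ((lC (12%:R^-1 * el) * lmono (r + m + r' + m' - 2)) *: b) *~ czR r m r' m'.
Proof.
move=> lb; apply/funext => w.
rewrite fctBE !fctDE !fct_mulrz fctZE.
have b0 := linf0 lb; have bD := linfD lb; pose q := 2 - r - r'.
have [M0 hM0] := T_restr w.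
(* For l + l' large, either the inner index is large, or it takes finitely
   many values and the outer index is large. *)
have [I hI] : exists I : nat, forall l l' : int, 0 <= l -> 0 <= l' -> I%:Z <= l + l' ->
    T (r + l) (T (r' + l') w) = 0 /\ T (r' + l') (T (r + l) w) = 0.
  have /all_sig[B hB] v : {B : int | forall n, B <= n -> T n v = 0} by exact: cid (T_restr v).
  pose B1 := (\sum_(i < `|M0| + `|r'|) `|B (T (r' + i%:Z) w)|)%N.
  pose B2 := (\sum_(i < `|M0| + `|r|) `|B (T (r + i%:Z) w)|)%N.
  exists (`|M0| + `|r| + `|r'| + B1 + B2 + `|M0| + `|r| + `|r'|)%N => l l' hl hl' h.
  split.
  - case: (ltP l' (`|M0| + `|r'|)%N) => h1; last by rewrite (hM0 (r' + l')) ?T0 //; lia.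
    apply: hB.
    have l'lt : (`|l'| < `|M0| + `|r'|)%N by lia.
    have : (`|B (T (r' + l') w)| <= B1)%N.
      rewrite /B1 (bigD1 (Ordinal l'lt)) //=.
      by rewrite (_ : r' + `|l'|%N = r' + l'); [exact: leq_addr|lia].
    lia.
  - case: (ltP l (`|M0| + `|r|)%N) => h1; last by rewrite (hM0 (r + l)) ?T0 //; lia.
    apply: hB.
    have llt : (`|l| < `|M0| + `|r|)%N by lia.
    have : (`|B (T (r + l) w)| <= B2)%N.
      rewrite /B2 (bigD1 (Ordinal llt)) //=.
      by rewrite (_ : r + `|l|%N = r + l); [exact: leq_addr|lia].
    lia.
pose e s : lser W -> lser W := fun y => (lmono (m + m' - s) *: y) *~ (sg (m + m') * sg s).
have eD s : {morph e s : y z / y + z} by move=> y z; rewrite /e scalerDr mulrzDl.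
have eN s y : e s (- y) = - e s y by rewrite /e scalerN mulNrz.
have e0 s : e s 0 = 0 by rewrite /e scaler0 mul0rz.
pose A l l' := e (l + l') (b (T (r + l) (T (r' + l') w))).
pose B l l' := e (l + l') (b (T (r' + l') (T (r + l) w))).
pose zz l l' := zb m l * zb m' l'.
pose N := I.
have A0 l l' : l < 0 \/ l' < 0 \/ I%:Z <= l + l' -> A l l' *~ zz l l' = 0.
  rewrite /A /zz; case: (ltP l 0) => [h|h]; first by rewrite zbN // mul0r mulr0z.
  case: (ltP l' 0) => [h'|h']; first by rewrite [zb m' _]zbN // mulr0 mulr0z.
  move=> H0; have [-> _] : T (r + l) (T (r' + l') w) = 0 /\ T (r' + l') (T (r + l) w) = 0.
    by apply: hI; lia.
  by rewrite b0 e0 mul0rz.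
have B0 l l' : l < 0 \/ l' < 0 \/ I%:Z <= l + l' -> B l l' *~ zz l l' = 0.
  rewrite /B /zz; case: (ltP l 0) => [h|h]; first by rewrite zbN // mul0r mulr0z.
  case: (ltP l' 0) => [h'|h']; first by rewrite [zb m' _]zbN // mulr0 mulr0z.
  move=> H0; have [_ ->] : T (r + l) (T (r' + l') w) = 0 /\ T (r' + l') (T (r + l) w) = 0.
    by apply: hI; lia.
  by rewrite b0 e0 mul0rz.
have -> : Rop r' m' (Rop r m b) w = zsum (fun l => zsum (fun l' => A l l' *~ zz l l')).
  rewrite (@zsum_exchange _ _ N) => [|l l' hl|l l' hl]; try by apply: A0; lia.
  rewrite {1}/Rop; apply: eq_zsum => l.
  rewrite /Rop zsum_scale; last exact: Rfsup.
  rewrite zsum_mulrz; last by apply: fsup_map (Rfsup _ _ _ b0); rewrite scaler0.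
  apply: eq_zsum => l'; rewrite -scalerMzr scalerA -lmonoD /A /e /zz -!mulrzA !sgD.
  rewrite (_ : m' - l + (m - l') = m + m' - (l' + l)); last by lia.
  by congr (_ *~ _); ring.
have -> : Rop r m (Rop r' m' b) w = zsum (fun l => zsum (fun l' => B l l' *~ zz l l')).
  rewrite {1}/Rop; apply: eq_zsum => l.
  rewrite /Rop zsum_scale; last exact: Rfsup.
  rewrite zsum_mulrz; last by apply: fsup_map (Rfsup _ _ _ b0); rewrite scaler0.
  apply: eq_zsum => l'; rewrite -scalerMzr scalerA -lmonoD /B /e /zz -!mulrzA !sgD.
  rewrite (_ : m - l + (m' - l') = m + m' - (l + l')); last by lia.
  by congr (_ *~ _); ring.
rewrite -zsumB; first last.
- by exists N => l hl; apply: zsum0 => l'; apply: B0; lia.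
- by exists N => l hl; apply: zsum0 => l'; apply: A0; lia.
transitivity (zsum (fun l => zsum (fun l' => (A l l' - B l l') *~ zz l l'))).
  apply: eq_zsum => l; rewrite -zsumB.
  - by apply: eq_zsum => l'; rewrite mulrzBl.
  - by exists (`|l| + N)%N => l' hl'; apply: A0; lia.
  - by exists (`|l| + N)%N => l' hl'; apply: B0; lia.
pose h s := e s (b (T (r + r' + s - 1) w)).
have [J [hJ1 hJ2]] : exists J : int, (forall s, J <= s -> h s = 0) /\ q < J.
  exists (`|M0| + `|r| + `|r'| + `|q| + 2)%N; split; last by lia.
  by move=> s hs; rewrite /h hM0 ?b0 ?e0 //; lia.
rewrite (@bracket_sum _ m m' (r - r') 1 q h
  (e q ((lC (12%:R^-1 * el)) *: b w)) (fun l => fall3 (r + l)) _ J) //; first last.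
- move=> l l' _ _; rewrite /A /B -eN -eD.
  have bN y : b (- y) = - b y by rewrite -scaleN1r linfZ // rmorphN1 scaleN1r.
  rewrite -bN -bD T_br2 bD eD /h; congr (_ + _).
    rewrite (morph_mulrz _ _ bD) (morph_mulrz _ _ (eD _)).
    have -> : r + l + (r' + l') - 1 = r + r' + (l + l') - 1 by lia.
    by congr (_ *~ _); lia.
  have -> : (r + l + (r' + l') == 2) = (l + l' == q) by rewrite /q; apply/eqP/eqP; lia.
  case: eqP => [<-|_]; last by rewrite b0 e0.
  by rewrite (morph_mulrz _ _ bD) (morph_mulrz _ _ (eD _)) linfZ.
congr (_ + _); last first.
  rewrite /e -mulrzA scalerA mulrC (_ : m + m' - q = r + m + r' + m' - 2) //; rewrite /q; lia.
rewrite /Rop zsum_mulrz; last exact: Rfsup.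
rewrite zsum_mulrz; last exact: Rfsup.
rewrite [X in _ = _ + X](zsum_shift _ (-1)) -zsumD.
- apply: eq_zsum => s; rewrite /h /e -!mulrzA.
  have -> : r + r' - 1 + s = r + r' + s - 1 by lia.
  have -> : r + r' + (s - 1) = r + r' + s - 1 by lia.
  have -> : m + m' - 1 - (s - 1) = m + m' - s by lia.
  rewrite -mulrzDr; congr (_ *~ _).
  rewrite !sgP; ring.
- by have [M hM] := Rfsup (r + r' - 1) (m + m') w b0; exists M => i hi; rewrite hM ?mul0rz.
- have [M hM] := Rfsup (r + r') (m + m' - 1) w b0; exists M.+1 => i hi; rewrite hM ?mul0rz //; lia.
Qed.

Lemma Lop_Rop r m r' m' b w : linf b ->
  Lop r m (Rop r' m' b w) = Rop r' m' (fun v => Lop r m (b v)) w.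
Proof.
move=> lb; rewrite /Rop (zsum_additive (LopD r m)); last by apply: Rfsup; apply: linf0.
by apply: eq_zsum => l; rewrite (morph_mulrz _ _ (LopD r m)) LopZ.
Qed.

(** Left and right operators commute, so the brackets of the left and of the
    right parts can be computed separately. *)
Lemma Xop_br (r m r' m' : int) b : linf b ->
  Xop r m (Xop r' m' b) - Xop r' m' (Xop r m b) =
  Xop (r + r' - 1) (m + m') b *~ (r - r') + Xop (r + r') (m + m' - 1) b *~ (m - m')
  + ((lC (12%:R^-1 * el) * lmono (r + m + r' + m' - 2)) *: b) *~ (czL r m r' m' - czR r m r' m').
Proof.
move=> lb; apply/funext => w; have lb0 := linf0 lb.
pose LL i j := (fun v => Lop i j (b v)) : H.
have lL i j : linf (LL i j) by move=> c u v; rewrite /LL lb LopD LopZ.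
have XE i j i' j' : Xop i j (Xop i' j' b) w =
   Lop i j (Lop i' j' (b w)) - Lop i j (Rop i' j' b w) - Lop i' j' (Rop i j b w) + Rop i j (Rop i' j' b) w.
  rewrite /Xop -/(Xop i' j' b) (_ : Xop i' j' b = LL i' j' + (-1 : k) *: Rop i' j' b); last first.
    by apply/funext => v; rewrite fctDE fctZE scaleN1r.
  rewrite RopD //; last by apply: linf_scale; apply: Rop_lin.
  rewrite RopZ; last exact: Rop_lin.
  rewrite !fctDE !fctZE !scaleN1r LopD -[- Rop _ _ _ w]scaleN1r LopZ scaleN1r.
  by rewrite opprD opprK addrA -(Lop_Rop i' j' i j).
rewrite fctBE !XE !fctDE !fct_mulrz fctZE /Xop.
have := Rop_br r m r' m' lb; move/(congr1 (fun b : H => b w)).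
rewrite fctBE !fctDE !fct_mulrz fctZE.
have := Lop_br r m r' m' (b w).
set a1 := Lop r m (Lop _ _ _); set a2 := Lop r' m' (Lop _ _ _).
set b1 := Lop r m (Rop _ _ _ _); set b2 := Lop r' m' (Rop _ _ _ _).
set c1 := Rop r' m' (Rop _ _ _) w; set c2 := Rop r m (Rop _ _ _) w => E1 E2.
have -> : a1 - b1 - b2 + c2 - (a2 - b2 - b1 + c1) = (a1 - a2) - (c1 - c2) by zlin.
by rewrite E1 E2; zlin.
Qed.


(** The mode of index m of T(x), with z as origin. *)
Definition Tm (m : int) : H -> H := Xop 0 m.

Lemma fall3_absorb m l : fall3 (m - l) * zb m l = fall3 m * zb (m - 3) l.
Proof.
rewrite /fall3.
have E1 := zb_absorb m l; have E2 := zb_absorb (m - 1) l.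
have E3 := zb_absorb (m - 2) l.
have -> : (m - l) * (m - l - 1) * (m - l - 2) * zb m l =
  (m - l - 1) * (m - l - 2) * ((m - l) * zb m l) by ring.
rewrite E1.
have -> : (m - l - 1) * (m - l - 2) * (m * zb (m - 1) l) =
  m * (m - l - 2) * ((m - 1 - l) * zb (m - 1) l) by ring.
rewrite E2 (_ : m - 1 - 1 = m - 2); last by lia.
have -> : m * (m - l - 2) * ((m - 1) * zb (m - 2) l) =
  m * (m - 1) * ((m - 2 - l) * zb (m - 2) l) by ring.
by rewrite E3 (_ : m - 2 - 1 = m - 3) ?mulrA //; lia.
Qed.

Lemma fall3_small l : 0 <= l -> l < 3 -> fall3 l = 0.
Proof. by case: l => // -[|[|[|l]]] // _ /ltP; lia. Qed.

Lemma czL0 m n : czL 0 m 0 n = if m + n == 2 then fall3 m else 0.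
Proof.
rewrite /czL add0r addr0; set q := m + n - 2.
under eq_zsum => l do rewrite mulrA fall3_absorb -mulrA.
have -> : zsum (fun l => fall3 m * (zb (m - 3) l * zb n (q - l))) = fall3 m * zb (m - 3 + n) q.
  by rewrite -zb_vdm (zsum_additive (f := fun x => fall3 m * x)) //;
     [move=> x y; rewrite mulrDr|apply: zb_fsup].
case: eqP => [E|E].
  have -> : q = 0 by rewrite /q; lia.
  by rewrite zb0l sg0 mul1r mulr1.
case: (ltP q 0) => hq; first by rewrite zbN // !mulr0.
by rewrite zb_large ?mulr0 //; rewrite /q in hq *; lia.
Qed.

(** Right multiplications by polynomial vector fields have no central term: l
    + l' = 2 forces l < 3, and third derivatives are then zero. *)
Lemma czR0 m n : czR 0 m 0 n = 0.
Proof.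
rewrite /czR !subr0 zsum0 ?mulr0 // => l; rewrite add0r.
case: (ltP l 0) => hl; first by rewrite zbN // mul0r mulr0.
case: (ltP 2 l) => h2; first by rewrite [zb n _]zbN ?mulr0 //; lia.
by rewrite fall3_small ?mul0r //; lia.
Qed.

(** Moving the origin to z does not change the relations. *)
Lemma Tm_br m n b : linf b -> Tm m (Tm n b) - Tm n (Tm m b) =
  Tm (m + n - 1) b *~ (m - n) +
  (if m + n == 2 then (lC (12%:R^-1 * el) *: b) *~ fall3 m else 0).
Proof.
move=> lb; rewrite /Tm Xop_br // subrr mulr0z add0r addr0 czL0 czR0 subr0.
congr (_ + _); case: eqP => [E|_]; last by rewrite mulr0z.
by rewrite (_ : 0 + m + n - 2 = 0) ?lmono0 ?mulr1 //; lia.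
Qed.

Lemma Xop0E r b w : linf b -> Xop r 0 b w = smap (T r) (b w) - b (T r w).
Proof.
move=> lb; rewrite /Xop; congr (_ - _).
  apply: lserP => c; rewrite LopE smapE ?T0 // (@zsum_pt _ _ 0) ?subr0 ?addr0 ?mulr1z //.
  by move=> i /negPf i0; rewrite zb0 i0 mulr0 mulr0z.
rewrite /Rop (@zsum_pt _ _ 0) ?subr0 ?addr0 ?mulr1z ?lmono0 ?scale1r //.
by move=> i /negPf i0; rewrite zb0 i0 !mulr0 mulr0z.
Qed.

(** The operator S - z on sequences, where S is the shift. *)
Definition Dz (e : int -> H) (r : int) : H := e (r + 1) - lmono 1 *: e r.
(** Quasi-polynomial sequences: the solutions of (S - z)^J e = 0 are
    combinations of the sequences (r choose j) z^(r - j) with j < J. *)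
Definition qpol (e : int -> H) : Prop := exists J : nat, forall r, iter J Dz e r = 0.

Lemma eq_Dz e e' : e =1 e' -> Dz e =1 Dz e'.
Proof. by move=> E r; rewrite /Dz !E. Qed.
Lemma eq_iterDz J e e' : e =1 e' -> iter J Dz e =1 iter J Dz e'.
Proof. by elim: J => //= J IH E; apply: eq_Dz; apply: IH. Qed.
Lemma DzD e e' r : Dz (fun r => e r + e' r) r = Dz e r + Dz e' r.
Proof. by rewrite /Dz scalerDr; zlin. Qed.
Lemma iterDzD J e e' r :
  iter J Dz (fun r => e r + e' r) r = iter J Dz e r + iter J Dz e' r.
Proof.
elim: J r => //= J IH r; rewrite -DzD; exact: eq_Dz.
Qed.
Lemma iterDz0 J r : iter J Dz (fun=> 0) r = 0.
Proof. by elim: J r => //= J IH r; rewrite /Dz !IH scaler0 subr0. Qed.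
Lemma iterDz_mono J J' e : (J <= J')%N -> (forall r, iter J Dz e r = 0) ->
  forall r, iter J' Dz e r = 0.
Proof.
move=> JJ h r; rewrite -(subnK JJ) iterD (eq_iterDz _ h); exact: iterDz0.
Qed.

Lemma eq_qpol e e' : e =1 e' -> qpol e -> qpol e'.
Proof. by move=> E [J hJ]; exists J => r; rewrite -(eq_iterDz J E). Qed.
Lemma qpolD e e' : qpol e -> qpol e' -> qpol (fun r => e r + e' r).
Proof.
move=> [J hJ] [J' hJ']; exists (J + J')%N => r.
rewrite iterDzD (iterDz_mono (leq_addr _ _) hJ) add0r.
exact: (iterDz_mono (leq_addl _ _) hJ').
Qed.
Lemma qpolZ (f : k) e : qpol e -> qpol (fun r => f *: e r).
Proof.
move=> [J hJ]; exists J => r.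
have E i s : iter i Dz (fun r => f *: e r) s = f *: iter i Dz e s.
  elim: i s => //= i IH s; rewrite {1}/Dz !IH /Dz scalerBr !scalerA.
  by rewrite mulrC.
by rewrite E hJ scaler0.
Qed.
Lemma qpolMz (n : int) e : qpol e -> qpol (fun r => e r *~ n).
Proof.
by move=> /(qpolZ n%:~R); apply: eq_qpol => r; rewrite scaler_int.
Qed.
Lemma qpol_shift a e : qpol e -> qpol (fun r => e (r + a)).
Proof.
move=> [J hJ]; exists J => r.
have -> // : iter J Dz (fun r => e (r + a)) r = iter J Dz e (r + a).
elim: J r {hJ} => //= J IH r; rewrite /Dz !IH (_ : r + 1 + a = r + a + 1) //; lia.
Qed.
Lemma qpolDz e : qpol (Dz e) -> qpol e.
Proof. by move=> [J hJ]; exists J.+1 => r; rewrite iterSr. Qed.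
Lemma qpol_mulr e : qpol e -> qpol (fun r => e r *~ r).
Proof.
move=> [J hJ]; elim: J e hJ => [|J IH] e hJ.
  by exists 0%N => r; have := hJ r; rewrite /= => ->; rewrite mul0rz.
apply: qpolDz; apply: (eq_qpol (e := fun r => Dz e r *~ r + e (r + 1))).
  by move=> r; rewrite /Dz /= -scalerMzr; zlin.
apply: qpolD; last by apply: qpol_shift; exists J.+1.
by apply: IH => r; rewrite -iterSr.
Qed.
Lemma qpol_mulrD (a : int) e : qpol e -> qpol (fun r => e r *~ (r + a)).
Proof.
move=> qe; apply: (eq_qpol (e := fun r => e r *~ r + e r *~ a)).
  by move=> r; zlin.
by apply: qpolD; [apply: qpol_mulr|apply: qpolMz].
Qed.

Lemma Dz_Xop m b r : linf b -> Dz (fun r => Xop r m b) r = Xop r (m + 1) b.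
Proof. by move=> lb; rewrite XopS. Qed.
Lemma iterDz_Xop J m b r : linf b -> iter J Dz (fun r => Xop r m b) r = Xop r (m + J%:Z) b.
Proof.
move=> lb; elim: J r => [|J IH] r; first by rewrite addr0.
rewrite iterS (eq_Dz IH) Dz_Xop // (_ : m + J + 1 = m + J.+1%:Z) //; lia.
Qed.

(** A field is local when its commutators with all modes of T(x) are killed
    by a power of x - z. *)
Definition local (b : H) : Prop := linf b /\ qpol (fun r => Xop r 0 b).

Lemma local_lin b : local b -> linf b. Proof. by case. Qed.

Lemma localP b : local b -> exists J : nat, forall r m, J%:Z <= m -> Xop r m b = 0.
Proof.
move=> [lb [J hJ]]; exists J => r m Jm.
have := iterDz_mono (J' := `|m|%N) _ hJ r; rewrite iterDz_Xop // add0r.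
by rewrite (_ : `|m|%N%:Z = m) => [->|] //; lia.
Qed.

Lemma local_qpol m b : local b -> qpol (fun r => Xop r m b).
Proof.
move=> hb; have [J hJ] := localP hb; exists (J + `|m|)%N => r.
rewrite iterDz_Xop; last exact: local_lin.
by apply: hJ; lia.
Qed.

Lemma local_0 : local 0.
Proof.
split; first exact: (@linf_0 K W).
by exists 0%N => r /=; rewrite Xop_0.
Qed.
Lemma local_add b b' : local b -> local b' -> local (b + b').
Proof.
move=> [lb qb] [lb' qb']; split; first exact: linf_add.
by apply: eq_qpol (qpolD qb qb') => r; rewrite XopD.
Qed.
Lemma local_scale (f : k) b : local b -> local (f *: b).
Proof.
move=> [lb qb]; split; first exact: linf_scale.
by apply: eq_qpol (qpolZ f qb) => r; rewrite XopZ.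
Qed.

(** The central term of [T_r, T_(m)] as a function of r. *)
Let Qc (m r : int) : int := sg (r + m) * (zb m (r + m - 2) - zb m (2 - r)).

Let zb_sym m j : 0 <= m -> zb m j = zb m (m - j).
Proof.
case: m => // m _; case: j => [j|j]; last by rewrite zbN // zb_large //; lia.
case: (leqP j m) => jm; last by rewrite zb_large ?[RHS]zbN //; lia.
by rewrite (_ : Posz m - Posz j = Posz (m - j)) /zb ?bin_sub //; lia.
Qed.

Let QcS m r : Qc (m + 1) r = Qc m (r + 1) - Qc m r.
Proof.
rewrite /Qc !zbS addrA sgS.
rewrite (_ : r + 1 + m = r + m + 1) ?sgS; last by lia.
rewrite (_ : r + m + 1 - 2 = r + m - 1); last by lia.
rewrite (_ : r + m - 1 - 1 = r + m - 2); last by lia.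
rewrite (_ : 2 - (r + 1) = 2 - r - 1); last by lia.
ring.
Qed.

Let czQ r m : czL r 0 0 m - czR r 0 0 m = fall3 r * Qc m r.
Proof.
rewrite /czL /czR /Qc !addr0 ?subr0 ?add0r.
rewrite (@zsum_pt _ _ 0) ?zb0l ?subr0; last first.
  by move=> i /negPf i0; rewrite zb0 i0 mul0r mulr0.
rewrite (@zsum_pt _ _ 0) ?zb0l ?subr0 ?addr0; last first.
  by move=> i /negPf i0; rewrite zb0 i0 mul0r mulr0.
have -> : sg (r + m - 2) = sg (r + m) by rewrite sgD mulr1.
have -> : sg m * sg (2 - r) = sg (r + m).
  by rewrite -sgD (_ : m + (2 - r) = (m - r) + 2) ?[LHS]sgD ?mulr1; [rewrite !sgD sgN mulrC|lia].
ring.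
Qed.

(** Qc m obeys Pascal's rule in m and vanishes for m >= 0, by the symmetry of
    the binomial coefficients; so r |-> z^r Qc m r is quasi-polynomial. *)
Let qpol_cz m b : qpol (fun r => ((lC (12%:R^-1 * el) * lmono (r + m - 2)) *: b)
  *~ (czL r 0 0 m - czR r 0 0 m)).
Proof.
apply: (eq_qpol (e := fun r => lC (12%:R^-1 * el) *:
    ((lmono (r + m - 2) *: b) *~ Qc m r *~ r *~ (r + -1) *~ (r + -2)))).
  by move=> r; rewrite czQ -!scalerMzr -!mulrzA scalerA; congr (_ *~ _); rewrite /fall3; ring.
apply: qpolZ; do 2!apply: qpol_mulrD; apply: qpol_mulr.
pose E m r := (lmono (r + m - 2) *: b) *~ Qc m r.
have DE j : Dz (E j) =1 E (j + 1).
  move=> r; rewrite /Dz /E QcS -scalerMzr scalerA -lmonoD.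
  rewrite (_ : r + 1 + j - 2 = r + (j + 1) - 2); last by lia.
  by rewrite (_ : 1 + (r + j - 2) = r + (j + 1) - 2) ?mulrzBr //; lia.
have itE J r : iter J Dz (E m) r = E (m + J%:Z) r.
  elim: J r => [|J IH] r; first by rewrite addr0.
  by rewrite iterS (eq_Dz IH) DE (_ : m + J + 1 = m + J.+1%:Z) //; lia.
exists `|m|%N => r; rewrite itE /E /Qc zb_sym; last by lia.
by rewrite (_ : m + `|m|%N - (r + (m + `|m|%N) - 2) = 2 - r) ?subrr ?mulr0 ?mulr0z //; lia.
Qed.

Lemma qpol_lin (f : H -> H) e :
  (forall b b', linf b -> linf b' -> f (b + b') = f b + f b') ->
  (forall (c : k) b, linf b -> f (c *: b) = c *: f b) ->
  (forall r, linf (e r)) -> qpol e -> qpol (fun r => f (e r)).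
Proof.
move=> fD fZ le [J hJ]; exists J => r.
have Dl i s : linf (iter i Dz e s).
  elim: i s => //= i IH s; rewrite /Dz; apply: linf_add => //.
  by rewrite -scaleN1r; do 2!apply: linf_scale.
have E i s : iter i Dz (fun r => f (e r)) s = f (iter i Dz e s).
  elim: i s => //= i IH s; rewrite {1}/Dz !IH /Dz.
  rewrite -[in RHS]scaleN1r [in RHS]scalerA fD //; last exact: linf_scale.
  by rewrite fZ // -scalerA scaleN1r.
by rewrite E hJ -[0 : H](scale0r 0) fZ ?scale0r //; exact: (@linf_0 K W).
Qed.

(** The commutators with T_(m) b are the images under T_(m) of those with b,
    plus the terms in [Xop_br]; all these are quasi-polynomial in r. *)
Lemma local_Tm m b : local b -> local (Tm m b).
Proof.
move=> hb; have lb := local_lin hb; split; first exact: Xop_lin.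
apply: (eq_qpol (e := fun r => Tm m (Xop r 0 b) + (Xop (r - 1) m b *~ r +
  (Xop r (m - 1) b *~ (- m) + ((lC (12%:R^-1 * el) * lmono (r + m - 2)) *: b)
  *~ (czL r 0 0 m - czR r 0 0 m))))).
  move=> r; have := Xop_br r 0 0 m lb; rewrite !addr0 ?subr0 !add0r => E.
  by rewrite -(subrK (Tm m (Xop r 0 b)) (Xop r 0 (Tm m b))) E; zlin.
apply: qpolD; first apply: (qpol_lin (f := Tm m)).
- by move=> *; apply: XopD.
- by move=> *; apply: XopZ.
- by move=> r; apply: Xop_lin.
- exact: local_qpol.
apply: qpolD; first by apply: qpol_mulr; apply: (@qpol_shift (-1) (fun r => Xop r m b)); apply: local_qpol.
by apply: qpolD; [apply: qpolMz; apply: local_qpol|apply: qpol_cz].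
Qed.

Lemma Tm_restr b : local b -> exists N : nat, forall n, N%:Z <= n -> Tm n b = 0.
Proof. by move=> hb; have [J hJ] := localP hb; exists J => n; apply: hJ. Qed.

(** Newton's interpolation formula. *)
Lemma newton (J : nat) (e : int -> H) : (forall r, iter J Dz e r = 0) ->
  forall r, e r = \sum_(j < J) (lmono (r - j%:Z) *: iter j Dz e 0) *~ zb r j%:Z.
Proof.
elim: J e => [|J IH] e hJ r; first by rewrite big_ord0; apply: (hJ r).
pose e' r := \sum_(j < J.+1) (lmono (r - j%:Z) *: iter j Dz e 0) *~ zb r j%:Z.
rewrite -/(e' r).
have hD s : Dz e s = \sum_(j < J) (lmono (s - j%:Z) *: iter j.+1 Dz e 0) *~ zb s j%:Z.
  rewrite (IH (Dz e)) => [|t]; last by rewrite -iterSr.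
  by apply: eq_bigr => j _; rewrite iterSr.
have De s : Dz e s = Dz e' s.
  rewrite hD [Dz e' s]/Dz /e' scaler_sumr -sumrB big_ord_recl /=.
  rewrite !zb0l !mulr1z !subr0 scalerA -lmonoD (addrC 1) subrr add0r.
  apply: eq_bigr => j _; rewrite /bump /= add1n.
  rewrite (_ : s + 1 - j.+1%:Z = s - j%:Z); last by lia.
  rewrite zbS (_ : j.+1%:Z - 1 = j%:Z); last by lia.
  rewrite -scalerMzr scalerA -lmonoD (_ : 1 + (s - j.+1%:Z) = s - j%:Z); last by lia.
  by zlin.
(* The sequences e and e' have the same image under S - z and the same value
   at 0; as z is invertible, they agree at negative r too. *)
pose d s := e s - e' s.
have d0 : d 0 = 0.
  rewrite /d /e' big_ord_recl /= zb0l subr0 lmono0 scale1r mulr1z big1 ?addr0 ?subrr //.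
have dS s : d (s + 1) = lmono 1 *: d s.
  have := De s; rewrite /Dz /d scalerBr => E.
  have -> : e (s + 1) = (e' (s + 1) - lmono 1 *: e' s) + lmono 1 *: e s.
    by rewrite -E; zlin.
  zlin.
have : forall s, d s = 0.
  elim/int_ind2 => // s h; first by rewrite dS h scaler0.
  by move: h; rewrite dS => /(congr1 (fun b => (lmono 1)^-1 *: b));
     rewrite scalerA mulVf ?lmono_neq0 // scale1r scaler0.
by move=> /(_ r) /eqP; rewrite subr_eq0 => /eqP.
Qed.

(** Locality makes the commutator with T_r a quasi-polynomial sequence in r,
    to which Newton's formula applies. *)
Lemma commutator b : local b -> exists J : nat, (forall j, J%:Z <= j -> Tm j b = 0) /\
  forall r w, smap (T r) (b w) - b (T r w) =
    \sum_(j < J) (lmono (r - j%:Z) *: Tm j b w) *~ zb r j%:Z.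
Proof.
move=> hb; have lb := local_lin hb; have [J hJ] := localP hb.
exists J; split=> [j|r w]; first exact: hJ.
rewrite -Xop0E // (@newton J (fun r => Xop r 0 b)) => [|s]; last first.
  by rewrite iterDz_Xop // add0r; apply: hJ.
rewrite fct_sum; apply: eq_bigr => j _.
by rewrite fct_mulrz fctZE iterDz_Xop // add0r.
Qed.

(** The field of the vacuum. *)
Definition idf : H := fun w => smono 0 w.

Lemma idf_lin : linf idf.
Proof.
move=> c u v; apply: lserP => n; rewrite scoefD scoef_lCZ !smonoE.
by case: eqP => // _; rewrite scaler0 addr0.
Qed.

Lemma idf_comm r : Xop r 0 idf = 0.
Proof.
apply/funext => w; rewrite Xop0E; last exact: idf_lin.
apply: lserP => n; rewrite scoefB smapE ?T0 // !smonoE fct0E scoef0.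
by case: eqP => _; rewrite ?T0 subrr.
Qed.

Lemma idf_local : local idf.
Proof. by split; [exact: idf_lin|exists 0%N => r; apply: idf_comm]. Qed.

Lemma Tm_idf m : 0 <= m -> Tm m idf = 0.
Proof.
move=> m0; have := iterDz_Xop `|m|%N 0 0 idf_lin; rewrite add0r.
have -> : `|m|%N%:Z = m by lia.
by rewrite /Tm => <-; rewrite (eq_iterDz _ idf_comm) iterDz0.
Qed.

End Fields.

(** * Taylor expansion and the local coordinate *)

(** Divided derivatives. *)
Section Hasse.
Variable M : zmodType.

Lemma hd_subproof (n : int) (x : lser M) : ltrunc (fun c => x (c + n) *~ zb (c + n) n).
Proof.
have [s hs] := sdom_ex x; exists (s - n) => c hc.
by rewrite hs ?mul0rz //; lia.
Qed.
Definition hd n x : lser M := LSer (hd_subproof n x).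
Lemma hdE n x c : hd n x c = x (c + n) *~ zb (c + n) n. Proof. by []. Qed.
Lemma hdN n x : n < 0 -> hd n x = 0.
Proof. by move=> hn; apply: lserP => c; rewrite hdE zbN // mulr0z. Qed.
Lemma hd0 x : hd 0 x = x.
Proof. by apply: lserP => c; rewrite hdE zb0l addr0 mulr1z. Qed.
Lemma hdD n x y : hd n (x + y) = hd n x + hd n y.
Proof. by apply: lserP => c; rewrite scoefD !hdE scoefD mulrzDl. Qed.
Lemma hd_sder n x : hd n (sder x) = hd (n + 1) x *~ (n + 1).
Proof.
apply: lserP => c; rewrite scoef_mulrz !hdE scoef_der -!mulrzA.
rewrite addrA; congr (_ *~ _); have := zb_diag (c + n + 1) (n + 1).
by rewrite !addrK => <-; rewrite mulrC.
Qed.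
End Hasse.

Section HasseScalar.
Variable F : fieldType.

Lemma hdl_subproof (n : int) (f : laurent F) : ltrunc (fun c => f (c + n) *~ zb (c + n) n).
Proof.
have [s hs] := ldom_ex f; exists (s - n) => c hc.
by rewrite hs ?mul0rz //; lia.
Qed.
Definition hdl n f : laurent F := Laurent (hdl_subproof n f).
Lemma hdlE n f c : hdl n f c = f (c + n) *~ zb (c + n) n. Proof. by []. Qed.
Lemma hdlN n f : n < 0 -> hdl n f = 0.
Proof. by move=> hn; apply: laurentP => c; rewrite hdlE zbN // mulr0z. Qed.
Lemma hdl0 f : hdl 0 f = f.
Proof. by apply: laurentP => c; rewrite hdlE zb0l addr0 mulr1z. Qed.
Lemma lderiv_hdl n f : lderiv (hdl n f) = hdl (n + 1) f *~ (n + 1).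
Proof.
apply: laurentP => c; rewrite lcoef_mulrz lcoef_deriv !hdlE -!mulrzA.
rewrite (_ : c + (n + 1) = c + 1 + n); last by lia.
congr (_ *~ _); have := zb_absorb (c + 1 + n) n; have := zb_diag (c + 1 + n) (n + 1).
rewrite (_ : c + 1 + n - n = c + 1) ?addrK; last by lia.
by move=> E1 E2; rewrite [LHS]mulrC E2 -E1 mulrC.
Qed.
Lemma hdl_lderiv n f : hdl n (lderiv f) = hdl (n + 1) f *~ (n + 1).
Proof.
apply: laurentP => c; rewrite lcoef_mulrz !hdlE lcoef_deriv -!mulrzA.
rewrite addrA; congr (_ *~ _); have := zb_diag (c + n + 1) (n + 1).
by rewrite !addrK => <-; rewrite mulrC.
Qed.

Variable M : lmodType F.

(** The Leibniz rule for divided derivatives is Vandermonde's identity. *)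
Lemma hd_scale n f (x : lser M) :
  hd n (f *: x) = zsum (fun a => hdl a f *: hd (n - a) x).
Proof.
have fsa : fsup (fun a => hdl a f *: hd (n - a) x).
  apply: (@fsupP _ _ 0 n) => a ha; first by rewrite hdlN ?scale0r.
  by rewrite hdN ?scaler0 //; lia.
apply: lserP => c; rewrite scoef_zsum // hdE scoefZ.
rewrite zsum_mulrz; last exact: sscale_fsup.
have [s hs] := ldom_ex f; have [t ht] := sdom_ex x.
pose G a i := (f i *: x (c + n - i)) *~ (zb i a * zb (c + n - i) (n - a)).
have G0 a i : a < 0 \/ n < a \/ i < s \/ c + n - i < t -> G a i = 0.
  rewrite /G => -[h|[h|[h|h]]].
  - by rewrite zbN // mul0r mulr0z.
  - by rewrite [X in _ * X]zbN ?mulr0 ?mulr0z //; lia.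
  - by rewrite hs // scale0r mul0rz.
  - by rewrite ht // scaler0 mul0rz.
transitivity (zsum (fun i => zsum (fun a => G a i))).
  apply: eq_zsum => i; rewrite /G -zsum_mulrzr; last exact: zb_fsup.
  by rewrite zb_vdm (_ : i + (c + n - i) = c + n) //; lia.
rewrite (@zsum_exchange _ _ (`|s| + `|t| + `|c| + `|n|)%N) => [|a i h|a i h]; try by apply: G0; lia.
apply: eq_zsum => a; rewrite scoefZ (zsum_shift _ a); apply: eq_zsum => i.
rewrite /G hdlE hdE (_ : c - i + (n - a) = c + n - (i + a)); last by lia.
by rewrite -scalerMzr -scalerMzl -mulrzA.
Qed.
End HasseScalar.

(** f(z) becomes f(z + s), a power series in s over K((z)). *)
Section Taylor.
Variable F : fieldType.

Lemma ts_subproof (f : laurent F) : ltrunc (fun n => hdl n f).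
Proof. by exists 0 => n; apply: hdlN. Qed.
Definition ts (f : laurent F) : laurent (laurent F) := Laurent (ts_subproof f).
Lemma tsE f n : ts f n = hdl n f. Proof. by []. Qed.

Lemma ts_dom f : ldom (ts f) 0.
Proof. by move=> n; apply: hdlN. Qed.

Section TaylorMod.
Variable M : lmodType F.
Lemma tsm_subproof (x : lser M) : ltrunc (fun n => hd n x).
Proof. by exists 0 => n; apply: hdN. Qed.
Definition tsm (x : lser M) : lser (lser M) := LSer (tsm_subproof x).
Lemma tsmE x n : tsm x n = hd n x. Proof. by []. Qed.
Lemma tsm_scale f x : tsm (f *: x) = ts f *: tsm x.
Proof. by apply: lserP => n; rewrite tsmE hd_scale scoefZ. Qed.
Lemma tsmD x y : tsm (x + y) = tsm x + tsm y.
Proof. by apply: lserP => n; rewrite scoefD !tsmE hdD. Qed.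
Lemma sder_tsm x : sder (tsm x) = tsm (sder x).
Proof. by apply: lserP => n; rewrite scoef_der !tsmE hd_sder. Qed.
End TaylorMod.

Lemma tsD f g : ts (f + g) = ts f + ts g.
Proof.
by apply: laurentP => n; rewrite lcoefD !tsE; apply: laurentP => c;
   rewrite lcoefD !hdlE lcoefD mulrzDl.
Qed.

Lemma ts1 : ts 1 = 1.
Proof.
apply: laurentP => n; rewrite tsE lcoef1; apply: laurentP => c.
rewrite hdlE lcoef1.
case: (n =P 0) => [->|n0]; first by rewrite addr0 zb0l mulr1z lcoef1.
rewrite mulr0n lcoef0; case: (c + n =P 0) => [->|]; last by rewrite mul0rz.
by rewrite zb0; case: eqP => //; rewrite mulr0z.
Qed.

Lemma tsM f g : ts (f * g) = ts f * ts g.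
Proof.
pose j (h : laurent F) : lser F^o := mks (h : int -> F^o).
have jE h n : j h n = h n by rewrite /j mksE //; apply: (laurent_subproof h).
have jM h h' : j (h * h') = h *: j h'.
  by apply: lserP => n; rewrite jE scoefZ; apply: eq_zsum => i; rewrite jE.
have jh n h : hd n (j h) = j (hdl n h) by apply: lserP => c; rewrite hdE !jE hdlE.
have ji h h' : j h = j h' -> h = h'.
  by move=> E; apply: laurentP => n; rewrite -!jE E.
have j_sum (G : int -> laurent F) : fsup G -> j (zsum G) = zsum (fun i => j (G i)).
  by apply: zsum_additive => x y; apply: lserP => n; rewrite scoefD !jE.
apply: laurentP => n; apply: ji; rewrite tsE -jh jM hd_scale lcoefM j_sum.
  by apply: eq_zsum => a; rewrite jh -jM.
apply: (@fsupP _ _ 0 n) => i hi; first by rewrite tsE hdlN ?mul0r.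
by rewrite [ts g _]hdlN ?mulr0 //; lia.
Qed.

Lemma lderiv_ts f : lderiv (ts f) = ts (lderiv f).
Proof. by apply: laurentP => n; rewrite lcoef_deriv !tsE hdl_lderiv. Qed.

(** The coefficientwise derivative d/dz of a series in s over K((z)). *)
Lemma dz_subproof (X : laurent (laurent F)) : ltrunc (fun n => lderiv (X n)).
Proof. by have [s hs] := ldom_ex X; exists s => n /hs ->; rewrite lderiv0. Qed.
Definition dz X : laurent (laurent F) := Laurent (dz_subproof X).
Lemma dzE X n : dz X n = lderiv (X n). Proof. by []. Qed.
Lemma dzD X Y : dz (X + Y) = dz X + dz Y.
Proof. by apply: laurentP => n; rewrite lcoefD !dzE lcoefD lderivD. Qed.
Lemma lderiv_zsum (G : int -> laurent F) : fsup G ->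
  lderiv (zsum G) = zsum (fun i => lderiv (G i)).
Proof. by apply: zsum_additive; apply: lderivD. Qed.
Lemma lmul_fsup (R : fieldType) (X Y : laurent R) n : fsup (fun i => X i * Y (n - i)).
Proof.
have [s hs] := ldom_ex X; have [t ht] := ldom_ex Y.
apply: (@fsupP _ _ s (n - t)) => i hi; first by rewrite hs ?mul0r.
by rewrite ht ?mulr0 //; lia.
Qed.
Lemma dzM X Y : dz (X * Y) = dz X * Y + X * dz Y.
Proof.
apply: laurentP => n; rewrite lcoefD dzE !lcoefM lderiv_zsum; last exact: lmul_fsup.
rewrite -zsumD; try exact: lmul_fsup.
by apply: eq_zsum => i; rewrite lderivM !dzE.
Qed.
Lemma dz_ts f : dz (ts f) = lderiv (ts f).
Proof. by apply: laurentP => n; rewrite dzE lcoef_deriv !tsE lderiv_hdl. Qed.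

(** This derivation kills the functions of z + s: it moves the origin z while
    keeping the point x = z + s fixed. *)
Definition nabla X := dz X - lderiv X.
Lemma nablaM X Y : nabla (X * Y) = nabla X * Y + X * nabla Y.
Proof. by rewrite /nabla dzM lderivM; ring. Qed.
Lemma nabla_ts f : nabla (ts f) = 0.
Proof. by rewrite /nabla dz_ts subrr. Qed.
End Taylor.

(** For an abstract derivation, as it is used for d/ds and for d/dz - d/ds. *)
Lemma deriv_expz (F : fieldType) (D : F -> F) (x : F) (n : int) :
  (forall a b, D (a * b) = D a * b + a * D b) -> x != 0 ->
  D (x ^ n) = n%:~R * x ^ (n - 1) * D x.
Proof.
move=> DM x0.
have D1 : D 1 = 0 by have := DM 1 1; rewrite !mulr1 mul1r => /eqP; rewrite -subr_eq subrr => /eqP.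
elim/int_ind2: n => [|n IH|n IH]; first by rewrite expr0z D1 !mul0r.
  rewrite expfzDr // expr1z DM IH addrK intrD mulrDl mul1r mulrDl.
  have E : x ^ n = x ^ (n - 1) * x by have := expfzDr (n - 1) 1 x0; rewrite subrK expr1z.
  rewrite E; ring.
have := DM (x ^ n) x; rewrite -{2}[x]expr1z -expfzDr // IH addrK => E.
apply: (mulIf x0); apply: (addIr (x ^ n * D x)); rewrite -E.
have E0 : x ^ n = x ^ (n - 1) * x by have := expfzDr (n - 1) 1 x0; rewrite subrK expr1z.
rewrite intrD E0; ring.
Qed.

Lemma ldomX (F : fieldType) (f : laurent F) (n : int) : ldom f 1 -> f 1 != 0 ->
  ldom (f ^ n) n /\ (f ^ n) n = f 1 ^ n.
Proof.
move=> hf f1.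
have bot (h h' : laurent F) s t : ldom h s -> ldom h' t -> (h * h') (s + t) = h s * h' t.
  move=> hs ht; rewrite lcoefM (@zsum_pt _ _ s); first by congr (_ * h' _); lia.
  move=> i /eqP is_; have [/hs ->|h1] := ltP i s; first by rewrite mul0r.
  by rewrite ht ?mulr0 //; lia.
have f0 : f != 0 by apply: contraNneq f1 => ->.
elim/int_ind2: n => [|n [IH1 IH2]|n [IH1 IH2]].
- by split; rewrite ?expr0z; [rewrite -lmono0; apply: ldom_mono|rewrite lcoef1 eqxx].
- have E : f ^ (n + 1) = f ^ n * f by rewrite expfzDr // expr1z.
  by rewrite E; split; [exact: (ldomM IH1 hf)|rewrite bot // IH2 expfzDr // expr1z].
have : ldom (f ^ n) n.
  have [m [hm1 hm2]] := laurent_order (expfz_neq0 n f0).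
  have : (f ^ n * f) (m + 1) != 0 by rewrite bot // mulf_neq0.
  rewrite -{2}[f]expr1z -expfzDr // => h i hi; apply: hm2.
  case: (ltP i m) => // mi; case/eqP: h; apply: IH1; lia.
move=> h; split=> //; apply: (mulIf f1); rewrite -bot //.
by rewrite -{2}[f]expr1z -expfzDr // IH2 expfzDr // expr1z.
Qed.

(** The fall3 derivative of g^m P in a differential field where D g = 1/P:
    the term in g^(m-1) carries the Schwarzian derivative. *)
Section DifferentialField.
Variables (F : fieldType) (D : F -> F) (g P : F).
Hypotheses (DD : forall a b, D (a + b) = D a + D b)
  (DM : forall a b, D (a * b) = D a * b + a * D b)
  (g0 : g != 0) (P0 : P != 0) (Dg : D g = P^-1).

Lemma D_expz n : D (g ^ n) = n%:~R * g ^ (n - 1) * P^-1.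
Proof. by rewrite (deriv_expz n DM g0) Dg. Qed.

Lemma D_intM (j : int) f : D (j%:~R * f) = j%:~R * D f.
Proof. by rewrite !mulrzl (morph_mulrz _ _ DD). Qed.

Lemma D_inv : D P^-1 = - P^-1 ^+ 2 * D P.
Proof.
have := deriv_expz (-1) DM P0; rewrite exprN1 => ->.
by rewrite (_ : -1 - 1 = - 2%:Z) // -exprz_inv mulN1r mulNr.
Qed.

Lemma third_deriv (m n : int) :
  D (D (D (g ^ m * P))) * (g ^ n * P) =
  (m * (m - 1) * (m - 2))%:~R * (g ^ (m + n - 3) * P^-1)
  + m%:~R * (g ^ (m + n - 1) * (2%:R * D (D P) - P^-1 * D P ^+ 2))
  + g ^ (m + n) * (D (D (D P)) * P).
Proof.
have E1 : D (g ^ m * P) = m%:~R * g ^ (m - 1) + g ^ m * D P.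
  by rewrite DM D_expz mulfVK.
have E2 : D (D (g ^ m * P)) = m%:~R * ((m - 1)%:~R * (g ^ (m - 2) * P^-1))
   + m%:~R * (g ^ (m - 1) * (P^-1 * D P)) + g ^ m * D (D P).
  rewrite E1 DD D_intM DM !D_expz (_ : m - 1 - 1 = m - 2); last by lia.
  ring.
have E3 : D (D (D (g ^ m * P))) =
   m%:~R * (m - 1)%:~R * (m - 2)%:~R * g ^ (m - 3) * P^-1 ^+ 2 +
   m%:~R * g ^ (m - 1) * (2%:R * D (D P) * P^-1 - P^-1 ^+ 2 * D P ^+ 2) + g ^ m * D (D (D P)).
  rewrite E2 !DD !D_intM !DM !D_expz D_inv.
  rewrite (_ : m - 2 - 1 = m - 3); last by lia.
  rewrite (_ : m - 1 - 1 = m - 2); last by lia.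
  ring.
rewrite E3 (_ : m + n - 3 = (m - 3) + n); last by lia.
rewrite (_ : m + n - 1 = (m - 1) + n); last by lia.
rewrite (expfzDr (m - 3) n g0) (expfzDr (m - 1) n g0) (expfzDr m n g0) !intrM; field.
exact: P0.
Qed.

Lemma deriv_schwarz : 2%:R != 0 :> F ->
  D (P * D (D P) - 2%:R^-1 * D P ^+ 2) = D (D (D P)) * P.
Proof.
move=> two; have DN a : D (- a) = - D a.
  by have := D_intM (-1) a; rewrite !mulN1r.
have D2 a : D (2%:R^-1 * a) = 2%:R^-1 * D a.
  apply: (mulfI two); have := D_intM 2 (2%:R^-1 * a).
  by rewrite !mulrA mulfV // !mul1r => ->.
by rewrite DD DN D2 expr2 !DM; field.
Qed.
Lemma half_schwarz (A B C : F) : 2%:R != 0 :> F ->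
  A * P^-1 * (P * C - 2%:R^-1 * B ^+ 2) = 2%:R^-1 * (A * (2%:R * C - P^-1 * B ^+ 2)).
Proof. by move=> two; field; rewrite two P0. Qed.
End DifferentialField.

Lemma lC_natV (F : fieldType) (n : nat) : lC (n%:R^-1 : F) = n%:R^-1.
Proof. by rewrite fmorphV rmorph_nat. Qed.


Lemma cocycle_arith (F : fieldType) (a b X Y : F) :
  (2%:R : F) != 0 -> (12%:R : F) != 0 -> (24%:R : F) != 0 ->
  12%:R^-1 * (Y + a * X + - (a + b) * (2%:R^-1 * X)) =
  (a - b) * (24%:R^-1 * X) + 12%:R^-1 * Y.
Proof. by move=> h2 h12 h24; field; rewrite ?h2 ?h12 ?h24. Qed.

Section Coordinate.
Variables (K : fieldType) (p : laurent K).
Hypotheses (ch : char0 K) (p0 : p != 0).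
Notation k := (laurent K).
Notation kk := (laurent k).

(** P(s) = p(z + s). *)
Definition PP : kk := ts p.

(** The coordinate at z in which the vector field p d/dx is constant:
    g(s) is the integral of dx / p(x) from z to z + s. *)
Lemma gg_subproof : ltrunc (fun n : int => (n%:~R : k)^-1 * hdl (n - 1) p^-1).
Proof. by exists 1 => n hn; rewrite hdlN ?mulr0 //; lia. Qed.
Definition gg : kk := Laurent gg_subproof.
Lemma ggE n : gg n = (n%:~R : k)^-1 * hdl (n - 1) p^-1. Proof. by []. Qed.

Lemma gg_dom : ldom gg 1.
Proof. by move=> n hn; rewrite ggE hdlN ?mulr0 //; lia. Qed.
Lemma gg1 : gg 1 = p^-1. Proof. by rewrite ggE subrr hdl0 invr1 mul1r. Qed.
Lemma gg1_neq0 : gg 1 != 0. Proof. by rewrite gg1 invr_eq0. Qed.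
Lemma gg_neq0 : gg != 0.
Proof. by apply: contraNneq gg1_neq0 => ->. Qed.

Let ch' := char0_laurent ch.

Lemma gg_mul n : gg n *~ n = if n == 0 then 0 else hdl (n - 1) p^-1.
Proof.
case: eqP => [->|/eqP n0] //; rewrite ggE -mulrzl mulrA mulfV ?mul1r //.
exact: char0_int.
Qed.

Lemma lderiv_gg : lderiv gg = ts p^-1.
Proof.
apply: laurentP => n; rewrite lcoef_deriv gg_mul tsE addrK.
by case: eqP => // E; rewrite hdlN //; lia.
Qed.

Lemma ts_p_inv : ts p^-1 = PP^-1.
Proof.
have E : ts p^-1 * PP = 1 by rewrite -tsM mulVf // ts1.
have P0 : PP != 0.
  by apply/eqP => P0; move: E; rewrite P0 mulr0 => /eqP; rewrite eq_sym oner_eq0.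
by apply: (mulIf P0); rewrite E mulVf.
Qed.

Lemma PP_neq0 : PP != 0.
Proof.
apply/eqP => P0; have : ts p^-1 * PP = 1 by rewrite -tsM mulVf // ts1.
by rewrite P0 mulr0 => /eqP; rewrite eq_sym oner_eq0.
Qed.

Lemma lderiv_ggE : lderiv gg = PP^-1. Proof. by rewrite lderiv_gg ts_p_inv. Qed.

(** Moving z at fixed z + s only moves the lower end of the integral g. *)
Lemma nabla_gg : nabla gg = - lC p^-1.
Proof.
apply: laurentP => n.
have -> : nabla gg n = lderiv (gg n) - lderiv gg n by [].
have -> : (- lC p^-1 : kk) n = - (if n == 0 then p^-1 else 0) by rewrite -lCE.
rewrite lderiv_gg tsE.
case: (n =P 0) => [->|/eqP n0].
  by rewrite hdl0 gg_dom // lderiv0 sub0r.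
rewrite oppr0; apply/eqP; rewrite subr_eq0; apply/eqP.
have nn := char0_int ch' n0; apply: (mulfI nn).
have lz (f : k) (j : int) : j%:~R * lderiv f = lderiv (j%:~R * f).
  by rewrite !mulrzl (morph_mulrz _ _ (@lderivD K)).
rewrite lz ggE mulrA mulfV // mul1r lderiv_hdl subrK mulrzl //.
Qed.

Lemma lderiv_ggX n : lderiv (gg ^ n) = n%:~R * gg ^ (n - 1) * PP^-1.
Proof. by rewrite (deriv_expz n (@lderivM k) gg_neq0) lderiv_ggE. Qed.
Lemma nabla_ggX n : nabla (gg ^ n) = - (n%:~R * gg ^ (n - 1) * lC p^-1).
Proof. by rewrite (deriv_expz n (@nablaM K) gg_neq0) nabla_gg mulrN. Qed.

Lemma res_lderiv (R : fieldType) (f : laurent R) : res (lderiv f) = 0.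
Proof. by rewrite /res lcoef_deriv addNr mulr0z. Qed.

(** The power g^r has a primitive in the coordinate y = g(s) unless r = -1. *)
Lemma res_gg (r : int) : res (gg ^ r * PP^-1) = (r == -1)%:R.
Proof.
case: eqP => [->|/eqP nr].
  have [h1 h2] := ldomX (-1) gg_dom gg1_neq0.
  rewrite /res lcoefM (@zsum_pt _ _ (-1)).
    by rewrite h2 subrr -ts_p_inv tsE hdl0 gg1 exprN1 invrK mulfV.
  move=> i /eqP i1; case: (ltP i (-1)) => hi; first by rewrite h1 // mul0r.
  by rewrite -ts_p_inv ts_dom ?mulr0 //; lia.
have rn : ((r + 1)%:~R : k) != 0 by apply: char0_int => //; rewrite -subr_eq0 opprK in nr.
apply: (mulfI rn); rewrite mulr0.
have : res (lderiv (gg ^ (r + 1))) = 0 by apply: res_lderiv.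
rewrite lderiv_ggX addrK => <-.
by rewrite -mulrA /res [in RHS]mulrzl lcoef_mulrz mulrzl.
Qed.

(** In the coordinate y = g(s) the cocycle of y^m d/dy and y^n d/dy is the
    standard one, up to a coboundary given by the Schwarzian derivative of the
    coordinate. *)
Lemma cocycle_gg (m n : int) :
  12%:R^-1 * res (lderiv (lderiv (lderiv (gg ^ m * PP))) * (gg ^ n * PP)) =
  (m - n)%:~R * alpha PP (gg ^ (m + n - 1)) +
  (if m + n == 2 then 12%:R^-1 * (m * (m - 1) * (m - 2))%:~R else 0).
Proof.
have g0 := gg_neq0; have P0 := PP_neq0.
pose P' := lderiv PP; pose P'' := lderiv P'; pose P''' := lderiv P''.
have gD i j : gg ^ i * gg ^ j = gg ^ (i + j) by rewrite expfzDr.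
pose Q := 2%:R * P'' - PP^-1 * P' ^+ 2.
have E4 := third_deriv (@lderivD k) (@lderivM k) g0 P0 lderiv_ggE m n.
rewrite -/P' -/P'' -/P''' -/Q in E4.
have two' : (2%:R : kk) != 0 by apply: (char0_laurent ch').
have E5 := deriv_schwarz PP (@lderivD k) (@lderivM k) two'.
rewrite -/P' -/P'' -/P''' in E5.
have resD (f h : kk) : res (f + h) = res f + res h by [].
have resz (j : int) (f : kk) : res (j%:~R * f) = j%:~R * res f.
  by rewrite /res !mulrzl lcoef_mulrz.
have two : (2%:R : k) != 0 by apply: ch'.
(* The term with P''' P is integrated by parts: P''' P is the derivative of P
   P'' - P'^2 / 2. *)
have E6 : res (gg ^ (m + n) * (P''' * PP)) = - (m + n)%:~R * (2%:R^-1 * res (gg ^ (m + n - 1) * Q)).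
  have := res_lderiv (gg ^ (m + n) * (PP * P'' - 2%:R^-1 * P' ^+ 2)).
  rewrite lderivM E5 resD => /eqP; rewrite addrC addr_eq0 => /eqP ->.
  rewrite lderiv_ggX mulNr -mulrA -mulrA resz; congr (- (_ * _)).
  have -> : gg ^ (m + n - 1) * PP^-1 * (PP * P'' - 2%:R^-1 * P' ^+ 2) =
     lC 2%:R^-1 * (gg ^ (m + n - 1) * Q).
    by rewrite lC_natV (half_schwarz P0 _ _ _ two').
  by rewrite /res lcoef_lCM.
set t1 := (m * (m - 1) * (m - 2))%:~R * _ in E4.
set t2 := m%:~R * _ in E4; set t3 := gg ^ (m + n) * _ in E4 E6.
have R1 : res t1 = (m * (m - 1) * (m - 2))%:~R * (m + n == 2)%:R.
  rewrite /t1 (resz _ (gg ^ (m + n - 3) * PP^-1)) res_gg; congr (_ * _%:R).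
  by congr nat_of_bool; apply/eqP/eqP; lia.
have R2 : res t2 = m%:~R * res (gg ^ (m + n - 1) * Q) by exact: resz.
have -> : alpha PP (gg ^ (m + n - 1)) = 24%:R^-1 * res (gg ^ (m + n - 1) * Q).
  by rewrite /alpha -lC_mul rmorph_nat.
rewrite E4 (resD (t1 + t2) t3) (resD t1 t2) R1 R2 E6.
move: (res (gg ^ (m + n - 1) * Q)) => X.
have n12 : (12%:R : k) != 0 by apply: ch'.
have n24 : (24%:R : k) != 0 by apply: ch'.
have -> : (if m + n == 2 then 12%:R^-1 * (m * (m - 1) * (m - 2))%:~R else 0) =
  12%:R^-1 * ((m * (m - 1) * (m - 2))%:~R * (m + n == 2)%:R) :> k.
  by case: eqP => _; rewrite ?mulr1 // !mulr0.
move: (_%:~R * (m + n == 2)%:R) => Y; rewrite intrB intrD.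
move: (m%:~R) (n%:~R) => a b; clear -n12 n24 two; exact: cocycle_arith.
Qed.

End Coordinate.

(** * The induced module and its universal property *)

Section VirmodFacts.
Variables (K : fieldType) (el : K).
Notation V := (virmod el).
Notation vac := (vacuum el).
Implicit Types (x y : vir K) (v w : V).

Lemma virmod_act_linear x : linear (@virmod_act K el x).
Proof. exact: indact_linear. Qed.

Lemma virmod_actD x v w : virmod_act x (v + w) = virmod_act x v + virmod_act x w.
Proof. by have := virmod_act_linear x 1 v w; rewrite !scale1r. Qed.
Lemma virmod_act0 x : virmod_act x (0 : V) = 0.
Proof. by apply: (@addrI _ (virmod_act x 0)); rewrite -virmod_actD !addr0. Qed.
Lemma virmod_actZ x c v : virmod_act x (c *: v) = c *: virmod_act x v.
Proof. by have := virmod_act_linear x c v 0; rewrite virmod_act0 !addr0. Qed.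

Lemma tensDl (u u' : uenv (@vir_br K)) c :
  tens (u + u') c = tens u c + tens u' c :> V.
Proof. by rewrite /tens tclsD; apply/tclsP; constructor. Qed.
Lemma tensZl a (u : uenv (@vir_br K)) c : tens (a *: u) c = a *: (tens u c : V).
Proof. by rewrite /tens; apply: etrans (esym (tclsZ _ _)); apply/tclsP; constructor. Qed.
Lemma tens0l c : tens (0 : uenv (@vir_br K)) c = 0 :> V.
Proof. by rewrite -(scale0r 0) tensZl scale0r. Qed.
Lemma tensZr a (u : uenv (@vir_br K)) c : tens u (a *: c) = a *: (tens u c : V).
Proof. by rewrite /tens; apply: etrans (esym (tclsZ _ _)); apply/tclsP; constructor. Qed.

(** A scalar in the one-dimensional module C can be moved into the enveloping
    algebra. *)
Lemma tens_ind (Q : V -> Prop) : (forall v w, Q v -> Q w -> Q (v + w)) ->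
  (forall c v, Q v -> Q (c *: v)) -> (forall u, Q (tens u 1)) -> forall v, Q v.
Proof.
move=> QD QZ Qt v; rewrite -[v]treprK; move: (repr v) => s.
elim: s => [u c||s IHs t IHt|c s IHs].
- have -> : tcls (TTens u c) = (c : K) *: (tens u 1 : V).
    by rewrite -tensZr /tens; congr (tcls (TTens _ _)); rewrite /GRing.scale /= mulr1.
  exact: QZ.
- have -> : tcls (TZero _ _) = 0 *: (tens 1 1 : V) by rewrite scale0r.
  exact: QZ.
- by rewrite -tclsD; apply: QD.
- by rewrite -tclsZ; apply: QZ.
Qed.

Lemma virmod_actDl x y v : virmod_act (x + y) v = virmod_act x v + virmod_act y v.
Proof.
elim/tens_ind: v => [v w Ev Ew|c v Ev|u].
- by rewrite !virmod_actD Ev Ew addrACA.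
- by rewrite !virmod_actZ Ev scalerDr.
- rewrite /virmod_act !indact_tens (_ : ugen (x + y) = ugen x + ugen y) ?mulrDl ?tensDl //.
  by rewrite raddfD.
Qed.

Lemma virmod_actZl c x v : virmod_act (c *: x) v = c *: virmod_act x v.
Proof.
elim/tens_ind: v => [v w Ev Ew|c' v Ev|u].
- by rewrite !virmod_actD Ev Ew scalerDr.
- by rewrite !virmod_actZ Ev !scalerA mulrC.
- rewrite /virmod_act !indact_tens (_ : ugen (c *: x) = c *: ugen x) ?linearZ //.
  by rewrite -scalerAl tensZl.
Qed.

Lemma virmod_br x y v :
  virmod_act (vir_br x y) v = virmod_act x (virmod_act y v) - virmod_act y (virmod_act x v).
Proof.
elim/tens_ind: v => [v w Ev Ew|c v Ev|u].
- by rewrite !virmod_actD Ev Ew; zlin.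
- by rewrite !virmod_actZ Ev scalerBr.
- rewrite /virmod_act !indact_tens -ugen_br mulrBl -!mulrA -scaleN1r tensDl tensZl.
  by rewrite scaleN1r.
Qed.

Lemma vacuum_act x : vir_nonneg x -> virmod_act x vac = ((x.2 : K) * el) *: vac.
Proof.
move=> hx; rewrite /vacuum /virmod_act indact_tens mulr1 -[ugen x]mul1r.
transitivity (tens 1 (vir_vacact el x 1) : V); first by apply/tclsP; constructor.
by rewrite /vir_vacact tensZr.
Qed.

(** The enveloping algebra is generated by the Virasoro algebra. *)
Lemma virmod_ind0 (Q : V -> Prop) : (forall v w, Q v -> Q w -> Q (v + w)) ->
  (forall c v, Q v -> Q (c *: v)) -> Q vac ->
  (forall x v, Q v -> Q (virmod_act x v)) -> forall v, Q v.
Proof.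
move=> QD QZ Qv Qa; apply: tens_ind => // u.
suff H (s : uexpr (vir K)) : forall u' : uenv (@vir_br K), Q (tens u' 1) -> Q (tens (ucls s * u') 1).
  by elim/uind: u => s; rewrite -[ucls s]mulr1; apply: H.
elim: s => [x|||s IHs t IHt|c s IHs|s IHs t IHt] u' Qu.
- have -> : tens (ucls (UGen x) * u') 1 = virmod_act x (tens u' 1) :> V.
    by rewrite /virmod_act indact_tens.
  exact: Qa.
- rewrite (_ : ucls (UZero _) = 0) ?mul0r //.
  have -> : tens (0 : uenv (@vir_br K)) 1 = 0 *: vac by rewrite tens0l scale0r.
  exact: QZ.
- by rewrite (_ : ucls (UOne _) = 1) ?mul1r.
- by rewrite -uclsD mulrDl tensDl; apply: QD; [apply: IHs|apply: IHt].
- by rewrite -uclsZ -scalerAl tensZl; apply: QZ; apply: IHs.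
- by rewrite -uclsM -mulrA; apply: IHs; apply: IHt.
Qed.

(** By induction on v: moving f past x leaves brackets of large order only. *)
Lemma virmod_tail v : exists M : int, forall f, ldom f M -> virmod_act (f, 0) v = 0.
Proof.
elim/virmod_ind0: v => [v w [M hM] [N hN]|c v [M hM]||[h t] v [M hM]].
- exists (Num.max M N) => f hf; rewrite virmod_actD hM ?hN ?addr0 //;
    by apply: (ldomW hf); rewrite le_max lexx ?orbT.
- by exists M => f hf; rewrite virmod_actZ hM ?scaler0.
- by exists 0 => f hf; rewrite vacuum_act //= mul0r scale0r.
have [s hs] := ldom_ex h.
exists (`|M| + `|s| + 4)%N => f hf; have hd := ldom_deriv hf; have sd := ldom_deriv hs.
have := virmod_br (f, 0) (h, t) v; rewrite (hM f) ?virmod_act0 ?subr0 => [<-|]; last first.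
  by apply: (ldomW hf); lia.
have -> : vir_br (f, 0) (h, t) = (f * lderiv h - h * lderiv f, 0).
  rewrite /vir_br; congr (_, _); rewrite [res _](_ : _ = 0) ?mulr0 //.
  by apply: (ldomM (ldom_deriv (ldom_deriv hd)) hs); lia.
apply: hM; apply: ldomD; [|apply: ldomN].
  by apply: (ldomW (ldomM hf sd)); lia.
by apply: (ldomW (ldomM hs hd)); lia.
Qed.

Definition om (n : int) v : V := virmod_act (- lmono n, 0) v.

Lemma virmod_central w : virmod_act (vir_central K) w = el *: w.
Proof.
elim/virmod_ind0: w => [a b Ea Eb|c a Ea||x a Ea].
- by rewrite virmod_actD Ea Eb scalerDr.
- by rewrite virmod_actZ Ea !scalerA mulrC.
- by rewrite vacuum_act /= ?mul1r // => n _; rewrite lcoef0.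
- have := virmod_br (vir_central K) x a; rewrite Ea virmod_actZ.
  have -> : vir_br (vir_central K) x = 0 *: x.
    rewrite scale0r /vir_br /= !lderiv0 !mul0r mulr0 subrr; congr (_, _).
    by rewrite /res lcoef0 mulr0.
  by rewrite virmod_actZl scale0r => /eqP; rewrite eq_sym subr_eq0 => /eqP.
Qed.

(** The vector fields of large order act trivially and c acts as a scalar, so
    each action is a finite combination of modes. *)
Lemma virmod_ind (Q : V -> Prop) : (forall v w, Q v -> Q w -> Q (v + w)) ->
  (forall c v, Q v -> Q (c *: v)) -> Q vac ->
  (forall n v, Q v -> Q (om n v)) -> forall v, Q v.
Proof.
move=> QD QZ Qv Qo; apply: virmod_ind0 => // -[f t] v Qv'.
have -> : (f, t) = (f, 0) + (t : K) *: vir_central K :> vir K.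
  by congr (_, _); rewrite /= ?scaler0 ?addr0 // add0r /GRing.scale /= mulr1.
rewrite virmod_actDl; apply: (QD); last by rewrite virmod_actZl virmod_central; apply: (QZ); apply: (QZ).
elim/laurent_span: f => [f g Qf Qg|c n|].
- have -> : (f + g, 0) = (f, 0) + (g, 0) :> vir K by congr (_, _); rewrite addr0.
  by rewrite virmod_actDl; apply: QD.
- have -> : (c *: lmono n, 0) = (- c) *: (- lmono n, 0) :> vir K.
    by congr (_, _); rewrite /=; [rewrite scaleNr scalerN opprK|rewrite scaler0].
  by rewrite virmod_actZl; apply: QZ; apply: Qo.
- have [M hM] := virmod_tail v; exists M => f hf; rewrite hM //.
  by rewrite -(scale0r vac); apply: QZ.
Qed.
End VirmodFacts.

Section Universal.
Variables (F F' : fieldType) (io : {rmorphism F -> F'}) (H : lmodType F').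
Variables (S : H -> Prop) (a : int -> H -> H) (el : F).
Hypothesis VM : vir_modes io S a el.
Notation act := (vact io a el).

Fixpoint ueval (s : uexpr (vir F)) (b : H) : H :=
  match s with
  | UGen x => act x b
  | UZero => 0
  | UOne => b
  | UAdd s t => ueval s b + ueval t b
  | UScale c s => io c *: ueval s b
  | UMul s t => ueval s (ueval t b)
  end.

Lemma ueval_S s b : S b -> S (ueval s b).
Proof.
move=> Sb; elim: s b Sb => [x|||s IHs t IHt|c s IHs|s IHs t IHt] b Sb //=.
- exact: (vact_S VM).
- exact: (vm_0 VM).
- by apply: (vm_D VM); [apply: IHs|apply: IHt].
- by apply: (vm_Z VM); apply: IHs.
- by apply: IHs; apply: IHt.
Qed.

Lemma uevalD s b c : S b -> S c -> ueval s (b + c) = ueval s b + ueval s c.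
Proof.
move=> Sb Sc; elim: s b c Sb Sc => [x|||s IHs t IHt|k s IHs|s IHs t IHt] b c Sb Sc //=.
- exact: (vact_addr VM).
- by rewrite addr0.
- by rewrite IHs // IHt // addrACA.
- by rewrite IHs // scalerDr.
- by rewrite IHt // IHs //; apply: ueval_S.
Qed.

Lemma uevalZ s r b : S b -> ueval s (r *: b) = r *: ueval s b.
Proof.
move=> Sb; elim: s b Sb => [x|||s IHs t IHt|k s IHs|s IHs t IHt] b Sb //=.
- exact: (vact_scaler VM).
- by rewrite scaler0.
- by rewrite IHs // IHt // scalerDr.
- by rewrite IHs // !scalerA mulrC.
- by rewrite IHt // IHs //; apply: ueval_S.
Qed.

Lemma ueval_eq s t b : ueq (@vir_br F) s t -> S b -> ueval s b = ueval t b.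
Proof.
move=> E; elim: E b => {s t} /=.
- by [].
- by move=> s t _ IH b Sb; rewrite IH.
- by move=> s t u _ IH1 _ IH2 b Sb; rewrite IH1 // IH2.
- by move=> s s' t t' _ IH1 _ IH2 b Sb; rewrite IH1 // IH2.
- by move=> c s s' _ IH b Sb; rewrite IH.
- by move=> s s' t t' _ IH1 _ IH2 b Sb; rewrite IH2 // IH1 //; apply: ueval_S.
- by move=> *; rewrite addrA.
- by move=> *; rewrite addrC.
- by move=> *; rewrite add0r.
- by move=> *; rewrite scalerA rmorphM.
- by move=> *; rewrite rmorph1 scale1r.
- by move=> *; rewrite rmorph0 scale0r.
- by move=> *; rewrite scalerDr.
- by move=> *; rewrite rmorphD scalerDl.
- by [].
- by [].
- by [].
- by [].
- by move=> s t u b Sb; rewrite uevalD //; apply: ueval_S.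
- by [].
- by move=> c s t b Sb; rewrite uevalZ //; apply: ueval_S.
- by move=> x y b Sb; rewrite (vact_addl VM).
- by move=> c x b Sb; rewrite (vact_scalel VM).
- by move=> x y b Sb; rewrite rmorphN1 scaleN1r (vact_br VM).
Qed.

Variable b0 : H.
Hypotheses (Sb0 : S b0) (vac0 : forall n, 0 <= n -> a n b0 = 0).

Lemma act_b0 x : vir_nonneg x -> act x b0 = io (x.2 * el) *: b0.
Proof.
move=> hx; rewrite /vact /mact zsum0 ?oppr0 ?add0r // => n.
case: (ltP n 0) => hn; first by rewrite hx // rmorph0 scale0r.
by rewrite vac0 // scaler0.
Qed.

Notation texprV := (texpr (@vir_br F) F^o).

Fixpoint teval (s : texprV) : H :=
  match s with
  | TTens u c => io c *: ueval (repr u) b0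
  | TZero => 0
  | TAdd s t => teval s + teval t
  | TScale c s => io c *: teval s
  end.

Lemma ueval_ucls s : ueval (repr (ucls s : uenv (@vir_br F))) b0 = ueval s b0.
Proof. by apply: ueval_eq => //; apply: urepr. Qed.

Lemma teval_eq s t : teq (@vir_nonneg F) (vir_vacact el) s t -> teval s = teval t.
Proof.
elim => {s t} /=.
- by [].
- by move=> s t _ ->.
- by move=> s t u _ -> _ ->.
- by move=> s s' t t' _ -> _ ->.
- by move=> c s s' _ ->.
- by move=> *; rewrite addrA.
- by move=> *; rewrite addrC.
- by move=> *; rewrite add0r.
- by move=> *; rewrite scalerA rmorphM.
- by move=> *; rewrite rmorph1 scale1r.
- by move=> *; rewrite rmorph0 scale0r.
- by move=> *; rewrite scalerDr.
- by move=> *; rewrite rmorphD scalerDl.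
- move=> u v x; rewrite -[u in LHS]ureprK -[v in LHS]ureprK uclsD ueval_ucls /=.
  by rewrite scalerDr.
- by move=> u x y; rewrite rmorphD scalerDl.
- move=> c u x; rewrite -[u in LHS]ureprK uclsZ ueval_ucls /=.
  by rewrite !scalerA mulrC.
- by move=> c u x; rewrite scalerA -rmorphM.
- move=> u b x Bb; rewrite -[u in LHS]ureprK uclsM ueval_ucls /= act_b0 //.
  by rewrite uevalZ // scalerA -rmorphM /vir_vacact; congr (io _ *: _); rewrite mulrC.
Qed.

(** The universal property of the induced module, for a vector [b0]
    annihilated by the modes with n >= 0. *)
Definition vmap (v : virmod el) : H := teval (repr v).

Lemma vmap_tcls s : vmap (tcls s) = teval s.
Proof. by rewrite /vmap; apply: teval_eq; apply: trepr. Qed.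

Lemma vmapD v w : vmap (v + w) = vmap v + vmap w.
Proof. by rewrite -[v]treprK -[w]treprK [_ + _]tclsD !vmap_tcls. Qed.

Lemma vmapZ c v : vmap (c *: v) = io c *: vmap v.
Proof.
rewrite -[v]treprK; move: (repr v) => s; rewrite vmap_tcls.
by rewrite -[io c *: teval s]/(teval (TScale c s)) -vmap_tcls; congr vmap; apply: tclsZ.
Qed.

Lemma vmap_vac : vmap (vacuum el) = b0.
Proof.
rewrite /vacuum /tens vmap_tcls /= rmorph1 scale1r.
exact: (ueval_ucls (UOne _)).
Qed.

Lemma teval_S s : S (teval s).
Proof.
elim: s => [u c||s IHs t IHt|c s IHs] /=.
- by apply: (vm_Z VM); apply: ueval_S.
- exact: (vm_0 VM).
- exact: (vm_D VM).
- exact: (vm_Z VM).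
Qed.

Lemma vmap_S v : S (vmap v). Proof. exact: teval_S. Qed.

Lemma vmap_act x v : vmap (virmod_act x v) = act x (vmap v).
Proof.
rewrite -[v]treprK; move: (repr v) => s; rewrite /virmod_act indactE !vmap_tcls.
elim: s => [u c||s IHs t IHt|c s IHs] /=.
- rewrite -[u in LHS]ureprK uclsM ueval_ucls /= (vact_scaler VM) //.
  exact: ueval_S.
- by have := vact_scaler VM x 0 (vm_0 VM); rewrite !scale0r.
- by rewrite IHs IHt (vact_addr VM) //; apply: teval_S.
- by rewrite IHs (vact_scaler VM) //; apply: teval_S.
Qed.
End Universal.

(** * The Virasoro action in the coordinate of the vector field p d/dx *)

Section LocalModes.
Variables (K : fieldType) (W : lmodType K) (T : int -> W -> W) (el : K).
Hypotheses (TV : vir_ops T el) (ch : char0 K).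
Variables (p : laurent K) (p0 : p != 0).
Notation k := (laurent K).
Notation kk := (laurent k).
Notation H := (W -> lser W).
Notation P := (PP p).
Notation g := (gg p0).
Let ch' := char0_laurent ch.

(** Relative to z, the local fields form a module over K((z)), on which z acts
    as a scalar. *)
Lemma fields_modes :
  vir_modes (idfun : {rmorphism k -> k}) (local TV) (Tm TV) (lC el).
Proof.
split.
- exact: local_0.
- exact: local_add.
- exact: local_scale.
- by move=> n b; apply: local_Tm.
- by move=> n b c [lb _] [lc _]; apply: XopD.
- by move=> n r b [lb _]; apply: XopZ.
- by move=> b hb; have [N hN] := Tm_restr hb; exists N%:Z.
- move=> m n b [lb _]; rewrite Tm_br //; congr (_ + _).
  have E : lC (12^-1 * el) = 12^-1 * lC el :> k.
    by rewrite (rmorphM (@lC K)); congr (_ * _); exact: (@lC_natV K 12).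
  by rewrite /fall3 E.
Qed.
Let VE := fields_modes.

(** The operator of - y^n d/dy, where y = g(s), with the central correction
    due to the change of coordinate. *)
Definition coord_op (n : int) (b : H) : H :=
  vact (idfun : {rmorphism k -> k}) (Tm TV) (lC el) (- (g ^ n * P), alpha P (g ^ n)) b.

Lemma coord_opE n b : local TV b -> coord_op n b =
  zsum (fun j => (g ^ n * P) j *: Tm TV j b) + (alpha P (g ^ n) * lC el) *: b.
Proof.
move=> hb; rewrite /coord_op /vact /= ; congr (_ + _); rewrite /mact -zsumN1.
  by apply: eq_zsum => j; rewrite lcoefN scaleNr opprK.
exact: (mact_fsup VE _ hb).
Qed.

Lemma fields_fsup (f : kk) (b : H) : local TV b -> fsup (fun j => f j *: Tm TV j b).
Proof. by move=> hb; exact: (mact_fsup VE f hb). Qed.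


Lemma gP_dom n : ldom (g ^ n * P) n.
Proof.
have [h _] := ldomX n (gg_dom p0) (gg1_neq0 p0).
by apply: (ldomW (ldomM h (@ts_dom K p))); lia.
Qed.

Lemma gP_bot n : (g ^ n * P) n = p^-1 ^ n * p.
Proof.
have [h1 h2] := ldomX n (gg_dom p0) (gg1_neq0 p0).
rewrite lcoefM (@zsum_pt _ _ n) ?h2 ?gg1 ?subrr ?tsE ?hdl0 //.
move=> i /eqP i1; case: (ltP i n) => hi; first by rewrite h1 // mul0r.
by rewrite ts_dom ?mulr0 //; lia.
Qed.

Lemma alpha_gg0 n : 0 <= n -> alpha P (g ^ n) = 0.
Proof.
move=> n0; have [h _] := ldomX n (gg_dom p0) (gg1_neq0 p0).
rewrite /alpha; set Q := _ - _.
have dQ : ldom Q 0.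
  have PV : P^-1 = ts p^-1 by rewrite -ts_p_inv.
  have d1 : ldom (2 *: lderiv (lderiv P)) 0.
    by apply: ldomZ; rewrite /PP !lderiv_ts; apply: ts_dom.
  have d2 : ldom (P^-1 * lderiv P ^+ 2) 0.
    rewrite PV /PP lderiv_ts //; apply: (@ldomW _ _ (0 + (0 + 0))); last by lia.
    by do 2?[apply: ldomM]; apply: ts_dom.
  exact: ldomD d1 (ldomN d2).
by rewrite /res (ldomM h dQ) ?mulr0 //; lia.
Qed.

(** By [cocycle_gg] the corrected operators satisfy the relations with the
    same central charge. *)
Lemma coord_op_modes : vir_modes (@lC K : {rmorphism K -> k}) (local TV) coord_op el.
Proof.
split.
- exact: local_0.
- exact: local_add.
- exact: local_scale.
- by move=> n b hb; apply: (vact_S VE).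
- by move=> n b c hb hc; apply: (vact_addr VE).
- by move=> n r b hb; apply: (vact_scaler VE).
- move=> b hb; have [M hM] := mact_tail VE hb; exists (`|M| + 1)%N%:Z => n hn.
  rewrite /coord_op /vact /= hM; last by apply: ldomN; apply: (ldomW (@gP_dom n)); lia.
  by rewrite alpha_gg0 ?mul0r ?scale0r ?addr0 //; lia.
move=> m n b hb; rewrite /coord_op -(vact_br VE) //.
have g0 := gg_neq0 p0; have P0 := PP_neq0 p0.
set A := g ^ m * P; set B := g ^ n * P.
have E1 : (- A) * lderiv (- B) - (- B) * lderiv (- A) =
    (m - n)%:~R *: (- (g ^ (m + n - 1) * P)).
  have dA i : lderiv (g ^ i * P) = i%:~R * g ^ (i - 1) + g ^ i * lderiv P.
    rewrite lderivM; congr (_ + _); rewrite (lderiv_ggX ch p0 i); exact: (mulfVK P0).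
  rewrite (lderivN B) (lderivN A) (dA m) (dA n) /A /B.
  have -> : g ^ (m + n - 1) = g ^ m * g ^ (n - 1) by rewrite -expfzDr // addrA.
  have -> : g ^ n = g ^ (n - 1) * g by have := expfzDr (n - 1) 1 g0; rewrite subrK expr1z.
  have -> : g ^ m = g ^ (m - 1) * g by have := expfzDr (m - 1) 1 g0; rewrite subrK expr1z.
  rewrite -lC_mul rmorph_int intrB.
  move: (m%:~R : kk) (n%:~R : kk) (g ^ (m - 1)) (g ^ (n - 1)) (lderiv P) (P) g => a b' c d e f x.
  ring.
have E2 : vir_br (- A, alpha P (g ^ m)) (- B, alpha P (g ^ n)) =
   (m - n)%:~R *: ((- (g ^ (m + n - 1) * P), alpha P (g ^ (m + n - 1))) : vir k)
   + ((0, if m + n == 2 then 12%:R^-1 * (m * (m - 1) * (m - 2))%:~R else 0) : vir k).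
  apply/eqP; rewrite -pair_eqE /=; apply/andP; split; apply/eqP.
    by rewrite E1 addr0.
  rewrite !lderivN mulrNN; exact: cocycle_gg.
rewrite E2 (vact_addl VE) // (vact_scalel VE) // /= scaler_int; congr (_ + _).
rewrite /vact /= -[X in mact _ _ X b](scale0r 0) (mactZl VE) // scale0r add0r.
case: eqP => _; last by rewrite mul0r scale0r.
have E : lC (12^-1 * el) = 12^-1 * lC el :> k.
  by rewrite (rmorphM (@lC K)); congr (_ * _); exact: (@lC_natV K 12).
by rewrite E mulrAC -scalerA scaler_int scalerMzr.
Qed.

End LocalModes.

Section Monomials.
Variables (K : fieldType) (el : K).

Lemma vir_br_mono (m n : int) :
  vir_br (- lmono m, 0) (- lmono n, 0) =
  (m - n)%:~R *: ((- lmono (m + n - 1), 0) : vir K) +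
  (if m + n == 2 then 12^-1 * (m * (m - 1) * (m - 2))%:~R else 0) *: vir_central K.
Proof.
apply/eqP; rewrite -pair_eqE /=; apply/andP; split; apply/eqP.
  rewrite scaler0 addr0 !lderivN !lderiv_mono !mulrNN !lmulZr -!lmonoD.
  have -> : m + (n - 1) = m + n - 1 by lia.
  have -> : n + (m - 1) = m + n - 1 by lia.
  by rewrite -scalerBl scalerN -scaleNr intrB opprB.
rewrite scaler0 add0r !lderivN !lderiv_mono !(lderivZ, lderiv_mono) mulrNN.
rewrite !lmulZl -lmonoD /res !lcoefZ lmonoE.
rewrite (_ : (-1 == m - 1 - 1 - 1 + n) = (m + n == 2)); last by apply/eqP/eqP; lia.
rewrite [RHS]mulr1; case: eqP => _; rewrite ?mulr0 // mulr1 (_ : m - 1 - 1 = m - 2); last by lia.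
by rewrite -!rmorphM mulrA.
Qed.

Lemma om_br (m n : int) (v : virmod el) : om m (om n v) - om n (om m v) =
  (m - n)%:~R *: om (m + n - 1) v +
  (if m + n == 2 then 12^-1 * el * (m * (m - 1) * (m - 2))%:~R else 0) *: v.
Proof.
rewrite /om -virmod_br vir_br_mono virmod_actDl !virmod_actZl; congr (_ + _).
rewrite virmod_central scalerA; congr (_ *: v); case: eqP => _; rewrite ?mul0r //; ring.
Qed.
End Monomials.

(** * The derivation of the fields *)

Section FieldDerivation.
Variables (K : fieldType) (W : lmodType K) (T : int -> W -> W) (el : K).
Hypotheses (TV : vir_ops T el).
Notation k := (laurent K).
Notation H := (W -> lser W).

Definition dF (b : H) : H := fun w => sder (b w).

Lemma dFD b c : dF (b + c) = dF b + dF c.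
Proof. by apply/funext => w; rewrite /dF !fctDE sderD. Qed.
Lemma dFZ (f : k) b : dF (f *: b) = lderiv f *: b + f *: dF b.
Proof. by apply/funext => w; rewrite /dF fctDE !fctZE sder_scale. Qed.
Lemma dFZc (c : K) b : dF (lC c *: b) = lC c *: dF b.
Proof. 
rewrite dFZ (_ : lderiv (lC c) = 0) ?scale0r ?add0r //.
by apply: laurentP => n; rewrite lcoef_deriv lcoef0 lCE; case: eqP => [->|_]; rewrite ?mulr0z ?mul0rz.
Qed.
Lemma dF0 : dF 0 = 0.
Proof. by have := dFZc 0 0; rewrite !rmorph0 !scale0r. Qed.
Lemma dF_lin b : linf b -> linf (dF b).
Proof.
move=> lb c u v; rewrite /dF lb sderD.
by have /(congr1 (fun b => b u)) := dFZc c b; rewrite /dF !fctZE => ->.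
Qed.
Lemma dF_zsum (G : int -> H) : fsup G -> dF (zsum G) = zsum (fun i => dF (G i)).
Proof. exact: (zsum_additive dFD). Qed.

Lemma Lop_sder r m x : sder (Lop TV r m x) = Lop TV r m (sder x) - Lop TV r (m - 1) x *~ m.
Proof.
apply: lserP => c; rewrite scoef_der scoefB scoef_mulrz !LopE.
rewrite !zsum_mulrz; try exact: (Lfsup TV r (m - 1) x c).
2: exact: (Lfsup TV r m x (c + 1)).
rewrite [X in _ - X](zsum_shift _ (-1)) -zsumB; first last.
- have [N hN] := Lfsup TV r (m - 1) x c; exists N.+1 => i hi.
  by rewrite hN ?mul0rz //; lia.
- exact: (Lfsup TV r m (sder x) c).
apply: eq_zsum => l.
rewrite scoef_der (Tmz TV) (_ : c - l + 1 = c + 1 - l); last by lia.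
rewrite (_ : r + (m - 1) - (l + -1) = r + m - l); last by lia.
rewrite (_ : c - (l + -1) = c + 1 - l); last by lia.
have D := zb_diag m l.
set t := T _ _.
rewrite -!mulrzA -mulrzBr sgP; congr (_ *~ _); rewrite mulNr mulNr opprK.
have E : zb (m - 1) (l - 1) * m = l * zb m l by rewrite D mulrC.
rewrite -[sg l * zb (m - 1) _ * m]mulrA E; ring.
Qed.
Lemma Rop_sder r m b : linf b -> dF (Rop T r m b) = Rop T r m (dF b) - Rop T r (m - 1) b *~ m.
Proof.
move=> lb; apply/funext => w; rewrite fctBE fct_mulrz /dF /Rop.
rewrite (zsum_additive (@sderD W)); last by apply: (Rfsup TV); apply: linf0.
rewrite zsum_mulrz; last by apply: (Rfsup TV); apply: linf0.
rewrite -zsumB; first last.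
- have [N hN] := @Rfsup _ _ _ _ TV r (m - 1) b w (linf0 lb); exists N => i hi.
  by rewrite hN ?mul0rz.
- exact: (@Rfsup _ _ _ _ TV r m (dF b) w (linf0 (dF_lin lb))).
apply: eq_zsum => l; rewrite (morph_mulrz _ _ (@sderD W)) sder_scale mulrzDl addrC.
congr (_ + _); rewrite lderiv_mono -lC_mul -scalerA rmorph_int scaler_int.
have D := zb_absorb m l.
rewrite -!mulrzA -mulrNz (_ : m - l - 1 = m - 1 - l); last by lia.
congr (_ *~ _); rewrite sgP.
transitivity (sg m * sg l * ((m - l) * zb m l)); first by ring.
by rewrite D; ring.
Qed.

(** Each half satisfies this as d/dz (x - z)^m = - m (x - z)^(m - 1). *)
Lemma Xop_sder r m b : linf b ->
  dF (Xop TV r m b) = Xop TV r m (dF b) - Xop TV r (m - 1) b *~ m.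
Proof.
move=> lb.
apply/funext => w; have /(congr1 (fun f => f w)) := Rop_sder r m lb.
rewrite fctBE fct_mulrz {1 2}/dF => ER.
rewrite fctBE fct_mulrz {1}/dF /Xop (_ : sder (_ - _) = sder (Lop TV r m (b w)) - sder (Rop T r m b w)).
  rewrite Lop_sder ER /dF; zlin.
have sderN (y : lser W) : sder (- y) = - sder y.
  by have := morph_mulrz y (-1) (@sderD W); rewrite !mulrN1z.
by rewrite sderD sderN.
Qed.

Lemma local_dF b : local TV b -> local TV (dF b).
Proof.
move=> hb; have lb := local_lin hb; have lb' := dF_lin lb; split=> //.
have [J hJ] := localP hb; exists J.+1 => r; rewrite iterDz_Xop // add0r.
have /eqP := Xop_sder r J.+1 lb; rewrite !hJ ?dF0 ?mul0rz ?subr0; try lia.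
by move/eqP.
Qed.


Variables (ch : char0 K) (p : laurent K) (p0 : p != 0).
Notation P := (PP p).
Notation g := (gg p0).

(** Among functions of g and of z + s, moving z at fixed z + s only changes g,
    with derivative - 1/p. *)
Lemma nabla_coef (Y : laurent k) (n j : int) : nabla Y = 0 ->
  p * nabla (g ^ n * Y) j = - ((g ^ (n - 1) * Y) j *~ n).
Proof.
move=> nY; rewrite nablaM nY mulr0 addr0 (nabla_ggX ch p0).
have -> : - (n%:~R * g ^ (n - 1) * lC p^-1) * Y = - (lC p^-1 * ((g ^ (n - 1) * Y) *~ n)).
  rewrite mulNr; congr (- _); rewrite -[(g ^ (n - 1) * Y) *~ n]mulrzl.
  by move: (n%:~R : laurent k) (g ^ _) (lC _) => a b c; ring.
by rewrite lcoefN lcoef_lCM lcoef_mulrz mulrN mulrA divff // mul1r.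
Qed.

Lemma dF_alpha n :
  p * lderiv (alpha P (g ^ n)) = - (alpha P (g ^ (n - 1)) *~ n).
Proof.
rewrite /alpha; set Q := _ - _.
have nQ : nabla Q = 0.
  have nD (X Y : laurent k) : nabla (X + Y) = nabla X + nabla Y.
    by rewrite /nabla dzD lderivD; zlin.
  have nN (X : laurent k) : nabla (- X) = - nabla X.
    by have := morph_mulrz X (-1) nD; rewrite !mulrN1z.
  have PV : P^-1 = ts p^-1 by rewrite ts_p_inv.
  rewrite /Q nD nN scaler_nat mulr2n nD expr2 !nablaM PV /PP !lderiv_ts // !nabla_ts.
  by rewrite !mul0r !mulr0 addr0 mulr0 addr0 subrr.
have E : lderiv (24^-1 * res (g ^ n * Q)) = 24^-1 * nabla (g ^ n * Q) (-1).
  rewrite -(lC_natV K 24) lC_mul lderivZ -lC_mul; congr (_ * _).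
  rewrite /nabla lcoefB dzE (_ : lderiv (g ^ n * Q) (-1) = 0) ?subr0 //.
  exact: res_lderiv.
by rewrite E mulrCA nabla_coef // mulrN -mulrzAr.
Qed.

(** The derivation p d/dz moves the origin of the coordinate y at unit speed,
    so its bracket with y^n d/dy is that of - d/dy. *)
Lemma coord_op_dF n b : local TV b ->
  p *: dF (coord_op TV p0 n b) = coord_op TV p0 n (p *: dF b) - coord_op TV p0 (n - 1) b *~ n.
Proof.
move=> hb; have hd := local_dF hb; have hpd := local_scale p hd.
have lb := local_lin hb; have lb' := local_lin hd.
have fs (f : laurent k) (c : H) : local TV c -> fsup (fun j => f j *: Tm TV j c).
  exact: fields_fsup.
rewrite !coord_opE //; set al := alpha P (g ^ n) * _; set al' := alpha P (g ^ (n - 1)) * _.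
have al_al' : p * lderiv al = - (al' *~ n).
  rewrite /al /al' [alpha _ (g ^ n) * _]mulrC lC_mul lderivZ -lC_mul mulrCA dF_alpha.
  by rewrite mulrN mulrzAr mulrC.
set G := g ^ n * P; set G' := g ^ (n - 1) * P.
have nG j : p * nabla G j = - (G' j *~ n) by apply: nabla_coef; apply: nabla_ts.
have E1 j : dF (G j *: Tm TV j b) = dz G j *: Tm TV j b +
    G j *: Tm TV j (dF b) - (G j *~ j) *: Tm TV (j - 1) b.
  rewrite dFZ -[RHS]addrA; congr (_ + _); rewrite [dF (Tm _ _ _)]Xop_sder // scalerBr.
  by congr (_ - _); rewrite -scalerMzr scalerMzl.
have E2 : zsum (fun j => (G j *~ j) *: Tm TV (j - 1) b) = zsum (fun j => lderiv G j *: Tm TV j b).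
  by rewrite (zsum_shift _ 1); apply: eq_zsum => j; rewrite addrK lcoef_deriv.
have F1 := fs (dz G) b hb; have F2 := fs G (dF b) hd; have F3 := fs (lderiv G) b hb.
have F4 : fsup (fun j => (G j *~ j) *: Tm TV (j - 1) b).
  by have [N hN] := F3; exists N.+1 => i hi; have := hN (i - 1); rewrite lcoef_deriv subrK; apply; lia.
rewrite dFD dF_zsum ?dFZ; last exact: fs.
rewrite (eq_zsum E1) zsumB //; last exact: fsupD.
rewrite zsumD // E2.
have E3 : p *: (zsum (fun j => dz G j *: Tm TV j b) - zsum (fun j => lderiv G j *: Tm TV j b)) =
    - (zsum (fun j => G' j *: Tm TV j b) *~ n).
  rewrite -zsumB // zsum_scale; last by apply: fsupD => //; apply: fsup_map (oppr0 _) F3.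
  rewrite zsum_mulrz -?zsumN1; last exact: fs.
    apply: eq_zsum => j; rewrite -scalerBl scalerA -lcoefB -/(nabla G) nG.
    by rewrite scaleNr scalerMzl.
  by have [N hN] := fs G' b hb; exists N => i hi; rewrite hN ?mul0rz.
have E4 : p *: zsum (fun j => G j *: Tm TV j (dF b)) = zsum (fun j => G j *: Tm TV j (p *: dF b)).
  rewrite zsum_scale; last exact: fs.
  by apply: eq_zsum => j; rewrite [Tm TV j (p *: _)]XopZ // !scalerA mulrC.
rewrite -E4 mulrzDl !scalerDr !scalerA al_al' scaleNr [p * al]mulrC -scalerA.
move: E3; rewrite scalerBr => E3.
rewrite opprD -E3 -scalerMzl !scalerN; zlin.
Qed.


Lemma coord_op_idf n : 0 <= n -> coord_op TV p0 n (@idf K W) = 0.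
Proof.
move=> n0; have hl := idf_local TV; rewrite coord_opE // (alpha_gg0 p0 n0) mul0r scale0r addr0.
apply: zsum0 => j; case: (ltP j n) => jn.
  by rewrite (@gP_dom _ _ p0) ?scale0r.
by rewrite Tm_idf ?scaler0 //; lia.
Qed.

(** The fields attached to the vectors of V. *)
Definition YF (v : virmod el) : H :=
  vmap (@lC K : {rmorphism K -> k}) (coord_op TV p0) (@idf K W) v.
Notation V := (virmod el).

Lemma YF_local v : local TV (YF v).
Proof. by apply: (vmap_S (coord_op_modes TV ch p0)); apply: idf_local. Qed.
Lemma YFD v w : YF (v + w) = YF v + YF w.
Proof. exact: (vmapD (coord_op_modes TV ch p0) (idf_local TV) coord_op_idf). Qed.
Lemma YFZ c v : YF (c *: v) = lC c *: YF v.
Proof. exact: (vmapZ (coord_op_modes TV ch p0) (idf_local TV) coord_op_idf). Qed.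
Lemma YF_vac : YF (vacuum el) = @idf K W.
Proof. exact: (vmap_vac (coord_op_modes TV ch p0) (idf_local TV) coord_op_idf). Qed.
Lemma YF_om n v : YF (om n v) = coord_op TV p0 n (YF v).
Proof.
rewrite /YF (vmap_act (coord_op_modes TV ch p0) (idf_local TV) coord_op_idf).
rewrite /vact /= mul0r rmorph0 scale0r addr0 -[- lmono n]scaleN1r.
rewrite (mactZl (coord_op_modes TV ch p0)); last exact: YF_local.
by rewrite rmorphN1 scaleN1r mact_mono opprK.
Qed.

(** Both sides vanish at the vacuum and have the same brackets with the modes.
    *)
Lemma YF_om0 v : YF (om 0 v) = p *: dF (YF v).
Proof.
elim/virmod_ind: v => [v w Ev Ew|c v Ev||n v Ev].
- by rewrite /om virmod_actD !YFD dFD scalerDr Ev Ew.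
- by rewrite /om virmod_actZ !YFZ dFZc Ev !scalerA mulrC.
- rewrite YF_om YF_vac coord_op_idf // (_ : dF _ = 0) ?scaler0 //.
  apply/funext => w; apply: lserP => n.
  by rewrite /dF scoef_der smonoE fct0E scoef0; case: eqP => [->|_]; rewrite ?mulr0z ?mul0rz.
- have -> : om 0 (om n v) = om n (om 0 v) - (n%:~R : K) *: om (n - 1) v.
    have := om_br 0 n v; rewrite !add0r => /eqP; rewrite subr_eq => /eqP ->.
    rewrite !mul0r mulr0 if_same scale0r addr0 rmorphN scaleNr addrC //.
  rewrite [_ - _]addrC -scaleNr YFD YFZ !(YF_om n) coord_op_dF; last exact: YF_local.
  by rewrite Ev YF_om (rmorphN (@lC K)) rmorph_int scaleNr scaler_int addrC.
Qed.

End FieldDerivation.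

(** * Series in two variables *)

Section Raw.
Variables (K : fieldType) (W : lmodType K).
Notation k := (laurent K).
Implicit Types (A B : int -> int -> W).

Definition z12 A i j : W := A (i - 1) j - A i (j - 1).
(** The shape of a product b(z1) c(z2) w; the powers of z1 - z2, expanded in
    |z1| > |z2|, act on such series. *)
Definition raw A : Prop := (exists N, forall i j, j < N -> A i j = 0) /\
  forall j, exists N, forall i, i < N -> A i j = 0.

Lemma mulz12S q A : mulz12 q.+1 A = z12 (mulz12 q A). Proof. by []. Qed.

Lemma z12D A B : z12 (fun i j => A i j + B i j) = fun i j => z12 A i j + z12 B i j.
Proof. by apply/funext => i; apply/funext => j; rewrite /z12; zlin. Qed.
Lemma mulz12D q A B :
  mulz12 q (fun i j => A i j + B i j) = fun i j => mulz12 q A i j + mulz12 q B i j.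
Proof. by elim: q => // q IH; rewrite mulz12S IH z12D. Qed.

Lemma raw_z12 A : raw A -> raw (z12 A).
Proof.
move=> [[N hN] h]; split.
  by exists N => i j hj; rewrite /z12 !hN ?subr0 //; lia.
move=> j; have [N1 h1] := h j; have [N2 h2] := h (j - 1).
by exists (Num.min N1 N2) => i hi; rewrite /z12 h1 ?h2 ?subr0 //; lia.
Qed.
Lemma raw_mulz12 q A : raw A -> raw (mulz12 q A).
Proof. by elim: q => // q IH /IH; apply: raw_z12. Qed.

Lemma ltrunc2_z12 A : ltrunc2 A -> ltrunc2 (z12 A).
Proof.
move=> [N hN]; exists N => i j hij; rewrite /z12 !hN ?subr0 //; lia.
Qed.
Lemma ltrunc2_mulz12 q A : ltrunc2 A -> ltrunc2 (mulz12 q A).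
Proof. by elim: q => // q IH /IH; apply: ltrunc2_z12. Qed.
Lemma ltrunc2D A B : ltrunc2 A -> ltrunc2 B -> ltrunc2 (fun i j => A i j + B i j).
Proof.
move=> [N hN] [M hM]; exists (Num.min N M) => i j hij.
by rewrite hN ?hM ?addr0 //; lia.
Qed.

(** Multiplication by (z1 - z2)^q, expanded in |z1| > |z2|. *)
Definition zpow (q : int) A i j : W :=
  zsum (fun l => A (i - q + l) (j - l) *~ (sg l * zb q l)).

Lemma zpow_fsup q A i j : raw A -> fsup (fun l => A (i - q + l) (j - l) *~ (sg l * zb q l)).
Proof.
move=> [[N hN] _]; apply: (@fsupP _ _ 0 (j - N)) => l hl.
  by rewrite zbN // mulr0 mulr0z.
by rewrite hN ?mul0rz //; lia.
Qed.
Lemma zpow0 A : zpow 0 A = A.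
Proof.
apply/funext => i; apply/funext => j; rewrite /zpow (@zsum_pt _ _ 0).
  by rewrite zb0 sg0 mulr1z !subr0; congr (A _ _); lia.
by move=> l /negPf l0; rewrite zb0 l0 mulr0 mulr0z.
Qed.
Lemma zpowS q A : raw A -> zpow (q + 1) A = z12 (zpow q A).
Proof.
move=> hA; apply/funext => i; apply/funext => j; rewrite /z12 /zpow.
rewrite [X in _ = _ - X](zsum_shift _ (-1)) -zsumB; first last.
- have [N hN] := zpow_fsup q i (j - 1) hA; exists N.+1 => l hl.
  by apply: hN; lia.
- exact: zpow_fsup.
apply: eq_zsum => l; rewrite zbS mulrDr mulrzDr sgP mulNr mulrNz opprK.
by congr (A _ _ *~ _ + A _ _ *~ _); lia.
Qed.
Lemma mulz12_zpow q r A : raw A -> mulz12 q (zpow r A) = zpow (r + q%:Z) A.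
Proof.
move=> hA; elim: q => [|q IH]; first by rewrite addr0.
rewrite mulz12S IH -zpowS //; congr (zpow _ A); lia.
Qed.
Lemma zpow_nat q A : raw A -> zpow q%:Z A = mulz12 q A.
Proof. by move=> hA; rewrite -[in RHS](zpow0 A) mulz12_zpow // add0r. Qed.

(** The coefficient of s^n z^m in A(z + s, z). *)
Definition tay (n : int) A (m : int) : W := zsum (fun i => A i (m + n - i) *~ zb i n).

Lemma diag_fsup A (F : int -> int) n : ltrunc2 A -> fsup (fun i => A i (n - i) *~ F i).
Proof.
move=> [N hN]; apply: (@fsupP _ _ N (n - N)) => i hi; rewrite hN ?mul0rz //; lia.
Qed.
Lemma tay_neg n A m : n < 0 -> tay n A m = 0.
Proof. by move=> n0; apply: zsum0 => i; rewrite zbN // mulr0z. Qed.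
Lemma tayD n A B m : ltrunc2 A -> ltrunc2 B ->
  tay n (fun i j => A i j + B i j) m = tay n A m + tay n B m.
Proof.
move=> hA hB; rewrite /tay -zsumD; try exact: diag_fsup.
by apply: eq_zsum => i; rewrite mulrzDl.
Qed.
Lemma tay_dom A : ltrunc2 A -> exists N, forall n m, m < N - n -> tay n A m = 0.
Proof.
move=> [N hN]; exists (N + N) => n m hm; apply: zsum0 => i.
by rewrite hN ?mul0rz //; lia.
Qed.
(** At z1 = z + s and z2 = z the factor z1 - z2 is s. *)
Lemma tay_z12 n A m : ltrunc2 A -> tay n (z12 A) m = tay (n - 1) A m.
Proof.
move=> hA; rewrite /tay /z12.
have E i : (A (i - 1) (m + n - i) - A i (m + n - i - 1)) *~ zb i n =
    A (i - 1) (m + (n - 1) - (i - 1)) *~ zb i n - A i (m + (n - 1) - i) *~ zb i n.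
  rewrite mulrzBl; congr (A _ _ *~ _ - A _ _ *~ _); lia.
rewrite (eq_zsum E) zsumB; last exact: diag_fsup; last first.
  have [N hN] := diag_fsup (fun i => zb (i + 1) n) (m + (n - 1)) hA.
  by exists N.+1 => i hi; have := hN (i - 1); rewrite subrK; apply; lia.
rewrite [X in X - _](zsum_shift _ 1) -zsumB; last exact: diag_fsup; last first.
  have [N hN] := diag_fsup (fun i => zb (i + 1) n) (m + (n - 1)) hA.
  by exists N => i hi; rewrite addrK; apply: hN.
apply: eq_zsum => i; rewrite addrK -mulrzBr zbS; congr (_ *~ _); ring.
Qed.
Lemma tay_mulz12 q n A m : ltrunc2 A -> tay n (mulz12 q A) m = tay (n - q%:Z) A m.
Proof.
elim: q n => [|q IH] n hA; first by rewrite subr0.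
rewrite mulz12S tay_z12 ?IH //; last exact: ltrunc2_mulz12.
by congr (tay _ A m); lia.
Qed.

Definition mul2 (f : k) A i j : W := zsum (fun r => f r *: A i (j - r)).
Definition mul1 (f : k) A i j : W := zsum (fun r => f r *: A (i - r) j).

Lemma mul2_fsup (f : k) A i j : raw A -> fsup (fun r => f r *: A i (j - r)).
Proof.
move=> [[N hN] _]; have [s hs] := ldom_ex f; apply: (@fsupP _ _ s (j - N)) => r hr.
  by rewrite hs ?scale0r.
by rewrite hN ?scaler0 //; lia.
Qed.
Lemma mul1_fsup (f : k) A i j : raw A -> fsup (fun r => f r *: A (i - r) j).
Proof.
move=> [_ h]; have [N hN] := h j; have [s hs] := ldom_ex f.
apply: (@fsupP _ _ s (i - N)) => r hr; first by rewrite hs ?scale0r.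
by rewrite hN ?scaler0 //; lia.
Qed.
Lemma ltrunc2_mul2 f A : ltrunc2 A -> ltrunc2 (mul2 f A).
Proof.
move=> [N hN]; have [s hs] := ldom_ex f; exists (Num.min N (N + s)) => i j hij.
apply: zsum0 => r; have [/hs ->|hr] := ltP r s; first by rewrite scale0r.
by rewrite hN ?scaler0 //; lia.
Qed.
Lemma ltrunc2_mul1 f A : ltrunc2 A -> ltrunc2 (mul1 f A).
Proof.
move=> [N hN]; have [s hs] := ldom_ex f; exists (Num.min N (N + s)) => i j hij.
apply: zsum0 => r; have [/hs ->|hr] := ltP r s; first by rewrite scale0r.
by rewrite hN ?scaler0 //; lia.
Qed.
Lemma z12_mul2 f A : raw A -> z12 (mul2 f A) = mul2 f (z12 A).
Proof.
move=> hA; apply/funext => i; apply/funext => j; rewrite /z12 /mul2 -zsumB; try exact: mul2_fsup.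
by apply: eq_zsum => r; rewrite scalerBr; congr (_ *: _ - _ *: A _ _); lia.
Qed.
Lemma z12_mul1 f A : raw A -> z12 (mul1 f A) = mul1 f (z12 A).
Proof.
move=> hA; apply/funext => i; apply/funext => j; rewrite /z12 /mul1 -zsumB; try exact: mul1_fsup.
by apply: eq_zsum => r; rewrite scalerBr; congr (_ *: A _ _ - _ *: _); lia.
Qed.
Lemma mulz12_mul2 q f A : raw A -> mulz12 q (mul2 f A) = mul2 f (mulz12 q A).
Proof. by move=> hA; elim: q => // q IH; rewrite !mulz12S IH z12_mul2 //; apply: raw_mulz12. Qed.
Lemma mulz12_mul1 q f A : raw A -> mulz12 q (mul1 f A) = mul1 f (mulz12 q A).
Proof. by move=> hA; elim: q => // q IH; rewrite !mulz12S IH z12_mul1 //; apply: raw_mulz12. Qed.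

Lemma tay_mul2 f n A m : ltrunc2 A ->
  tay n (mul2 f A) m = zsum (fun r => f r *: tay n A (m - r)).
Proof.
move=> hA; have [s hs] := ldom_ex f; have [N hN] := hA.
pose G i r := (f r *: A i (m + n - i - r)) *~ zb i n.
transitivity (zsum (fun i => zsum (fun r => G i r))).
  apply: eq_zsum => i; rewrite /mul2 zsum_mulrz //.
  apply: (@fsupP _ _ s (m + n - i - N)) => r hr; first by rewrite hs ?scale0r.
  by rewrite hN ?scaler0 //; lia.
rewrite (@zsum_exchange _ _ (`|s| + `|N| + `|m| + `|n| + `|N|)%N) => [|i r hi|i r hi].
- apply: eq_zsum => r; rewrite /tay zsum_scale; last exact: diag_fsup.
  by apply: eq_zsum => i; rewrite /G scalerMzr (_ : m - r + n - i = m + n - i - r) //; lia.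
- rewrite /G; have [/hs ->|hr] := ltP r s; first by rewrite scale0r mul0rz.
  by rewrite hN ?scaler0 ?mul0rz //; lia.
- rewrite /G; have [/hs ->|hr] := ltP r s; first by rewrite scale0r mul0rz.
  by rewrite hN ?scaler0 ?mul0rz //; lia.
Qed.


(** A factor f(z1) becomes f(z + s); for monomials this is Vandermonde's
    identity. *)
Lemma tay_mul1 (f : k) n A m : ltrunc2 A ->
  tay n (mul1 f A) m =
  zsum (fun a => zsum (fun r => hdl a f r *: tay (n - a) A (m - r))).
Proof.
move=> hA; have [N hN] := hA; have [D hD] := tay_dom hA.
have fsI (h : k) i j : fsup (fun r => h r *: A (i - r) j).
  have [s hs] := ldom_ex h; apply: (@fsupP _ _ s (i - N)) => r hr; first by rewrite hs ?scale0r.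
  by rewrite hN ?scaler0 //; lia.
have fsT (h : k) b : fsup (fun r => h r *: tay b A (m - r)).
  have [s hs] := ldom_ex h; apply: (@fsupP _ _ s (m - D + b)) => r hr; first by rewrite hs ?scale0r.
  by rewrite hD ?scaler0 //; lia.
have fsA (h : k) : fsup (fun a => zsum (fun r => hdl a h r *: tay (n - a) A (m - r))).
  apply: (@fsupP _ _ 0 n) => a ha; apply: zsum0 => r.
    by rewrite hdlN // lcoef0 scale0r.
  by rewrite tay_neg ?scaler0 //; lia.
elim/laurent_span: f => [f g Ef Eg|c r|].
- transitivity (tay n (fun i j => mul1 f A i j + mul1 g A i j) m).
    congr (tay n _ m); apply/funext => i; apply/funext => j; rewrite /mul1 -zsumD; try exact: fsI.
    by apply: eq_zsum => r; rewrite lcoefD scalerDl.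
  rewrite tayD; try exact: ltrunc2_mul1; rewrite Ef Eg -zsumD; try exact: fsA.
  apply: eq_zsum => a; rewrite -zsumD; try exact: fsT.
  by apply: eq_zsum => r; rewrite -scalerDl -lcoefD -!tsE -lcoefD -tsD.
- have L i : mul1 (c *: lmono r) A i (m + n - i) = c *: A (i - r) (m + n - i).
    rewrite /mul1 (@zsum_pt _ _ r) ?lcoefZ ?lmonoE ?eqxx ?mulr1 // => j /negPf jr.
    by rewrite lcoefZ lmonoE jr mulr0 scale0r.
  have R a b : hdl a (c *: lmono r) b = if b == r - a then c *~ zb r a else 0.
    rewrite hdlE lcoefZ lmonoE (_ : (b + a == r) = (b == r - a)); last by apply/eqP/eqP; lia.
    by case: eqP => [->|_]; rewrite ?subrK ?mulr1 // mulr0 mul0rz.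
  pose G a i := c *: A i (m + n - r - i) *~ (zb r a * zb i (n - a)).
  transitivity (zsum (fun i => zsum (fun a => G a i))).
    rewrite /tay (zsum_shift _ r); apply: eq_zsum => i; rewrite L addrK -zsum_mulrzr; last exact: zb_fsup.
    rewrite zb_vdm [i + r]addrC; congr (_ *: _ *~ _); congr (A _ _); lia.
  rewrite (@zsum_exchange _ _ (`|N| + `|m| + `|n| + `|r| + `|N|)%N) => [|i a hi|i a ha].
  + apply: eq_zsum => a; rewrite [RHS](@zsum_pt _ _ (r - a)) => [|b /negPf br]; last by rewrite R br scale0r.
    rewrite R eqxx /tay zsum_scale; last exact: diag_fsup.
    apply: eq_zsum => i; rewrite /G (_ : m - (r - a) + (n - a) - i = m + n - r - i); last by lia.
    by rewrite [zb r a * _]mulrC mulrzA -scalerMzl -scalerMzr.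
  + by rewrite /G hN ?scaler0 ?mul0rz //; lia.
  + case: (ltP a 0) => a0; first by rewrite /G zbN // mul0r mulr0z.
    by rewrite /G (@zbN i) ?mulr0 ?mulr0z //; lia.
exists (Num.max (m + n - N - N) (m + n - D) + 1) => f hf; rewrite /tay zsum0 => [|i].
  apply/esym; apply: zsum0 => a; apply: zsum0 => r; rewrite hdlE.
  case: (ltP (r + a) (Num.max (m + n - N - N) (m + n - D) + 1)) => hr.
    by rewrite hf // mul0rz scale0r.
  by rewrite [zsum _]hD ?scaler0 //; lia.
rewrite /mul1 zsum0 ?mul0rz // => r.
case: (ltP r (Num.max (m + n - N - N) (m + n - D) + 1)) => hr; first by rewrite hf ?scale0r.
have [hi|hi] := ltP (i - r) N; first by rewrite hN ?hi ?scaler0.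
by rewrite hN ?scaler0 //; lia.
Qed.
End Raw.

(** * Products of two fields *)

Lemma mulz12_sum (K : fieldType) (W : lmodType K) q (I : Type) (r : seq I) (A : I -> int -> int -> W) :
  mulz12 q (fun i j => \sum_(x <- r) A x i j) = fun i j => \sum_(x <- r) mulz12 q (A x) i j.
Proof.
elim: q => [|q IH]; first by apply/funext => i; apply/funext => j; apply: eq_bigr.
rewrite mulz12S IH; apply/funext => i; apply/funext => j.
by rewrite /z12 -sumrB; apply: eq_bigr.
Qed.
Lemma mulz12_mulz (K : fieldType) (W : lmodType K) q (n : int) (A : int -> int -> W) :
  mulz12 q (fun i j => A i j *~ n) = fun i j => mulz12 q A i j *~ n.
Proof.
elim: q => [|q IH] //; rewrite mulz12S IH; apply/funext => i; apply/funext => j.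
by rewrite /z12 -mulrzBl.
Qed.
Lemma tay_mulz (K : fieldType) (W : lmodType K) n (z : int) (A : int -> int -> W) m : ltrunc2 A ->
  tay n (fun i j => A i j *~ z) m = tay n A m *~ z.
Proof.
move=> hA; rewrite /tay zsum_mulrz; last exact: diag_fsup.
by apply: eq_zsum => i; rewrite -!mulrzA mulrC.
Qed.
Lemma ltrunc2_mulz (K : fieldType) (W : lmodType K) (z : int) (A : int -> int -> W) : ltrunc2 A ->
  ltrunc2 (fun i j => A i j *~ z).
Proof. by move=> [N hN]; exists N => i j hij; rewrite hN // mul0rz. Qed.
Lemma ltrunc2_sum (K : fieldType) (W : lmodType K) (J : nat) (A : 'I_J -> int -> int -> W) :
  (forall x, ltrunc2 (A x)) -> ltrunc2 (fun i j => \sum_(x < J) A x i j).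
Proof.
move=> h; elim: J A h => [|J IH] A h; first by exists 0 => i j _; rewrite big_ord0.
have [N hN] := IH _ (fun x => h (widen_ord (leqnSn J) x)); have [M hM] := h ord_max.
exists (Num.min N M) => i j hij; rewrite big_ord_recr /= hN ?hM ?addr0 //; lia.
Qed.
Lemma tay_sum (K : fieldType) (W : lmodType K) (J : nat) n (A : 'I_J -> int -> int -> W) m :
  (forall x, ltrunc2 (A x)) ->
  tay n (fun i j => \sum_(x < J) A x i j) m = \sum_(x < J) tay n (A x) m.
Proof.
move=> h; rewrite /tay; elim: J A h => [|J IH] A h.
  by rewrite big_ord0; apply: zsum0 => i; rewrite big_ord0 mul0rz.
rewrite big_ord_recr /= -(IH (fun x => A (widen_ord (leqnSn J) x))); last by move=> x; apply: h.
rewrite -zsumD; last exact: diag_fsup.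
  by apply: eq_zsum => i; rewrite big_ord_recr mulrzDl.
by have := diag_fsup (fun i => zb i n) (m + n) (ltrunc2_sum (fun x => h (widen_ord (leqnSn J) x))).
Qed.

Lemma sum_pad (V : zmodType) (f : nat -> V) (J M : nat) : (forall y, (J <= y)%N -> f y = 0) ->
  (J <= M)%N -> \sum_(y < M) f y = \sum_(y < J) f y.
Proof.
move=> hf; elim: M => [|M IH]; first by rewrite leqn0 => /eqP ->.
rewrite leq_eqVlt => /orP[/eqP -> //|]; rewrite ltnS => JM.
by rewrite big_ord_recr /= IH // hf // addr0.
Qed.

Section Products.
Variables (K : fieldType) (W : lmodType K) (T : int -> W -> W) (el : K).
Hypotheses (TV : vir_ops T el).
Notation k := (laurent K).
Notation H := (W -> lser W).
Notation Tm := (Tm TV).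

Definition fprod (b c : H) (w : W) (i j : int) : W := b (c w j) i.

Lemma fprod_raw b c w : linf b -> raw (fprod b c w).
Proof.
move=> lb; split.
  by have [N hN] := sdom_ex (c w); exists N => i j hj; rewrite /fprod hN // linf0.
by move=> j; have [N hN] := sdom_ex (b (c w j)); exists N.
Qed.
Lemma fprod0 b c i j : linf b -> linf c -> fprod b c 0 i j = 0.
Proof. by move=> lb lc; rewrite /fprod linf0 // scoef0 linf0. Qed.

(** The operator T_(m), in the variable z2, on families of series. *)
Definition Tm_fam m (A : W -> int -> int -> W) w i j : W :=
  zsum (fun l => (T (m - l) (A w i (j - l)) - A (T l w) i (j - (m - l)) *~ sg m) *~ (sg l * zb m l)).

Lemma Tm_fam_fsup m (A : W -> int -> int -> W) w i j :
  (exists N, forall i j, j < N -> A w i j = 0) -> (forall i j, A 0 i j = 0) ->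
  fsup (fun l => (T (m - l) (A w i (j - l)) - A (T l w) i (j - (m - l)) *~ sg m) *~ (sg l * zb m l)).
Proof.
move=> [N hN] A0; have [L hL] := vo_restr TV w.
apply: (@fsupP _ _ 0 (Num.max (j - N) L)) => l hl; first by rewrite zbN // mulr0 mulr0z.
by rewrite hN ?(T0 TV) ?hL ?A0 ?mul0rz ?subr0 ?mul0rz //; lia.
Qed.

Lemma z12_Tm_fam m (A : W -> int -> int -> W) w : raw (A w) -> (forall i j, A 0 i j = 0) ->
  z12 (Tm_fam m A w) = Tm_fam m (fun w => z12 (A w)) w.
Proof.
move=> rA A0; apply/funext => i; apply/funext => j; rewrite /z12 /Tm_fam -zsumB; try by apply: Tm_fam_fsup => //; case: rA.
apply: eq_zsum => l; rewrite -mulrzBl; congr (_ *~ _).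
have TB n u v : T n (u - v) = T n u - T n v.
  by rewrite (TD TV) -mulrN1z (Tmz TV) mulrN1z.
rewrite TB mulrzBl.
have -> : j - 1 - l = j - l - 1 by lia.
have -> : j - 1 - (m - l) = j - (m - l) - 1 by lia.
zlin.
Qed.
Lemma mulz12_Tm_fam q m (A : W -> int -> int -> W) w : raw (A w) -> (forall i j, A 0 i j = 0) ->
  mulz12 q (Tm_fam m A w) = Tm_fam m (fun w => mulz12 q (A w)) w.
Proof.
move=> rA A0; elim: q => [|q IH] //; rewrite mulz12S IH z12_Tm_fam //; first exact: raw_mulz12.
have -> : A 0 = fun _ _ => 0 by apply/funext => i; apply/funext => j.
elim: q {IH} => // q IH i j; by rewrite mulz12S /z12 !IH subr0.
Qed.

Lemma Tm_fam_bound (A : W -> int -> int -> W) w : (forall w, ltrunc2 (A w)) -> (forall i j, A 0 i j = 0) ->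
  exists N, (forall i j, (i < N) || (j < N) -> A w i j = 0) /\
    forall l i j, 0 <= l -> (i < N) || (j < N) -> A (T l w) i j = 0.
Proof.
move=> hA A0; have [L hL] := vo_restr TV w.
have H (J : nat) : exists N, forall l i j, 0 <= l -> l < J%:Z -> (i < N) || (j < N) -> A (T l w) i j = 0.
  elim: J => [|J [N hN]]; first by exists 0 => l i j; lia.
  have [M hM] := hA (T J%:Z w); exists (Num.min N M) => l i j l0 lJ hij.
  case: (l =P J%:Z) => [->|nl]; first by apply: hM; lia.
  by apply: hN; lia.
have [N hN] := H `|L|%N; have [M hM] := hA w; exists (Num.min N M); split=> [i j hij|l i j l0 hij].
  by apply: hM; lia.
case: (ltP l `|L|%N%:Z) => hl; first by apply: hN => //; lia.
by rewrite hL ?A0 //; lia.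
Qed.

Lemma ltrunc2_Tm_fam m (A : W -> int -> int -> W) w : (forall w, ltrunc2 (A w)) -> (forall i j, A 0 i j = 0) ->
  ltrunc2 (Tm_fam m A w).
Proof.
move=> hA A0; have [L hL] := vo_restr TV w; have [N [h1 h2]] := Tm_fam_bound w hA A0.
exists (Num.min N (N + Num.min 0 (m - L))) => i j hij; apply: zsum0 => l.
case: (ltP l 0) => l0; first by rewrite zbN // mulr0 mulr0z.
rewrite h1 ?(T0 TV); last by lia.
case: (ltP l L) => hl; last by rewrite hL // A0 mul0rz subr0 mul0rz.
by rewrite h2 // ?mul0rz ?subr0 ?mul0rz //; lia.
Qed.

Lemma Tm_coef m (b : H) w c : linf b -> Tm m b w c =
  zsum (fun l => (T (m - l) (b w (c - l)) - b (T l w) (c - (m - l)) *~ sg m) *~ (sg l * zb m l)).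
Proof.
move=> lb; rewrite /Tm /Xop scoefB LopE /Rop scoef_zsum; last by apply: (Rfsup TV); apply: linf0.
rewrite -zsumB; first last.
- have [N hN] := Rfsup TV 0 m w (linf0 lb); exists N => i hi; by rewrite hN ?scoef0.
- exact: (Lfsup TV).
apply: eq_zsum => l; rewrite scoef_mulrz scoef_monoZ !add0r mulrzBl; congr (_ - _).
by rewrite -mulrzA.
Qed.

(** The operator T_(m) is based at z2, which the substitution z1 = z2 + s does
    not move. *)
Lemma tay_Tm_fam n m (A : W -> int -> int -> W) w c : (forall w, ltrunc2 (A w)) -> (forall i j, A 0 i j = 0) ->
  tay n (Tm_fam m A w) c =
  zsum (fun l => (T (m - l) (tay n (A w) (c - l)) - tay n (A (T l w)) (c - (m - l)) *~ sg m)
    *~ (sg l * zb m l)).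
Proof.
move=> hA A0; have [L hL] := vo_restr TV w; have [N [h1 h2]] := Tm_fam_bound w hA A0.
pose G i l := (T (m - l) (A w i (c + n - i - l)) - A (T l w) i (c + n - i - (m - l)) *~ sg m)
   *~ (sg l * zb m l) *~ zb i n.
have G0 i l : l < 0 \/ (L <= l /\ c + n - N - N < l) \/ i < N \/ (c + n - N < i + l /\ c + n - N - (m - l) < i)
   -> G i l = 0.
  rewrite /G => -[hl|[[hl1 hl2]|[hi|[hi1 hi2]]]].
  - by rewrite [zb m l]zbN // mulr0 mulr0z mul0rz.
  - rewrite hL // A0 mul0rz subr0; case: (ltP i N) => iN; rewrite h1 ?(T0 TV) ?mul0rz //; lia.
  - case: (ltP l 0) => l0; first by rewrite [zb m l]zbN // mulr0 mulr0z mul0rz.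
    by rewrite h1 ?h2 ?(T0 TV) ?mul0rz ?subr0 ?mul0rz //; lia.
  - case: (ltP l 0) => l0; first by rewrite [zb m l]zbN // mulr0 mulr0z mul0rz.
    by rewrite h1 ?h2 ?(T0 TV) ?mul0rz ?subr0 ?mul0rz //; lia.
transitivity (zsum (fun i => zsum (fun l => G i l))).
  apply: eq_zsum => i; rewrite /Tm_fam zsum_mulrz //.
  by apply: Tm_fam_fsup => //; exists N => i' j hj; apply: h1; rewrite hj orbT.
rewrite (@zsum_exchange _ _ (`|N| * 4 + `|c| * 2 + `|n| * 2 + `|L| + `|m|)%N) => [|i l hi|i l hl]; first last.
- by apply: G0; lia.
- case: (ltP l 0) => l0; first by apply: G0; left.
  case: (ltP i N) => iN; first by apply: G0; right; right; left.
  case: (ltP l L) => lL; first by apply: G0; right; right; right; lia.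
  case: (ltP (c + n - N - N) l) => lN; first by apply: G0; right; left.
  by apply: G0; right; right; right; lia.
apply: eq_zsum => l; rewrite /tay.
have fs1 := diag_fsup (fun i => zb i n) (c - l + n) (hA w).
have fs2 := diag_fsup (fun i => zb i n) (c - (m - l) + n) (hA (T l w)).
rewrite (zsum_additive (TD TV (m - l))) // zsum_mulrz // -zsumB; first last.
- by have [M hM] := fs2; exists M => i hi; rewrite hM ?mul0rz.
- by have [M hM] := fs1; exists M => i hi; rewrite hM ?(T0 TV).
rewrite zsum_mulrz; last first.
  have [M1 hM1] := fs1; have [M2 hM2] := fs2; exists (M1 + M2)%N => i hi.
  by rewrite hM1 ?hM2 ?(T0 TV) ?mul0rz ?subr0 ?mul0rz //; lia.
apply: eq_zsum => i; rewrite /G (Tmz TV).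
have -> : c + n - i - l = c - l + n - i by lia.
have -> : c + n - i - (m - l) = c - (m - l) + n - i by lia.
move: (T _ _) (A _ _ _) => x y.
rewrite -!mulrzA ![_ * zb i n]mulrC. zlin.
Qed.

(** Wick's rule: moving T_(m) past the first field costs the commutators of b
    with the modes, whose binomial coefficients combine into powers of z1 -
    z2. *)
Lemma fprod_Tm (J : nat) b c m w i j : local TV b -> linf c -> (forall n, J%:Z <= n -> Tm n b = 0) ->
  fprod b (Tm m c) w i j = Tm_fam m (fprod b c) w i j -
    \sum_(x < J) zpow (m - x%:Z) (fprod (Tm x%:Z b) c w) i j *~ zb m x%:Z.
Proof.
move=> hb lc hJ; have lb := local_lin hb.
have fC : fsup (fun l => (T (m - l) (c w (j - l)) - c (T l w) (j - (m - l)) *~ sg m) *~ (sg l * zb m l)).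
  apply: (@Tm_fam_fsup m (fun w _ j => c w j) w 0 j) => [|_ j']; last by rewrite linf0 ?scoef0.
  by have [N hN] := sdom_ex (c w); exists N.
have bmz u (n : int) : b (u *~ n) = b u *~ n by apply: morph_mulrz; apply: linfD.
have bB u v : b (u - v) = b u - b v.
  by rewrite (linfD lb) -mulrN1z bmz mulrN1z.
have comm r x : b (T r x) = smap (T r) (b x) - \sum_(y < J) (lmono (r - y%:Z) *: Tm y%:Z b x) *~ zb r y%:Z.
  have [J0 [h0 c0]] := commutator hb.
  pose f y := (lmono (r - y%:Z) *: Tm y%:Z b x) *~ zb r y%:Z.
  have f0 y : J%:Z <= y%:Z \/ J0%:Z <= y%:Z -> f y = 0.
    by rewrite /f => -[h|h]; [rewrite hJ|rewrite h0] => //; rewrite fct0E scaler0 mul0rz.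
  have := c0 r x; rewrite -[\sum_(y < J0) _]/(\sum_(y < J0) f y) -[\sum_(y < J) _]/(\sum_(y < J) f y).
  rewrite -(@sum_pad _ f J (J + J0)) ?leq_addr // -?(@sum_pad _ f J0 (J + J0)) ?leq_addl //.
  - by move=> <-; zlin.
  - by move=> y hy; apply: f0; right; lia.
  - by move=> y hy; apply: f0; left; lia.
rewrite /fprod Tm_coef // (zsum_additive (linfD lb)) // scoef_zsum; last first.
  by have [N hN] := fC; exists N => l hl; rewrite hN // linf0.
have E l : b ((T (m - l) (c w (j - l)) - c (T l w) (j - (m - l)) *~ sg m) *~ (sg l * zb m l)) i =
  (T (m - l) (b (c w (j - l)) i) - b (c (T l w) (j - (m - l))) i *~ sg m) *~ (sg l * zb m l)
  - \sum_(x < J) fprod (Tm x%:Z b) c w (i - (m - x%:Z) + l) (j - l) *~ (sg l * zb (m - x%:Z) l) *~ zb m x%:Z.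
  rewrite bmz bB bmz comm scoef_mulrz !scoefB scoef_mulrz (smapE _ _ (T0 TV _)).
  set S := \sum_(y < J) _; set X := T _ _; set Y := b _ _.
  rewrite (_ : X - S i - Y *~ sg m = X - Y *~ sg m - S i); last by zlin.
  rewrite mulrzBl; congr (_ - _); rewrite /S scoef_sum.
  rewrite mulrz_suml; apply: eq_bigr => y _; rewrite scoef_mulrz scoef_monoZ /fprod.
  rewrite (_ : i - (m - y%:Z) + l = i - (m - l - y%:Z)); last by lia.
  rewrite -!mulrzA; congr (_ *~ _).
  transitivity (sg l * (zb m l * zb (m - l) y%:Z)); first by ring.
  by rewrite zb_trinom; ring.
have fZ (x : 'I_J) : fsup (fun l => fprod (Tm x%:Z b) c w (i - (m - x%:Z) + l) (j - l) *~ (sg l * zb (m - x%:Z) l)).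
  by apply: zpow_fsup; apply: fprod_raw; apply: Xop_lin.
have fZ' (x : 'I_J) : fsup (fun l => fprod (Tm x%:Z b) c w (i - (m - x%:Z) + l) (j - l) *~ (sg l * zb (m - x%:Z) l) *~ zb m x%:Z).
  by have [N hN] := fZ x; exists N => l hl; rewrite hN ?mul0rz.
rewrite (eq_zsum E) zsumB.
- congr (_ - _).
  rewrite zsum_sum //; apply: eq_bigr => x _; rewrite -zsum_mulrz //.
- apply: (@Tm_fam_fsup m (fprod b c)) => [|i' j']; last exact: fprod0.
  by case: (fprod_raw c w lb).
- exact: fsup_sum.
Qed.


(** [prodexp b c Th]: some power (z - x)^q b(z) c(x) is a Laurent series in both
    variables and its expansion at z = x + s is s^q times the series [Th] in s. *)
Definition prodexp_at (q : nat) (b c : H) (Th : int -> H) : Prop :=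
  forall w, ltrunc2 (mulz12 q (fprod b c w)) /\
    forall n m, tay n (mulz12 q (fprod b c w)) m = Th (n - q%:Z) w m.
Definition prodexp b c Th : Prop := exists q, prodexp_at q b c Th.

Lemma prodexp_le q q' b c Th : (q <= q')%N -> prodexp_at q b c Th -> prodexp_at q' b c Th.
Proof.
move=> qq' h w; have [h1 h2] := h w.
have -> : mulz12 q' (fprod b c w) = mulz12 (q' - q) (mulz12 q (fprod b c w)).
  by rewrite {1}/mulz12 -{1}(subnK qq') iterD.
split=> [|n m]; first exact: ltrunc2_mulz12.
rewrite tay_mulz12 // h2; congr (Th _ w m); lia.
Qed.

Lemma prodexp_uniq b c Th Th' : prodexp b c Th -> prodexp b c Th' -> Th = Th'.
Proof.
move=> [q h] [q' h']; have := prodexp_le (leq_addr q' q) h.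
have {h'} := prodexp_le (leq_addl q q') h' => h' {}h.
apply/funext => n; apply/funext => w; apply: lserP => m.
have [_ /(_ (n + (q + q')%N%:Z) m)] := h w; have [_ /(_ (n + (q + q')%N%:Z) m)] := h' w.
by rewrite addrK => -> ->.
Qed.

Lemma fprodDr b c c' w : linf b -> fprod b (c + c') w = fun i j => fprod b c w i j + fprod b c' w i j.
Proof.
move=> lb; apply/funext => i; apply/funext => j.
by rewrite /fprod fctDE scoefD (linfD lb) scoefD.
Qed.
Lemma fprodDl b b' c w : fprod (b + b') c w = fun i j => fprod b c w i j + fprod b' c w i j.
Proof. by apply/funext => i; apply/funext => j; rewrite /fprod fctDE scoefD. Qed.

Lemma prodexpDr b c c' Th Th' : linf b -> prodexp b c Th -> prodexp b c' Th' ->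
  prodexp b (c + c') (fun n => Th n + Th' n).
Proof.
move=> lb [q h] [q' h']; exists (q + q')%N => w.
have [h1 h2] := prodexp_le (leq_addr q' q) h w; have [h1' h2'] := prodexp_le (leq_addl q q') h' w.
rewrite fprodDr // mulz12D; split=> [|n m]; first exact: ltrunc2D.
by rewrite tayD // h2 h2' fctDE scoefD.
Qed.
Lemma prodexpDl b b' c Th Th' : prodexp b c Th -> prodexp b' c Th' ->
  prodexp (b + b') c (fun n => Th n + Th' n).
Proof.
move=> [q h] [q' h']; exists (q + q')%N => w.
have [h1 h2] := prodexp_le (leq_addr q' q) h w; have [h1' h2'] := prodexp_le (leq_addl q q') h' w.
rewrite fprodDl // mulz12D; split=> [|n m]; first exact: ltrunc2D.
by rewrite tayD // h2 h2' fctDE scoefD.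
Qed.
Lemma prodexp0r b : linf b -> prodexp b 0 (fun=> 0).
Proof.
move=> lb; exists 0%N => w; have E : mulz12 0 (fprod b 0 w) = fun _ _ => 0.
  by apply/funext => i; apply/funext => j; rewrite /= /fprod fct0E scoef0 linf0 ?scoef0.
rewrite E; split=> [|n m]; first by exists 0.
by rewrite fct0E scoef0; apply: zsum0 => i; rewrite mul0rz.
Qed.
Lemma prodexp0l c : prodexp 0 c (fun=> 0).
Proof.
exists 0%N => w; have E : mulz12 0 (fprod 0 c w) = fun _ _ => 0.
  by apply/funext => i; apply/funext => j; rewrite /= /fprod fct0E scoef0.
rewrite E; split=> [|n m]; first by exists 0.
by rewrite fct0E scoef0; apply: zsum0 => i; rewrite mul0rz.
Qed.

Lemma prodexpZr (f : k) b c Th : linf b -> prodexp b c Th -> prodexp b (f *: c) (fun n => f *: Th n).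
Proof.
move=> lb [q h]; exists q => w; have [h1 h2] := h w.
have -> : fprod b (f *: c) w = mul2 f (fprod b c w).
  apply/funext => i; apply/funext => j; rewrite /fprod fctZE scoefZ.
  rewrite (zsum_additive (linfD lb)); last exact: sscale_fsup.
  rewrite scoef_zsum; last by apply: fsup_map (linf0 lb) _; apply: sscale_fsup.
  by apply: eq_zsum => r; rewrite linfZ // scoef_lCZ.
rewrite mulz12_mul2; last exact: fprod_raw.
split=> [|n m]; first exact: ltrunc2_mul2.
by rewrite tay_mul2 // fctZE scoefZ; apply: eq_zsum => r; rewrite h2.
Qed.

Lemma prodexpZl (f : k) b c Th : linf b -> prodexp b c Th ->
  prodexp (f *: b) c (fun n => zsum (fun a => hdl a f *: Th (n - a))).
Proof.
move=> lb [q h]; exists q => w; have [h1 h2] := h w.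
have -> : fprod (f *: b) c w = mul1 f (fprod b c w).
  by apply/funext => i; apply/funext => j; rewrite /fprod fctZE scoefZ.
rewrite mulz12_mul1; last exact: fprod_raw.
split=> [|n m]; first exact: ltrunc2_mul1.
rewrite tay_mul1 //.
have Th0 r : r < - q%:Z -> Th r = 0.
  move=> hr; apply/funext => w'; apply: lserP => m'; have [_ h2'] := h w'.
  by have := h2' (r + q%:Z) m'; rewrite addrK tay_neg ?scoef0 //; lia.
have fsa : fsup (fun a => hdl a f *: Th (n - q%:Z - a)).
  apply: (@fsupP _ _ 0 n) => a ha; first by rewrite hdlN // scale0r.
  by rewrite Th0 ?scaler0 //; lia.
have -> : zsum (fun a => hdl a f *: Th (n - q%:Z - a)) w = zsum (fun a => hdl a f *: Th (n - q%:Z - a) w).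
  by rewrite fct_zsum.
rewrite scoef_zsum; last by have [N hN] := fsa; exists N => a ha; rewrite -fctZE hN.
apply: eq_zsum => a; rewrite scoefZ; apply: eq_zsum => r.
by rewrite h2 addrAC.
Qed.

(** Wick's rule multiplied by a large power of z1 - z2, so that each factor
    (z1 - z2)^(m - x) becomes s^(m - x). *)
Lemma prodexp_Tm (J : nat) b c m Th (Th_ : nat -> int -> H) : local TV b -> linf c ->
  (forall n, J%:Z <= n -> Tm n b = 0) ->
  (forall n, linf (Th n)) ->
  prodexp b c Th -> (forall x, (x < J)%N -> prodexp (Tm x%:Z b) c (Th_ x)) ->
  prodexp b (Tm m c) (fun n => Tm m (Th n) - \sum_(x < J) Th_ x (n - (m - x%:Z)) *~ zb m x%:Z).
Proof.
move=> hb lc hJ lTh [q0 h0] hx; have lb := local_lin hb.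
have [Q hQ] : exists Q : nat, forall x : nat, (x < J)%N -> exists2 r : nat, (r <= Q)%N & prodexp_at r (Tm x%:Z b) c (Th_ x).
  elim: {-2}J (leqnn J) => [|J' IH] JJ; first by exists 0%N.
  have [Q hQ] := IH (ltnW JJ); have [r hr] := hx J' JJ; exists (Q + r)%N => x.
  rewrite ltnS leq_eqVlt => /orP[/eqP ->|xJ]; first by exists r => //; rewrite leq_addl.
  by have [r' r'Q hr'] := hQ x xJ; exists r' => //; rewrite (leq_trans r'Q) ?leq_addr.
(* A common exponent for which every (z1 - z2)^(m - x + q) is a polynomial and
   regularizes the product with T_(x) b. *)
pose q := (q0 + Q + `|m| + J)%N; exists q => w.
have rA w' : raw (fprod b c w') by apply: fprod_raw.
have A0 i j : fprod b c 0 i j = 0 by apply: fprod0.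
have qb : (q0 <= q)%N by rewrite /q; lia.
have h0' := prodexp_le qb h0.
pose r (x : 'I_J) := `|(m - x%:Z + q%:Z)%R|%N.
have rE (x : 'I_J) : (r x)%:Z = m - x%:Z + q%:Z by rewrite /r /q; have := ltn_ord x; lia.
have hx' (x : 'I_J) : prodexp_at (r x) (Tm x%:Z b) c (Th_ x).
  have [r' r'Q hr'] := hQ x (ltn_ord x); apply: prodexp_le hr'.
  by have := rE x; rewrite /q; have := ltn_ord x; lia.
have E : mulz12 q (fprod b (Tm m c) w) = fun i j =>
    Tm_fam m (fun w => mulz12 q (fprod b c w)) w i j +
    \sum_(x < J) mulz12 (r x) (fprod (Tm x%:Z b) c w) i j *~ (- zb m x%:Z).
  have -> : fprod b (Tm m c) w = fun i j => Tm_fam m (fprod b c) w i j +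
      \sum_(x < J) zpow (m - x%:Z) (fprod (Tm x%:Z b) c w) i j *~ (- zb m x%:Z).
    apply/funext => i; apply/funext => j; rewrite (fprod_Tm m w i j hb lc hJ) -sumrN; congr (_ + _).
    by apply: eq_bigr => x _; rewrite mulrNz.
  rewrite mulz12D mulz12_Tm_fam //; apply/funext => i; apply/funext => j; congr (_ + _).
  rewrite mulz12_sum; apply: eq_bigr => x _.
  rewrite mulz12_mulz mulz12_zpow; last by apply: fprod_raw; apply: Xop_lin.
  by rewrite -rE zpow_nat //; apply: fprod_raw; apply: Xop_lin.
have lA w' : ltrunc2 (mulz12 q (fprod b c w')) by have [] := h0' w'.
have lx (x : 'I_J) : ltrunc2 (mulz12 (r x) (fprod (Tm x%:Z b) c w)) by have [] := hx' x w.
have q00 : forall i j, mulz12 q (fprod b c 0) i j = 0.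
  have -> : fprod b c 0 = fun _ _ => 0 by apply/funext => i; apply/funext => j.
  elim: (q) => // q' IH i j; by rewrite mulz12S /z12 !IH subr0.
have lTm := ltrunc2_Tm_fam m w lA q00.
have lS : ltrunc2 (fun i j => \sum_(x < J) mulz12 (r x) (fprod (Tm x%:Z b) c w) i j *~ (- zb m x%:Z)).
  by apply: ltrunc2_sum => x; apply: ltrunc2_mulz.
rewrite E; split=> [|n c']; first exact: ltrunc2D.
rewrite tayD // tay_Tm_fam // tay_sum; last by move=> x; apply: ltrunc2_mulz.
rewrite fctBE scoefB Tm_coef // fct_sum scoef_sum -sumrN; congr (_ + _).
  by apply: eq_zsum => l; rewrite !(proj2 (h0' _)).
apply: eq_bigr => x _; rewrite tay_mulz // (proj2 (hx' x w)) fct_mulrz scoef_mulrz mulrNz.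
by congr (- (Th_ _ _ w _ *~ _)); rewrite rE; lia.
Qed.
End Products.

(** * The action of vector fields on products of fields *)

Section VectorFieldProducts.
Variables (K : fieldType) (W : lmodType K) (T : int -> W -> W) (el : K).
Hypotheses (TV : vir_ops T el) (ch : char0 K).
Notation k := (laurent K).
Notation kk := (laurent k).
Notation H := (W -> lser W).
Notation Tm := (Tm TV).

Lemma prodexp_dom b c (Th : int -> H) : prodexp b c Th -> ltrunc Th.
Proof.
move=> [q h]; exists (- q%:Z) => r hr; apply/funext => w; apply: lserP => m.
by have [_ /(_ (r + q%:Z) m)] := h w; rewrite addrK tay_neg ?scoef0 //; lia.
Qed.

Lemma prodexp_lser b c (Th : int -> H) : prodexp b c Th -> exists L : lser H, Th = L.
Proof.
move=> h; exists (mks Th); apply/funext => n; rewrite mksE //.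
exact: prodexp_dom h.
Qed.

Lemma prodexp_eq b c (Th Th' : int -> H) : prodexp b c Th -> Th =1 Th' -> prodexp b c Th'.
Proof. by move=> h /funext <-. Qed.

Lemma prodexp_sum b (n : nat) (F : 'I_n -> H) (G : 'I_n -> int -> H) : linf b ->
  (forall x, prodexp b (F x) (G x)) ->
  prodexp b (\sum_(x < n) F x) (fun N => \sum_(x < n) G x N).
Proof.
move=> lb; elim: n F G => [|n IH] F G h.
  rewrite big_ord0; apply: prodexp_eq (prodexp0r lb) _ => N; by rewrite big_ord0.
rewrite big_ord_recr /=.
apply: prodexp_eq (prodexpDr lb (IH (fun x => F (widen_ord (leqnSn n) x)) _ _) (h ord_max)) _.
  by move=> x; apply: h.
by move=> N; rewrite big_ord_recr.
Qed.
Lemma prodexp_suml c (n : nat) (F : 'I_n -> H) (G : 'I_n -> int -> H) :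
  (forall x, prodexp (F x) c (G x)) ->
  prodexp (\sum_(x < n) F x) c (fun N => \sum_(x < n) G x N).
Proof.
elim: n F G => [|n IH] F G h.
  rewrite big_ord0; apply: prodexp_eq (@prodexp0l _ _ c) _ => N; by rewrite big_ord0.
rewrite big_ord_recr /=.
apply: prodexp_eq (prodexpDl (IH (fun x => F (widen_ord (leqnSn n) x)) _ _) (h ord_max)) _.
  by move=> x; apply: h.
by move=> N; rewrite big_ord_recr.
Qed.

Lemma prodexp_zsum b (F : int -> H) (G : int -> int -> H) : linf b -> fsup F ->
  (forall j, prodexp b (F j) (G j)) ->
  fsup G /\ prodexp b (zsum F) (fun N => zsum (fun j => G j N)).
Proof.
move=> lb [N hN] h.
have G0 j : F j = 0 -> G j = 0.
  by move=> Fj; have := h j; rewrite Fj => hj; rewrite (prodexp_uniq hj (prodexp0r lb)).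
have hG j : (N < `|j|)%N -> G j = 0 by move=> /hN; apply: G0.
split; first by exists N.
rewrite (zsumN hN); apply: prodexp_eq (prodexp_sum lb (fun x => h _)) _ => n.
by rewrite (@zsumN _ (fun j => G j n) N) // => j /hG ->.
Qed.

(** Summed with the coefficients of the vector field G d/ds, the powers s^(j -
    x) weighted by (j choose x) form the divided derivatives of G. *)
Lemma prodexp_vf (J : nat) b c (G : kk) (a : k) (L : lser H) (L_ : nat -> lser H) :
  local TV b -> local TV c -> (forall n, J%:Z <= n -> Tm n b = 0) ->
  (forall n, local TV (L n)) ->
  prodexp b c L -> (forall x, (x < J)%N -> prodexp (Tm x%:Z b) c (L_ x)) ->
  prodexp b (zsum (fun j => G j *: Tm j c) + a *: c)
    (fun N => (zsum (fun j => G j *: Tm j (L N)) + a *: L N)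
       - \sum_(x < J) (hdl x%:Z G *: L_ x) N).
Proof.
move=> hb hc hJ lL hL hx; have lb := local_lin hb; have lc := local_lin hc.
pose Ps j N := G j *: (Tm j (L N) - \sum_(x < J) L_ x (N - (j - x%:Z)) *~ zb j x%:Z).
have hP j : prodexp b (G j *: Tm j c) (Ps j).
  apply: prodexpZr => //.
  exact: (@prodexp_Tm _ _ _ _ TV J b c j L (fun x => L_ x) hb lc hJ (fun n => local_lin (lL n)) hL hx).
have [_ hZ] := prodexp_zsum lb (fields_fsup G hc) hP.
apply: prodexp_eq (prodexpDr lb hZ (prodexpZr a lb hL)) _ => N.
rewrite -[RHS]addrA [X in _ = _ + X]addrC [RHS]addrA; congr (_ + _).
pose Q (x : 'I_J) j : H := (G j *~ zb j x%:Z) *: L_ x (N - (j - x%:Z)).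
have fQ x : fsup (Q x).
  have [s hs] := ldom_ex G; have [t ht] := sdom_ex (L_ x).
  apply: (@fsupP _ _ s (N - t + x%:Z)) => j hj; first by rewrite /Q hs // mul0rz scale0r.
  by rewrite /Q ht ?scaler0 //; lia.
have E j : Ps j N = G j *: Tm j (L N) - \sum_(x < J) Q x j.
  rewrite /Ps scalerBr scaler_sumr; congr (_ - _); apply: eq_bigr => x _.
  by rewrite /Q -scalerMzr scalerMzl.
rewrite (eq_zsum E) zsumB; [|exact: fields_fsup|exact: fsup_sum]; congr (_ - _).
rewrite zsum_sum //; apply: eq_bigr => x _; rewrite scoefZ (zsum_shift _ x%:Z).
by apply: eq_zsum => j; rewrite /Q hdlE addrK.
Qed.

Variables (p : laurent K) (p0 : p != 0).
Notation P := (PP p).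
Notation g := (gg p0).
Notation coord_op := (coord_op TV p0).

Lemma ts_0 : ts (0 : k) = 0.
Proof. by apply: (@addrI _ (ts 0)); rewrite -tsD !addr0. Qed.

(** Taylor expansion, in the coordinate y = g(s), of the vector fields y^m
    d/dy. By induction on i, as both sides satisfy the recursion obtained by
    differentiating in s. *)
Lemma taylor_gP (m i : int) : 0 <= i ->
  hdl i (g ^ m * P) = zsum (fun j => (ts ((g ^ j * P) i) * g ^ (m - j)) *~ (zb m j)).
Proof.
case: i => // i _; elim: i => [|i IH] in m *.
  rewrite hdl0 (@zsum_pt _ _ 0) => [|j /eqP j0].
    by rewrite zb0l mulr1z subr0 expr0z mul1r tsE hdl0 mulrC.
  case: (ltP j 0) => hj; first by rewrite zbN // mulr0z.
  by rewrite (@gP_dom _ _ p0 j) ?ts_0 ?mul0r ?mul0rz //; lia.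
pose c j i := (g ^ j * P) i.
have c0 j i' : i' < j -> ts (c j i') = 0 by move=> hj; rewrite /c (@gP_dom _ _ p0 j) ?ts_0.
have i1 : (i.+1%:Z)%:~R != 0 :> kk by apply: char0_int => //; apply: char0_laurent; apply: char0_laurent.
apply: (mulIf i1); rewrite !mulrzr.
rewrite (_ : i.+1%:Z = i%:Z + 1) -?lderiv_hdl; last by lia.
have fA (m' : int) i' : fsup (fun j => (ts (c j i') * g ^ (m' - j)) *~ zb m' j).
  apply: (@fsupP _ _ 0 i') => j hj; first by rewrite zbN ?mulr0z.
  by rewrite c0 // mul0r mul0rz.
rewrite IH (lderiv_zsum (fA m i%:Z)) [RHS](zsum_mulrz (i%:Z + 1) (fA m (i%:Z + 1))).
(* Coefficients of functions of z + s are divided derivatives in z, except for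
   the dependence of g on z. *)
have nc j : c j (i%:Z + 1) *~ (i%:Z + 1) = lderiv (c j i) + p^-1 * c (j - 1) i *~ j.
  have := nabla_coef ch p0 j i (nabla_ts p); rewrite -/P /nabla lcoefB dzE lcoef_deriv -/(c j i) => E.
  have E' : lderiv (c j i) - c j (i%:Z + 1) *~ (i%:Z + 1) = - (p^-1 * c (j - 1) i *~ j).
    by apply: (mulfI p0); rewrite E mulrN -mulrzAr mulrA divff // mul1r.
  by apply/eqP; rewrite -subr_eq0 -oppr_eq0 !opprD opprK -E'; apply/eqP; zlin.
have tsz (f : k) (z : int) : ts (f *~ z) = ts f *~ z by apply: morph_mulrz; apply: tsD.
pose U j := (lderiv (ts (c j i)) * g ^ (m - j)) *~ zb m j.
pose V j := (ts (c j i) * (P^-1 * g ^ (m - j - 1))) *~ ((m - j) * zb m j).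
have fU : fsup U.
  apply: (@fsupP _ _ 0 i) => j hj; first by rewrite /U zbN ?mulr0z.
  by rewrite /U c0 // lderiv0 mul0r mul0rz.
have fV : fsup V.
  apply: (@fsupP _ _ 0 i) => j hj; first by rewrite /V zbN ?mulr0 ?mulr0z.
  by rewrite /V c0 // mul0r mul0rz.
transitivity (zsum U + zsum V).
  rewrite -zsumD //; apply: eq_zsum => j.
  rewrite (morph_mulrz _ _ (@lderivD k)) lderivM (lderiv_ggX ch p0) /U /V mulrzDl; congr (_ + _).
  rewrite mulrzA (_ : ts (c j i) * (P^-1 * _) *~ (m - j) = ts (c j i) * ((m - j)%:~R * g ^ (m - j - 1) / P)) //.
  rewrite -[LHS]mulrzl.
  by move: ((m - j)%:~R : kk) (ts _) (P^-1) (g ^ _) => a b d e; ring.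
have E j : (ts (c j (i%:Z + 1)) * g ^ (m - j)) *~ zb m j *~ (i%:Z + 1) = U j + V (j - 1).
  rewrite -mulrzA [zb m j * _]mulrC mulrzA.
  rewrite (_ : ts (c j (i%:Z + 1)) * g ^ (m - j) *~ (i%:Z + 1) =
    ts (c j (i%:Z + 1) *~ (i%:Z + 1)) * g ^ (m - j)); last by rewrite tsz mulrzAl.
  rewrite nc tsD tsz tsM (ts_p_inv p0) mulrDl mulrzDl -(lderiv_ts (c j i)).
  congr (_ + _); rewrite /V.
  have -> : m - (j - 1) - 1 = m - j by lia.
  have -> : (m - (j - 1)) * zb m (j - 1) = j * zb m j by rewrite zb_absorb zb_diag.
  rewrite mulrzA (_ : ts (c (j - 1) i) * (P^-1 * _) *~ j = P^-1 * ts (c (j - 1) i) *~ j * g ^ (m - j)) //.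
  rewrite -[LHS]mulrzl -[_ * _ *~ j]mulrzl.
  by move: (j%:~R : kk) (ts _) (P^-1) (g ^ _) => a b d e; ring.
have ES : zsum (fun j => V (j - 1)) = zsum V.
  by rewrite (zsum_shift _ 1); apply: eq_zsum => j; rewrite addrK.
rewrite (eq_zsum E) zsumD // ?ES //.
by have [N hN] := fV; exists N.+1 => j hj; apply: hN; lia.
Qed.
End VectorFieldProducts.

(** * Change of the formal variable *)

Section Substitution.
Variables (F : fieldType) (M : lmodType F).
Implicit Types (X : lser M) (h : int -> laurent F).

(** With h l = g^l this is the substitution of g for the variable; derivatives
    and multiples of the powers of g occur as well. *)
Definition comb h X : lser M := mks (fun N => zsum (fun l => h l N *: X l)).

(** The orders grow with l, so that each coefficient of [comb h X] is a finite
    sum. *)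
Definition ladder h (c : int) : Prop := forall l, ldom (h l) (l + c).

Lemma comb_fsup h c X N : ladder h c -> fsup (fun l => h l N *: X l).
Proof.
move=> hh; have [s hs] := sdom_ex X; apply: (@fsupP _ _ s (N - c)) => l hl.
  by rewrite hs // scaler0.
by rewrite hh ?scale0r //; lia.
Qed.
Lemma combE h c X N : ladder h c -> comb h X N = zsum (fun l => h l N *: X l).
Proof.
move=> hh; rewrite mksE //; have [s hs] := sdom_ex X; exists (s + c) => n hn.
apply: zsum0 => l; case: (ltP l s) => ls; first by rewrite hs // scaler0.
by rewrite hh ?scale0r //; lia.
Qed.

Lemma comb_scale (f : laurent F) h c X : ladder h c ->
  f *: comb h X = comb (fun l => f * h l) X.
Proof.
move=> hh; have [t ht] := ldom_ex f; have [s hs] := sdom_ex X.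
have hh' : ladder (fun l => f * h l) (t + c).
  by move=> l; apply: (ldomW (ldomM ht (hh l))); lia.
apply: lserP => N; rewrite (combE _ _ hh') scoefZ.
pose G i l := (f i * h l (N - i)) *: X l.
have G0 i l : i < t \/ l < s \/ N - i < l + c -> G i l = 0.
  rewrite /G => -[hi|[hl|hil]]; first by rewrite ht // mul0r scale0r.
    by rewrite hs // scaler0.
  by rewrite hh ?mulr0 ?scale0r //; lia.
transitivity (zsum (fun i => zsum (fun l => G i l))).
  apply: eq_zsum => i; rewrite (combE _ _ hh) zsum_scale; last exact: comb_fsup hh.
  by apply: eq_zsum => l; rewrite scalerA.
rewrite (@zsum_exchange _ _ (`|t| + `|s| + `|N| + `|c|)%N) => [|i l hi|i l hl]; try by apply: G0; lia.
apply: eq_zsum => l; rewrite lcoefM -zsum_scalel //.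
exact: lmul_fsup.
Qed.

Lemma combD h c X Y : ladder h c -> comb h (X + Y) = comb h X + comb h Y.
Proof.
move=> hh; apply: lserP => N; rewrite scoefD !(combE _ _ hh) -zsumD; try exact: comb_fsup hh.
by apply: eq_zsum => l; rewrite scoefD scalerDr.
Qed.

Definition delta (P : laurent F) (X : lser M) : lser M := P *: sder X.

Lemma deltaD P X Y : delta P (X + Y) = delta P X + delta P Y.
Proof. by rewrite /delta sderD scalerDr. Qed.
Lemma iter_delta0 P n : iter n (delta P) 0 = 0.
Proof.
have d0 : delta P 0 = 0 by apply: (@addrI _ (delta P 0)); rewrite -deltaD !addr0.
by elim: n => // n IH; rewrite iterS IH d0.
Qed.
Lemma iter_deltaB P n X Y :
  iter n (delta P) (X - Y) = iter n (delta P) X - iter n (delta P) Y.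
Proof.
have dN Z : delta P (- Z) = - delta P Z.
  by have := morph_mulrz Z (-1) (deltaD P); rewrite !mulrN1z.
by elim: n => // n IH; rewrite !iterS IH deltaD dN.
Qed.

(** As P has a nonzero constant term, each application of delta lowers the
    order by one and multiplies the leading coefficient by a nonzero scalar,
    until it becomes a constant term. *)
Lemma delta_inj (P : laurent F) (Z : lser M) : char0 F -> P 0 != 0 -> ldom P 0 -> sdom Z 0 ->
  (forall n, (iter n (delta P) Z) 0 = 0) -> Z = 0.
Proof.
move=> chF P0 dP dZ hZ.
have H (n : nat) : sdom Z n%:Z.
  elim: n => [|n IH] //.
  have L (j : nat) : (j <= n)%N -> sdom (iter j (delta P) Z) (n - j)%N%:Z /\
     exists2 c, c != 0 & (iter j (delta P) Z) (n - j)%N%:Z = c *: Z n%:Z.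
    elim: j => [|j IHj] jn; first by rewrite subn0; split=> //; exists 1; rewrite ?oner_neq0 ?scale1r.
    have [d [c c0 Ec]] := IHj (ltnW jn); rewrite iterS.
    have d' : sdom (sder (iter j (delta P) Z)) (n - j.+1)%N%:Z.
      by move=> i hi; rewrite scoef_der d ?mul0rz //; lia.
    split.
      move=> i hi; rewrite /delta scoefZ; apply: zsum0 => a; case: (ltP a 0) => ha.
        by rewrite dP // scale0r.
      by rewrite d' ?scaler0 //; lia.
    exists (P 0 * c *~ (n - j)%N%:Z).
      rewrite -mulrzr mulf_neq0 ?mulf_neq0 //; apply: char0_int => //; lia.
    rewrite /delta scoefZ (@zsum_pt _ _ 0) => [|a /eqP a0].
      rewrite subr0 scoef_der (_ : (n - j.+1)%N%:Z + 1 = (n - j)%N%:Z); last by lia.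
      by rewrite Ec scalerMzl scalerA mulrzAr.
    case: (ltP a 0) => ha; first by rewrite dP // scale0r.
    by rewrite d' ?scaler0 //; lia.
  have [_ [c c0]] := L n (leqnn n); rewrite subnn hZ => /esym/eqP.
  rewrite scaler_eq0 (negPf c0) => /eqP Zn i hi.
  by case: (i =P n%:Z) => [->|h] //; apply: IH; lia.
by apply: lserP => i; rewrite (H `|i|.+1) //; lia.
Qed.
(** Power series in a variable of order one. *)
Variables (g : laurent F) (g_dom : ldom g 1) (g1 : g 1 != 0).
Let gX := fun l : int => g ^ l.
Lemma gX_ladder : ladder gX 0.
Proof. by move=> l; rewrite addr0; have [] := ldomX l g_dom g1. Qed.
Let hg := gX_ladder.
Let g_neq0 : g != 0. Proof. by apply: contraNneq g1 => ->. Qed.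

Definition scomp X := comb gX X.

Lemma scompE X N : scomp X N = zsum (fun l => (g ^ l) N *: X l).
Proof. exact: (combE _ _ hg). Qed.
Lemma scomp_fsup X N : fsup (fun l => (g ^ l) N *: X l).
Proof. exact: comb_fsup hg. Qed.
Lemma scompD X Y : scomp (X + Y) = scomp X + scomp Y.
Proof. exact: combD hg. Qed.
Lemma scomp_dom X s : sdom X s -> sdom (scomp X) s.
Proof.
move=> hs N hN; rewrite scompE; apply: zsum0 => l.
case: (ltP l s) => ls; first by rewrite hs // scaler0.
by rewrite hg ?scale0r //; lia.
Qed.

Lemma scomp_bot X s : sdom X s -> scomp X s = g 1 ^ s *: X s.
Proof.
move=> hs; rewrite scompE (@zsum_pt _ _ s) => [|l /eqP ls].
  by have [_ ->] := ldomX s g_dom g1.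
case: (ltP l s) => h; first by rewrite hs // scaler0.
by rewrite hg ?scale0r //; lia.
Qed.

Lemma scomp_dom_inv X s : sdom (scomp X) s -> sdom X s.
Proof.
move=> hc; have [t ht] := sdom_ex X.
have H (n : nat) : t + n%:Z <= s -> sdom X (t + n%:Z).
  elim: n => [|n IH] h; first by rewrite addr0.
  have hX : sdom X (t + n%:Z) by apply: IH; lia.
  move=> i hi; have [lt|ge] := ltP i (t + n%:Z); first exact: hX.
  have -> : i = t + n%:Z by lia.
  have := scomp_bot hX; rewrite hc; last by lia.
  move=> /esym/eqP; rewrite scaler_eq0 => /orP[|/eqP //].
  by rewrite (negPf (expfz_neq0 _ g1)).
case: (ltP s t) => st; first by apply: (sdomW ht); lia.
by have := H `|s - t|%N; rewrite (_ : t + `|s - t|%N%:Z = s); [apply; lia|lia].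
Qed.

Lemma scomp_mono n X : scomp (lmono n *: X) = g ^ n *: scomp X.
Proof.
rewrite /scomp (comb_scale _ _ hg); have hh : ladder (fun l => g ^ n * gX l) n.
  move=> l; have [h _] := ldomX n g_dom g1.
  have [h' _] := ldomX l g_dom g1.
  by apply: (ldomW (ldomM h h')); lia.
apply: lserP => N; rewrite (combE _ _ hh) (combE _ _ hg) (zsum_shift _ n).
by apply: eq_zsum => l; rewrite scoef_monoZ addrK /gX expfzDr // mulrC.
Qed.

Lemma lsubst_subproof (E : laurent F) : ltrunc (fun N => zsum (fun l => (g ^ l) N * E l)).
Proof.
have [s hs] := ldom_ex E; exists s => N hN; apply: zsum0 => l.
case: (ltP l s) => ls; first by rewrite hs // mulr0.
by rewrite hg ?mul0r //; lia.
Qed.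
Definition lsubst (E : laurent F) : laurent F := Laurent (lsubst_subproof E).
Lemma lsubstE (E : laurent F) N : lsubst E N = zsum (fun l => (g ^ l) N * E l).
Proof. by []. Qed.
Lemma lsubst_fsup (E : laurent F) N : fsup (fun l => (g ^ l) N * E l).
Proof.
have [s hs] := ldom_ex E; apply: (@fsupP _ _ s N) => l hl; first by rewrite hs // mulr0.
by rewrite hg ?mul0r //; lia.
Qed.

(** Substitution is multiplicative; both sides have large order with E, so
    this reduces to monomials. *)
Lemma scomp_scale (E : laurent F) X : scomp (E *: X) = lsubst E *: scomp X.
Proof.
apply: lserP => N; have [s hs] := sdom_ex X; have hcs := scomp_dom hs.
elim/laurent_span: E => [E E' h h'|c n|].
- rewrite scalerDl scompD scoefD h h' -scoefD -scalerDl.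
  have -> : lsubst (E + E') = lsubst E + lsubst E'; last by [].
  apply: laurentP => j; rewrite lcoefD !lsubstE -zsumD; try exact: lsubst_fsup.
  by apply: eq_zsum => l; rewrite lcoefD mulrDr.
- have E1 : lsubst (c *: lmono n) = lC c * g ^ n.
    apply: laurentP => j; rewrite lcoef_lCM lsubstE (@zsum_pt _ _ n).
      by rewrite lcoefZ lmonoE eqxx mulr1 mulrC.
    by move=> l /negPf nl; rewrite lcoefZ lmonoE nl !mulr0.
  rewrite E1 -lC_mul -scalerA -scalerA -scomp_mono.
  rewrite scoef_lCZ !scompE zsum_scale; last exact: scomp_fsup.
  by apply: eq_zsum => l; rewrite scoef_lCZ !scalerA mulrC.
exists (N - s + 1) => E hE.
have d1 : sdom (E *: X) (N + 1).
  move=> i hi; rewrite scoefZ; apply: zsum0 => j.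
  case: (ltP j (N - s + 1)) => hj; first by rewrite hE // scale0r.
  by rewrite hs ?scaler0 //; lia.
rewrite (scomp_dom d1); last by lia.
rewrite scoefZ zsum0 // => j; case: (ltP j (N - s + 1)) => hj.
  rewrite (_ : lsubst E j = 0) ?scale0r // lsubstE zsum0 // => l.
  case: (ltP l (N - s + 1)) => hl; first by rewrite hE // mulr0.
  by rewrite hg ?mul0r //; lia.
by rewrite hcs ?scaler0 //; lia.
Qed.

(** This hypothesis says that P d/ds is the derivation d/dg. *)
Variables (P : laurent F) (Pg : forall l : int, P * lderiv (g ^ l) = l%:~R * g ^ (l - 1)).

Lemma delta_comp X : delta P (scomp X) = scomp (sder X).
Proof.
have hh : ladder (fun l => lderiv (g ^ l)) (-1).
  by move=> l; apply: ldom_deriv; have [] := ldomX l g_dom g1.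
have E : sder (scomp X) = comb (fun l => lderiv (g ^ l)) X.
  apply: lserP => N; rewrite scoef_der scompE (combE _ _ hh) zsum_mulrz; last exact: scomp_fsup.
  by apply: eq_zsum => l; rewrite lcoef_deriv scalerMzl.
rewrite /delta E (comb_scale _ _ hh).
have hh' : ladder (fun l => P * lderiv (g ^ l)) (-1).
  move=> l; rewrite Pg mulrzl; have [h _] := ldomX (l - 1) g_dom g1.
  by move=> i hi; rewrite lcoef_mulrz h ?mul0rz //; lia.
apply: lserP => N; rewrite (combE _ _ hh') scompE (zsum_shift _ 1).
apply: eq_zsum => l; rewrite Pg addrK mulrzl lcoef_mulrz scoef_der.
by rewrite -scalerMzl scalerMzr.
Qed.

(** Taylor's formula in the variable g. *)
Lemma iter_delta_comp n X : sdom X 0 -> (iter n (delta P) (scomp X)) 0 = X n%:Z *~ n`!%:Z.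
Proof.
move=> hX; have E m : iter m (delta P) (scomp X) = scomp (iter m (@sder M) X).
  by elim: m => // m IH; rewrite !iterS IH delta_comp.
have d m : sdom (iter m (@sder M) X) 0.
  elim: m => // m IH; rewrite iterS => i hi; rewrite scoef_der.
  case: (i =P -1) => [->|h]; first by rewrite addNr mulr0z.
  by rewrite IH ?mul0rz //; lia.
rewrite E scomp_bot // expr0z scale1r.
have : forall m i, iter m (@sder M) X i = X (i + m%:Z) *~ (zb (i + m%:Z) m%:Z * m`!%:Z).
  elim=> [|m IH] i; first by rewrite addr0 zb0l mulr1z.
  rewrite iterS scoef_der IH -mulrzA factS.
  have -> : i + 1 + m%:Z = i + m.+1%:Z by lia.
  congr (_ *~ _); have D := zb_diag (i + m.+1%:Z) m.+1%:Z.
  have A := zb_absorb (i + m.+1%:Z) m%:Z.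
  have -> : zb (i + m.+1) m.+1 * (m.+1 * m`!)%N = (m.+1%:Z * zb (i + m.+1) m.+1) * m`!.
    by rewrite PoszM; ring.
  rewrite D (_ : m.+1%:Z - 1 = m) -?A; last by lia.
  rewrite (_ : i + m.+1%:Z - m%:Z = i + 1); [ring|lia].
by move=> ->; rewrite add0r (_ : zb n n = 1) ?mul1r // /zb binn.
Qed.

End Substitution.

Lemma natsumE (V : zmodType) (G : nat -> V) (N : nat) : (forall i, (N <= i)%N -> G i = 0) ->
  \sum_(i \in [set: nat]) G i = \sum_(i < N) G i.
Proof.
move=> h; rewrite (fsbigE (iota 0 N)) //; last first.
- by move=> i _ hi; rewrite h // leqNgt; apply: contra hi; rewrite mem_iota.
- by rewrite iota_uniq.
rewrite (eq_bigl xpredT) => [|i]; last by rewrite in_setT.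
by rewrite (_ : iota 0 N = index_iota 0 N) ?big_mkord // /index_iota subn0.
Qed.

Section PhiSubstitution.
Variables (K : fieldType) (ch : char0 K) (p : laurent K) (p0 : p != 0).
Notation k := (laurent K).
Notation kk := (laurent k).
Notation P := (PP p).
Notation g := (gg p0).
Let chk := char0_laurent ch.

Lemma Pgg (l : int) : P * lderiv (g ^ l) = l%:~R * g ^ (l - 1).
Proof. by rewrite (lderiv_ggX ch p0) mulrC mulfVK //; apply: PP_neq0. Qed.

Lemma P_bot : P 0 = p. Proof. by rewrite tsE hdl0. Qed.

(** A scalar series viewed as a series of vectors, to which [scomp] and
    [delta] apply. *)
Definition sl (f : kk) : lser k^o := mks (f : int -> k^o).
Lemma slE f n : sl f n = f n. Proof. by rewrite mksE //; apply: (laurent_subproof f). Qed.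

Definition pd (f : k) : k := p * lderiv f.

Definition phiE_coef (n : int) : k := if n is Posz m then phi_sub_x p m else 0.
Lemma phiE_subproof : ltrunc phiE_coef.
Proof. by exists 0 => -[]. Qed.
(** The series phi(z, y) - z in the variable y. *)
Definition phiE : kk := Laurent phiE_subproof.
Lemma phiEE n : phiE n = phiE_coef n. Proof. by []. Qed.

Lemma ts_x : ts (lmono 1) = lC (lmono 1) + lmono 1 :> kk.
Proof.
apply: laurentP => n; rewrite lcoefD lCE lmonoE tsE; apply: laurentP => j.
rewrite hdlE lcoefD lmonoE.
have [->|n0] := eqVneq n 0; first by rewrite zb0l addr0 mulr1z lcoef0 addr0 lmonoE.
have [->|n1] := eqVneq n 1.
  rewrite add0r lcoef1 (_ : (j + 1 == 1) = (j == 0)); last by apply/eqP/eqP; lia.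
  by case: eqP => [->|_]; rewrite ?mul0rz // add0r zb1.
rewrite !lcoef0 addr0; case: eqP => [->|_]; rewrite ?mul0rz //.
case: n n0 n1 => [n|n] n0 n1; last by rewrite zbN.
by rewrite zb_large //; lia.
Qed.

(** In terms of s, phi(z, y) is z + s: both sides have the same iterated
    derivatives under P d/ds at s = 0, because P d/ds acts on f(z + s) as p
    d/dx acts on f. *)
Lemma lsubst_phiE : lsubst (gg_dom p0) (gg1_neq0 p0) phiE = lmono 1.
Proof.
have gd := gg_dom p0; have g1 := gg1_neq0 p0.
have E : scomp g (sl phiE) = sl (lsubst gd g1 phiE).
  apply: lserP => n; rewrite scompE // slE lsubstE; apply: eq_zsum => l.
  by rewrite slE.
have dX : sdom (sl phiE) 0 by move=> i hi; rewrite slE; case: i hi.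
have Z0 : scomp g (sl phiE) - sl (lmono 1) = 0.
  apply: (@delta_inj _ _ P (scomp g (sl phiE) - sl (lmono 1))).
  - exact: chk.
  - by rewrite P_bot.
  - exact: ts_dom.
  - move=> i hi; rewrite scoefB (scomp_dom gd g1 dX) // slE lmonoE.
    by case: eqP => [h|_]; [lia|rewrite subr0].
  move=> n.
  rewrite iter_deltaB scoefB (iter_delta_comp gd g1 Pgg) // slE phiEE /phiE_coef /phi_sub_x.
(* s is (z + s) - z. *)
  have -> : sl (lmono 1) = sl (ts (lmono 1)) - sl (lC (lmono 1)).
    by apply: lserP => j; rewrite scoefB !slE ts_x lcoefD; zlin.
  rewrite iter_deltaB scoefB.
  have D1 f : delta P (sl (ts f)) = sl (ts (pd f)).
    apply: lserP => j; rewrite /pd tsM -lderiv_ts scoefZ slE lcoefM; apply: eq_zsum => i.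
    by rewrite scoef_der slE lcoef_deriv.
  have D2 j : iter j (delta P) (sl (ts (lmono 1))) = sl (ts (iter j pd (lmono 1))).
    by elim: j => // j IH; rewrite !iterS IH D1.
  have D3 f : delta P (sl (lC f)) = 0.
    apply: lserP => j; rewrite scoefZ; apply: zsum0 => i; rewrite scoef_der slE lCE.
    case: eqP => [h|_]; rewrite ?mul0rz ?scaler0 //.
    by rewrite h mulr0z scaler0.
  rewrite D2 slE tsE hdl0.
  case: n => [|n].
    by rewrite /= slE lCE eqxx /phi /= fact0 invr1 scale1r !subrr ?mul0rz ?subrr.
  rewrite [iter n.+1 (delta P) _]iterSr D3 subr0.
  rewrite iter_delta0.
  have E' : phi p n.+1 *~ (n.+1)`!%:Z = iter n.+1 pd (lmono 1).
    rewrite /phi scalerMzl -mulrzr mulVf ?scale1r //.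
    exact: char0_fact.
  rewrite scoef0 !subr0; apply/eqP; rewrite subr_eq0; apply/eqP; exact: E'.
apply: laurentP => n.
have /(congr1 (fun X : lser k^o => X n)) := Z0; rewrite E scoefB !slE => /eqP.
by rewrite subr_eq0 => /eqP.
Qed.

Lemma scomp_phiE (M : lmodType k) (q : nat) (X : lser M) :
  scomp g (phiE ^+ q *: X) = lmono q%:Z *: scomp g X.
Proof.
elim: q => [|q IH]; first by rewrite expr0 scale1r lmono0 scale1r.
rewrite exprS -scalerA (scomp_scale (gg_dom p0) (gg1_neq0 p0)) IH.
by rewrite lsubst_phiE scalerA -lmonoD (_ : 1 + q%:Z = q.+1%:Z) //; lia.
Qed.

Section SubstPhi.
Variable W : lmodType K.
Implicit Type A : int -> int -> W.

Lemma tayS_subproof A (hA : ltrunc2 A) n : ltrunc (tay n A).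
Proof. by have [N hN] := tay_dom hA; exists (N - n) => m; apply: hN. Qed.
(** The expansion of A(z + s, z) as a power series in s over W((z)). *)
Definition tayS A : lser (lser W) := mks (fun n => mks (tay n A)).
Lemma tayS_dom A : ltrunc (fun n => mks (tay n A)).
Proof.
exists 0 => n hn; apply: lserP => m; rewrite mksE ?scoef0 ?tay_neg //.
by exists 0 => i _; rewrite tay_neg.
Qed.
Lemma tayS0 A : sdom (tayS A) 0.
Proof.
move=> n hn; rewrite mksE; last exact: tayS_dom.
apply: lserP => m; rewrite mksE ?scoef0 ?tay_neg //.
by exists 0 => i _; rewrite tay_neg.
Qed.
Lemma tayE A n m : ltrunc2 A -> tayS A n m = tay n A m.
Proof.
move=> hA; rewrite mksE; last exact: tayS_dom.
by rewrite mksE //; apply: tayS_subproof.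
Qed.

Definition d1 A i j : W := A (i + 1) j *~ (i + 1).
Lemma ltrunc2_d1 A : ltrunc2 A -> ltrunc2 (d1 A).
Proof. by move=> [N hN]; exists (N - 1) => i j hij; rewrite /d1 hN ?mul0rz //; lia. Qed.
Lemma pderiv1E A : pderiv1 p A = mul1 p (d1 A).
Proof.
apply/funext => i; apply/funext => j; apply: eq_zsum => r.
by rewrite /d1 scaler_int.
Qed.

(** The derivation p(z1) d/dz1 becomes P(s) d/ds. *)
Lemma tayS_pderiv1 A : ltrunc2 A -> tayS (pderiv1 p A) = delta P (tayS A).
Proof.
move=> hA; rewrite pderiv1E; have hd := ltrunc2_d1 hA.
apply: lserP => n; apply: lserP => m; rewrite tayE; last exact: ltrunc2_mul1.
rewrite tay_mul1 // /delta scoefZ scoef_zsum; last first.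
  apply: (@fsupP _ _ 0 n) => a ha; first by rewrite ts_dom // scale0r.
  rewrite scoef_der; case: (n - a =P -1) => [->|h]; first by rewrite addNr mulr0z scaler0.
  by rewrite tayS0 ?mul0rz ?scaler0 //; lia.
apply: eq_zsum => a; rewrite scoefZ tsE; apply: eq_zsum => r; congr (_ *: _).
rewrite scoef_der scoef_mulrz tayE // /tay (zsum_shift _ (-1)) zsum_mulrz; last exact: diag_fsup.
apply: eq_zsum => i; rewrite /d1 subrK -!mulrzA.
have -> : m - r + (n - a) - (i + -1) = m - r + (n - a + 1) - i by lia.
congr (_ *~ _); have := zb_diag i (n - a + 1); rewrite addrK => <-; ring.
Qed.
Lemma ltrunc2_pderiv1 A : ltrunc2 A -> ltrunc2 (pderiv1 p A).
Proof. by move=> hA; rewrite pderiv1E; apply/ltrunc2_mul1/ltrunc2_d1. Qed.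

Lemma subst_phiE A (n : nat) m : ltrunc2 A ->
  subst_phi p A n%:Z m *~ n`!%:Z = (iter n (delta P) (tayS A)) 0 m.
Proof.
move=> hA; rewrite /subst_phi.
have H j : ltrunc2 (iter j (pderiv1 p) A) /\ tayS (iter j (pderiv1 p) A) = iter j (delta P) (tayS A).
  elim: j => // j [h1 h2]; rewrite !iterS; split; first exact: ltrunc2_pderiv1.
  by rewrite tayS_pderiv1 // h2.
have [h1 <-] := H n; rewrite tayE // scalerMzl -mulrzr mulVf ?scale1r; last first.
  exact: char0_fact.
by apply: eq_zsum => i; rewrite zb0l mulr1z addr0.
Qed.

(** If A(z + s, z) is the image of X under y = g(s), then A(phi(z, y), z) is
    X: its coefficients are the iterated derivatives under P d/ds = d/dy at y
    = 0. *)
Lemma subst_phi_comp A (X : lser (lser W)) n m : ltrunc2 A -> tayS A = scomp g X ->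
  subst_phi p A n m = X n m.
Proof.
move=> hA E; have gd := gg_dom p0; have g1 := gg1_neq0 p0.
have dX : sdom X 0 by apply: (scomp_dom_inv gd g1); rewrite -E; apply: tayS0.
case: n => n; last by rewrite dX.
have nz : ((n`!%:Z)%:~R : K) != 0 by rewrite -pmulrn; apply: char0_fact.
apply: (scalerI nz); rewrite !scaler_int -scoef_mulrz subst_phiE // E.
by rewrite (iter_delta_comp gd g1 Pgg).
Qed.

(** The hypotheses on X say that it is the exponential of y0 p d/dz applied to
    y, with y0 the variable of X: the Taylor expansion of y in the coordinate
    of p d/dx. *)
Lemma taylor_comp (y : lser W) (X : lser (lser W)) : sdom X 0 -> X 0 = y ->
  (forall n : int, 0 < n -> X n *~ n = p *: sder (X (n - 1))) ->
  tsm y = scomp g X.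
Proof.
move=> dX X0 hX; have gd := gg_dom p0; have g1 := gg1_neq0 p0.
apply/eqP; rewrite -subr_eq0; apply/eqP; apply: (@delta_inj _ _ P (tsm y - scomp g X)).
- exact: chk.
- by rewrite P_bot.
- exact: ts_dom.
- by move=> i hi; rewrite scoefB (scomp_dom gd g1 dX) // tsmE hdN // subr0.
move=> n; rewrite iter_deltaB scoefB (iter_delta_comp gd g1 Pgg) //.
have D1 (x : lser W) : delta P (tsm x) = tsm (p *: sder x).
  by rewrite /delta tsm_scale sder_tsm.
have -> j : iter j (delta P) (tsm y) = tsm (iter j (fun x => p *: sder x) y).
  by elim: j => // j IH; rewrite !iterS IH D1.
rewrite tsmE hd0; apply/eqP; rewrite subr_eq0; apply/eqP.
elim: n => [|n IH]; first by rewrite /= fact0 mulr1z.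
rewrite iterS IH factS PoszM mulrzA hX //.
have -> : n.+1%:Z - 1 = n by lia.
by rewrite (morph_mulrz _ _ (@sderD W)) -scalerMzr.
Qed.
End SubstPhi.
End PhiSubstitution.

(** * The vertex algebra *)

Section VertexAlgebra.
Variables (K : fieldType) (ch : char0 K) (el : K).
Notation V := (virmod el).
Notation vac := (vacuum el).
Variables (Y : V -> V -> int -> V) (YV : is_vertex_algebra Y vac).
Hypothesis Y_omega : forall (n : int) (v : V), mode Y (omega el) n v = om n v.

Let YM := va_vertex_map YV.

Lemma YDl u v w n : Y (u + v) w n = Y u w n + Y v w n.
Proof. by have := vertex_map_linearl YM w n 1 u v; rewrite !scale1r. Qed.
Lemma Y0l w n : Y 0 w n = 0.
Proof. by apply: (@addrI _ (Y 0 w n)); rewrite -YDl !addr0. Qed.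
Lemma YZl c u w n : Y (c *: u) w n = c *: Y u w n.
Proof. by have := vertex_map_linearl YM w n c u 0; rewrite Y0l !addr0. Qed.
Lemma YDr u v w n : Y w (u + v) n = Y w u n + Y w v n.
Proof. by have := vertex_map_linearr YM w n 1 u v; rewrite !scale1r. Qed.
Lemma Y0r w n : Y w 0 n = 0.
Proof. by apply: (@addrI _ (Y w 0 n)); rewrite -YDr !addr0. Qed.
Lemma YZr c u w n : Y w (c *: u) n = c *: Y w u n.
Proof. by have := vertex_map_linearr YM w n c u 0; rewrite Y0r !addr0. Qed.
Lemma Y_trunc u v : ltrunc (Y u v).
Proof. exact: vertex_map_trunc YM u v. Qed.

Lemma om_large (v : V) : exists N, forall n, N <= n -> om n v = 0.
Proof.
have [M hM] := virmod_tail v; exists M => n hn; rewrite /om hM //.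
by apply: ldomN; apply: (ldomW (@ldom_mono K n)).
Qed.
Lemma om_vac n : 0 <= n -> om n vac = 0.
Proof.
move=> n0; rewrite /om vacuum_act /= ?mul0r ?scale0r // => i hi /=.
by rewrite lcoefN lmonoE; case: eqP => [h|_]; [lia|rewrite oppr0].
Qed.

(** The commutator formula with the modes of omega: Borcherds' identity whose
    first exponent is 0. *)
Lemma Y_om (m l : int) u v : Y u (om m v) l =
  om m (Y u v l) - zsum (fun j => Y (om j u) v (l - m + j) *~ zb m j).
Proof.
have J := va_jacobi YV (omega el) u v 0 m (- l - 1); rewrite /mode in J.
have [N hN] := om_large u.
rewrite (@natsumE _ _ `|N|) in J; last first.
  move=> i hi; have := Y_omega (0 + i%:Z) u; rewrite /mode => ->.
  by rewrite hN ?Y0l ?scaler0 //; lia.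
rewrite (@natsumE _ _ 1) in J; last first.
  by move=> i hi; rewrite binz_zb // zb0 (_ : (i%:Z == 0) = false) ?mulr0 ?scale0r //; lia.
rewrite big_ord1 /= expr0 mul1r binz_zb // zb0 eqxx scale1r expr0z scale1r !subr0 ?addr0 in J.
have := Y_omega m (Y u v (- (- l - 1) - 1)); rewrite /mode => E; rewrite E {E} in J.
have := Y_omega m v; rewrite /mode => E; rewrite E {E} in J.
have El : - (- l - 1) - 1 = l by lia.
rewrite El in J.
have -> : zsum (fun j => Y (om j u) v (l - m + j) *~ zb m j) = om m (Y u v l) - Y u (om m v) l.
  rewrite -J (@zsum_nat _ _ `|N|) => [|j hj|j hj].
  - apply: eq_bigr => i _; have := Y_omega i%:Z u; rewrite /mode add0r => ->.
    rewrite binz_zb // scaler_int; congr (Y _ _ _ *~ _); lia.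
  - by rewrite zbN // mulr0z.
  - by rewrite hN ?Y0l ?mul0rz //; lia.
by rewrite opprB addrCA subrr addr0.
Qed.

Lemma Yvac_neg u n : n < 0 -> Y u vac n = 0.
Proof. by move=> h; have [_] := va_creation YV u; apply. Qed.

(** Borcherds' identity with second exponent 0, applied to the vacuum; only
    one of its two series survives, since omega_n 1 = 0 for n >= 0. *)
Lemma Yvac_om (m N : int) u : Y (om m u) vac N =
  zsum (fun i => om (m - i) (Y u vac (N - i)) *~ (sg i * zb m i)).
Proof.
have J := va_jacobi YV (omega el) u vac m 0 (- N - 1); rewrite /mode in J.
rewrite (@natsumE _ _ 1) in J; last first.
  by move=> i hi; rewrite binz_zb // zb0 (_ : (i%:Z == 0) = false) ?scale0r //; lia.
rewrite big_ord1 binz_zb // zb0 eqxx scale1r addr0 in J.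
have := Y_omega m u; rewrite /mode => E; rewrite E {E} in J.
have EN : - (0 + (- N - 1) - 0%N%:Z) - 1 = N by lia.
rewrite EN in J; rewrite J.
rewrite (@natsumE _ _ (`|N| + 1)) => [|i hi].
  rewrite (@zsum_nat _ _ (`|N| + 1)) => [|i hi|i hi].
  - apply: eq_bigr => i _.
    have := Y_omega (0 + i%:Z) vac; rewrite /mode => ->; rewrite om_vac ?Y0r ?scaler0 ?subr0; last by lia.
    have := Y_omega (0 + m - i%:Z) (Y u vac (- (- N - 1 + i%:Z) - 1)); rewrite /mode => ->.
    rewrite binz_zb // -scaler_int add0r; congr (_ *: om _ (Y _ _ _)); last by lia.
    by rewrite rmorphM; congr (_ * _); rewrite /sg rmorphXn /= rmorphN1.
  - by rewrite zbN // mulr0 mulr0z.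
  - by rewrite Yvac_neg ?(virmod_act0 _) /om ?virmod_act0 ?mul0rz //; lia.
have := Y_omega (0 + i%:Z) vac; rewrite /mode => ->; rewrite om_vac ?Y0r ?scaler0 ?subr0; last by lia.
have := Y_omega (0 + m - i%:Z) (Y u vac (- (- N - 1 + i%:Z) - 1)); rewrite /mode => ->.
by rewrite Yvac_neg /om ?virmod_act0 ?scaler0 //; lia.
Qed.

(** Y(u, z) 1 is the exponential of z omega_0 applied to u, by induction on u:
    both sides change in the same way under the modes of omega. *)
Lemma Yvac_trans u n : Y u vac n *~ n = om 0 (Y u vac (n - 1)).
Proof.
elim/virmod_ind: u n => [u v hu hv|c u hu||m u hu] n.
- by rewrite !YDl mulrzDl hu hv /om virmod_actD.
- by rewrite !YZl scalerMzr hu /om virmod_actZ.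
- have h i : Y vac vac i = if i == 0 then vac else 0 by apply: (va_vacuum YV).
  rewrite !h; case: eqP => [->|_]; first by rewrite mulr0z; case: eqP => [//|_]; rewrite /om virmod_act0.
  by rewrite mul0rz; case: eqP => _; rewrite ?om_vac // /om virmod_act0.
- have fs (N : int) (c : int -> int) : fsup (fun i => om (m - i) (Y u vac (N - i)) *~ (c i * zb m i)).
    apply: (@fsupP _ _ 0 N) => i hi; first by rewrite zbN // mulr0 mulr0z.
    by rewrite Yvac_neg /om ?virmod_act0 ?mul0rz //; lia.
  have omD j : {morph @om K el j : x y / x + y} by move=> x y; rewrite /om virmod_actD.
  have ommz j x (z : int) : om j (x *~ z) = om j x *~ z by rewrite -!scaler_int /om virmod_actZ.
  rewrite !Yvac_om // zsum_mulrz // (zsum_additive (omD 0)) //.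
  have c0 i x : om 0 (om (m - i) x) = om (m - i) (om 0 x) - om (m - i - 1) x *~ (m - i).
    have := om_br 0 (m - i) x; rewrite !add0r => /eqP; rewrite subr_eq => /eqP ->.
    by rewrite !mul0r mulr0 if_same scale0r addr0 rmorphN scaleNr scaler_int addrC.
  have E i : om 0 (om (m - i) (Y u vac (n - 1 - i)) *~ (sg i * zb m i)) =
     om (m - i) (Y u vac (n - i)) *~ ((n - i) * sg i * zb m i) -
     om (m - i - 1) (Y u vac (n - 1 - i)) *~ ((m - i) * (sg i * zb m i)).
    rewrite ommz c0 (_ : n - 1 - i = n - i - 1); last by lia.
    by rewrite -hu ommz mulrzBl -!mulrzA; congr (_ *~ _ - _); ring.
  rewrite (eq_zsum E) zsumB //; last first.
    apply: (@fsupP _ _ 0 (n - 1)) => i hi; first by rewrite zbN // !mulr0 mulr0z.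
    by rewrite (Yvac_neg u (n := n - 1 - i)) /om ?virmod_act0 ?mul0rz //; lia.
  rewrite [X in _ = _ - X](zsum_shift _ (-1)) -zsumB //; last first.
    apply: (@fsupP _ _ 1 n) => i hi; first by rewrite (@zbN m) ?mulr0 ?mulr0z //; lia.
    by rewrite (Yvac_neg u (n := n - 1 - (i + -1))) /om ?virmod_act0 ?mul0rz //; lia.
  apply: eq_zsum => i.
  have -> : m - (i + -1) - 1 = m - i by lia.
  have -> : n - 1 - (i + -1) = n - i by lia.
  rewrite -mulrzBr -mulrzA; congr (_ *~ _); rewrite sgP.
  have -> : (m - (i + -1)) * (- sg i * zb m (i + -1)) = - sg i * (i * zb m i).
    by rewrite zb_diag -zb_absorb; ring.
  ring.
Qed.
End VertexAlgebra.

(** * Restricted modules are phi-coordinated modules *)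

Section FieldAssociativity.
Variables (K : fieldType) (ch : char0 K) (el : K).
Notation V := (virmod el).
Notation vac := (vacuum el).
Variables (Y : V -> V -> int -> V) (YV : is_vertex_algebra Y vac).
Hypothesis Y_omega : forall (n : int) (v : V), mode Y (omega el) n v = om n v.
Variables (W : lmodType K) (T : int -> W -> W) (TV : vir_ops T el).
Variables (p : laurent K) (p0 : p != 0).
Notation k := (laurent K).
Notation kk := (laurent k).
Notation H := (W -> lser W).
Notation P := (PP p).
Notation g := (gg p0).
Notation coord_op := (coord_op TV p0).
Notation YF := (YF TV p0).
Notation Tm := (Tm TV).
Let gd := gg_dom p0.
Let g1 := gg1_neq0 p0.

Lemma YF_lin v : linf (YF v). Proof. exact: local_lin (YF_local TV ch p0 v). Qed.
Lemma YF0 : YF 0 = 0.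
Proof. by have := YFZ TV ch p0 0 0; rewrite !scale0r rmorph0 scale0r. Qed.

Definition XF u v : lser H := mks (fun n => YF (Y u v n)).
Lemma XFE u v n : XF u v n = YF (Y u v n).
Proof.
rewrite mksE //; have [N hN] := Y_trunc YV u v; exists N => i hi.
by rewrite hN // YF0.
Qed.
(** The expected expansion of the product of the fields of u and v. *)
Definition Th u v : lser H := scomp g (XF u v).

Lemma local_zsum (F : int -> H) : fsup F -> (forall i, local TV (F i)) -> local TV (zsum F).
Proof.
move=> [N hN] h; rewrite (zsumN hN).
by apply: (big_ind (local TV)) => //; [apply: local_0|apply: local_add].
Qed.

Lemma Th_local u v N : local TV (Th u v N).
Proof.
rewrite /Th scompE //; apply: local_zsum; first exact: scomp_fsup.
by move=> l; rewrite XFE; apply: local_scale; apply: YF_local.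
Qed.

Lemma coord_op_local n b : local TV b -> local TV (coord_op n b).
Proof. exact: (vm_S (coord_op_modes TV ch p0)). Qed.
Lemma coord_op0 n : coord_op n 0 = 0.
Proof. by have := vm_aZ (coord_op_modes TV ch p0) n 0 (local_0 TV); rewrite !scale0r. Qed.

Lemma coord_op_zsum n (f : int -> k) (b : int -> H) : fsup (fun i => f i *: b i) ->
  (forall i, local TV (b i)) ->
  coord_op n (zsum (fun i => f i *: b i)) = zsum (fun i => f i *: coord_op n (b i)).
Proof.
move=> [N hN] hb; have hs i : local TV (f i *: b i) by apply: local_scale.
rewrite (zsumN hN) (@zsumN _ _ N) => [|i hi]; last first.
  by rewrite -(vm_aZ (coord_op_modes TV ch p0)) // hN // coord_op0.
elim: (N * 2).+1 => [|M IH]; first by rewrite !big_ord0 coord_op0.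
rewrite !big_ord_recr /= (vm_aD (coord_op_modes TV ch p0)) //.
  by rewrite IH (vm_aZ (coord_op_modes TV ch p0)).
by apply: (big_ind (local TV)) => //; [apply: local_0|apply: local_add].
Qed.

Lemma scomp_sum (I : Type) (r : seq I) (X : I -> lser H) :
  scomp g (\sum_(i <- r) X i) = \sum_(i <- r) scomp g (X i).
Proof.
elim/big_rec2: _ => [|i y x _ <-]; last exact: scompD.
by apply: (@addrI _ (scomp g 0)); rewrite -scompD // !addr0.
Qed.

(** The commutator formula in V, transported by y = g(s). *)
Lemma Th_om (J : nat) u v m N : (forall j, J%:Z <= j -> om j u = 0) ->
  Th u (om m v) N = coord_op m (Th u v N) -
    (\sum_(j < J) (g ^ (m - j%:Z) *: Th (om j%:Z u) v) *~ zb m j%:Z) N.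
Proof.
move=> hJ.
have E : XF u (om m v) = smap (coord_op m) (XF u v) -
    \sum_(j < J) (lmono (m - j%:Z) *: XF (om j%:Z u) v) *~ zb m j%:Z.
  apply: lserP => n; rewrite scoefB smapE ?coord_op0 // !XFE Y_om // -scaleN1r YFD // YFZ // YF_om //.
  rewrite rmorphN1 scaleN1r; congr (_ - _).
  rewrite (@zsum_nat _ _ J) => [|j hj|j hj]; first last.
  - by rewrite hJ // (Y0l YV) mul0rz.
  - by rewrite zbN // mulr0z.
  have YFs (I : Type) (r : seq I) (F : I -> V) : YF (\sum_(i <- r) F i) = \sum_(i <- r) YF (F i).
    by elim/big_rec2: _ => [|i y x _ <-]; [exact: YF0|rewrite YFD].
  rewrite YFs scoef_sum; apply: eq_bigr => j _.
  rewrite scoef_mulrz scoef_monoZ XFE -scaler_int YFZ // rmorph_int scaler_int.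
  by congr (YF (Y _ _ _) *~ _); lia.
have sB (A B : lser H) : scomp g (A - B) = scomp g A - scomp g B.
  apply: (@addIr _ (scomp g B)); by rewrite -scompD // !subrK.
have sz (A : lser H) (n : int) : scomp g (A *~ n) = scomp g A *~ n.
  by apply: morph_mulrz => x y; apply: scompD.
rewrite /Th E sB scoefB; congr (_ - _).
  rewrite !scompE // coord_op_zsum; first by apply: eq_zsum => l; rewrite smapE // coord_op0.
    exact: scomp_fsup.
  by move=> l; rewrite XFE; apply: YF_local.
by rewrite scomp_sum !scoef_sum; apply: eq_bigr => j _; rewrite sz scomp_mono.
Qed.

Lemma coord_op_finite (J : nat) (j : nat) b : local TV b -> (forall n, J%:Z <= n -> Tm n b = 0) ->
  coord_op j%:Z b = \sum_(x < J) (g ^ j%:Z * P) x%:Z *: Tm x%:Z b.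
Proof.
move=> hb hJ; rewrite coord_opE // alpha_gg0 // mul0r scale0r addr0.
apply: zsum_nat => x hx; first by rewrite (@gP_dom _ _ p0) ?scale0r //; lia.
by rewrite hJ // scaler0.
Qed.

(** The operators T_(x) are combinations of the operators of y^j d/dy, since
    the order at s = 0 makes this family triangular. *)
Lemma low_modes (J : nat) b c : local TV b -> (forall n, J%:Z <= n -> Tm n b = 0) ->
  (forall j : nat, exists L : lser H, prodexp (coord_op j%:Z b) c L) ->
  forall x : nat, exists L : lser H, prodexp (Tm x%:Z b) c L.
Proof.
move=> hb hJ ha.
have Tl x : linf (Tm x b) by apply: Xop_lin; apply: local_lin hb.
(* Downward induction on x, starting from T_(x) b = 0 for x >= J. *)
suff H (d : nat) : forall x : nat, (J - x <= d)%N -> exists Th', prodexp (Tm x%:Z b) c Th'.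
  by move=> x; have [Th' h] := H _ x (leqnn _); have [L E] := prodexp_lser h; exists L; rewrite -E.
elim: d => [|d IH] x hx.
  by rewrite hJ; [exists (fun=> 0); apply: prodexp0l|lia].
case: (ltnP x J) => xJ; last by rewrite hJ; [exists (fun=> 0); apply: prodexp0l|lia].
set G := g ^ x%:Z * P.
have Gx : G x%:Z != 0.
  by rewrite /G gP_bot mulf_neq0 // expfz_neq0 // invr_neq0.
have E : Tm x%:Z b = (G x%:Z)^-1 *: (coord_op x%:Z b +
    \sum_(y < J) (if y != Ordinal xJ then - G y%:Z *: Tm y%:Z b else 0)).
  rewrite (coord_op_finite x hb hJ) (bigD1 (Ordinal xJ)) //= -big_mkcond /= -addrA -big_split /=.
  rewrite big1 ?addr0 => [|y _]; last by rewrite scaleNr subrr.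
  by rewrite scalerA mulVf // scale1r.
have [L hL] := ha x.
have hs (n : nat) (F : 'I_n -> H) : (forall y, exists Th', prodexp (F y) c Th') ->
    exists Th', prodexp (\sum_(y < n) F y) c Th'.
  elim: n F => [|n IHn] F hF; first by rewrite big_ord0; exists (fun=> 0); apply: prodexp0l.
  have [A hA] := IHn (fun y => F (widen_ord (leqnSn n) y)) (fun y => hF _).
  have [B hB] := hF ord_max; exists (fun n => A n + B n).
  by rewrite big_ord_recr /=; apply: prodexpDl.
have [B hB] : exists Th', prodexp (\sum_(y < J) (if y != Ordinal xJ then - G y%:Z *: Tm y%:Z b else 0)) c Th'.
  apply: hs => y; case: eqP => [_|/eqP yx]; first by exists (fun=> 0); apply: prodexp0l.
  case: (ltnP y x) => yx'.
    have -> : G y%:Z = 0 by rewrite /G (@gP_dom _ _ p0).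
    by rewrite oppr0 scale0r; exists (fun=> 0); apply: prodexp0l.
  have xy : (x < y)%N by rewrite ltn_neqAle yx' andbT eq_sym; apply: contra yx => /eqP e; apply/eqP/val_inj.
  have yd : (J - y <= d)%N by lia.
  have [A hA] := IH y yd.
  by rewrite /=; eexists; exact: (prodexpZl (- G y%:Z) (Tl y) hA).
rewrite E; eexists; apply: prodexpZl; last exact: prodexpDl hL hB.
apply: linf_add; first exact: local_lin (coord_op_local x%:Z hb).
apply: (big_ind (@linf K W)) => [||y _]; [exact: linf_0|exact: linf_add|].
by case: eqP => _; [exact: linf_0|exact: linf_scale].
Qed.

Lemma scomp_app (X : lser H) N w : scomp g X N w = scomp g (mks (fun n => X n w)) N.
Proof.
rewrite !scompE // fct_zsum; last exact: scomp_fsup.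
apply: eq_zsum => l; rewrite mksE //.
by have [s hs] := sdom_ex X; exists s => i hi; rewrite hs.
Qed.

(** With the identity as second field, the expansion of the product is
    Taylor's formula for the first field. *)
Lemma prodexp_idf u : prodexp (YF u) (@idf K W) (Th u vac).
Proof.
set b := YF u; have lb : linf b by apply: YF_lin.
have E w i j : fprod b (@idf K W) w i j = if j == 0 then b w i else 0.
  by rewrite /fprod smonoE; case: eqP => // _; rewrite linf0 // scoef0.
exists 0%N => w; split.
  have [s hs] := sdom_ex (b w); exists (Num.min s 0) => i j hij; rewrite /= E.
  by case: eqP => // j0; rewrite hs //; lia.
move=> n m; rewrite subr0 /= scomp_app.
set X := mks _; have XE i : X i = YF (Y u vac i) w.
  rewrite /X mksE ?XFE //; have [s hs] := sdom_ex (XF u vac); exists s => j hj.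
  by rewrite hs.
rewrite -(taylor_comp ch p0 (y := b w)).
- rewrite tsmE hdE /tay (@zsum_pt _ _ (m + n)) ?E ?subrr ?eqxx // => i ni.
  by rewrite E; case: eqP => [h|_]; [case/eqP: ni; lia|rewrite mul0rz].
- by move=> i hi; rewrite XE (Yvac_neg YV) // YF0.
- by rewrite XE; have [-> _] := va_creation YV u.
move=> i hi; rewrite !XE.
rewrite -[RHS]/((p *: dF (YF (Y u vac (i - 1)))) w) -YF_om0 // -(Yvac_trans ch YV Y_omega).
by rewrite -[in RHS]scaler_int YFZ // rmorph_int scaler_int fct_mulrz.
Qed.

(** By induction on v. When omega_m is applied to v, the commutator formula of
    V involves g^(m - j), and Wick's rule involves the divided derivatives of
    g^m P; [taylor_gP] relates them. *)
Lemma prodexp_YF u v : prodexp (YF u) (YF v) (Th u v).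
Proof.
elim/virmod_ind: v u => [v v' hv hv'|c v hv||m v hv] u.
- have -> : Th u (v + v') = Th u v + Th u v' :> lser H.
    rewrite /Th -scompD //; congr (scomp g _); apply: lserP => n.
    by rewrite scoefD !XFE (YDr YV) YFD.
  by rewrite YFD //; apply: prodexpDr => //; apply: YF_lin.
- have -> : Th u (c *: v) = lC (lC c) *: Th u v :> lser H.
    apply: lserP => N; rewrite scoef_lCZ /Th !scompE // zsum_scale; last exact: scomp_fsup.
    apply: eq_zsum => l; rewrite !XFE (YZr YV) YFZ // !scalerA mulrC //.
  rewrite YFZ //; apply: prodexp_eq (prodexpZr (lC c) (YF_lin u) (hv u)) _ => n.
  by rewrite scoef_lCZ.
- rewrite YF_vac //; exact: prodexp_idf.
set b := YF u; set c := YF v.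
have hb : local TV b by apply: YF_local. have hc : local TV c by apply: YF_local.
have lb := local_lin hb.
have [J [hJ _]] := commutator hb.
have [M hM] := om_large u.
have hJ' j : (J + `|M|)%N%:Z <= j -> om j u = 0 by move=> hj; apply: hM; lia.
have [j|L_ hL_] := choice (low_modes (c := c) hb hJ _).
  by exists (Th (om j%:Z u) v); rewrite -YF_om //; apply: hv.
rewrite YF_om // coord_opE //.
set G := g ^ m * P; set al := alpha P (g ^ m) * lC el.
have hP := prodexp_vf G al hb hc hJ (Th_local u v) (hv u) (fun x _ => hL_ x).
apply: prodexp_eq hP _ => N.
rewrite (Th_om _ _ _ hJ') coord_opE //; last exact: Th_local.
congr (_ - _).
(* The induction hypothesis also applies to omega_j u, whose field is a finite
   combination of the T_(x) b; expansions of products are unique. *)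
have ThE j : Th (om j%:Z u) v = \sum_(x < J) ts ((g ^ j%:Z * P) x%:Z) *: L_ x.
  have h1 := hv (om j%:Z u); rewrite YF_om // (coord_op_finite j hb hJ) in h1.
  have h2 := prodexp_suml (fun x : 'I_J => prodexpZl ((g ^ j%:Z * P) x%:Z)
    (Xop_lin TV 0 x%:Z lb) (hL_ x)).
  apply: lserP => n; have /(congr1 (fun F => F n)) := prodexp_uniq h1 h2 => ->.
  rewrite scoef_sum; apply: eq_bigr => x _; rewrite scoefZ; by apply: eq_zsum => a.
rewrite -scoef_sum; congr (scoef _ N); apply/esym.
transitivity (\sum_(j < J + `|M|) \sum_(x < J)
   ((ts ((g ^ j%:Z * P) x%:Z) * g ^ (m - j%:Z)) *~ zb m j%:Z) *: L_ x).
  apply: eq_bigr => j _; rewrite ThE scaler_sumr mulrz_suml; apply: eq_bigr => x _.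
  by rewrite scalerA mulrC scalerMzl.
have hx (x : 'I_J) : hdl x%:Z G =
    \sum_(j < J + `|M|) (ts ((g ^ j%:Z * P) x%:Z) * g ^ (m - j%:Z)) *~ zb m j%:Z.
  rewrite (taylor_gP ch p0 m) // (@zsum_nat _ _ (J + `|M|)) // => j hj.
    by rewrite zbN // mulr0z.
  rewrite (@gP_dom _ _ p0) ?ts_0 ?mul0r ?mul0rz //; have := ltn_ord x; lia.
rewrite exchange_big; apply: eq_bigr => x _.
by rewrite hx scaler_suml.
Qed.
End FieldAssociativity.

Section ModuleModes.
Variables (K : fieldType) (el : K) (W : lmodType K) (act : vir K -> W -> W).
Hypotheses (mod_act : is_vir_module act) (restr : is_restricted act) (lev : has_level act el).

Lemma actDl x y w : act (x + y) w = act x w + act y w.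
Proof. by have := vir_module_linearl mod_act w 1 x y; rewrite !scale1r. Qed.
Lemma act0l w : act 0 w = 0.
Proof. by apply: (@addrI _ (act 0 w)); rewrite -actDl !addr0. Qed.
Lemma actZl c x w : act (c *: x) w = c *: act x w.
Proof. by have := vir_module_linearl mod_act w c x 0; rewrite act0l !addr0. Qed.

Definition Tact (n : int) (w : W) : W := act (- lmono n, 0) w.

Lemma actN_mono n w : act (lmono n, 0) w = - Tact n w.
Proof.
rewrite /Tact -scaleN1r -actZl; congr (act _ w); congr (_, _); rewrite /= ?scaleN1r ?opprK //.
by rewrite oppr0.
Qed.

Lemma Tact_ops : vir_ops Tact el.
Proof.
split.
- by move=> n; apply: vir_module_linearr mod_act _.
- move=> w; have [[N hN] _] := restr w; exists N => n hn.
  by apply/eqP; rewrite -oppr_eq0 -actN_mono hN.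
- move=> m n w; rewrite /Tact -(vir_module_br mod_act) vir_br_mono actDl !actZl lev scaler_int.
  congr (_ + _); rewrite scalerA; case: eqP => _; last by rewrite mul0r scale0r.
  by rewrite mulrAC mulrzr -scalerMzl.
Qed.

Lemma act_series f a w : act (- f, a) w = zsum (fun i => f i *: Tact i w) + (a * el) *: w.
Proof.
have -> : (- f, a) = (- f, 0) + (a : K) *: vir_central K :> vir K.
  by congr (_, _); rewrite /= ?scaler0 ?addr0 // add0r /GRing.scale /= mulr1.
rewrite actDl actZl lev scalerA; congr (_ + _).
have [_ ->] := restr w; apply: eq_zsum => i.
by rewrite actN_mono scalerN -scaleNr lcoefN opprK.
Qed.
End ModuleModes.

Section RestrictedToPhi.
Variables (K : fieldType) (ch : char0 K) (el : K).
Notation V := (virmod el).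
Notation vac := (vacuum el).
Variables (Y : V -> V -> int -> V) (YV : is_vertex_algebra Y vac).
Hypothesis Y_omega : forall (n : int) (v : V), mode Y (omega el) n v = om n v.
Variables (W : lmodType K) (T : int -> W -> W) (TV : vir_ops T el).
Variables (p : laurent K) (p0 : p != 0).
Notation k := (laurent K).
Notation kk := (laurent k).
Notation H := (W -> lser W).
Notation P := (PP p).
Notation g := (gg p0).
Notation YF := (YF TV p0).

Definition YWmap (u : V) (w : W) (m : int) : W := YF u w m.

Lemma iter_psmul (q i : nat) : iter q (psmul (phi_sub_x p)) (@psone K) i = (phiE p ^+ q) i%:Z.
Proof.
elim: q i => [|q IH] i; first by rewrite expr0 lcoef1 /psone; case: i.
have d : ldom (phiE p ^+ q) 0.
  elim: q {IH} => [|q IH] j hj; first by rewrite expr0 lcoef1; case: eqP => // h; lia.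
  by rewrite exprS (ldomM (s := 0) (t := 0) _ IH) //; case.
rewrite iterS exprS lcoefM (@zsum_nat _ _ i.+1) => [|j hj|j hj].
- apply: eq_bigr => j _; have -> : i%:Z - j%:Z = (i - j)%N%:Z by have := ltn_ord j; lia.
  by rewrite IH phiEE.
- by case: j hj => // j _; rewrite phiEE /= mul0r.
- by rewrite d ?mulr0 //; lia.
Qed.

Lemma psactE (q : nat) (X : lser (lser W)) n m :
  psact (iter q (psmul (phi_sub_x p)) (@psone K)) (fun n m => X n m) n m = (phiE p ^+ q *: X) n m.
Proof.
have [s hs] := sdom_ex X.
have d : ldom (phiE p ^+ q) 0.
  elim: q => [|q IH] j hj; first by rewrite expr0 lcoef1; case: eqP => // h; lia.
  by rewrite exprS (ldomM (s := 0) (t := 0) _ IH) //; case.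
have z (i : int) : `|n - s|.+1%:Z <= i -> X (n - i) = 0 by move=> hi; rewrite hs //; lia.
rewrite /psact (@natsumE _ _ `|n - s|.+1) => [|i hi]; last first.
  by apply: zsum0 => j; rewrite z ?scoef0 ?scaler0 //; lia.
rewrite scoefZ scoef_zsum; last exact: sscale_fsup.
rewrite (@zsum_nat _ _ `|n - s|.+1) => [|i hi|i hi]; first last.
- by rewrite z // scaler0 scoef0.
- by rewrite d // scale0r scoef0.
apply: eq_bigr => i _; rewrite scoefZ; apply: eq_zsum => j.
by rewrite iter_psmul.
Qed.

Lemma YWmap_assoc (u v : V) : exists q : nat,
  let A w := mulz12 q (fun i j => YWmap u (YWmap v w j) i) in
  (forall w, ltrunc2 (A w)) /\
  (forall w n m,
     psact (iter q (psmul (phi_sub_x p)) (@psone K)) (fun n m => YWmap (Y u v n) w m) n m =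
     subst_phi p (A w) n m).
Proof.
have [q h] := prodexp_YF ch YV Y_omega TV p0 u v; exists q => A.
have hA w : ltrunc2 (A w) by have [] := h w.
split=> // w n m; have [_ h2] := h w.
pose Xw : lser (lser W) := mks (fun n => YF (Y u v n) w).
have XwE i : Xw i = YF (Y u v i) w.
  rewrite /Xw mksE //; have [s hs] := Y_trunc YV u v; exists s => j hj.
  by rewrite hs // (YF0 ch).
have E : tayS (A w) = scomp g (phiE p ^+ q *: Xw).
  rewrite (scomp_phiE ch).
  apply: lserP => i; apply: lserP => j; rewrite tayE // scoef_monoZ.
  rewrite [LHS]h2 /Th (scomp_app p0).
  have -> : mks (fun n => XF Y TV p0 u v n w) = Xw; last by [].
  apply: lserP => r; rewrite XwE mksE ?(XFE ch YV) //.
  by have [s hs] := sdom_ex (XF Y TV p0 u v); exists s => j' hj; rewrite hs.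
rewrite (subst_phi_comp ch n m (hA w) E).
rewrite -psactE; congr (psact _ _ n m); apply/funext => i; apply/funext => j.
by rewrite XwE.
Qed.

Lemma YWmap_phi : is_phi_module p Y vac YWmap.
Proof.
split.
- split.
  + move=> w m c u v; rewrite /YWmap YFD // YFZ //.
    by rewrite fctDE fctZE scoefD scoef_lCZ.
  + move=> v m c u u'; rewrite /YWmap; have -> := YF_lin ch TV p0 v c u u'.
    by rewrite scoefD scoef_lCZ.
  + by move=> v w; have [s hs] := sdom_ex (YF v w); exists s.
- by move=> w m; rewrite /YWmap YF_vac // smonoE.
- exact: YWmap_assoc.
Qed.

(** The field T_(-1) 1 is the series T(z) itself. *)
Lemma Tm_idf_bot w c : Tm TV (-1) (@idf K W) w c = T (- 1 - c) w.
Proof.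
rewrite Tm_coef; last exact: idf_lin.
have TV0 n : T n 0 = 0 by apply: (T0 TV).
have sz l : 0 <= l -> sg l * zb (-1) l = 1 by move=> l0; rewrite zbN1 // sg_sqr.
rewrite (@zsum_pt _ _ (if 0 <= c then c else - 1 - c)) => [|l hl].
  case: ifP => hc; rewrite sz ?mulr1z; try lia.
    by rewrite !smonoE subrr eqxx; case: eqP => [h|_]; [lia|rewrite mul0rz subr0].
  rewrite !smonoE; case: eqP => [h|_]; first by lia.
  by case: eqP => [_|h]; [rewrite TV0 sub0r (_ : sg (-1) = -1) // mulrNz mulr1z opprK|lia].
case: (ltP l 0) => l0; first by rewrite zbN // mulr0 mulr0z.
rewrite !smonoE; case: eqP => h1.
  have lc : l = c by lia.
  have c0 : 0 <= c by lia.
  by move: hl; rewrite c0 lc eqxx.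
case: eqP => h2; last by rewrite TV0 mul0rz subr0 mul0rz.
have lc : l = -1 - c by lia.
have c0 : (0 <= c) = false by lia.
by move: hl; rewrite c0 lc eqxx.
Qed.

(** omega is omega_(-1) 1, and on the identity only T_(-1) and the central
    term of the operator of - y^(-1) d/dy are nonzero. *)
Lemma YWmap_omega n w : mode YWmap (omega el) n w =
  zsum (fun i => (lmono n * p ^+ 2) i *: T i w) + (alpha p (lmono n * p) * el) *: w.
Proof.
rewrite /mode /YWmap -[omega el]/(om (-1) vac) YF_om // YF_vac // coord_opE; last exact: idf_local.
rewrite (@zsum_pt _ _ (-1)) => [|j /eqP hj]; last first.
  case: (ltP j (-1)) => j1; first by rewrite gP_dom // scale0r.
  by rewrite Tm_idf ?scaler0 //; lia.
rewrite gP_bot exprN1 invrK -expr2.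
rewrite fctDE !fctZE scoefD; congr (_ + _).
  rewrite scoefZ (zsum_shift _ (- n)); apply: eq_zsum => i.
  rewrite Tm_idf_bot lcoef_lmonoM; congr (_ *: T _ w); lia.
pose Q := 2 *: lderiv (lderiv p) - p^-1 * lderiv p ^+ 2.
have EQ : 2 *: lderiv (lderiv P) - P^-1 * lderiv P ^+ 2 = ts Q.
  have tN f : ts (- f : k) = - ts f by have := morph_mulrz f (-1) (@tsD K); rewrite !mulrN1z.
  by rewrite /Q !scaler_nat !mulr2n !tsD tN !expr2 !tsM (ts_p_inv p0) /PP !lderiv_ts.
have [h1 h2] := ldomX (-1) (gg_dom p0) (gg1_neq0 p0).
have EA : alpha P (g ^ (-1)) = 24^-1 * (p * Q).
  rewrite /alpha EQ; congr (_ * _); rewrite /res lcoefM (@zsum_pt _ _ (-1)) => [|i /eqP hi].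
    by rewrite h2 gg1 exprN1 invrK subrr tsE hdl0.
  case: (ltP i (-1)) => i1; first by rewrite h1 // mul0r.
  by rewrite ts_dom ?mulr0 //; lia.
rewrite scoefZ (@zsum_pt _ _ (- n - 1)) => [|i /eqP hi]; last first.
  by rewrite smonoE; case: eqP => [h|_]; [lia|rewrite scaler0].
rewrite smonoE subrr eqxx [_ * lC el]mulrC lcoef_lCM mulrC; congr ((_ * _) *: _).
rewrite EA -(lC_natV K 24) lcoef_lCM /alpha -/Q /res -mulrA lcoef_lmonoM; congr (_ * _).
by congr (lcoef _ _); lia.
Qed.
End RestrictedToPhi.

(** * Exchanging the two variables *)

(** The difference of the two expansions of (z1 - z2)^(- q) is a multiple of
    the derivative of order q - 1 of the delta function. *)
Lemma zb_inv_diff (q : nat) (i : int) :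
  zb i (q%:Z - 1) = sg (i - q%:Z + 1) * zb (- q%:Z) (i - q%:Z + 1) -
    sg q%:Z * (sg (-1 - i) * zb (- q%:Z) (-1 - i)).
Proof.
pose R (q : nat) i := sg (i - q%:Z + 1) * zb (- q%:Z) (i - q%:Z + 1) -
    sg q%:Z * (sg (-1 - i) * zb (- q%:Z) (-1 - i)).
rewrite -/(R q i); elim: q i => [|q IH] i.
  rewrite zbN // /R oppr0 sg0 mul1r !zb0 !subr0.
  have -> : (-1 - i == 0) = (i + 1 == 0) by apply/eqP/eqP; lia.
  case: eqP => h; last by rewrite !mulr0 subrr.
  by rewrite h (_ : -1 - i = 0) ?subrr //; lia.
have step j : R q.+1 (j + 1) - R q.+1 j = zb j (q%:Z - 1).
  rewrite IH /R.
  have -> : j + 1 - q.+1%:Z + 1 = j - q%:Z + 1 by lia.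
  have -> : j - q.+1%:Z + 1 = j - q%:Z by lia.
  have -> : -1 - (j + 1) = -1 - j - 1 by lia.
  have -> : sg q.+1%:Z = - sg q%:Z by rewrite (_ : q.+1%:Z = q%:Z + 1) ?sgS //; lia.
  have E1 := zbS (- q.+1%:Z) (j - q%:Z + 1); rewrite addrK in E1.
  have E2 := zbS (- q.+1%:Z) (-1 - j).
  have qq : - q.+1%:Z + 1 = - q%:Z by lia.
  rewrite qq in E1 E2; rewrite E1 E2 sgP sgS; ring.
have base : R q.+1 0 = zb 0 q%:Z.
  rewrite /R (@zbN _ (-1 - 0)) // !mulr0 subr0 zb0; case: q {IH step} => [|q].
    by rewrite zb0l.
  by rewrite zbN ?mulr0 //; lia.
have -> : q.+1%:Z - 1 = q%:Z by lia.
elim/int_ind2: i => [|i IHi|i IHi]; first by rewrite base.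
  have := step i; rewrite -IHi => /eqP; rewrite subr_eq => /eqP ->.
  by rewrite zbS addrC.
have := step i; rewrite -IHi zbS => /eqP; rewrite subr_eq addrC => /eqP E.
by move: E; move: (zb i (q%:Z - 1)) (zb i q) (R q.+1 i) => a b c; lia.
Qed.

(** The binomial identity behind exchanging the origin z with the point z + s.
    *)
Lemma zb_reflect (m n j : int) :
  zsum (fun r => sg r * zb j r * zb (m + n - r) (n - r)) = zb (m + n - j) n.
Proof.
have fs j' n' : fsup (fun r => sg r * zb j' r * zb (m + n' - r) (n' - r)).
  apply: (@fsupP _ _ 0 n') => r hr; first by rewrite (zbN j') ?mulr0 ?mul0r.
  by rewrite (@zbN _ (n' - r)) ?mulr0 //; lia.
pose L j n := zsum (fun r => sg r * zb j r * zb (m + n - r) (n - r)).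
have LS j' n' : L (j' + 1) n' = L j' n' - L j' (n' - 1).
  rewrite /L [X in _ - X](zsum_shift _ (-1)) -zsumB //; last first.
    have [N hN] := fs j' (n' - 1); exists N.+1 => r hr; apply: hN; lia.
  apply: eq_zsum => r; rewrite zbS sgP.
  have -> : m + (n' - 1) - (r + -1) = m + n' - r by lia.
  have -> : n' - 1 - (r + -1) = n' - r by lia.
  ring.
suff : (L j n - zb (m + n - j) n) * sg n = 0.
  move=> /eqP; rewrite mulf_eq0 => /orP[|/eqP h].
    by rewrite subr_eq0 => /eqP.
  by have := sg_sqr n; rewrite h mul0r.
apply: (@pascal0 _ (fun j n => (L j n - zb (m + n - j) n) * sg n)) => [j' n'|n'|j' n' hn].
- rewrite LS sgP; have := zbS (m + n' - j' - 1) n'; rewrite subrK => E.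
  have -> : m + n' - (j' + 1) = m + n' - j' - 1 by lia.
  have -> : m + (n' - 1) - j' = m + n' - j' - 1 by lia.
  rewrite E; ring.
- rewrite /L (@zsum_pt _ _ 0) => [|r /negPf r0]; last by rewrite zb0 r0 mulr0 mul0r.
  by rewrite zb0 eqxx sg0 !subr0 !mul1r subrr mul0r.
- rewrite (@zbN _ n') // subr0 /L zsum0 ?mul0r // => r.
  case: (ltP r 0) => hr; first by rewrite (zbN j') ?mulr0 ?mul0r.
  by rewrite (@zbN _ (n' - r)) ?mulr0 //; lia.
Qed.

Section Transpose.
Variables (K : fieldType) (W : lmodType K).
Notation k := (laurent K).
Implicit Types (A B : int -> int -> W).

Definition tr A i j : W := A j i.

Lemma mulz12_tr q A : mulz12 q (tr A) = fun i j => mulz12 q A j i *~ sg q%:Z.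
Proof.
elim: q => [|q IH]; first by apply/funext => i; apply/funext => j; rewrite sg0 mulr1z.
rewrite !mulz12S IH; apply/funext => i; apply/funext => j.
have -> : q.+1%:Z = q%:Z + 1 by lia.
by rewrite /z12 sgS -mulrzBl mulrNz -mulNrz opprB.
Qed.

Lemma zpow_z12 r A : raw A -> zpow r (z12 A) = z12 (zpow r A).
Proof.
move=> hA; apply/funext => i; apply/funext => j; rewrite /z12 /zpow -zsumB; try exact: zpow_fsup.
apply: eq_zsum => l; rewrite mulrzBl; congr (A _ _ *~ _ - A _ _ *~ _); lia.
Qed.
Lemma zpow_mulz12 q A : raw A -> zpow (- q%:Z) (mulz12 q A) = A.
Proof.
move=> hA; have E n r : zpow r (mulz12 n A) = mulz12 n (zpow r A).
  by elim: n => // n IH; rewrite !mulz12S zpow_z12 ?IH //; apply: raw_mulz12.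
by rewrite E mulz12_zpow // addNr zpow0.
Qed.

(** The residue in z1 of the difference of the two expansions of
    (z1 - z2)^(-q) B. *)
Lemma res_difference q A A' B j : raw A -> raw (tr A') ->
  mulz12 q A = B -> mulz12 q A' = B -> ltrunc2 B ->
  A (-1) j - A' (-1) j = tay (q%:Z - 1) B j.
Proof.
move=> rA rA' EA EA' hB.
have E1 : A (-1) j = zsum (fun l => B (-1 + q%:Z + l) (j - l) *~ (sg l * zb (- q%:Z) l)).
  by rewrite -{1}(zpow_mulz12 q rA) EA /zpow opprK.
have E2 : A' (-1) j = zsum (fun l => B (-1 - l) (j + q%:Z + l) *~ sg q%:Z *~ (sg l * zb (- q%:Z) l)).
  rewrite -[A' (-1) j]/(tr A' j (-1)) -{1}(zpow_mulz12 q rA') mulz12_tr EA' /zpow.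
  by apply: eq_zsum => l; rewrite opprK.
rewrite E1 E2 (zsum_shift (fun l => B (-1 + q%:Z + l) (j - l) *~ _) (- q%:Z + 1)).
rewrite [X in _ - X](zsum_rev _ (-1)).
have fs (F : int -> int) : fsup (fun i => B i (j + (q%:Z - 1) - i) *~ F i).
  exact: diag_fsup.
rewrite /tay -(eq_zsum (F := fun i => B i (j + (q%:Z - 1) - i) *~ (sg (i - q%:Z + 1) * zb (- q%:Z) (i - q%:Z + 1)))).
  rewrite -[X in _ - X](eq_zsum (F := fun i => B i (j + (q%:Z - 1) - i) *~ (sg q%:Z * (sg (-1 - i) * zb (- q%:Z) (-1 - i))))).
    rewrite -zsumB; try exact: fs.
    by apply: eq_zsum => i; rewrite -mulrzBr -zb_inv_diff.
  by move=> i; rewrite -mulrzA; congr (B _ _ *~ (_ * (sg _ * zb _ _))); lia.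
by move=> i; congr (B _ _ *~ (sg _ * zb _ _)); lia.
Qed.

(** Exchanging the two variables takes (z, s) to (z + s, - s). *)
Lemma tay_tr n A m : ltrunc2 A ->
  tay n (tr A) m = zsum (fun r => tay r A (m + n - r) *~ (sg r * zb (m + n - r) (n - r))).
Proof.
move=> hA; have [N hN] := hA.
pose G r i := A i (m + n - i) *~ (sg r * zb i r * zb (m + n - r) (n - r)).
transitivity (zsum (fun i => zsum (fun r => G r i))).
  rewrite /tay (zsum_rev _ (m + n)).
  apply: eq_zsum => i; rewrite /G -zsum_mulrzr.
    rewrite zb_reflect /tr; congr (A _ _ *~ zb _ _); lia.
  apply: (@fsupP _ _ 0 n) => r hr; first by rewrite (zbN i) ?mulr0 ?mul0r.
  by rewrite (@zbN _ (n - r)) ?mulr0 //; lia.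
have G0 r i : r < 0 \/ n < r \/ i < N \/ m + n - i < N -> G r i = 0.
  rewrite /G => -[h|[h|[h|h]]].
  - by rewrite (zbN i) // mulr0 mul0r mulr0z.
  - by rewrite (@zbN _ (n - r)) ?mulr0 ?mulr0z //; lia.
  - by rewrite hN ?mul0rz // h.
  - by rewrite hN ?mul0rz // h orbT.
rewrite (@zsum_exchange _ _ (`|N| + `|n| + `|m|)%N) => [|i r hi|i r hr]; try by apply: G0; lia.
apply: eq_zsum => r; rewrite /tay zsum_mulrz; last exact: diag_fsup.
apply: eq_zsum => i; rewrite /G -!mulrzA; congr (A _ _ *~ _); [lia|ring].
Qed.

(** On each line i + j = d only finitely many coefficients are nonzero, and
    the expansion is a triangular system for them. *)
Lemma tay_inj A : ltrunc2 A -> (forall n m, tay n A m = 0) -> forall i j, A i j = 0.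
Proof.
move=> hA h0; have [N hN] := hA.
(* After this shift only nonnegative powers of z1 occur, for which the matrix
   zb is unipotent. *)
pose B := mul1 (lmono (- N) : k) A.
have BE i j : B i j = A (i + N) j.
  rewrite /B /mul1 (@zsum_pt _ _ (- N)) ?lmonoE ?eqxx ?scale1r ?opprK // => r /negPf hr.
  by rewrite lmonoE hr scale0r.
have hB := ltrunc2_mul1 (lmono (- N)) hA : ltrunc2 B.
have tB n m : tay n B m = 0.
  rewrite tay_mul1 //; apply: zsum0 => a; apply: zsum0 => r; by rewrite h0 scaler0.
suff H d i : B i (d - i) = 0.
  by move=> i j; have := H (j + (i - N)) (i - N); rewrite BE subrK addrK.
have [M hM] := hB.
have H (t : nat) : forall i, `|d - M|%N%:Z - t%:Z < i -> B i (d - i) = 0.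
  elim: t => [|t IH] i' hi; first by apply: hM; lia.
  case: (ltP (`|d - M|%N%:Z - t%:Z) i') => hi'; first exact: IH.
  case: (ltP i' 0) => i0; first by rewrite BE hN //; lia.
  have := tB i' (d - i'); rewrite /tay (@zsum_pt _ _ i') => [|i'' /eqP hne].
    by rewrite subrK (_ : zb i' i' = 1) ?mulr1z //; case: i' i0 {hi hi'} => // i' _; rewrite /zb binn.
  rewrite subrK; case: (ltP i'' 0) => i0'; first by rewrite BE hN ?mul0rz //; lia.
  case: (ltP i'' i') => lt; last by rewrite IH ?mul0rz //; lia.
  by rewrite zb_large ?mulr0z //; lia.
by apply: (H (`|d - M| + `|i|).+1); lia.
Qed.

(** tau exchanges the roles of the expansion point and of the shifted point:
    X(z, s) becomes X(z + s, - s). *)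
Lemma tau_subproof (X : lser (lser W)) :
  ltrunc (fun N => zsum (fun r => hd (N - r) (X r) *~ sg r)).
Proof.
have [s hs] := sdom_ex X; exists s => N hN; apply: zsum0 => r.
case: (ltP r s) => hr; first by rewrite hs // (_ : hd _ 0 = 0) ?mul0rz //; apply: lserP => c; rewrite hdE scoef0 mul0rz.
by rewrite hdN ?mul0rz //; lia.
Qed.
Definition tau X : lser (lser W) := LSer (tau_subproof X).
Lemma hd_0 n : hd n (0 : lser W) = 0.
Proof. by apply: lserP => c; rewrite hdE scoef0 mul0rz. Qed.
Lemma tauE X N : tau X N = zsum (fun r => hd (N - r) (X r) *~ sg r).
Proof. by []. Qed.
Lemma tau_fsup (X : lser (lser W)) N : fsup (fun r => hd (N - r) (X r) *~ sg r).
Proof.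
have [s hs] := sdom_ex X; apply: (@fsupP _ _ s N) => r hr; first by rewrite hs // hd_0 mul0rz.
by rewrite hdN ?mul0rz //; lia.
Qed.
Lemma tauD X Y : tau (X + Y) = tau X + tau Y.
Proof.
apply: lserP => N; rewrite scoefD !tauE -zsumD; try exact: tau_fsup.
by apply: eq_zsum => r; rewrite scoefD hdD mulrzDl.
Qed.
Lemma tau_dom X s : sdom X s -> sdom (tau X) s.
Proof.
move=> hs N hN; rewrite tauE; apply: zsum0 => r.
case: (ltP r s) => hr; first by rewrite hs // hd_0 mul0rz.
by rewrite hdN ?mul0rz //; lia.
Qed.

Lemma tayS_tr A : ltrunc2 A -> tayS (tr A) = tau (tayS A).
Proof.
move=> hA; apply: lserP => n; apply: lserP => m.
have htr : ltrunc2 (tr A) by have [N hN] := hA; exists N => i j hij; apply: hN; rewrite orbC.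
rewrite tayE // tay_tr // tauE scoef_zsum; last exact: tau_fsup.
apply: eq_zsum => r; rewrite scoef_mulrz hdE tayE // -mulrzA mulrC.
by rewrite (_ : m + (n - r) = m + n - r) //; lia.
Qed.

Lemma taul_subproof (f : laurent k) :
  ltrunc (fun N => zsum (fun r => hdl (N - r) (f r) *~ sg r)).
Proof.
have [s hs] := ldom_ex f; exists s => N hN; apply: zsum0 => r.
case: (ltP r s) => hr; first by rewrite hs // (_ : hdl _ 0 = 0) ?mul0rz //; apply: laurentP => c; rewrite hdlE lcoef0 mul0rz.
by rewrite hdlN ?mul0rz //; lia.
Qed.
(** The operation tau on scalar series. *)
Definition taul f : laurent k := Laurent (taul_subproof f).
Lemma taulE f N : taul f N = zsum (fun r => hdl (N - r) (f r) *~ sg r).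
Proof. by []. Qed.
Lemma hdl_0 n : hdl n (0 : k) = 0.
Proof. by apply: laurentP => c; rewrite hdlE lcoef0 mul0rz. Qed.
Lemma hdlD n (f h : k) : hdl n (f + h) = hdl n f + hdl n h.
Proof. by rewrite -!tsE tsD lcoefD. Qed.
Lemma taul_fsup (f : laurent k) N : fsup (fun r => hdl (N - r) (f r) *~ sg r).
Proof.
have [s hs] := ldom_ex f; apply: (@fsupP _ _ s N) => r hr; first by rewrite hs // hdl_0 mul0rz.
by rewrite hdlN ?mul0rz //; lia.
Qed.
Lemma taulD f h : taul (f + h) = taul f + taul h.
Proof.
apply: laurentP => N; rewrite lcoefD !taulE -zsumD; try exact: taul_fsup.
by apply: eq_zsum => r; rewrite lcoefD hdlD mulrzDl.
Qed.
Lemma taul_dom f s : ldom f s -> ldom (taul f) s.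
Proof.
move=> hs N hN; rewrite taulE; apply: zsum0 => r.
case: (ltP r s) => hr; first by rewrite hs // hdl_0 mul0rz.
by rewrite hdlN ?mul0rz //; lia.
Qed.
Lemma taul_mono (c : k) n : taul (lC c * lmono n) = lmono n * ts c *~ sg n.
Proof.
apply: laurentP => N; rewrite taulE.
have E r : (lC c * lmono n) r = if r == n then c else 0.
  by rewrite lcoef_lCM lmonoE; case: eqP => _; rewrite ?mulr1 ?mulr0.
rewrite (@zsum_pt _ (fun r => hdl (N - r) ((lC c * lmono n) r) *~ sg r) n) => [|r /negPf rn].
  by rewrite E eqxx [RHS]lcoef_mulrz [(lmono n * _) N]lcoef_lmonoM.
by rewrite E rn hdl_0 mul0rz.
Qed.
Lemma tau_mono n X : tau (lmono n *: X) = lmono n *: tau X *~ sg n.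
Proof.
apply: lserP => N; rewrite scoef_mulrz scoef_monoZ !tauE (zsum_shift _ n) zsum_mulrz; last exact: tau_fsup.
apply: eq_zsum => r; rewrite scoef_monoZ addrK sgD mulrzA.
by rewrite (_ : N - (r + n) = N - n - r) //; lia.
Qed.
Lemma tau_lC (c : k) X : tau (lC c *: X) = ts c *: tau X.
Proof.
apply: lserP => N; rewrite scoefZ tauE.
have [s hs] := sdom_ex X.
pose G r a := hdl a c *: hd (N - r - a) (X r) *~ sg r.
have G0 r a : r < s \/ a < 0 \/ N < r + a -> G r a = 0.
  rewrite /G => -[h|[h|h]].
  - by rewrite hs // hd_0 scaler0 mul0rz.
  - by rewrite hdlN // scale0r mul0rz.
  - by rewrite hdN ?scaler0 ?mul0rz //; lia.
transitivity (zsum (fun r => zsum (fun a => G r a))).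
  apply: eq_zsum => r; rewrite scoef_lCZ hd_scale zsum_mulrz //.
  apply: (@fsupP _ _ 0 (N - r)) => a ha; first by rewrite hdlN // scale0r.
  by rewrite hdN ?scaler0 //; lia.
rewrite (@zsum_exchange _ _ (`|s| + `|N|)%N) => [|r a hr|r a ha]; try by apply: G0; lia.
apply: eq_zsum => a; rewrite tauE zsum_scale; last exact: tau_fsup.
apply: eq_zsum => r; rewrite /G scalerMzr (_ : N - a - r = N - r - a) //; lia.
Qed.

Lemma tau_scale (f : laurent k) X : tau (f *: X) = taul f *: tau X.
Proof.
apply: lserP => N; have [s hs] := sdom_ex X; have hts := tau_dom hs.
elim/laurent_span: f => [f h Ef Eh|c n|].
- by rewrite scalerDl tauD scoefD Ef Eh -scoefD -scalerDl -taulD.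
- rewrite -lC_mul -scalerA tau_lC tau_mono taul_mono -scalerMzr scalerMzl scalerA.
  by rewrite mulrzAl [ts c * _]mulrC.
exists (N - s + 1) => f hf.
have d1 : sdom (f *: X) (N + 1).
  move=> i hi; rewrite scoefZ; apply: zsum0 => j.
  case: (ltP j (N - s + 1)) => hj; first by rewrite hf // scale0r.
  by rewrite hs ?scaler0 //; lia.
rewrite (tau_dom d1); last by lia.
rewrite scoefZ zsum0 // => j; case: (ltP j (N - s + 1)) => hj.
  by rewrite (taul_dom hf) // scale0r.
by rewrite hts ?scaler0 //; lia.
Qed.
Lemma tau_const y : tau (smono 0 y) = tsm y.
Proof.
apply: lserP => N; rewrite tauE (@zsum_pt _ _ 0).
  by rewrite smonoE eqxx subr0 sg0 mulr1z tsmE.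
by move=> r /negPf r0; rewrite smonoE r0 hd_0 mul0rz.
Qed.

(** The chain rule for X(z + s, - s). *)
Lemma lderiv_taul f : lderiv (taul f) = taul (nabla f).
Proof.
apply: laurentP => N; rewrite lcoef_deriv !taulE zsum_mulrz; last exact: taul_fsup.
pose U r := hdl (N + 1 - r) (f r) *~ (sg r * (N + 1 - r)).
pose V r := hdl (N - r) (f (r + 1)) *~ (sg r * (r + 1)).
have fU : fsup U.
  by have [M hM] := taul_fsup f (N + 1); exists M => r hr; rewrite /U mulrzA hM // mul0rz.
have fV : fsup V.
  have [s hs] := ldom_ex f; apply: (@fsupP _ _ (s - 1) N) => r hr.
    by rewrite /V hs ?hdl_0 ?mul0rz //; lia.
  by rewrite /V hdlN ?mul0rz //; lia.
have E r : hdl (N - r) (nabla f r) *~ sg r = U r - V r.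
  have hB (a b : k) n : hdl n (a - b) = hdl n a - hdl n b.
    by apply: (@addIr _ (hdl n b)); rewrite -hdlD !subrK.
  have hz (a : k) n z : hdl n (a *~ z) = hdl n a *~ z by apply: (morph_mulrz _ _ (hdlD n)).
  rewrite /nabla lcoefB dzE lcoef_deriv hB hdl_lderiv hz mulrzBl /U /V.
  rewrite (_ : N - r + 1 = N + 1 - r); last by lia.
  by rewrite -!mulrzA ![_ * sg r]mulrC.
rewrite (eq_zsum E) zsumB // [X in _ = _ - X](zsum_shift _ (-1)) -zsumB //; last first.
  by have [M hM] := fV; exists M.+1 => r hr; apply: hM; lia.
apply: eq_zsum => r; rewrite /U /V subrK sgP.
rewrite (_ : N - (r + -1) = N + 1 - r); last by lia.
by rewrite -mulrzBr -mulrzA; congr (_ *~ _); ring.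
Qed.
End Transpose.

(** * Skew symmetry and residues in the coordinate g *)

Section Skew.
Variables (K : fieldType) (ch : char0 K) (p : laurent K) (p0 : p != 0) (W : lmodType K).
Notation k := (laurent K).
Notation kk := (laurent k).
Notation P := (PP p).
Notation g := (gg p0).
Let gd := gg_dom p0.
Let g1 := gg1_neq0 p0.

Lemma lser_span (M : zmodType) (Q : lser M -> Prop) :
  (forall x y, Q x -> Q y -> Q (x + y)) -> (forall n c, Q (smono n c)) ->
  (exists N, forall x, sdom x N -> Q x) -> forall x, Q x.
Proof.
move=> QD Qm [N QN] x; have [s hs] := sdom_ex x.
have : forall (n : nat) y, sdom y (N - n%:Z) -> Q y.
  elim=> [|n IH] y hy; first by apply: QN; rewrite subr0 in hy.
  set t := N - _ in hy.
  have -> : y = (y - smono t (y t)) + smono t (y t) by rewrite subrK.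
  apply: QD => //; apply: IH => i hi; rewrite scoefB smonoE.
  case: eqP => [->|ti]; first by rewrite subrr.
  by rewrite hy ?subr0 //; lia.
by move=> /(_ `|N - s|%N); apply; apply: (sdomW hs); lia.
Qed.

(** The function g(z, s), an integral of 1/p from z to z + s, is odd under the
    exchange of its endpoints. *)
Lemma taul_gg : taul g = - g.
Proof.
have E : lderiv (taul g + g) = 0.
  rewrite lderivD lderiv_taul (nabla_gg ch p0) lderiv_ggE //.
  have -> : - lC p^-1 = lC (- p^-1) * lmono 0 :> kk by rewrite lmono0 mulr1 rmorphN.
  rewrite taul_mono lmono0 mul1r sg0 mulr1z -(ts_p_inv p0).
  have := morph_mulrz p^-1 (-1) (@tsD K); rewrite !mulrN1z => ->.
  by rewrite addNr.
apply/eqP; rewrite -subr_eq0 opprK; apply/eqP; apply: laurentP => n; rewrite lcoef0.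
have [->|n0] := eqVneq n 0.
  by rewrite lcoefD (taul_dom gd) // gd // addr0.
have /(congr1 (fun f : kk => f (n - 1))) := E.
rewrite lcoef_deriv lcoef0 subrK -mulrzr => /eqP; rewrite mulf_eq0 => /orP[/eqP //|].
by rewrite (negPf (char0_int (char0_laurent ch) n0)).
Qed.

Lemma tau_ggX n (X : lser (lser W)) : tau (g ^ n *: X) = (g ^ n *: tau X) *~ sg n.
Proof.
have g0 := gg_neq0 p0.
have T1 Z : tau (g *: Z) = - (g *: tau Z) by rewrite tau_scale taul_gg scaleNr.
elim/int_ind2: n X => [|n IH|n IH] X.
- by rewrite expr0z !scale1r sg0 mulr1z.
- by rewrite expfzDr // expr1z -!scalerA IH T1 scalerN sgS mulNrz mulrNz.
have -> : X = g *: (g^-1 *: X) by rewrite scalerA divff // scale1r.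
have Eg : g ^ (n + 1) = g ^ n * g by rewrite expfzDr // expr1z.
rewrite scalerA -Eg.
rewrite IH T1 scalerN sgS mulrNz mulNrz; congr (- (_ *~ _)).
by rewrite Eg -scalerA.
Qed.

Lemma scomp_const (x : lser W) : scomp g (smono 0 x) = smono 0 x.
Proof.
apply: lserP => N; rewrite scompE // (@zsum_pt _ _ 0) => [|l /negPf l0]; last by rewrite smonoE l0 scaler0.
by rewrite !smonoE eqxx expr0z lcoef1; case: eqP => _; rewrite ?scale1r ?scale0r.
Qed.

(** As g is odd, g(s)^m X_m(z) becomes (-1)^m g(s)^m X_m(z + s). *)
Lemma tau_scomp (X : lser (lser W)) N :
  tau (scomp g X) N = zsum (fun m => (g ^ m *: tsm (X m)) N *~ sg m).
Proof.
have tsm0 : tsm (0 : lser W) = 0.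
  by apply: lserP => j; rewrite tsmE hd_0.
have d (m : int) (x : lser W) : sdom (g ^ m *: tsm x) m.
  move=> i hi; rewrite scoefZ; apply: zsum0 => j; have [h _] := ldomX m gd g1.
  case: (ltP j m) => jm; first by rewrite h // scale0r.
  by rewrite tsmE hdN ?scaler0 //; lia.
have fs (Y : lser (lser W)) : fsup (fun m => (g ^ m *: tsm (Y m)) N *~ sg m).
  have [s hs] := sdom_ex Y; apply: (@fsupP _ _ s N) => m hm.
    by rewrite hs // tsm0 scaler0 scoef0 mul0rz.
  by rewrite d // mul0rz.
elim/lser_span: X => [X Y EX EY|n c|].
- rewrite scompD // tauD scoefD EX EY -zsumD //; apply: eq_zsum => m.
  by rewrite scoefD tsmD scalerDr scoefD mulrzDl.
- have E : smono n c = lmono n *: smono 0 c.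
    by apply: lserP => j; rewrite scoef_monoZ !smonoE subr_eq0.
  rewrite {1}E scomp_mono // scomp_const tau_ggX tau_const scoef_mulrz (@zsum_pt _ _ n).
    by rewrite smonoE eqxx.
  move=> m /negPf mn; rewrite smonoE mn tsm0 scaler0 scoef0 mul0rz //.
exists (N + 1) => X hX; rewrite (tau_dom (scomp_dom gd g1 hX)); last by lia.
apply/esym; apply: zsum0 => m; case: (ltP m (N + 1)) => hm.
  by rewrite hX // tsm0 scaler0 scoef0 mul0rz.
by rewrite d ?mul0rz //; lia.
Qed.

(** If X(y) = exp(y D) X(- y), then X(g(s)) is invariant under the exchange of
    z and z + s. *)
Lemma skew_tau (X : lser (lser W)) (Ex : int -> lser (lser W)) (s : int) :
  (forall m, m < s -> Ex m = 0) -> (forall m, sdom (Ex m) 0) ->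
  (forall m, tsm (X m) = scomp g (Ex m)) ->
  (forall n, X n = zsum (fun i => Ex (n - i) i *~ sg (n - i))) ->
  tau (scomp g X) = scomp g X.
Proof.
move=> E0 dE hE hX; apply: lserP => N; rewrite tau_scomp scompE //.
pose G m n := (g ^ n) N *: Ex m (n - m) *~ sg m.
have G0 m n : m < s \/ n < m \/ N < n -> G m n = 0.
  rewrite /G => -[h|[h|h]].
  - by rewrite E0 // scoef0 scaler0 mul0rz.
  - by rewrite dE ?scaler0 ?mul0rz //; lia.
  - have [hd _] := ldomX n gd g1; by rewrite hd // scale0r mul0rz.
transitivity (zsum (fun m => zsum (fun n => G m n))).
  apply: eq_zsum => m; rewrite hE -scomp_mono // scompE // zsum_mulrz; last exact: scomp_fsup.
  by apply: eq_zsum => n; rewrite scoef_monoZ.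
rewrite (@zsum_exchange _ _ (`|s| + `|N|)%N) => [|m n hm|m n hn]; try by apply: G0; lia.
apply: eq_zsum => n; rewrite hX (zsum_rev _ n) zsum_scale.
  by apply: eq_zsum => m; rewrite /G scalerMzr subKr.
apply: (@fsupP _ _ 0 (n - s)) => i hi; first by rewrite dE ?mul0rz.
by rewrite E0 ?scoef0 ?mul0rz //; lia.
Qed.

Lemma mul_cancel (F : fieldType) (a b c d : F) : c != 0 ->
  b * c * (d * a / c) = d * (b * a).
Proof. by move=> c0; field. Qed.

(** Residues of f(z + s) / g(s)^(j + 1) are, up to factorials, Taylor
    coefficients of f p in the coordinate g; the recursion is an integration
    by parts. *)
Lemma res_ts_rec (f : k) (j : int) :
  res (ts f * g ^ (- j - 1)) *~ j = res (ts (lderiv (f * p)) * g ^ (- j)).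
Proof.
have := res_lderiv (ts (f * p) * g ^ (- j)).
rewrite lderivM (lderiv_ggX ch p0) lderiv_ts tsM.
have -> : ts f * ts p * ((- j)%:~R * g ^ (- j - 1) / P) = - ((ts f * g ^ (- j - 1)) *~ j).
  rewrite mulrNz !mulNr mulrN; congr (- _); rewrite -[RHS]mulrzl.
  exact: mul_cancel (PP_neq0 p0).
rewrite /res lcoefD lcoefN lcoef_mulrz => /eqP; rewrite subr_eq0 => /eqP <-.
by rewrite [f * p]mulrC.
Qed.
Lemma res_ts1 (f : k) : res (ts f * g ^ (-1)) = f * p.
Proof.
have [h1 h2] := ldomX (-1) gd g1.
rewrite mulrC /res lcoefM (@zsum_pt _ _ (-1)) => [|i /eqP hi].
  by rewrite h2 gg1 exprN1 invrK subrr tsE hdl0 mulrC.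
case: (ltP i (-1)) => i1; first by rewrite h1 // mul0r.
by rewrite ts_dom ?mulr0 //; lia.
Qed.
Lemma res_ts_ge (f : k) (l : int) : 0 <= l -> res (ts f * g ^ l) = 0.
Proof.
move=> l0; have [h1 _] := ldomX l gd g1.
by rewrite /res (ldomM (@ts_dom K f) h1) //; lia.
Qed.
Lemma res_ts2 (f : k) : res (ts f * g ^ (-2)) = pd p (f * p).
Proof.
have := res_ts_rec f 1; rewrite mulr1z => ->.
by rewrite res_ts1 mulrC.
Qed.
Lemma res_ts4 (f : k) : res (ts f * g ^ (-4)) *~ (3 * 2) = pd p (pd p (pd p (f * p))).
Proof.
have r3 := res_ts_rec f 3; rewrite (_ : - 3 - 1 = -4) // in r3.
rewrite mulrzA r3.
have r2 := res_ts_rec (lderiv (f * p)) 2; rewrite (_ : - 2 - 1 = -3) // in r2.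
rewrite r2 res_ts2 /pd.
by rewrite !(mulrC p).
Qed.
End Skew.

(** * phi-coordinated modules are restricted modules *)

Section RawMul.
Variables (K : fieldType) (W : lmodType K).
Implicit Types A : int -> int -> W.

Lemma raw_mul1 (f : laurent K) A : raw A -> raw (mul1 f A).
Proof.
move=> [[N hN] h]; have [s hs] := ldom_ex f; split.
  by exists N => i j hj; apply: zsum0 => r; rewrite hN // scaler0.
move=> j; have [M hM] := h j; exists (s + M) => i hi; apply: zsum0 => r.
case: (ltP r s) => hr; first by rewrite hs // scale0r.
by rewrite hM ?scaler0 //; lia.
Qed.

Lemma raw_mul2 (f : laurent K) A : raw A -> raw (mul2 f A).
Proof.
move=> [[N hN] h]; have [s hs] := ldom_ex f; split.
  exists (N + s) => i j hj; apply: zsum0 => r.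
  case: (ltP r s) => hr; first by rewrite hs // scale0r.
  by rewrite hN ?scaler0 //; lia.
move=> j; have H (n : nat) : exists M, forall j', j' < N + n%:Z -> forall i, i < M -> A i j' = 0.
  elim: n => [|n [M hM]]; first by exists 0 => j' hj' i _; apply: hN; lia.
  have [M' hM'] := h (N + n%:Z); exists (Num.min M M') => j' hj' i hi.
  by case: (j' =P N + n%:Z) => [->|ne]; [apply: hM'; lia|apply: hM; lia].
have [M hM] := H `|(j - s - N + 1)%R|%N; exists M => i hi; apply: zsum0 => r.
case: (ltP r s) => hr; first by rewrite hs // scale0r.
by rewrite hM ?scaler0 //; lia.
Qed.
End RawMul.

Section PhiModule.
Variables (K : fieldType) (ch : char0 K) (el : K).
Notation V := (virmod el).
Notation vac := (vacuum el).
Variables (Y : V -> V -> int -> V) (YV : is_vertex_algebra Y vac).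
Hypothesis Y_omega : forall (n : int) (v : V), mode Y (omega el) n v = om n v.
Variables (p : laurent K) (p0 : p != 0).
Variables (W : lmodType K) (YW : V -> W -> int -> W) (PM : is_phi_module p Y vac YW).
Notation k := (laurent K).
Notation kk := (laurent k).
Notation H := (W -> lser W).
Notation P := (PP p).
Notation g := (gg p0).
Let gd := gg_dom p0.
Let g1 := gg1_neq0 p0.
Let chk := char0_laurent ch.
Let VM := phi_vertex_map PM.

Definition FW (u : V) : H := fun w => mks (YW u w).
Lemma FWE u w m : FW u w m = YW u w m.
Proof. by rewrite /FW mksE //; apply: vertex_map_trunc VM u w. Qed.
Lemma FW_lin u : linf (FW u).
Proof.
move=> c w w'; apply: lserP => m; rewrite scoefD scoef_lCZ !FWE.
exact: (vertex_map_linearr VM).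
Qed.
Lemma FWD u v w : FW (u + v) w = FW u w + FW v w.
Proof.
apply: lserP => m; rewrite scoefD !FWE.
by have := vertex_map_linearl VM w m 1 u v; rewrite !scale1r.
Qed.
Lemma FW0 w : FW 0 w = 0.
Proof. by apply: (@addrI _ (FW 0 w)); rewrite -FWD !addr0. Qed.
Lemma FWZ c u w : FW (c *: u) w = lC c *: FW u w.
Proof.
apply: lserP => m; rewrite scoef_lCZ !FWE.
have := vertex_map_linearl VM w m c u 0; rewrite addr0 => /eqP; rewrite -subr_eq0 => /eqP.
by have := FWE 0 w m; rewrite FW0 scoef0 => <-; rewrite addr0 => /eqP; rewrite subr_eq0 => /eqP.
Qed.
Lemma FW_vac w : FW vac w = smono 0 w.
Proof. by apply: lserP => m; rewrite FWE smonoE; apply: phi_vacuum PM w m. Qed.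

Definition FX u v w : lser (lser W) := mks (fun n => FW (Y u v n) w).
Lemma FXE u v w n : FX u v w n = FW (Y u v n) w.
Proof.
rewrite /FX mksE //; have [s hs] := Y_trunc YV u v; exists s => i hi.
by rewrite hs // FW0.
Qed.

(** The converse of [subst_phi_comp]: the iterated derivatives under d/dy
    determine the expansion. *)
Lemma tayS_of_subst (A : int -> int -> W) (X : lser (lser W)) : ltrunc2 A ->
  (forall n m, subst_phi p A n m = X n m) -> tayS A = scomp g X.
Proof.
move=> hA hX.
have dX : sdom X 0.
  by case=> // n _; apply: lserP => m; rewrite -hX scoef0.
apply/eqP; rewrite -subr_eq0; apply/eqP; apply: (@delta_inj _ _ P (tayS A - scomp g X)).
- exact: chk.
- by rewrite P_bot.
- exact: ts_dom.
- by move=> i hi; rewrite scoefB (scomp_dom gd g1 dX) // tayS0 // subr0.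
move=> n; rewrite iter_deltaB scoefB (iter_delta_comp gd g1 (Pgg ch p0)) //.
apply: lserP => m; rewrite scoefB -(subst_phiE ch) // hX scoef_mulrz subrr scoef0 //.
Qed.

Lemma tayS_mulz12 r (A : int -> int -> W) : ltrunc2 A -> tayS (mulz12 r A) = lmono r%:Z *: tayS A.
Proof.
move=> hA; apply: lserP => n; apply: lserP => m; rewrite scoef_monoZ !tayE //; last exact: ltrunc2_mulz12.
by rewrite tay_mulz12.
Qed.

(** Associativity rewritten in terms of y = g(s), with any sufficiently large
    exponent. *)
Lemma FW_assoc u v : exists q : nat, forall r : nat, (q <= r)%N -> forall w,
  ltrunc2 (mulz12 r (fprod (FW u) (FW v) w)) /\
  tayS (mulz12 r (fprod (FW u) (FW v) w)) = lmono r%:Z *: scomp g (FX u v w).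
Proof.
have [q [h1 h2]] := phi_assoc PM u v.
have E w : (fun i j => YW u (YW v w j) i) = fprod (FW u) (FW v) w.
  by apply/funext => i; apply/funext => j; rewrite /fprod !FWE.
exists q => r qr w; have hq : ltrunc2 (mulz12 q (fprod (FW u) (FW v) w)) by rewrite -E.
have T : tayS (mulz12 q (fprod (FW u) (FW v) w)) = lmono q%:Z *: scomp g (FX u v w).
  rewrite -(scomp_phiE ch).
  apply: tayS_of_subst => // n m; have := h2 w n m; rewrite E => <-.
  rewrite -(psactE p0); congr (psact _ _ n m); apply/funext => i; apply/funext => j.
  by rewrite FXE FWE.
have -> : mulz12 r (fprod (FW u) (FW v) w) = mulz12 (r - q) (mulz12 q (fprod (FW u) (FW v) w)).
  by rewrite {1}/mulz12 -{1}(subnK qr) iterD.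
split; first exact: ltrunc2_mulz12.
have -> : (lmono r%:Z : kk) = lmono (r - q)%N%:Z * lmono q%:Z.
  by rewrite -lmonoD; congr lmono; lia.
by rewrite tayS_mulz12 // T scalerA.
Qed.

(** Associativity with the vacuum as second vector: the product of the two
    fields is then the field of u in the variable z1. *)
Lemma FW_taylor u w : tsm (FW u w) = scomp g (FX u vac w).
Proof.
have [q hq] := FW_assoc u vac; have [_] := hq q (leqnn q) w.
have E i j : fprod (FW u) (FW vac) w i j = if j == 0 then FW u w i else 0.
  rewrite /fprod FW_vac smonoE; case: eqP => // _; rewrite linf0 ?scoef0 //; exact: FW_lin.
have hA : ltrunc2 (fprod (FW u) (FW vac) w).
  have [s hs] := sdom_ex (FW u w); exists (Num.min s 0) => i j hij; rewrite E.
  by case: eqP => // j0; rewrite hs //; lia.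
rewrite tayS_mulz12 //; have nz : lmono q%:Z != 0 :> kk by apply: lmono_neq0.
move/(scalerI nz) => <-; apply: lserP => n; apply: lserP => m; rewrite tayE // tsmE hdE.
rewrite /tay (@zsum_pt _ _ (m + n)) ?E ?subrr ?eqxx // => i /eqP ni.
by rewrite E; case: eqP => [h|_]; [lia|rewrite mul0rz].
Qed.

(** The coefficient of y in [FW_taylor]. *)
Lemma FW_om0 u w : FW (om 0 u) w = p *: sder (FW u w).
Proof.
have dX : sdom (FX u vac w) 0.
  by move=> i hi; rewrite FXE (Yvac_neg YV) // FW0.
have := iter_delta_comp gd g1 (Pgg ch p0) 1 dX.
rewrite -FW_taylor /= mulr1z FXE.
have := Yvac_trans ch YV Y_omega u 1; rewrite mulr1z subrr => ->.
have [-> _] := va_creation YV u => <-.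
by rewrite /delta sder_tsm -tsm_scale tsmE hd0.
Qed.

(** Skew symmetry: Borcherds' identity with exponents (- n - 1, -1, 0),
    applied to the vacuum, where only one term of the right side survives. *)
Lemma Yskew u v n : Y v u n =
  zsum (fun i => Y (Y u v (n - i)) vac i *~ sg (n - i)).
Proof.
have J := va_jacobi YV u v vac (- n - 1) (-1) 0; rewrite /mode in J.
have [s hs] := Y_trunc YV u v.
have Y0 x i : 0 <= i -> Y x vac (- (0 + i) - 1) = 0 by move=> hi; apply: (Yvac_neg YV); lia.
rewrite (@natsumE _ _ `|n - s|.+1) in J; last first.
  by move=> i hi; rewrite hs ?(Y0l YV) ?scaler0 //; lia.
rewrite (@natsumE _ _ 1) in J; last first.
  move=> i hi; rewrite Y0 // (Y0r YV) sub0r (Yvac_neg YV) ?(Y0r YV) ?scaler0 ?oppr0 ?scaler0 //; lia.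
rewrite big_ord1 /= expr0 mul1r binz_zb // zb0l scale1r Y0 // (Y0r YV) sub0r in J.
have [c0 _] := va_creation YV u.
have e1 : - (-1 + 0) - 1 = 0 :> int by lia.
have e2 : - (0 + (- n - 1) - 0) - 1 = n by lia.
rewrite e1 c0 e2 in J.
have sgE (l : int) : (-1) ^ l = (sg l)%:~R :> K.
  by case: l => l; rewrite /sg /= ?NegzE /exprz ?abszN rmorphXn rmorphN1 //= -exprVn invrN1.
rewrite sgE scaler_int in J.
have -> : Y v u n = - (Y v u n *~ sg (- n - 1)) *~ sg n.
  by rewrite sgP sgN mulrNz opprK -mulrzA sg_sqr mulr1z.
rewrite -J mulrz_suml (@zsum_nat _ _ `|n - s|.+1) => [|i hi|i hi].
- apply: eq_bigr => i _; rewrite binz_zb // scaler_int zbN1 // -mulrzA.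
  by congr (Y (Y _ _ _) _ _ *~ _); [lia|lia|rewrite sgD sgN mulrC].
- by rewrite (Yvac_neg YV) // mul0rz.
- by rewrite hs ?(Y0l YV) ?mul0rz //; lia.
Qed.

Notation w0 := (omega el).
Notation a := (FW w0).
Notation X := (FX w0 w0).

(** Skew symmetry of Y matches Taylor's formula for the fields. *)
Lemma X_skew w : tau (scomp g (X w)) = scomp g (X w).
Proof.
have [s hs] := Y_trunc YV w0 w0.
apply: (@skew_tau _ ch _ p0 _ (X w) (fun m => FX (Y w0 w0 m) vac w) s).
- by move=> m hm; apply: lserP => i; rewrite FXE hs // (Y0l YV) FW0 scoef0.
- by move=> m i hi; rewrite FXE (Yvac_neg YV) // FW0.
- by move=> m; rewrite FXE FW_taylor.
move=> n; rewrite FXE {1}Yskew.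
have fs : fsup (fun i => Y (Y w0 w0 (n - i)) vac i *~ sg (n - i)).
  apply: (@fsupP _ _ 0 (n - s)) => i hi; first by rewrite (Yvac_neg YV) // mul0rz.
  by rewrite hs ?(Y0l YV) ?mul0rz //; lia.
rewrite (zsum_additive (f := fun u => FW u w)) // => [|x y]; last exact: FWD.
apply: eq_zsum => i; rewrite FXE -scaler_int FWZ rmorph_int scaler_int //.
Qed.

(** By [X_skew] the expansions of the product and of its transpose agree, and
    an expansion determines the series. The exponent is taken even, so that
    (z1 - z2)^q is symmetric. *)
Lemma omega_local : exists2 q : nat, forall w, ltrunc2 (mulz12 q (fprod a a w)) /\
    tayS (mulz12 q (fprod a a w)) = lmono q%:Z *: scomp g (X w) &
    forall w, mulz12 q (tr (fprod a a w)) = mulz12 q (fprod a a w).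
Proof.
have [q hq] := FW_assoc w0 w0; exists (q + q)%N => w.
  by apply: hq; rewrite leq_addr.
have [hA TA] := hq (q + q)%N (leq_addr q q) w.
set A := mulz12 _ (fprod a a w) in hA TA *.
have sgq : sg (q + q)%N%:Z = 1 by rewrite PoszD sgD sg_sqr.
have -> : mulz12 (q + q) (tr (fprod a a w)) = tr A.
  by rewrite mulz12_tr; apply/funext => i; apply/funext => j; rewrite sgq mulr1z.
have htr : ltrunc2 (tr A) by have [N hN] := hA; exists N => i j hij; apply: hN; rewrite orbC.
have E : tayS (tr A) = tayS A.
  by rewrite tayS_tr // TA tau_mono X_skew sgq mulr1z.
have hB : ltrunc2 (fun i j => tr A i j + A i j *~ (-1)).
  by apply: ltrunc2D => //; apply: ltrunc2_mulz.
have hz : forall n m, tay n (fun i j => tr A i j + A i j *~ (-1)) m = 0.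
  move=> n m; rewrite tayD ?tay_mulz //; last exact: ltrunc2_mulz.
  by rewrite -!tayE // E mulrN1z subrr.
apply/funext => i; apply/funext => j; have /eqP := tay_inj hB hz i j.
by rewrite mulrN1z subr_eq0 => /eqP.
Qed.
End PhiModule.

Lemma sum4 (M : zmodType) (F : nat -> M) :
  \sum_(i < 4) F i = F 0%N + F 1%N + F 2%N + F 3%N.
Proof. by rewrite !big_ord_recr big_ord0 /= add0r. Qed.

Lemma lderiv_nat (K : fieldType) n : lderiv (n%:R : laurent K) = 0.
Proof.
elim: n => [|n IH]; first by rewrite lderiv0.
rewrite -natr1 lderivD IH add0r -[1]/(lmono 0 : laurent K) lderiv_mono.
by rewrite scale0r.
Qed.

Lemma linear_series (K : fieldType) (M : lmodType K) (L : laurent K -> M) :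
  (forall f h, L (f + h) = L f + L h) -> (forall c f, L (c *: f) = c *: L f) ->
  (exists N, forall f, ldom f N -> L f = 0) ->
  (exists N, forall n, N <= n -> L (lmono n) = 0) /\
  forall f, L f = zsum (fun n => f n *: L (lmono n)).
Proof.
move=> LD LZ [N LN]; have L0 n : N <= n -> L (lmono n) = 0.
  by move=> hn; apply: LN; apply: (ldomW (@ldom_mono _ n)).
split; first by exists N.
have fs (f : laurent K) : fsup (fun n => f n *: L (lmono n)).
  have [s hs] := ldom_ex f; apply: (@fsupP _ _ s N) => i hi; first by rewrite hs // scale0r.
  by rewrite L0 ?scaler0 //; lia.
apply: laurent_span => [f h Ef Eh|c n|].
- by rewrite LD Ef Eh -zsumD //; apply: eq_zsum => n; rewrite lcoefD scalerDl.
- rewrite LZ (@zsum_pt _ _ n) => [|i /eqP hi]; rewrite lcoefZ lmonoE.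
    by rewrite eqxx mulr1.
  by case: eqP => [/hi //|_]; rewrite mulr0 scale0r.
exists N => f hf; rewrite LN // zsum0 // => n.
by have [hn|hn] := ltP n N; [rewrite hf // scale0r|rewrite L0 // scaler0].
Qed.

Section PhiToRestricted.
Variables (K : fieldType) (ch : char0 K) (el : K).
Notation V := (virmod el).
Notation vac := (vacuum el).
Variables (Y : V -> V -> int -> V) (YV : is_vertex_algebra Y vac).
Hypothesis Y_omega : forall (n : int) (v : V), mode Y (omega el) n v = om n v.
Variables (p : laurent K) (p0 : p != 0).
Variables (W : lmodType K) (YW : V -> W -> int -> W) (PM : is_phi_module p Y vac YW).
Notation k := (laurent K).
Notation kk := (laurent k).
Notation P := (PP p).
Notation g := (gg p0).
Notation D := (pd p).
Notation w0 := (omega el).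
Notation a := (FW YW w0).
Notation X := (FX Y YW w0 w0).
Let gd := gg_dom p0.
Let g1 := gg1_neq0 p0.

Lemma a_lin : linf a. Proof. exact: FW_lin PM w0. Qed.

(** The residue of f(z) Y_W(omega, z). *)
Definition ares (f : k) (w : W) : W := (f *: a w) (-1).

Lemma aresE f w : ares f w = zsum (fun r => f r *: a w (-1 - r)).
Proof. by rewrite /ares scoefZ. Qed.
Lemma ares_fsup (f : k) w : fsup (fun r => f r *: a w (-1 - r)).
Proof. exact: sscale_fsup. Qed.
Lemma aresDl f h w : ares (f + h) w = ares f w + ares h w.
Proof. by rewrite /ares scalerDl. Qed.
Lemma aresZl c f w : ares (c *: f) w = c *: ares f w.
Proof. by rewrite /ares -lC_mul -scalerA scoef_lCZ. Qed.
Lemma aresDr f : {morph ares f : u v / u + v}.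
Proof. by move=> u v; rewrite /ares (linfD a_lin) scalerDr. Qed.
Lemma aresZr f c u : ares f (c *: u) = c *: ares f u.
Proof.
rewrite /ares linfZ; last exact: a_lin.
have E : f * lC c = lC c * f by rewrite mulrC.
by rewrite scalerA E -scalerA scoef_lCZ.
Qed.
Lemma ares0 f : ares f 0 = 0.
Proof. by apply: (@addrI _ (ares f 0)); rewrite -aresDr !addr0. Qed.

(** The singular part of the product of omega with itself. *)
Lemma om_omega n : 0 <= n -> om n w0 = (n + 1)%:~R *: om (n - 2) vac +
  (if n == 3 then 12^-1 * el * (n * (n - 1) * (n - 2))%:~R else 0) *: vac.
Proof.
move=> n0; have E := om_br n (-1) vac; rewrite (om_vac _ n0) {3}/om virmod_act0 subr0 in E.
rewrite -[w0]/(om (-1) vac) E opprK; congr (_ *: om _ vac + _ *: _); first by lia.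
by rewrite (_ : (n + -1 == 2) = (n == 3)) //; apply/eqP/eqP; lia.
Qed.

Lemma X_om w l : X w l = FW YW (om (- l - 1) w0) w.
Proof. by rewrite (FXE YV PM) -Y_omega /mode; congr (FW YW (Y _ _ _) w); lia. Qed.
Lemma X_lt w l : l < -4 -> X w l = 0.
Proof.
move=> hl; rewrite X_om om_omega; last by lia.
rewrite om_vac; last by lia.
rewrite (_ : (- l - 1 == 3) = false); last by apply/eqP; lia.
by rewrite scaler0 scale0r addr0 (FW0 PM).
Qed.
Lemma X_4 w : X w (-4) = (lC (12^-1 * el) *: smono 0 w) *~ (3 * 2).
Proof.
rewrite X_om om_omega // om_vac // scaler0 add0r /= (FWZ PM) (FW_vac PM).
by rewrite (rmorphM (@lC K)) rmorph_int mulrC -scalerA scaler_int.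
Qed.
Lemma X_3 w : X w (-3) = 0.
Proof. by rewrite X_om om_omega // om_vac // scaler0 add0r /= scale0r (FW0 PM). Qed.
Lemma X_2 w : X w (-2) = a w *~ 2.
Proof.
rewrite X_om om_omega // /= scale0r addr0 (FWZ PM) rmorph_int scaler_int //.
Qed.
Lemma X_1 w : X w (-1) = p *: sder (a w).
Proof. by rewrite X_om (FW_om0 ch YV Y_omega p0 PM). Qed.

(** By locality the commutator is the residue at s = 0 of f(z + s) times the
    product of omega with itself in the variable g(s), of which only the four
    singular terms contribute. *)
Lemma ares_comm f w j : ares f (a w j) - a (ares f w) j =
  (((12^-1 * el) *: D (D (D (f * p)))) *: smono 0 w + (2 * D (f * p)) *: a w
    + (f * p * p) *: sder (a w)) j.
Proof.
have [q hq htr] := omega_local ch YV p0 PM.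
set A0 := fprod a a w; have rA : raw A0 by apply: fprod_raw; apply: a_lin.
have [hA TA] := hq w; set A := mulz12 q A0 in hA TA.
have E1 : ares f (a w j) = mul1 f A0 (-1) j by rewrite aresE.
have E2 : a (ares f w) j = mul1 f (tr A0) (-1) j.
  rewrite aresE (zsum_additive (linfD a_lin)); last exact: ares_fsup.
  rewrite scoef_zsum; last by apply: fsup_map (linf0 a_lin) _; apply: ares_fsup.
  by apply: eq_zsum => r; rewrite linfZ ?scoef_lCZ //; apply: a_lin.
(* Both orders of multiplication give the same series after multiplication by
   (z1 - z2)^q. *)
have M2 : mulz12 q (mul1 f (tr A0)) = mul1 f A.
  have -> : mul1 f (tr A0) = tr (mul2 f A0) by [].
  have tA i i' : A i i' *~ sg q%:Z = A i' i.
    have /(congr1 (fun B => B i' i)) := htr w; rewrite -/A0 -/A mulz12_tr => <-.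
    by [].
  rewrite mulz12_tr mulz12_mul2 //; apply/funext => i; apply/funext => j'.
  rewrite /mul2 /mul1 zsum_mulrz; last by apply: mul2_fsup; apply: raw_mulz12.
  by apply: eq_zsum => r; rewrite scalerMzr tA.
rewrite E1 E2 (@res_difference _ _ q _ _ (mul1 f A)) //; first last.
- exact: ltrunc2_mul1.
- by rewrite mulz12_mul1.
- exact: raw_mul2.
- exact: raw_mul1.
rewrite tay_mul1 //.
have -> : zsum (fun b => zsum (fun r => hdl b f r *: tay (q%:Z - 1 - b) A (j - r))) = (ts f *: scomp g (X w)) (-1) j.
  have -> : (ts f *: scomp g (X w)) (-1) = (ts f *: tayS A) (q%:Z - 1).
    have E0 : ts f * lmono q%:Z = lmono q%:Z * ts f by rewrite mulrC.
    rewrite TA scalerA E0 -scalerA scoef_monoZ.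
    by have -> : q%:Z - 1 - q%:Z = -1 by lia.
  rewrite scoefZ scoef_zsum; last exact: sscale_fsup.
  by apply: eq_zsum => b; rewrite scoefZ; apply: eq_zsum => r; rewrite tayE.
congr (scoef _ j); have L : ladder (fun l => g ^ l) 0 by exact: (gX_ladder gd g1).
have L' : ladder (fun l => ts f * g ^ l) 0.
  move=> l; have [h _] := ldomX l gd g1.
  by apply: (ldomW (ldomM (@ts_dom K f) h)); lia.
rewrite /scomp (comb_scale _ _ L) (combE _ _ L').
(* The product vanishes in degrees below -4 and the residue in degrees at
   least 0. *)
rewrite (@zsum_lo _ _ (-4) 4) => [|l hl|l hl]; first last.
- by have := res_ts_ge p0 f hl; rewrite /res => ->; rewrite scale0r.
- by rewrite X_lt // scaler0.
rewrite (sum4 (fun i => (ts f * g ^ (-4 + i%:Z)) (-1) *: X w (-4 + i%:Z))).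
rewrite (_ : -4 + 0%:Z = -4) // (_ : -4 + 1%:Z = -3) // (_ : -4 + 2%:Z = -2) // (_ : -4 + 3%:Z = -1) //.
rewrite X_4 X_3 X_2 X_1 scaler0 addr0.
have r1 := res_ts1 p0 f; have r2 := res_ts2 ch p0 f; have r4 := res_ts4 ch p0 f.
rewrite /res in r1 r2 r4; rewrite r1 r2.
congr (_ + _ + _).
- by rewrite -scalerMzr scalerMzl r4 scalerA mulrC lC_mul.
- by rewrite -scalerMzr scalerMzl -mulrzl.
- by rewrite scalerA.
Qed.

(** Applying the residue of h in [ares_comm]; the term with the derivative of
    a is integrated by parts. *)
Lemma ares_br f h w : ares f (ares h w) - ares h (ares f w) =
  (12^-1 * el * res (h * D (D (D (f * p))))) *: w +
  ares (2 * (h * D (f * p)) - lderiv (h * (f * p * p))) w.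
Proof.
have -> : ares f (ares h w) = zsum (fun r => h r *: ares f (a w (-1 - r))).
  rewrite [ares h w]aresE (zsum_additive (aresDr f)); last exact: ares_fsup.
  by apply: eq_zsum => r; rewrite aresZr.
rewrite {2}/ares scoefZ -zsumB; first last.
- exact: sscale_fsup.
- by have [N hN] := ares_fsup h w; exists N => r hr; rewrite -aresZr hN // ares0.
have E r : h r *: ares f (a w (-1 - r)) - h r *: a (ares f w) (-1 - r) =
   h r *: (((12^-1 * el) *: D (D (D (f * p)))) *: smono 0 w + (2 * D (f * p)) *: a w
    + (f * p * p) *: sder (a w)) (-1 - r) by rewrite -scalerBr ares_comm.
rewrite (eq_zsum E) -[LHS]/((h *: _ : lser W) (-1)) !scalerDr !scoefD -addrA; congr (_ + _).
  rewrite scalerA lmulZr scoefZ (@zsum_pt _ _ (-1)) => [|r /eqP hr]; last first.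
    by rewrite smonoE; case: eqP => [e|_]; [lia|rewrite scaler0].
  by rewrite smonoE eqxx lcoefZ.
have S : (sder ((h * (f * p * p)) *: a w)) (-1) = 0 by rewrite scoef_der addNr mulr0z.
rewrite sder_scale scoefD in S; move/eqP: S; rewrite addr_eq0 => /eqP S.
have E2 : h * (2 * D (f * p)) = 2 * (h * D (f * p)) by rewrite mulrCA.
by rewrite !scalerA E2 /ares scalerBl scoefB S opprK addrC.
Qed.

Lemma alphaD f h : alpha p (f + h) = alpha p f + alpha p h.
Proof. by rewrite /alpha mulrDl /res lcoefD mulrDr. Qed.
Lemma alphaZ c f : alpha p (c *: f) = c * alpha p f.
Proof. by rewrite /alpha lmulZl /res lcoefZ mulrCA. Qed.

Let R := 2 * (p * lderiv (lderiv p)) - lderiv p ^+ 2.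

(** With D = p d/dx, the cocycle of f p D and h p D computed in the coordinate
    where D is constant is the standard one plus a coboundary and an exact
    term. *)
Lemma third_derivative_identity f h : let x := f * p ^+ 2 in let y := h * p ^+ 2 in
  2 * (h * D (D (D (f * p)))) = 2 * (lderiv (lderiv (lderiv x)) * y) +
    (R * (f * lderiv y - h * lderiv x)) - lderiv (R * (f * h * p ^+ 2)).
Proof.
move=> x y; rewrite /x /y /R /pd !expr2.
have L2 : lderiv 2 = 0 :> k by apply: lderiv_nat.
do ?rewrite !(lderivM, lderivD, lderivB, lderivN, L2, mul0r, add0r).
move: (lderiv (lderiv (lderiv p))) (lderiv (lderiv (lderiv f))) => p3 f3.
move: (lderiv (lderiv p)) (lderiv (lderiv f)) => p2 f2.
move: (lderiv p) (lderiv f) (lderiv h) => p1 f1 h1.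
ring.
Qed.

Lemma wact_cocycle f h : let x := f * p ^+ 2 in let y := h * p ^+ 2 in
  12^-1 * el * res (h * D (D (D (f * p)))) =
  (12^-1 * res (lderiv (lderiv (lderiv x)) * y) +
   alpha p ((x * lderiv y - y * lderiv x) * p^-1)) * el.
Proof.
move=> x y; set u := res (h * _); set v := res (_ * y).
have n2 : 2 != 0 :> K := ch 1.
have n24 : 24 != 0 :> K := ch 23.
have n12 : 12 != 0 :> K := ch 11.
have A : (x * lderiv y - y * lderiv x) * p^-1 *
    (2%:R *: lderiv (lderiv p) - p^-1 * lderiv p ^+ 2) =
    R * (f * lderiv y - h * lderiv x).
  rewrite scaler_nat -mulr_natl /x /y /R.
  move: (lderiv (h * p ^+ 2)) (lderiv (f * p ^+ 2)) => y' x'.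
  move: (lderiv (lderiv p)) (lderiv p) => p2 p1.
  by field.
have E : 2 * u = 2 * v + res (R * (f * lderiv y - h * lderiv x)).
  have T := congr1 (@res K) (third_derivative_identity f h).
  have r2 e : res (2 * e) = 2 * res e :> K.
    by rewrite /res -[2 * e]/((2%:R : k) * e) mulr_natl mulr_natl /= mulr2n.
  have rB e e' : res (e - e') = res e - res e' :> K by [].
  have rD e e' : res (e + e') = res e + res e' :> K by [].
  by rewrite r2 rB rD r2 res_lderiv subr0 in T.
rewrite /alpha A; move: E; move: (res (R * _)) => z E.
have -> : z = 2 * u - 2 * v by rewrite E addrC addKr.
by field; rewrite n24 n12.
Qed.

(** The residue inverts the formula for the modes of omega: for x = - z^n p^2
    the two central corrections cancel. *)
Definition wact (x : vir K) (w : W) : W :=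
  - ares (x.1 * p ^- 2) w + (((x.2 : K) + alpha p (x.1 * p^-1)) * el) *: w.

Lemma aresN f w : ares (- f) w = - ares f w.
Proof. by rewrite /ares scaleNr scoefN. Qed.

Lemma wact_module : is_vir_module wact.
Proof.
split.
- move=> w c [x s] [y t]; rewrite /wact /=.
  have -> : (c *: x + y) * p ^- 2 = c *: (x * p ^- 2) + y * p ^- 2 by rewrite mulrDl lmulZl.
  have -> : (c *: x + y) * p^-1 = c *: (x * p^-1) + y * p^-1 by rewrite mulrDl lmulZl.
  rewrite aresDl aresZl alphaD alphaZ.
  have -> : (c *: s + t : K) = c * s + t by [].
  have -> : (c * s + t + (c * alpha p (x * p^-1) + alpha p (y * p^-1))) * el =
    c * ((s + alpha p (x * p^-1)) * el) + (t + alpha p (y * p^-1)) * el :> K by ring.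
  by rewrite [in LHS]scalerDl opprD scalerDr scalerN [in RHS]scalerA addrACA.
- move=> [x s] c u v; rewrite /wact /= aresDr aresZr opprD !scalerDr scalerN addrACA.
  by rewrite !scalerA [c * _]mulrC.
move=> [x s] [y t] w; rewrite /wact /=.
set f := x * p ^- 2; set h := y * p ^- 2.
have xE : x = f * p ^+ 2 by rewrite /f mulfVK // expf_neq0.
have yE : y = h * p ^+ 2 by rewrite /h mulfVK // expf_neq0.
have xp : x * p^-1 = f * p by rewrite xE expr2 mulrA mulfK.
have yp : y * p^-1 = h * p by rewrite yE expr2 mulrA mulfK.
set al := (s + _) * el; set be := (t + _) * el.
have C : ares f (ares h w) - ares h (ares f w) =
  (- ares f (- ares h w + be *: w) + al *: (- ares h w + be *: w)) -
  (- ares h (- ares f w + al *: w) + be *: (- ares f w + al *: w)).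
  rewrite !aresDr !aresZr !scalerDr !scalerN !scalerA [al * be]mulrC.
  have aN e u : ares e (- u) = - ares e u by rewrite -scaleN1r aresZr scaleN1r.
  rewrite !aN; zlin.
rewrite -C ares_br.
have E1 : (x * lderiv y - y * lderiv x) * p ^- 2 = - (2 * (h * D (f * p)) - lderiv (h * (f * p * p))).
  apply: (mulIf (expf_neq0 2 p0)); rewrite mulfVK ?expf_neq0 // xE yE /pd.
  rewrite !expr2 !lderivM.
  move: (lderiv p) (lderiv f) (lderiv h) => p1 f1 h1; ring.
rewrite E1 aresN opprK addrC; congr (_ *: _ + _).
by rewrite xE yE; apply/esym/wact_cocycle.
Qed.

Lemma wact_level : has_level wact el.
Proof.
move=> w; rewrite /wact /= !mul0r.
have -> : ares 0 w = 0 by rewrite /ares scale0r.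
have -> : alpha p 0 = 0 by rewrite /alpha mul0r /res /= mulr0.
by rewrite oppr0 add0r addr0 mul1r.
Qed.

Lemma wact_restricted : is_restricted wact.
Proof.
move=> w.
apply: (linear_series (L := fun f => wact (f, 0) w)).
- move=> f h; rewrite -(actDl wact_module).
  by congr (wact (_, _) w); rewrite /= addr0.
- move=> c f; rewrite -(actZl wact_module).
  by congr (wact (_, _) w); rewrite /= scaler0.
have [s hs] := ldom_ex (p ^- 2); have [t ht] := sdom_ex (a w).
have [r hr] := ldom_ex (p^-1 * (2%:R *: lderiv (lderiv p) - p^-1 * lderiv p ^+ 2)).
exists (`|s| + `|t| + `|r| + 1) => f hf; rewrite /wact /=.
have -> : ares (f * p ^- 2) w = 0 by apply: (sdomZ (ldomM hf hs) ht); lia.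
have -> : alpha p (f * p^-1) = 0.
  by rewrite /alpha -mulrA /res (ldomM hf hr) ?mulr0 //; lia.
by rewrite oppr0 !add0r mul0r scale0r.
Qed.

Lemma wact_omega n w :
  mode YW w0 n w = wact (- (lmono n * p ^+ 2), alpha p (lmono n * p)) w.
Proof.
rewrite /wact /=.
have -> : - (lmono n * p ^+ 2) * p ^- 2 = - lmono n.
  by rewrite mulNr mulfK // expf_neq0.
have -> : - (lmono n * p ^+ 2) * p^-1 = - (lmono n * p).
  by rewrite mulNr expr2 mulrA mulfK.
have -> : alpha p (- (lmono n * p)) = - alpha p (lmono n * p).
  by rewrite -scaleN1r alphaZ mulN1r.
rewrite subrr mul0r scale0r addr0 aresN opprK /ares scoef_monoZ.
by rewrite (FWE PM) /mode; congr (YW _ _ _); lia.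
Qed.
End PhiToRestricted.

Lemma char0_complex (R : realType) : char0 R[i].
Proof. by move=> n; rewrite pnatr_eq0. Qed.

Theorem proposition6p7 (R : realType) (p : laurent R[i]) (p_neq0 : p != 0)
  (ell : R[i])
  (Y : virmod ell -> virmod ell -> int -> virmod ell)
  (Y_va : is_vertex_algebra Y (vacuum ell))
  (Y_omega : forall (n : int) (v : virmod ell),
     mode Y (omega ell) n v = virmod_act (- lmono n, 0) v) :
  (forall (W : lmodType R[i]) (act : vir R[i] -> W -> W),
     is_vir_module act -> is_restricted act -> has_level act ell ->
     exists YW : virmod ell -> W -> int -> W,
       is_phi_module p Y (vacuum ell) YW /\
       forall (n : int) (w : W), mode YW (omega ell) n w =
         act (- (lmono n * p ^+ 2), alpha p (lmono n * p)) w) /\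
  (forall (W : lmodType R[i]) (YW : virmod ell -> W -> int -> W),
     is_phi_module p Y (vacuum ell) YW ->
     exists act : vir R[i] -> W -> W,
       (is_vir_module act /\ is_restricted act /\ has_level act ell) /\
       forall (n : int) (w : W), mode YW (omega ell) n w =
         act (- (lmono n * p ^+ 2), alpha p (lmono n * p)) w).
Proof.
have ch := @char0_complex R; split=> W.
  move=> act actV restr lev; exists (YWmap (Tact_ops actV restr lev) p_neq0).
  split=> [|n w]; first exact: YWmap_phi.
  by rewrite YWmap_omega // (act_series actV restr lev).
move=> YW PM; exists (wact p YW); split=> [|n w].
  split; first exact: (wact_module ch Y_va Y_omega p_neq0 PM).
  by split; [exact: (wact_restricted ch Y_va Y_omega p_neq0 PM) | exact: wact_level].
exact: wact_omega PM n w.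
Qed.
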